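(* Let $\alpha,\beta,\mu,\nu$ be real, let $\tau\in\mathbb{C}$ with $|\arg\tau|<\pi/2$, put $z=i\tau$ and $q=e(z)=e^{-2\pi\tau}$. Set $$\mathcal{A}(s,\alpha,\mu)=\cos(\pi s)\,\psi(s,-\alpha,-\mu)+\psi(s,\alpha,\mu).$$ Then $\mathcal{A}(s,\alpha,\mu)$ is holomorphic for all $s\in\mathbb{C}$ and satisfies $$\mathcal{A}(s,\alpha,\mu)=e(\alpha\mu)\frac{(2\pi)^s}{2\Gamma(s)}\bigl\{e^{-\pi is/2}\psi(1-s,-\mu,\alpha)+e^{\pi is/2}\psi(1-s,\mu,-\alpha)\bigr\}.$$ Moreover $$F_{\mathbb{Z}^2}(s;\alpha,\beta;\mu,\nu;z)=\delta(\beta)\mathcal{A}(s,\alpha,\mu)+e(\alpha\mu)\frac{(2\pi)^s}{\Gamma(s)}\bigl\{e^{-\pi is/2}\mathcal{S}_{1-s}(\beta,-\mu;\nu,\alpha;q)+e^{\pi is/2}\mathcal{S}_{1-s}(-\beta,\mu;-\nu,-\alpha;q)\bigr\},$$ where the $q$-series on the right converge absolutely for all $s\in\mathbb{C}$; this provides the holomorphic continuation of $F_{\mathbb{Z}^2}(s;\alpha,\beta;\mu,\nu;z)$ (initially defined for $\operatorname{Re}s>2$) to the whole $s$-plane.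
   Context: Notation: $e(x)=e^{2\pi i x}$. For real $x$, $\delta(x)=1$ if $x\in\mathbb{Z}$ and $\delta(x)=0$ otherwise. $(2\pi)^s=e^{s\log 2\pi}$. For real $\gamma,\kappa$ the Lerch-type zeta function is $\psi(r,\gamma,\kappa)=\sum_{k\in\mathbb{Z},\,k>-\gamma}e\{(\gamma+k)\kappa\}(\gamma+k)^{-r}$ for $\operatorname{Re}r>1$ (real positive bases), meromorphically continued to $r\in\mathbb{C}$ (entire if $\kappa\notin\mathbb{Z}$, otherwise with at most a simple pole at $r=1$). For real $\gamma,\delta,\kappa,\lambda$, complex $r$ and $q=e(z)$ with $z$ in the upper half-plane, with $q^x:=e(xz)$ for real $x$, $$\mathcal{S}_r(\gamma,\delta;\kappa,\lambda;q)=\sum_{\substack{k\in\mathbb{Z},\,k>-\gamma\\ l\in\mathbb{Z},\,l>-\delta}}\frac{e\{(\gamma+k)\kappa+(\delta+l)\lambda\}}{(\delta+l)^r}q^{(\gamma+k)(\delta+l)}.$$ For $z$ in the upper half-plane and $\operatorname{Re}s>2$, $F^{\pm}_{\mathbb{Z}^2}(s;\alpha,\beta;\mu,\nu;z)=\sum'_{m,n\in\mathbb{Z}}e\{(\alpha+m)\mu+(\beta+n)\nu\}\{\alpha+m+(\beta+n)z\}^{-s}$, the sum omitting the term with $\alpha+m+(\beta+n)z=0$ (if any), where in $F^+$ the argument of $\alpha+m+(\beta+n)z$ is taken in $(-\pi,\pi]$ and in $F^-$ in $[-\pi,\pi)$; and $F_{\mathbb{Z}^2}=\frac12(F^+_{\mathbb{Z}^2}+F^-_{\mathbb{Z}^2})$.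 *)

(* Defs.v *)
(* Stdlib reals and Coquelicot's complex numbers. *)
From Stdlib Require Export Reals ZArith List.
From Coquelicot Require Export Coquelicot.
Open Scope R_scope.
Open Scope C_scope.

Definition is_int (x : R) : Prop := exists n : Z, x = IZR n.

Definition delta (x : R) : R :=
  if Req_EM_T (IZR (Int_part x)) x then 1%R else 0%R.

Definition Cexp (w : C) : C := RtoC (exp (Re w)) * (cos (Im w), sin (Im w)).

Definition Ccos (w : C) : C := (Cexp (Ci * w) + Cexp (- (Ci * w))) / 2.

Definition e (x : C) : C := Cexp (2 * PI * Ci * x).

(* [x ^ s] for real [x > 0] and complex [s]. *)
Definition Rcpow (x : R) (s : C) : C := Cexp (s * ln x).

(* The arguments of [w <> 0] in (-PI, PI] and in [-PI, PI). They differ only on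
   the negative real axis; at [w = 0] their values are irrelevant. *)
Definition Carg (w : C) : R :=
  if Rlt_dec (Im w) 0 then (- acos (Re w / Cmod w))%R else acos (Re w / Cmod w).

Definition Carg_lower (w : C) : R :=
  if Rlt_dec 0 (Im w) then acos (Re w / Cmod w) else (- acos (Re w / Cmod w))%R.

(* [w ^ s] for [w <> 0], with [arg] selecting the branch of the logarithm. *)
Definition Cpow_arg (arg : C -> R) (w s : C) : C :=
  Cexp (s * (ln (Cmod w) + Ci * arg w)).

Definition holomorphic_at (f : C -> C) (s : C) : Prop :=
  ex_derive (K := C_AbsRing) (V := C_NormedModule) f s.

Definition entire (f : C -> C) : Prop := forall s : C, holomorphic_at f s.

(* Unordered sums over an index type: the limit of the sums over finite sets
   (duplicate-free lists) of indices, directed by inclusion. *)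
Definition finite_subsets (T : Type) (P : list T -> Prop) : Prop :=
  exists l0 : list T, forall l : list T, NoDup l -> incl l0 l -> P l.

Definition finite_sum {T : Type} (f : T -> C) (l : list T) : C :=
  fold_right Cplus 0 (map f l).

Definition is_usum {T : Type} (f : T -> C) (v : C_CompleteNormedModule) : Prop :=
  filterlim (finite_sum f : list T -> C_CompleteNormedModule)
    (finite_subsets T) (locally v).

Definition usum {T : Type} (f : T -> C) : C :=
  iota (T := C_CompleteNormedModule) (is_usum f).

Definition abs_summable {T : Type} (f : T -> C) : Prop :=
  exists M : R, forall l : list T, NoDup l ->
    (fold_right Rplus 0%R (map (fun t => Cmod (f t)) l) <= M)%R.

(* 1 / Gamma, which is entire and vanishes at the poles 0, -1, -2, ... of Gamma,
   by Euler's limit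
     Gamma s = lim  n! n^s / (s (s + 1) ... (s + n)). *)
Fixpoint rising (s : C) (n : nat) : C :=
  match n with
  | O => 1
  | S m => rising s m * (s + INR m)
  end.

Definition rGamma (s : C) : C :=
  iota (T := C_CompleteNormedModule) (fun v =>
    filterlim
      (fun n : nat =>
         (rising s (S n) / (INR (fact n) * Rcpow (INR n) s)) : C_CompleteNormedModule)
      eventually (locally v)).

Definition lerch_term (r : C) (gamma kappa : R) (k : Z) : C :=
  if Rlt_dec (- gamma) (IZR k) then
    e ((gamma + IZR k) * kappa) * Rcpow (gamma + IZR k) (- r)
  else 0.

Record is_lerch (gamma kappa : R) (f : C -> C) : Prop := {
  lerch_series : forall r : C, (1 < Re r)%R -> is_usum (lerch_term r gamma kappa) (f r);
  lerch_holo : forall r : C, r <> 1 \/ ~ is_int kappa -> holomorphic_at f r;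
  lerch_pole : exists g : C -> C, entire g /\ forall r : C, r <> 1 -> g r = (r - 1) * f r
}.

(* The value at [r] of the meromorphic continuation. It is left undetermined
   where the continuation may have its pole, at [r = 1] with [kappa] an integer. *)
Definition psi (r : C) (gamma kappa : R) : C :=
  iota (T := C_CompleteNormedModule)
    (fun v => exists f : C -> C, is_lerch gamma kappa f /\ f r = v).

(* As [q ^ x] for real [x] means [e (x * z)], where [q = e z], the series depends
   on [z] and not only on [q]. *)
Definition qseries_term (r : C) (gamma delta kappa lambda : R) (z : C) (kl : Z * Z) : C :=
  let (k, l) := kl in
  if Rlt_dec (- gamma) (IZR k) then
    if Rlt_dec (- delta) (IZR l) then
      e ((gamma + IZR k) * kappa + (delta + IZR l) * lambda)
        / Rcpow (delta + IZR l) r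
      * e ((gamma + IZR k) * (delta + IZR l) * z)
    else 0
  else 0.

Definition qseries (r : C) (gamma delta kappa lambda : R) (z : C) : C :=
  usum (qseries_term r gamma delta kappa lambda z).

Definition F_term (arg : C -> R) (s : C) (alpha beta mu nu : R) (z : C) (mn : Z * Z) : C :=
  let (m, n) := mn in
  let w := alpha + IZR m + (beta + IZR n) * z in
  if Ceq_dec w 0 then 0
  else e ((alpha + IZR m) * mu + (beta + IZR n) * nu) * Cpow_arg arg w (- s).

Definition F_plus (s : C) (alpha beta mu nu : R) (z : C) : C :=
  usum (F_term Carg s alpha beta mu nu z).

Definition F_minus (s : C) (alpha beta mu nu : R) (z : C) : C :=
  usum (F_term Carg_lower s alpha beta mu nu z).

Definition F_Z2 (s : C) (alpha beta mu nu : R) (z : C) : C :=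
  (F_plus s alpha beta mu nu z + F_minus s alpha beta mu nu z) / 2.

Definition calA (s : C) (alpha mu : R) : C :=
  Ccos (PI * s) * psi s (- alpha) (- mu) + psi s alpha mu.

(* Main.v *)
(* For [Im w > 0] the sum over [m] of [e (m mu) (m + w)^(-s)] is given by Lipschitz's formula, and
   summing it over the rows [w = alpha + (beta + n) z] yields the q-series. For [Re s > 1] we obtain
   that formula from the binomial series [(1 - x)^(-s) = sum_l b_l x^l] at the [N] points
   [x = e ((j + w) / N)]: a finite Fourier transform in [j] isolates a residue class of [l] modulo [N],
   and as [N] tends to infinity Euler's limit [b_l ~ l^(s-1) / Gamma s] turns the right-hand side into
   the series in [l - mu] while the left-hand side becomes the lattice sum.
   The one-sided sums are continued in [s] by Euler-Maclaurin summation with a complex shift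
   [w = alpha + i y], so the identity theorem gives Lipschitz's formula for all [s]; letting [y] tend
   to [0] when [Re s < 0], and continuing once more, gives the functional equation of [psi].
   The identity theorem and Weierstrass' theorem on limits are deduced from Goursat's lemma applied to
   [f (c + exp z)], for which circles around [c] become vertical segments. *)

Require Import Defs.
From Stdlib Require Import Lra Lia Psatz Classical ClassicalEpsilon Permutation.
From Stdlib Require Import FunctionalExtensionality PropExtensionality FinFun.

Bind Scope C_scope with C.
Arguments Cmod x%_C.
Arguments Re z%_C.
Arguments Im z%_C.
Arguments Cexp w%_C.
Arguments RtoC x%_R.

(** Formulas are proved where the sums converge absolutely and carried further by the identity
    theorem, so the continuations have to exist as functions before any identity between them is
    stated: [Psi gamma kappa s y] continues the one-sided series with base points shifted by [i y].
    The shift serves two purposes. It moves the bilateral sum into the upper half-plane, where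
    Lipschitz's formula applies, and it is a parameter in which both halves stay continuous down to
    the real line. Only a summand with [alpha + j = 0] is singular there, and for [Re s < 0] it
    vanishes in the limit. The other obstacle is the pole. For integral [mu] the expression [calA]
    is undetermined at [s = 1]; for integral [alpha] the other side of its functional equation is
    undetermined at [s = 0]. These are different points, so gluing the two expressions yields an
    entire function without computing a residue. Unordered sums give absolute convergence, dominated
    convergence and the interchange of summations one common form over [nat], [Z] and [Z * Z]. *)

Lemma Cmod_minus_sym (a b : C) : Cmod (a - b) = Cmod (b - a).
Proof. rewrite <- Cmod_opp. f_equal. ring. Qed.

Lemma Cmod_triangle_minus (a b : C) : (Cmod (a - b) <= Cmod a + Cmod b).
Proof. unfold Cminus. rewrite <- (Cmod_opp b). apply Cmod_triangle. Qed.

Lemma Cmod_sub_le (a b : C) : (Cmod a <= Cmod (a - b) + Cmod b).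
Proof. replace a with ((a - b) + b) at 1 by ring. apply Cmod_triangle. Qed.

Lemma Cmod_zero_eq (a b : C) : (forall eps : R, (0 < eps) -> (Cmod (a - b) <= eps)) -> a = b.
Proof.
  intros H. assert (Cmod (a - b) = 0%R).
  { apply Rle_antisym; [|apply Cmod_ge_0]. apply le_epsilon. intros e He.
    rewrite Rplus_0_l. now apply H. }
  apply Cmod_eq_0 in H0. replace a with ((a - b) + b) by ring. rewrite H0. ring.
Qed.

Lemma inverse_small (K eps : R) : 0 < eps -> exists N, forall n, (N <= n)%nat -> K / INR (S n) <= eps.
Proof.
  intros He. destruct (INR_archimed 1 (K / eps)) as [N HN]; [lra|]. exists N. intros n Hn.
  assert (HS : 0 < INR (S n)) by (apply lt_0_INR; lia).
  apply Rmult_le_reg_r with (INR (S n) * / eps)%R. apply Rmult_lt_0_compat; auto. now apply Rinv_0_lt_compat.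
  replace (K / INR (S n) * (INR (S n) * / eps))%R with (K / eps)%R by (field; lra).
  replace (eps * (INR (S n) * / eps))%R with (INR (S n)) by (field; lra).
  rewrite S_INR. apply le_INR in Hn. lra.
Qed.

Lemma RtoC_neq_0 (x : R) : x <> 0%R -> RtoC x <> 0.
Proof. intros H E. apply H. now apply RtoC_inj. Qed.

(** * Complex derivatives as epsilon-delta estimates *)

Definition cder (f : C -> C) (s d : C) : Prop :=
  forall eps : R, (0 < eps) -> exists del : R, (0 < del) /\
    forall h : C, (Cmod h < del) -> (Cmod (f (s + h) - f s - d * h) <= eps * Cmod h).

(** The bridge between the filter-based [ex_derive] of the statement and the explicit estimate with
    which all later arguments work. *)
Lemma holomorphic_at_cder (f : C -> C) (s : C) :
  holomorphic_at f s <-> exists d, cder f s d.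
Proof.
  split.
  - intros [d [_ Hd]]. exists d. intros eps He.
    destruct (Hd s (fun P H => H) (mkposreal eps He)) as [del Hdel].
    exists del. split; [apply cond_pos|]. intros h Hh.
    assert (E : (s + h) - s = h) by ring.
    assert (Hb : @ball (AbsRing_UniformSpace C_AbsRing) s del (s + h)).
    { change (Cmod ((s + h) - s) < del). now rewrite E. }
    pose proof (Hdel _ Hb : Cmod ((f (s + h) - f s) - ((s + h) - s) * d) <= eps * Cmod ((s + h) - s)) as K.
    rewrite E in K. now rewrite (Cmult_comm d h).
  - intros [d Hd]. exists d. split.
    + apply is_linear_scal_l.
    + intros x Hx. apply (@is_filter_lim_locally_unique C_AbsRing (AbsRing_NormedModule C_AbsRing)) in Hx.
      subst x. intros eps. destruct (Hd eps (cond_pos eps)) as [del [Hp Hdel]].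
      exists (mkposreal del Hp). intros y Hy. change (Cmod (y - s) < del) in Hy.
      specialize (Hdel (y - s) Hy).
      assert (E : s + ((y : C) - s) = (y : C)) by (set (u := y : C); ring).
      rewrite E in Hdel.
      change (Cmod ((f y - f s) - (y - s) * d) <= eps * Cmod (y - s)).
      now rewrite (Cmult_comm _ d).
Qed.

Lemma entire_cder (f : C -> C) : entire f -> exists df, forall s, cder f s (df s).
Proof.
  intros Hf. exists (fun s => proj1_sig (constructive_indefinite_description _
     (proj1 (holomorphic_at_cder f s) (Hf s)))).
  intros s. apply proj2_sig.
Qed.

Lemma cder_ext_loc (f g : C -> C) (s d : C) (r : R) :
  (0 < r) -> (forall h, (Cmod h < r) -> f (s + h) = g (s + h)) -> cder f s d -> cder g s d.
Proof.
  intros Hr E Hf eps He. destruct (Hf eps He) as [del [Hd H]].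
  exists (Rmin r del). split; [now apply Rmin_pos|]. intros h Hh.
  rewrite <- E by (apply Rlt_le_trans with (1 := Hh); apply Rmin_l).
  assert (E0 : f s = g s). { generalize (E 0). rewrite Cplus_0_r, Cmod_0. auto. }
  rewrite <- E0. apply H. apply Rlt_le_trans with (1 := Hh); apply Rmin_r.
Qed.

Lemma cder_ext (f g : C -> C) (s d : C) : (forall z, f z = g z) -> cder f s d -> cder g s d.
Proof. intros E. apply (cder_ext_loc f g s d 1); [lra|auto]. Qed.

Lemma cder_const (c s : C) : cder (fun _ => c) s 0.
Proof.
  intros eps He. exists 1%R. split; [lra|]. intros h _.
  replace (c - c - 0 * h) with (RtoC 0) by ring. rewrite Cmod_0.
  generalize (Cmod_ge_0 h). nra.
Qed.

Lemma cder_id (s : C) : cder (fun z => z) s 1.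
Proof.
  intros eps He. exists 1%R. split; [lra|]. intros h _.
  replace (s + h - s - 1 * h) with (RtoC 0) by ring. rewrite Cmod_0.
  generalize (Cmod_ge_0 h). nra.
Qed.

Lemma cder_plus (f g : C -> C) (s a b : C) :
  cder f s a -> cder g s b -> cder (fun z => f z + g z) s (a + b).
Proof.
  intros Hf Hg eps He.
  destruct (Hf (eps / 2)%R) as [d1 [P1 H1]]; [lra|].
  destruct (Hg (eps / 2)%R) as [d2 [P2 H2]]; [lra|].
  exists (Rmin d1 d2). split; [now apply Rmin_pos|]. intros h Hh.
  specialize (H1 h (Rlt_le_trans _ _ _ Hh (Rmin_l _ _))).
  specialize (H2 h (Rlt_le_trans _ _ _ Hh (Rmin_r _ _))).
  replace (f (s + h) + g (s + h) - (f s + g s) - (a + b) * h)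
    with ((f (s + h) - f s - a * h) + (g (s + h) - g s - b * h)) by ring.
  generalize (Cmod_triangle (f (s + h) - f s - a * h) (g (s + h) - g s - b * h)). lra.
Qed.

Lemma cder_lip (f : C -> C) (s d : C) : cder f s d -> exists del, (0 < del) /\
  forall h, (Cmod h < del) -> (Cmod (f (s + h) - f s) <= (Cmod d + 1) * Cmod h).
Proof.
  intros H. destruct (H 1%R Rlt_0_1) as [del [P Q]]. exists del. split; [exact P|].
  intros h Hh. specialize (Q h Hh).
  generalize (Cmod_sub_le (f (s + h) - f s) (d * h)). rewrite Cmod_mult. lra.
Qed.

Lemma cder_cont (f : C -> C) (s d : C) : cder f s d -> forall eps, (0 < eps) -> exists del, (0 < del) /\
  forall h, (Cmod h < del) -> (Cmod (f (s + h) - f s) <= eps).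
Proof.
  intros H eps He. destruct (cder_lip _ _ _ H) as [del [P Q]].
  assert (K : (0 < Cmod d + 1)) by (generalize (Cmod_ge_0 d); lra).
  assert (K2 : (0 < eps / (Cmod d + 1))) by (apply Rdiv_lt_0_compat; lra).
  exists (Rmin del (eps / (Cmod d + 1))). split; [now apply Rmin_pos|]. intros h Hh.
  specialize (Q h (Rlt_le_trans _ _ _ Hh (Rmin_l _ _))).
  apply Rle_trans with (1 := Q).
  assert (Cmod h <= eps / (Cmod d + 1))
    by (apply Rlt_le, (Rlt_le_trans _ _ _ Hh (Rmin_r _ _))).
  apply Rle_trans with ((Cmod d + 1) * (eps / (Cmod d + 1)))%R.
  - apply Rmult_le_compat_l; lra.
  - right. field. lra.
Qed.

Lemma cder_mult (f g : C -> C) (s a b : C) :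
  cder f s a -> cder g s b -> cder (fun z => f z * g z) s (a * g s + f s * b).
Proof.
  intros Hf Hg eps He.
  set (A := (Cmod a + 1)%R). set (K := (Cmod (g s) + Cmod (f s) + Cmod b + 3 + A)%R).
  assert (0 < K) by (unfold K, A; generalize (Cmod_ge_0 (g s)) (Cmod_ge_0 (f s)) (Cmod_ge_0 b) (Cmod_ge_0 a); lra).
  assert (Ke : (0 < eps / (3 * K))) by (apply Rdiv_lt_0_compat; lra).
  destruct (Hf _ Ke) as [d1 [P1 H1]].
  destruct (Hg _ Ke) as [d2 [P2 H2]].
  destruct (cder_lip _ _ _ Hf) as [d3 [P3 H3]].
  destruct (cder_cont _ _ _ Hg _ Ke) as [d4 [P4 H4]].
  exists (Rmin (Rmin d1 d2) (Rmin d3 d4)).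
  split; [repeat apply Rmin_pos; auto|]. intros h Hh.
  assert (L1 : (Cmod h < d1)) by (apply Rlt_le_trans with (1 := Hh); eapply Rle_trans; [apply Rmin_l|apply Rmin_l]).
  assert (L2 : (Cmod h < d2)) by (apply Rlt_le_trans with (1 := Hh); eapply Rle_trans; [apply Rmin_l|apply Rmin_r]).
  assert (L3 : (Cmod h < d3)) by (apply Rlt_le_trans with (1 := Hh); eapply Rle_trans; [apply Rmin_r|apply Rmin_l]).
  assert (L4 : (Cmod h < d4)) by (apply Rlt_le_trans with (1 := Hh); eapply Rle_trans; [apply Rmin_r|apply Rmin_r]).
  specialize (H1 h L1). specialize (H2 h L2). specialize (H3 h L3). specialize (H4 h L4).
  (* Two linear errors and one product of increments; the choice of [K] makes each at most a third
     of [eps * Cmod h]. *)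
  replace (f (s + h) * g (s + h) - f s * g s - (a * g s + f s * b) * h) with
    ((f (s + h) - f s - a * h) * g s + f s * (g (s + h) - g s - b * h)
      + (f (s + h) - f s) * (g (s + h) - g s)) by ring.
  eapply Rle_trans; [apply Cmod_triangle|].
  eapply Rle_trans; [apply Rplus_le_compat_r, Cmod_triangle|].
  rewrite !Cmod_mult.
  set (e3 := (eps / (3 * K))%R) in *.
  assert (E3 : (3 * K * e3 = eps)%R) by (unfold e3; field; lra).
  fold A in H3.
  generalize (Cmod_ge_0 (g s)) (Cmod_ge_0 (f s)) (Cmod_ge_0 b) (Cmod_ge_0 a) (Cmod_ge_0 h)
   (Cmod_ge_0 (f (s + h) - f s - a * h)) (Cmod_ge_0 (g (s + h) - g s - b * h))
   (Cmod_ge_0 (f (s + h) - f s)) (Cmod_ge_0 (g (s + h) - g s)). intros.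
  assert (X1 : (Cmod (f (s + h) - f s - a * h) * Cmod (g s) <= e3 * Cmod h * K)).
  { apply Rmult_le_compat; auto. unfold K, A. lra. }
  assert (X2 : (Cmod (f s) * Cmod (g (s + h) - g s - b * h) <= K * (e3 * Cmod h))).
  { apply Rmult_le_compat; auto. unfold K, A. lra. }
  assert (X3 : (Cmod (f (s + h) - f s) * Cmod (g (s + h) - g s) <= (K * Cmod h) * e3)).
  { apply Rmult_le_compat; auto. apply Rle_trans with (1 := H3). apply Rmult_le_compat_r; auto. unfold K. lra. }
  rewrite <- E3. lra.
Qed.

Lemma cder_comp (f g : C -> C) (s a b : C) :
  cder f s a -> cder g (f s) b -> cder (fun z => g (f z)) s (b * a).
Proof.
  intros Hf Hg eps He.
  set (A := (Cmod a + 1)%R). assert (0 < A) by (unfold A; generalize (Cmod_ge_0 a); lra).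
  assert (HB : (0 < Cmod b + 1)) by (generalize (Cmod_ge_0 b); lra).
  destruct (Hg (eps / (2 * A))%R) as [d1 [P1 H1]]; [apply Rdiv_lt_0_compat; lra|].
  destruct (Hf (eps / (2 * (Cmod b + 1)))%R) as [d2 [P2 H2]]; [apply Rdiv_lt_0_compat; lra|].
  destruct (cder_lip _ _ _ Hf) as [d3 [P3 H3]].
  destruct (cder_cont _ _ _ Hf (d1 / 2)%R) as [d4 [P4 H4]]; [lra|].
  exists (Rmin d2 (Rmin d3 d4)).
  split; [repeat apply Rmin_pos; auto|]. intros h Hh.
  assert (L2 : (Cmod h < d2)) by (apply Rlt_le_trans with (1 := Hh); apply Rmin_l).
  assert (L3 : (Cmod h < d3)) by (apply Rlt_le_trans with (1 := Hh); eapply Rle_trans; [apply Rmin_r|apply Rmin_l]).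
  assert (L4 : (Cmod h < d4)) by (apply Rlt_le_trans with (1 := Hh); eapply Rle_trans; [apply Rmin_r|apply Rmin_r]).
  specialize (H2 h L2). specialize (H3 h L3). specialize (H4 h L4).
  specialize (H1 (f (s + h) - f s)). replace (f s + (f (s + h) - f s)) with (f (s + h)) in H1 by ring.
  assert (L1 : (Cmod (f (s + h) - f s) < d1)) by lra. specialize (H1 L1).
  replace (g (f (s + h)) - g (f s) - b * a * h) with
   ((g (f (s + h)) - g (f s) - b * (f (s + h) - f s)) + b * (f (s + h) - f s - a * h)) by ring.
  eapply Rle_trans; [apply Cmod_triangle|]. rewrite Cmod_mult. fold A in H3.
  assert (X1 : (eps / (2 * A) * Cmod (f (s + h) - f s) <= eps / 2 * Cmod h)).
  { apply Rle_trans with (eps / (2 * A) * (A * Cmod h))%R.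
    - apply Rmult_le_compat_l; auto. apply Rlt_le, Rdiv_lt_0_compat; lra.
    - right. field. lra. }
  assert (X2 : (Cmod b * Cmod (f (s + h) - f s - a * h) <= eps / 2 * Cmod h)).
  { apply Rle_trans with ((Cmod b + 1) * (eps / (2 * (Cmod b + 1)) * Cmod h))%R.
    - apply Rmult_le_compat; auto using Cmod_ge_0. lra.
    - right. field. lra. }
  lra.
Qed.

Lemma cder_eq (f : C -> C) (s d d' : C) : d = d' -> cder f s d -> cder f s d'.
Proof. now intros ->. Qed.

Lemma cder_scal (c : C) (f : C -> C) (s d : C) : cder f s d -> cder (fun z => c * f z) s (c * d).
Proof.
  intros H. apply (cder_eq _ _ (0 * f s + c * d)); [ring|].
  apply (cder_mult (fun _ => c) f). apply cder_const. exact H.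
Qed.

Lemma cder_opp (f : C -> C) (s d : C) : cder f s d -> cder (fun z => - f z) s (- d).
Proof.
  intros H. apply (cder_eq _ _ (-(1) * d)); [ring|].
  apply (cder_ext (fun z => -(1) * f z)). intros; ring. now apply cder_scal.
Qed.

Lemma cder_minus (f g : C -> C) (s a b : C) :
  cder f s a -> cder g s b -> cder (fun z => f z - g z) s (a - b).
Proof. intros. apply cder_plus; auto. now apply cder_opp. Qed.

(** * Differentiable paths and the mean value inequality *)

(** Taken coordinate by coordinate, so that the rules for real derivatives and [auto_derive] apply
    to each component. *)
Definition pder (g : R -> C) (t : R) (d : C) : Prop :=
  is_derive (fun t => fst (g t)) t (fst d) /\ is_derive (fun t => snd (g t)) t (snd d).

Lemma pder_ext (f g : R -> C) (t : R) (d : C) : (forall t, f t = g t) -> pder f t d -> pder g t d.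
Proof.
  intros E [H1 H2]. split.
  - apply (is_derive_ext (fun t => fst (f t))); auto. intros u. now rewrite E.
  - apply (is_derive_ext (fun t => snd (f t))); auto. intros u. now rewrite E.
Qed.

Lemma pder_eq (f : R -> C) (t : R) (d d' : C) : d = d' -> pder f t d -> pder f t d'.
Proof. now intros ->. Qed.

Lemma pder_affine (a b : C) (t : R) : pder (fun t => a + t * b) t b.
Proof. destruct a, b. split; simpl; auto_derive; auto; ring. Qed.

Lemma pder_const (a : C) (t : R) : pder (fun t => a) t 0.
Proof. destruct a. split; simpl; auto_derive; auto; ring. Qed.

Lemma pder_plus (f g : R -> C) (t : R) (a b : C) :
  pder f t a -> pder g t b -> pder (fun t => f t + g t) t (a + b).
Proof.
  intros [H1 H2] [H3 H4]. split.
  - apply (is_derive_plus (fun t => fst (f t)) (fun t => fst (g t))); auto.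
  - apply (is_derive_plus (fun t => snd (f t)) (fun t => snd (g t))); auto.
Qed.

Lemma pder_mult (f g : R -> C) (t : R) (a b : C) :
  pder f t a -> pder g t b -> pder (fun t => f t * g t) t (a * g t + f t * b).
Proof.
  intros [H1 H2] [H3 H4].
  assert (M := fun u v du dv Hu Hv => is_derive_mult u v t du dv Hu Hv Rmult_comm).
  unfold mult, plus in M; simpl in M.
  split.
  - apply (is_derive_ext (fun t => (fst (f t) * fst (g t) - snd (f t) * snd (g t))%R)); [reflexivity|].
    replace (fst (a * g t + f t * b)) with
      ((fst a * fst (g t) + fst (f t) * fst b) - (snd a * snd (g t) + snd (f t) * snd b))%R by (simpl; ring).
    apply (is_derive_minus (fun t => (fst (f t) * fst (g t))%R) (fun t => (snd (f t) * snd (g t))%R)).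
    now apply (M (fun t => fst (f t)) (fun t => fst (g t))).
    now apply (M (fun t => snd (f t)) (fun t => snd (g t))).
  - apply (is_derive_ext (fun t => (fst (f t) * snd (g t) + snd (f t) * fst (g t))%R)); [reflexivity|].
    replace (snd (a * g t + f t * b)) with
      ((fst a * snd (g t) + fst (f t) * snd b) + (snd a * fst (g t) + snd (f t) * fst b))%R by (simpl; ring).
    apply (is_derive_plus (fun t => (fst (f t) * snd (g t))%R) (fun t => (snd (f t) * fst (g t))%R)).
    now apply (M (fun t => fst (f t)) (fun t => snd (g t))).
    now apply (M (fun t => snd (f t)) (fun t => fst (g t))).
Qed.

Lemma pder_scal (c : C) (f : R -> C) (t : R) (a : C) :
  pder f t a -> pder (fun t => c * f t) t (c * a).
Proof.
  intros H. apply (pder_eq _ _ (0 * f t + c * a)); [ring|].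
  apply (pder_mult (fun _ => c)); auto. apply pder_const.
Qed.

(** A path has no intermediate point, so the argument is projected onto [D = g b - g a]: the
    function [k], the inner product of [D] with [g t] minus [Cmod D * phi t], has nonpositive
    derivative by Cauchy-Schwarz, and [k b <= k a] gives the bound after division by [Cmod D]. The
    variable majorant [phi] is what the iterated Taylor estimate in [identity_theorem] needs. *)
Lemma mean_value_ineq (g dg : R -> C) (phi dphi : R -> R) (a b : R) : (a <= b) ->
  (forall t, (a <= t <= b) -> pder g t (dg t)) ->
  (forall t, (a <= t <= b) -> is_derive phi t (dphi t)) ->
  (forall t, (a <= t <= b) -> (Cmod (dg t) <= dphi t)) ->
  (Cmod (g b - g a) <= phi b - phi a).
Proof.
  intros Hab Hg Hphi Hb.
  set (D := g b - g a). set (m := Cmod D).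
  set (k := fun t => (fst D * fst (g t) + snd D * snd (g t) - m * phi t)%R).
  set (dk := fun t => (fst D * fst (dg t) + snd D * snd (dg t) - m * dphi t)%R).
  assert (Hk : forall t, (a <= t <= b) -> is_derive k t (dk t)).
  { intros t Ht. destruct (Hg t Ht) as [H1 H2]. specialize (Hphi t Ht). unfold k, dk.
    apply (is_derive_minus (fun t => (fst D * fst (g t) + snd D * snd (g t))%R) (fun t => (m * phi t)%R)).
    - apply (is_derive_plus (fun t => (fst D * fst (g t))%R) (fun t => (snd D * snd (g t))%R)).
      + apply (is_derive_scal (fun t => fst (g t))). exact H1.
      + apply (is_derive_scal (fun t => snd (g t))). exact H2.
    - apply (is_derive_scal phi). exact Hphi. }
  destruct (MVT_gen k a b dk) as [c [Hc E]].
  - intros x. rewrite Rmin_left, Rmax_right by auto. intros Hx. apply Hk. lra.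
  - intros x. rewrite Rmin_left, Rmax_right by auto. intros Hx.
    apply continuity_pt_filterlim. apply (ex_derive_continuous k x). exists (dk x). apply Hk. lra.
  - rewrite Rmin_left, Rmax_right in Hc by auto.
    assert (Hdk : (dk c <= 0)).
    { unfold dk. assert (fst D * fst (dg c) + snd D * snd (dg c) <= m * Cmod (dg c)).
      { replace (fst D * fst (dg c) + snd D * snd (dg c))%R with (Re (Cconj D * dg c)).
        - eapply Rle_trans; [apply Rle_abs|]. eapply Rle_trans; [apply re_le_Cmod|].
          rewrite Cmod_mult, Cmod_conj. apply Rle_refl.
        - unfold Cconj, Re, Cmult; simpl. ring. }
      specialize (Hb c Hc). assert (0 <= m) by apply Cmod_ge_0. nra. }
    assert (k b - k a <= 0) by (rewrite E; nra).
    assert (Q : (k b - k a = m * m - m * (phi b - phi a))%R).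
    { unfold k. assert (m * m = fst D * fst D + snd D * snd D)%R.
      { unfold m. generalize (Cmod2_alt D). unfold Re, Im. simpl. lra. }
      rewrite H0. unfold D. simpl. ring. }
    (* For [D = 0] the function [k] carries no information; it remains that [phi] does not
       decrease. *)
    rewrite Q in H. destruct (Rle_lt_or_eq_dec 0 m (Cmod_ge_0 _)) as [Hm|Hm].
    + apply Rmult_le_reg_l with m; auto. lra.
    + rewrite <- Hm.
      assert (M2 : forall t, (a <= t <= b) -> (0 <= dphi t)).
      { intros t Ht. eapply Rle_trans; [apply Cmod_ge_0|apply Hb, Ht]. }
      destruct (MVT_gen phi a b dphi) as [c' [Hc' E']].
      * intros x. rewrite Rmin_left, Rmax_right by auto. intros Hx. apply Hphi. lra.
      * intros x. rewrite Rmin_left, Rmax_right by auto. intros Hx.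
        apply continuity_pt_filterlim. apply (ex_derive_continuous phi x). exists (dphi x). apply Hphi. lra.
      * rewrite Rmin_left, Rmax_right in Hc' by auto. specialize (M2 c' Hc'). nra.
Qed.

Lemma mean_value_ineq_const (g dg : R -> C) (B a b : R) : (a <= b) ->
  (forall t, (a <= t <= b) -> pder g t (dg t)) ->
  (forall t, (a <= t <= b) -> (Cmod (dg t) <= B)) ->
  (Cmod (g b - g a) <= B * (b - a)).
Proof.
  intros Hab Hg Hb.
  replace (B * (b - a))%R with (B * b - B * a)%R by ring.
  apply (mean_value_ineq g dg (fun t => (B * t)%R) (fun _ => B)); auto.
  intros t Ht. auto_derive; auto. ring.
Qed.

Lemma cder_pder (f : C -> C) (a b d : C) (t : R) :
  cder f (a + t * b) d -> pder (fun t => f (a + t * b)) t (d * b).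
Proof.
  intros H.
  assert (K : forall eps : R, (0 < eps) -> exists del, (0 < del) /\ forall h : R, (Rabs h < del) ->
    (Cmod (f (a + (t + h)%R * b) - f (a + t * b) - d * b * h) <= eps * Rabs h)).
  { intros eps He. assert (HB : (0 < Cmod b + 1)) by (generalize (Cmod_ge_0 b); lra).
    destruct (H (eps / (Cmod b + 1))%R) as [del [P Q]]; [apply Rdiv_lt_0_compat; lra|].
    exists (del / (Cmod b + 1))%R. split; [apply Rdiv_lt_0_compat; lra|].
    intros h Hh. specialize (Q (h * b)).
    assert (L : (Cmod (h * b) <= (Cmod b + 1) * Rabs h)).
    { rewrite Cmod_mult, Cmod_R. generalize (Rabs_pos h). nra. }
    replace (a + t * b + h * b) with (a + (t + h)%R * b) in Q by (rewrite RtoC_plus; ring).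
    replace (d * b * h) with (d * (h * b)) by ring.
    eapply Rle_trans; [apply Q|].
    - eapply Rle_lt_trans; [apply L|]. apply Rmult_lt_reg_l with (/ (Cmod b + 1))%R.
      now apply Rinv_0_lt_compat. field_simplify; [|lra..]. unfold Rdiv in *. field_simplify in Hh; lra.
    - apply Rle_trans with (eps / (Cmod b + 1) * ((Cmod b + 1) * Rabs h))%R.
      apply Rmult_le_compat_l; auto. apply Rlt_le, Rdiv_lt_0_compat; lra. right; field; lra. }
  split; (split; [apply is_linear_scal_l|]); intros x Hx;
    apply (@is_filter_lim_locally_unique R_AbsRing (AbsRing_NormedModule R_AbsRing)) in Hx; subst x;
    intros eps; destruct (K eps (cond_pos eps)) as [del [P Q]]; exists (mkposreal del P); intros y Hy;
    change (Rabs (y - t) < del) in Hy; specialize (Q _ Hy);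
    (assert (E : (t + ((y : R) - t))%R = (y : R)) by (set (u := y : R); ring)); rewrite E in Q.
  - change (Rabs (fst (f (a + y * b)) - fst (f (a + t * b)) - (y - t) * fst (d * b)) <= eps * Rabs (y - t)).
    eapply Rle_trans; [|exact Q].
    eapply Rle_trans; [|apply Rmax_Cmod]. eapply Rle_trans; [|apply Rmax_l].
    right. f_equal. simpl. ring.
  - change (Rabs (snd (f (a + y * b)) - snd (f (a + t * b)) - (y - t) * snd (d * b)) <= eps * Rabs (y - t)).
    eapply Rle_trans; [|exact Q].
    eapply Rle_trans; [|apply Rmax_Cmod]. eapply Rle_trans; [|apply Rmax_r].
    right. f_equal. simpl. ring.
Qed.

Lemma cder_mean_value (f df : C -> C) (a b : C) (B : R) :
  (forall t : R, (0 <= t <= 1) -> cder f (a + t * (b - a)) (df (a + t * (b - a))) /\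
      (Cmod (df (a + t * (b - a))) <= B)) ->
  (Cmod (f b - f a) <= B * Cmod (b - a)).
Proof.
  intros H.
  assert (K := mean_value_ineq_const (fun t => f (a + t * (b - a))) (fun t => df (a + t * (b - a)) * (b - a))
    (B * Cmod (b - a)) 0 1).
  cbv beta in K. replace (a + 1%R * (b - a)) with b in K by ring.
  replace (a + 0%R * (b - a)) with a in K by ring.
  rewrite Rminus_0_r, Rmult_1_r in K. apply K.
  - lra.
  - intros t Ht. apply cder_pder. apply H, Ht.
  - intros t Ht. rewrite Cmod_mult. apply Rmult_le_compat_r; [apply Cmod_ge_0|]. apply H, Ht.
Qed.

(** * The complex exponential *)

Lemma Cexp_plus (a b : C) : Cexp (a + b) = Cexp a * Cexp b.
Proof.
  unfold Cexp. destruct a as [a1 a2], b as [b1 b2]. unfold Re, Im, Cplus, Cmult, RtoC; simpl.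
  rewrite exp_plus, cos_plus, sin_plus. f_equal; ring.
Qed.

Lemma Cexp_0 : Cexp 0 = 1.
Proof. unfold Cexp, Re, Im, RtoC, Cmult; simpl. rewrite exp_0, cos_0, sin_0. f_equal; ring. Qed.

Lemma Cmod_Cexp (a : C) : Cmod (Cexp a) = exp (Re a).
Proof.
  unfold Cexp. rewrite Cmod_mult, Cmod_R, Rabs_pos_eq by (apply Rlt_le, exp_pos).
  unfold Cmod; simpl. replace (_ + _)%R with 1%R. rewrite sqrt_1; ring.
  generalize (sin2_cos2 (Im a)). unfold Rsqr. lra.
Qed.

Lemma Cexp_neq_0 (a : C) : Cexp a <> 0.
Proof. apply Cmod_gt_0. rewrite Cmod_Cexp. apply exp_pos. Qed.

Lemma Cexp_opp (a : C) : Cexp (- a) = / Cexp a.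
Proof.
  transitivity (Cexp (- a) * Cexp a * / Cexp a).
  - field. apply Cexp_neq_0.
  - rewrite <- Cexp_plus. replace (- a + a) with (RtoC 0) by ring. rewrite Cexp_0. ring.
Qed.

Lemma Cexp_pow (a : C) (n : nat) : Cexp (INR n * a) = Cexp a ^ n.
Proof.
  induction n as [|n IH].
  - simpl. rewrite Cmult_0_l. apply Cexp_0.
  - rewrite S_INR, RtoC_plus, Cmult_plus_distr_r, Cexp_plus, IH, Cmult_1_l. simpl. ring.
Qed.

Lemma Cexp_R (x : R) : Cexp x = exp x.
Proof. unfold Cexp, Re, Im, RtoC, Cmult; simpl. rewrite cos_0, sin_0. f_equal; ring. Qed.

Lemma pder_Cexp (a b : C) (t : R) : pder (fun t => Cexp (a + t * b)) t (b * Cexp (a + t * b)).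
Proof.
  destruct a as [a1 a2], b as [b1 b2].
  split; unfold Cexp, Re, Im, RtoC, Cmult, Cplus; simpl.
  - auto_derive; auto. unfold Rminus. ring.
  - auto_derive; auto. unfold Rminus. ring.
Qed.

Lemma Cexp_bound1 (h : C) : (Cmod (Cexp h - 1) <= Cmod h * exp (Cmod h)).
Proof.
  assert (K := mean_value_ineq_const (fun t => Cexp (0 + t * h)) (fun t => h * Cexp (0 + t * h))
    (Cmod h * exp (Cmod h)) 0 1).
  cbv beta in K. replace (0 + 1%R * h) with h in K by ring. replace (0 + 0%R * h) with (RtoC 0) in K by ring.
  rewrite Cexp_0, Rminus_0_r, Rmult_1_r in K. apply K.
  - lra.
  - intros. apply pder_Cexp.
  - intros t Ht. rewrite Cmod_mult, Cmod_Cexp. apply Rmult_le_compat_l; [apply Cmod_ge_0|].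
    assert (Re (0 + t * h) <= Cmod h).
    { eapply Rle_trans; [apply Rle_abs|]. eapply Rle_trans; [apply re_le_Cmod|].
      rewrite Cplus_0_l, Cmod_mult, Cmod_R, Rabs_pos_eq by lra. generalize (Cmod_ge_0 h). nra. }
    destruct H as [H|H]; [left; now apply exp_increasing|right; now rewrite H].
Qed.

(** Along the segment from 0 to [h] the derivative of the remainder is [h * (Cexp (t * h) - 1)], to
    which [Cexp_bound1] applies. The quadratic error gives both the derivative of [Cexp] and the
    rate at which [N (1 - e (a / N))] converges. *)
Lemma Cexp_bound2 (h : C) : (Cmod (Cexp h - 1 - h) <= Cmod h * Cmod h * exp (Cmod h)).
Proof.
  assert (K := mean_value_ineq_const (fun t => Cexp (0 + t * h) - 1 - t * h) (fun t => h * Cexp (0 + t * h) - h)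
    (Cmod h * Cmod h * exp (Cmod h)) 0 1).
  cbv beta in K. replace (0 + 1%R * h) with h in K by ring. replace (0 + 0%R * h) with (RtoC 0) in K by ring.
  rewrite Cexp_0, Rminus_0_r, Rmult_1_r in K.
  replace (Cexp h - 1 - 1%R * h - (1 - 1 - 0%R * h)) with (Cexp h - 1 - h) in K by ring. apply K.
  - lra.
  - intros t Ht. apply (pder_ext (fun t => Cexp (0 + t * h) + (- (1) + t * (- h)))).
    intros; ring. apply pder_plus. apply pder_Cexp. apply pder_affine.
  - intros t Ht. replace (h * Cexp (0 + t * h) - h) with (h * (Cexp (0 + t * h) - 1)) by ring.
    rewrite Cmod_mult, Rmult_assoc. apply Rmult_le_compat_l; [apply Cmod_ge_0|].
    rewrite Cplus_0_l. eapply Rle_trans; [apply Cexp_bound1|].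
    assert (Cmod (t * h) <= Cmod h).
    { rewrite Cmod_mult, Cmod_R, Rabs_pos_eq by lra. generalize (Cmod_ge_0 h). nra. }
    apply Rmult_le_compat; auto using Cmod_ge_0. left; apply exp_pos.
    destruct H as [H|H]; [left; now apply exp_increasing|right; now rewrite H].
Qed.

Lemma cder_Cexp (s : C) : cder Cexp s (Cexp s).
Proof.
  intros eps He.
  set (K := (Cmod (Cexp s) * exp 1 + 1)%R).
  assert (HK : (0 < K)) by (unfold K; generalize (Cmod_ge_0 (Cexp s)) (exp_pos 1); nra).
  exists (Rmin 1 (eps / K)). split; [apply Rmin_pos; [lra|apply Rdiv_lt_0_compat; lra]|].
  intros h Hh. rewrite Cexp_plus.
  replace (Cexp s * Cexp h - Cexp s - Cexp s * h) with (Cexp s * (Cexp h - 1 - h)) by ring.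
  rewrite Cmod_mult. 
  assert (L1 : (Cmod h <= 1)) by (apply Rlt_le, (Rlt_le_trans _ _ _ Hh (Rmin_l _ _))).
  assert (L2 : (Cmod h <= eps / K)) by (apply Rlt_le, (Rlt_le_trans _ _ _ Hh (Rmin_r _ _))).
  assert (L3 : (K * Cmod h <= eps)).
  { apply Rle_trans with (K * (eps / K))%R. apply Rmult_le_compat_l; lra. right; field; lra. }
  assert (E1 : (exp (Cmod h) <= exp 1)) by (destruct L1 as [L|L]; [left; now apply exp_increasing|right; now rewrite L]).
  generalize (Cexp_bound2 h) (Cmod_ge_0 (Cexp s)) (Cmod_ge_0 h) (exp_pos (Cmod h)). intros.
  apply Rle_trans with (Cmod (Cexp s) * (Cmod h * Cmod h * exp 1))%R.
  - apply Rmult_le_compat_l; auto. eapply Rle_trans; [apply H|].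
    apply Rmult_le_compat_l; nra.
  - apply Rle_trans with ((K * Cmod h) * Cmod h)%R; [|apply Rmult_le_compat_r; lra].
    unfold K. nra.
Qed.

(** * Complex analysis *)

(** Nested rectangles in place of compactness. [P x y a b] speaks of the rectangle with lower left
    corner [(x, y)] and sides [a], [b]; if it always passes to some quarter, it holds for
    arbitrarily small rectangles around one point. Goursat's lemma and the boundedness of entire
    functions on discs both rest on it. *)
Lemma bisection (P : R -> R -> R -> R -> Prop) (x0 y0 A B : R) :
  0 <= A -> 0 <= B ->
  (forall x y a b, 0 <= a -> 0 <= b -> P x y a b ->
     P x y (a / 2)%R (b / 2)%R \/ P (x + a / 2)%R y (a / 2)%R (b / 2)%R \/
     P x (y + b / 2)%R (a / 2)%R (b / 2)%R \/ P (x + a / 2)%R (y + b / 2)%R (a / 2)%R (b / 2)%R) ->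
  P x0 y0 A B ->
  exists p q, forall del, 0 < del -> exists x y a b,
    x <= p <= x + a /\ y <= q <= y + b /\ 0 <= a < del /\ 0 <= b < del /\ P x y a b.
Proof.
  intros HA HB Hstep H0.
  (* A corner at level [n] carries its proof of [P], so that the choice of the next quarter can be
     iterated as a function. *)
  set (T := fun n : nat => {xy : R * R | P (fst xy) (snd xy) (A / 2 ^ n)%R (B / 2 ^ n)%R}).
  assert (HP : forall n : nat, (0 < 2 ^ n)) by (intros; apply pow_lt; lra).
  assert (PA : forall n : nat, (0 <= A / 2 ^ n)) by (intros; apply Rdiv_le_0_compat; auto).
  assert (PB : forall n : nat, (0 <= B / 2 ^ n)) by (intros; apply Rdiv_le_0_compat; auto).
  assert (EA : forall n : nat, (A / 2 ^ S n = A / 2 ^ n / 2)%R) by (intros; simpl; field; apply Rgt_not_eq, HP).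
  assert (EB : forall n : nat, (B / 2 ^ S n = B / 2 ^ n / 2)%R) by (intros; simpl; field; apply Rgt_not_eq, HP).
  assert (next : forall n (t : T n), {t' : T (S n) |
     (fst (proj1_sig t) <= fst (proj1_sig t') /\ fst (proj1_sig t') + A / 2 ^ S n <= fst (proj1_sig t) + A / 2 ^ n) /\
     (snd (proj1_sig t) <= snd (proj1_sig t') /\ snd (proj1_sig t') + B / 2 ^ S n <= snd (proj1_sig t) + B / 2 ^ n)}).
  { intros n [[x y] Hxy]. simpl fst in *. simpl snd in *. apply constructive_indefinite_description.
    specialize (PA n). specialize (PB n).
    assert (K := Hstep _ _ _ _ PA PB Hxy). rewrite <- EA, <- EB in K.
    assert (G : forall x' y', P x' y' (A / 2 ^ S n)%R (B / 2 ^ S n)%R ->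
      (x <= x' /\ x' + A / 2 ^ S n <= x + A / 2 ^ n) ->
      (y <= y' /\ y' + B / 2 ^ S n <= y + B / 2 ^ n) -> exists t' : T (S n),
      (x <= fst (proj1_sig t') /\ fst (proj1_sig t') + A / 2 ^ S n <= x + A / 2 ^ n) /\
     (y <= snd (proj1_sig t') /\ snd (proj1_sig t') + B / 2 ^ S n <= y + B / 2 ^ n)).
    { intros x' y' HH H1 H2. exists (exist _ (x', y') HH). simpl proj1_sig. auto. }
    assert (EAn := EA n). assert (EBn := EB n).
    destruct K as [K|[K|[K|K]]]; apply (G _ _ K); lra. }
  (* The two [eq_ind] casts only rewrite the sides [A] and [B] as [A / 2 ^ 0] and [B / 2 ^ 0]. *)
  set (seq := fix seq n : T n := match n with O => exist _ (x0, y0)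
     (eq_ind _ (fun u => P x0 y0 u (B / 2 ^ 0)%R) (eq_ind _ (fun u => P x0 y0 A u) H0 _ (eq_sym (Rdiv_1_r B))) _ (eq_sym (Rdiv_1_r A)))
     | S m => proj1_sig (next m (seq m)) end).
  set (xs := fun n => fst (proj1_sig (seq n))). set (ys := fun n => snd (proj1_sig (seq n))).
  assert (Hs : forall n, (xs n <= xs (S n) /\ xs (S n) + A / 2 ^ S n <= xs n + A / 2 ^ n) /\
     (ys n <= ys (S n) /\ ys (S n) + B / 2 ^ S n <= ys n + B / 2 ^ n)).
  { intros n. apply (proj2_sig (next n (seq n))). }
  (* Nested intervals in one coordinate: the common point is the supremum of the left end points. *)
  assert (L : forall (us : nat -> R) D, (forall n : nat, 0 <= D / 2 ^ n) ->
    (forall n, us n <= us (S n) /\ us (S n) + D / 2 ^ S n <= us n + D / 2 ^ n) ->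
    exists p, forall n, us n <= p <= us n + D / 2 ^ n).
  { intros us D HD Hu.
    assert (M1 : forall n k, us n <= us (n + k)%nat /\ us (n + k)%nat + D / 2 ^ (n + k) <= us n + D / 2 ^ n).
    { intros n k. induction k as [|k IH]. rewrite Nat.add_0_r. lra.
      rewrite Nat.add_succ_r. generalize (Hu (n + k)%nat). lra. }
    assert (M2 : forall n m, us m <= us n + D / 2 ^ n).
    { intros n m. destruct (Nat.le_ge_cases n m) as [C|C].
      - replace m with (n + (m - n))%nat by lia. generalize (M1 n (m - n)%nat) (HD (n + (m - n))%nat). lra.
      - replace n with (m + (n - m))%nat by lia. generalize (M1 m (n - m)%nat) (HD (m + (n - m))%nat). lra. }
    destruct (completeness (fun v => exists n, v = us n)) as [p [Hp1 Hp2]].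
    - exists (us 0%nat + D / 2 ^ 0)%R. intros v [n ->]. apply M2.
    - exists (us 0%nat). now exists 0%nat.
    - exists p. intros n. split. apply Hp1. now exists n. apply Hp2. intros v [m ->]. apply M2. }
  destruct (L xs A PA) as [p Hp]. { intros n. apply Hs. }
  destruct (L ys B PB) as [q Hq]. { intros n. apply Hs. }
  exists p, q. intros del Hdel.
  assert (exists n : nat, (A + B) / del < 2 ^ n) as [n Hn].
  { destruct (INR_archimed 1 ((A + B) / del)) as [n Hn]; [lra|]. exists n.
    assert (K := poly n 1 Rlt_0_1). replace (1 + 1)%R with 2%R in K by ring. lra. }
  assert (HAB : A + B < del * 2 ^ n).
  { apply Rmult_lt_compat_l with (r := del) in Hn; auto. replace (del * ((A + B) / del))%R with (A + B)%R in Hn by (field; lra). lra. }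
  assert (A / 2 ^ n < del) by (apply Rmult_lt_reg_r with (2 ^ n)%R; auto; unfold Rdiv; rewrite Rmult_assoc, Rinv_l; [lra|apply Rgt_not_eq, HP]).
  assert (B / 2 ^ n < del) by (apply Rmult_lt_reg_r with (2 ^ n)%R; auto; unfold Rdiv; rewrite Rmult_assoc, Rinv_l; [lra|apply Rgt_not_eq, HP]).
  exists (xs n), (ys n), (A / 2 ^ n)%R, (B / 2 ^ n)%R. repeat split; auto; try apply Hp; try apply Hq.
  apply (proj2_sig (seq n)).
Qed.

(** * Integrals along segments and around rectangles *)

Definition pcont (f : R -> C) : Prop :=
  forall t, continuous (fun t => fst (f t)) t /\ continuous (fun t => snd (f t)) t.

(** The integral is taken in each coordinate, so that only the real Riemann integral of continuous
    functions is involved. *)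
Definition CI (f : R -> C) (a b : R) : C := (RInt (fun t => fst (f t)) a b, RInt (fun t => snd (f t)) a b).

Lemma pcont_minus (f g : R -> C) : pcont f -> pcont g -> pcont (fun t => f t - g t).
Proof.
  intros Hf Hg t. destruct (Hf t), (Hg t). split.
  - now apply (continuous_minus (fun t => fst (f t)) (fun t => fst (g t))).
  - now apply (continuous_minus (fun t => snd (f t)) (fun t => snd (g t))).
Qed.

Lemma pcont_const (c : C) : pcont (fun _ => c).
Proof. intros t; split; apply continuous_const. Qed.

Lemma CI_minus (f g : R -> C) (a b : R) : pcont f -> pcont g ->
  CI (fun t => f t - g t) a b = CI f a b - CI g a b.
Proof.
  intros Hf Hg. unfold CI. simpl. unfold Cminus, Cplus, Copp; simpl. f_equal.
  - apply (RInt_minus (fun t => fst (f t)) (fun t => fst (g t))); apply ex_RInt_continuous; intros; [apply Hf|apply Hg].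
  - apply (RInt_minus (fun t => snd (f t)) (fun t => snd (g t))); apply ex_RInt_continuous; intros; [apply Hf|apply Hg].
Qed.

Lemma CI_const (c : C) (a b : R) : CI (fun _ => c) a b = (b - a)%R * c.
Proof.
  unfold CI. rewrite !RInt_const. unfold Cmult, scal; simpl. unfold mult; simpl. f_equal; ring.
Qed.

Lemma CI_Chasles (f : R -> C) (a b c : R) : pcont f -> CI f a b + CI f b c = CI f a c.
Proof.
  intros Hf. unfold CI, Cplus; simpl. f_equal.
  - apply (RInt_Chasles (fun t => fst (f t))); apply ex_RInt_continuous; intros; apply Hf.
  - apply (RInt_Chasles (fun t => snd (f t))); apply ex_RInt_continuous; intros; apply Hf.
Qed.

Lemma Cmod_le_sum (z : C) : Cmod z <= Rabs (fst z) + Rabs (snd z).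
Proof.
  destruct z as [x y]. replace (Cmod (x, y)) with (Cmod (RtoC x + Ci * RtoC y)).
  - eapply Rle_trans; [apply Cmod_triangle|]. rewrite Cmod_mult, !Cmod_R, Cmod_Ci. apply Req_le. simpl. ring.
  - f_equal. unfold Cplus, Cmult, RtoC, Ci; simpl. f_equal; ring.
Qed.

Lemma Rabs_fst_le (z : C) : Rabs (fst z) <= Cmod z.
Proof. eapply Rle_trans; [|apply Rmax_Cmod]. apply Rmax_l. Qed.

Lemma Rabs_snd_le (z : C) : Rabs (snd z) <= Cmod z.
Proof. eapply Rle_trans; [|apply Rmax_Cmod]. apply Rmax_r. Qed.

(** The factor 2 is the price of bounding the two coordinates separately; it only affects the
    constants of the later estimates. *)
Lemma CI_bound (f : R -> C) (a b M : R) : pcont f -> a <= b ->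
  (forall t, a <= t <= b -> Cmod (f t) <= M) -> Cmod (CI f a b) <= 2 * M * (b - a).
Proof.
  intros Hf Hab HM.
  assert (L : forall h : R -> R, (forall t, continuous h t) -> (forall t, a <= t <= b -> Rabs (h t) <= M) ->
     Rabs (RInt h a b) <= (b - a) * M).
  { intros h Hc Hh. apply (norm_RInt_le_const h a b (RInt h a b) M); auto.
    apply (@RInt_correct R_CompleteNormedModule). apply (@ex_RInt_continuous R_CompleteNormedModule). intros; apply Hc. }
  eapply Rle_trans; [apply Cmod_le_sum|]. unfold CI; simpl.
  assert (L1 := L (fun t => fst (f t)) (fun t => proj1 (Hf t)) (fun t Ht => Rle_trans _ _ _ (Rabs_fst_le _) (HM t Ht))).
  assert (L2 := L (fun t => snd (f t)) (fun t => proj2 (Hf t)) (fun t Ht => Rle_trans _ _ _ (Rabs_snd_le _) (HM t Ht))).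
  lra.
Qed.

Lemma CI_ext (f g : R -> C) (a b : R) : (forall t, f t = g t) -> CI f a b = CI g a b.
Proof. intros E. unfold CI. f_equal; apply RInt_ext; intros; now rewrite E. Qed.

Lemma is_derive_continuous_R (h : R -> R) (t d : R) : is_derive h t d -> continuous h t.
Proof. intros H. apply (ex_derive_continuous h). now exists d. Qed.

Lemma pcont_affine (f : C -> C) (a b : C) : (forall s, exists d, cder f s d) -> pcont (fun t => f (a + t * b)).
Proof.
  intros Hf t. destruct (Hf (a + t * b)) as [d Hd]. destruct (cder_pder f a b d t Hd) as [H1 H2].
  split; [exact (is_derive_continuous_R _ _ _ H1)|exact (is_derive_continuous_R _ _ _ H2)].
Qed.

Definition pt (x y : R) : C := x + y * Ci.

Lemma pcont_h (f : C -> C) (y : R) : (forall s, exists d, cder f s d) -> pcont (fun x => f (pt x y)).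
Proof.
  intros Hf. assert (H := pcont_affine f (y * Ci) 1 Hf). intros t. specialize (H t).
  destruct H as [H1 H2]. split.
  - apply (continuous_ext (fun t : R => fst (f (y * Ci + t * 1)))); auto. intros. do 2 f_equal. unfold pt. ring.
  - apply (continuous_ext (fun t : R => snd (f (y * Ci + t * 1)))); auto. intros. do 2 f_equal. unfold pt. ring.
Qed.

Lemma pcont_v (f : C -> C) (x : R) : (forall s, exists d, cder f s d) -> pcont (fun y => f (pt x y)).
Proof. intros Hf. apply (pcont_affine f x Ci Hf). Qed.

(** The counterclockwise boundary integral over the rectangle with abscissae [a], [b] and ordinates
    [c], [d], with opposite sides paired under one integral. *)
Definition rect_int (f : C -> C) (a b c d : R) : C :=
  CI (fun x => f (pt x c) - f (pt x d)) a b + Ci * CI (fun y => f (pt b y) - f (pt a y)) c d.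

Lemma rect_int_split (f : C -> C) (a m b c n d : R) : (forall s, exists d, cder f s d) ->
  rect_int f a b c d = rect_int f a m c n + rect_int f m b c n + rect_int f a m n d + rect_int f m b n d.
Proof.
  intros Hf. unfold rect_int.
  repeat rewrite CI_minus by (auto using pcont_h, pcont_v).
  rewrite <- (CI_Chasles (fun x => f (pt x c)) a m b) by (auto using pcont_h).
  rewrite <- (CI_Chasles (fun x => f (pt x d)) a m b) by (auto using pcont_h).
  rewrite <- (CI_Chasles (fun y => f (pt a y)) c n d) by (auto using pcont_v).
  rewrite <- (CI_Chasles (fun y => f (pt b y)) c n d) by (auto using pcont_v).
  ring.
Qed.

(** The affine part of [f] at [pt p q] contributes [D * Ci * (c - d) * (b - a)] on the horizontal
    sides and its negative on the vertical ones. What is left is at most [eps * L] on the boundary,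
    and the sides have total length [2 * L]. *)
Lemma rect_int_small (f : C -> C) (p q : R) (D : C) (eps : R) : (forall s, exists d, cder f s d) -> 0 < eps ->
  cder f (pt p q) D -> exists del, 0 < del /\ forall a b c d, a <= p <= b -> c <= q <= d ->
  b - a < del -> d - c < del -> Cmod (rect_int f a b c d) <= 4 * eps * ((b - a) + (d - c)) ^ 2.
Proof.
  intros Hf He HD. destruct (HD eps He) as [del [Hdel H]].
  exists (del / 2)%R. split; [lra|]. intros a b c d Hp Hq Hab Hcd.
  set (L := ((b - a) + (d - c))%R).
  assert (E : forall x y, a <= x <= b -> c <= y <= d ->
    Cmod (f (pt x y) - f (pt p q) - D * (pt x y - pt p q)) <= eps * L).
  { intros x y Hx Hy.
    assert (K : Cmod (pt x y - pt p q) <= L).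
    { eapply Rle_trans; [apply Cmod_le_sum|]. unfold pt. simpl. unfold L.
      apply Rplus_le_compat; apply Rabs_le; lra. }
    specialize (H (pt x y - pt p q)).
    replace (pt p q + (pt x y - pt p q)) with (pt x y) in H by ring.
    eapply Rle_trans; [apply H|]. unfold L in K; lra. apply Rmult_le_compat_l; lra. }
  assert (X1 : Cmod (CI (fun x => f (pt x c) - f (pt x d) - D * (Ci * (c - d)%R)) a b) <= 2 * (2 * (eps * L)) * (b - a)).
  { apply CI_bound; [|lra|].
    - apply pcont_minus; [apply pcont_minus; auto using pcont_h|apply pcont_const].
    - intros t Ht. replace (f (pt t c) - f (pt t d) - D * (Ci * (c - d)%R)) with
       ((f (pt t c) - f (pt p q) - D * (pt t c - pt p q)) - (f (pt t d) - f (pt p q) - D * (pt t d - pt p q))).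
      + eapply Rle_trans; [apply Cmod_triangle_minus|].
        assert (E1 := E t c Ht). assert (E2 := E t d Ht). lra.
      + unfold pt. rewrite RtoC_minus. ring. }
  assert (X2 : Cmod (CI (fun y => f (pt b y) - f (pt a y) - D * (b - a)%R) c d) <= 2 * (2 * (eps * L)) * (d - c)).
  { apply CI_bound; [|lra|].
    - apply pcont_minus; [apply pcont_minus; auto using pcont_v|apply pcont_const].
    - intros t Ht. replace (f (pt b t) - f (pt a t) - D * (b - a)%R) with
       ((f (pt b t) - f (pt p q) - D * (pt b t - pt p q)) - (f (pt a t) - f (pt p q) - D * (pt a t - pt p q))).
      + eapply Rle_trans; [apply Cmod_triangle_minus|].
        assert (E1 := E b t). assert (E2 := E a t). lra.
      + unfold pt. rewrite RtoC_minus. ring. }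
  assert (EQ : rect_int f a b c d = CI (fun x => f (pt x c) - f (pt x d) - D * (Ci * (c - d)%R)) a b +
     Ci * CI (fun y => f (pt b y) - f (pt a y) - D * (b - a)%R) c d).
  { unfold rect_int.
    rewrite (CI_minus (fun x => f (pt x c) - f (pt x d))), (CI_minus (fun y => f (pt b y) - f (pt a y))), !CI_const.
    - rewrite !RtoC_minus. ring.
    - apply pcont_minus; auto using pcont_v.
    - apply pcont_const.
    - apply pcont_minus; auto using pcont_h.
    - apply pcont_const. }
  rewrite EQ. eapply Rle_trans; [apply Cmod_triangle|]. rewrite Cmod_mult, Cmod_Ci, Rmult_1_l.
  fold L. unfold L in *. nra.
Qed.

(* Goursat's argument: a rectangle violating [Cmod (rect_int f ..) <= 4 eps L^2] would have
   arbitrarily small subrectangles violating it, around a point of differentiability. *)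
Lemma goursat (f : C -> C) (a b c d : R) : (forall s, exists d, cder f s d) ->
  a <= b -> c <= d -> rect_int f a b c d = 0.
Proof.
  intros Hf Hab Hcd. apply Cmod_zero_eq.
  assert (K : forall eps, 0 < eps -> Cmod (rect_int f a b c d) <= 4 * eps * ((b - a) + (d - c)) ^ 2).
  { intros eps He. apply Rnot_lt_le. intros Hbad.
    set (P := fun x y u v => 4 * eps * (u + v) ^ 2 < Cmod (rect_int f x (x + u) y (y + v))).
    destruct (bisection P a c (b - a) (d - c)) as [p [q Hpq]]; try lra.
    - intros x y u v Hu Hv HP. apply NNPP. intros HN.
      apply not_or_and in HN. destruct HN as [N1 HN].
      apply not_or_and in HN. destruct HN as [N2 HN].
      apply not_or_and in HN. destruct HN as [N3 N4].
      unfold P in *. apply Rnot_lt_le in N1, N2, N3, N4.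
      replace (x + u / 2 + u / 2)%R with (x + u)%R in * by field.
      replace (y + v / 2 + v / 2)%R with (y + v)%R in * by field.
      rewrite (rect_int_split f x (x + u / 2) (x + u) y (y + v / 2) (y + v)) in HP by auto.
      assert (X := Cmod_triangle (rect_int f x (x + u / 2) y (y + v / 2) + rect_int f (x + u / 2) (x + u) y (y + v / 2)
        + rect_int f x (x + u / 2) (y + v / 2) (y + v)) (rect_int f (x + u / 2) (x + u) (y + v / 2) (y + v))).
      assert (Y := Cmod_triangle (rect_int f x (x + u / 2) y (y + v / 2) + rect_int f (x + u / 2) (x + u) y (y + v / 2))
        (rect_int f x (x + u / 2) (y + v / 2) (y + v))).
      assert (Z := Cmod_triangle (rect_int f x (x + u / 2) y (y + v / 2)) (rect_int f (x + u / 2) (x + u) y (y + v / 2))).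
      nra.
    - unfold P. replace (a + (b - a))%R with b by ring. replace (c + (d - c))%R with d by ring. exact Hbad.
    - destruct (Hf (pt p q)) as [D HD].
      destruct (rect_int_small f p q D eps Hf He HD) as [del [Hdel Hs]].
      destruct (Hpq del Hdel) as (x & y & u & v & H1 & H2 & H3 & H4 & H5).
      unfold P in H5. specialize (Hs x (x + u)%R y (y + v)%R).
      replace (x + u - x)%R with u in Hs by ring. replace (y + v - y)%R with v in Hs by ring.
      specialize (Hs H1 H2 (proj2 H3) (proj2 H4)). lra. }
  intros eps He. replace (rect_int f a b c d - 0) with (rect_int f a b c d) by ring.
  set (M := (4 * ((b - a) + (d - c)) ^ 2 + 1)%R).
  assert (0 < M) by (unfold M; nra).
  eapply Rle_trans; [apply (K (eps / M)%R); apply Rdiv_lt_0_compat; lra|].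
  assert (0 < eps / M) by (apply Rdiv_lt_0_compat; lra).
  apply Rle_trans with (eps / M * M)%R; [|right; field; lra].
  replace (4 * (eps / M) * (b - a + (d - c)) ^ 2)%R with (eps / M * (M - 1))%R by (unfold M at 2; ring).
  apply Rmult_le_compat_l; lra.
Qed.

(** * Cauchy's estimate and uniform limits of entire functions *)

Lemma Cexp_2PI : Cexp (2 * PI * Ci) = 1.
Proof.
  unfold Cexp, Re, Im, RtoC, Ci, Cmult; simpl.
  replace ((2 * PI - 0 * 0) * 0 - (2 * 0 + 0 * PI) * 1)%R with 0%R by ring.
  replace ((2 * PI - 0 * 0) * 1 + (2 * 0 + 0 * PI) * 0)%R with (2 * PI)%R by ring.
  rewrite exp_0, cos_2PI, sin_2PI. f_equal; ring.
Qed.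

(** The entire function [G] is the difference quotient of [f] at [c] with increment [exp z]. It has
    period [2 PI i], so its integrals over the vertical segments above [ln r0] and [ln r] agree: on
    the small circle the value is close to [2 PI * df c], on the large one the quotient is at most
    [2 B / r]. The constant 4 is this 2 times the 2 of [CI_bound]. *)
Lemma cauchy_derivative_bound (f df : C -> C) (c : C) (r B : R) : 0 < r ->
  (forall s, cder f s (df s)) -> (forall h, Cmod h <= r -> Cmod (f (c + h)) <= B) ->
  Cmod (df c) <= 4 * B / r.
Proof.
  intros Hr Hf HB. apply le_epsilon. intros eps He.
  assert (HPI := PI_RGT_0).
  destruct (Hf c (eps / 2)%R) as [del [Hdel Hd]]; [lra|].
  (* A radius so small that the difference quotient is within [eps / 2] of [df c]. *)
  set (r0 := Rmin r (del / 2)). assert (Hr0 : 0 < r0) by (apply Rmin_pos; lra).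
  assert (Hr0r : r0 <= r) by apply Rmin_l. assert (Hr0d : r0 < del) by (generalize (Rmin_r r (del / 2)); fold r0; lra).
  set (G := fun z => (f (c + Cexp z) - f c) * Cexp (- z)).
  assert (HG : forall s, exists d, cder G s d).
  { intros s. eexists. apply cder_mult.
    - apply cder_minus; [|apply cder_const]. apply (cder_comp (fun z => c + Cexp z) f).
      + apply cder_plus. apply cder_const. apply cder_Cexp.
      + apply Hf.
    - apply (cder_comp (fun z => - z) Cexp). apply cder_opp, cder_id. apply cder_Cexp. }
  assert (J := goursat G (ln r0) (ln r) 0 (2 * PI) HG).
  assert (Hln : ln r0 <= ln r) by (destruct Hr0r as [X|X]; [left; now apply ln_increasing|rewrite X; lra]).
  specialize (J Hln ltac:(lra)). unfold rect_int in J.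
  (* Periodicity: the two horizontal sides cancel. *)
  rewrite (CI_ext (fun x => G (pt x 0) - G (pt x (2 * PI))) (fun _ => 0)) in J.
  2:{ intros x. unfold G. rewrite !Cexp_opp.
      assert (E : Cexp (pt x (2 * PI)) = Cexp (pt x 0)).
      { unfold pt. replace (x + (2 * PI)%R * Ci) with (x + 0%R * Ci + 2 * PI * Ci) by (rewrite RtoC_mult; ring).
        rewrite (Cexp_plus _ (2 * PI * Ci)), Cexp_2PI. ring. }
      rewrite E. ring. }
  rewrite CI_const, Cmult_0_r, Cplus_0_l in J.
  rewrite CI_minus in J by (auto using pcont_v).
  assert (Emod : forall rr y, 0 < rr -> Cmod (Cexp (pt (ln rr) y)) = rr).
  { intros rr y Hrr. rewrite Cmod_Cexp. unfold pt, Re, Cplus, Cmult, Ci, RtoC; simpl.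
    replace (ln rr + (y * 0 - 0 * 1))%R with (ln rr) by ring. now apply exp_ln. }
  assert (J1 : Cmod (CI (fun y => G (pt (ln r) y)) 0 (2 * PI)) <= 2 * (2 * B / r) * (2 * PI - 0)).
  { apply CI_bound; [auto using pcont_v|lra|]. intros y _. unfold G. rewrite Cexp_opp, Cmod_mult.
    rewrite Cmod_inv by apply Cexp_neq_0. rewrite Emod by auto.
    apply Rmult_le_compat_r; [apply Rlt_le, Rinv_0_lt_compat; lra|].
    eapply Rle_trans; [apply Cmod_triangle_minus|].
    assert (X := HB (Cexp (pt (ln r) y))). rewrite Emod in X by auto.
    assert (Y := HB 0). rewrite Cmod_0, Cplus_0_r in Y. lra. }
  assert (J2 : Cmod (CI (fun y => G (pt (ln r0) y) - df c) 0 (2 * PI)) <= 2 * (eps / 2) * (2 * PI - 0)).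
  { apply CI_bound; [apply pcont_minus; auto using pcont_v, pcont_const|lra|]. intros y _. unfold G.
    set (E := Cexp (pt (ln r0) y)). assert (EE : Cmod E = r0) by (apply Emod; auto).
    replace ((f (c + E) - f c) * Cexp (- pt (ln r0) y) - df c) with ((f (c + E) - f c - df c * E) * Cexp (- pt (ln r0) y)).
    - rewrite Cmod_mult, Cexp_opp, Cmod_inv by apply Cexp_neq_0. fold E. rewrite EE.
      apply Rle_trans with (eps / 2 * r0 * / r0)%R; [|right; field; lra].
      apply Rmult_le_compat_r; [apply Rlt_le, Rinv_0_lt_compat; lra|].
      rewrite <- EE. apply Hd. lra.
    - rewrite Cexp_opp. fold E. field. apply Cexp_neq_0. }
  rewrite CI_minus in J2 by (auto using pcont_v, pcont_const).
  rewrite CI_const in J2.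
  set (I1 := CI (fun y => G (pt (ln r) y)) 0 (2 * PI)) in *.
  set (I0 := CI (fun y => G (pt (ln r0) y)) 0 (2 * PI)) in *.
  assert (I1 = I0).
  { replace I1 with (I0 - Ci * (Ci * (I1 - I0))). rewrite J. ring.
    replace (Ci * (Ci * (I1 - I0))) with (Ci * Ci * (I1 - I0)) by ring. 
    replace (Ci * Ci) with (-(1)). ring. unfold Ci, Cmult, Copp, RtoC; simpl. f_equal; ring. }
  rewrite <- H in J2.
  assert (Z : 2 * PI * Cmod (df c) <= 8 * PI * B / r + 2 * PI * eps).
  { replace (2 * PI * Cmod (df c))%R with (Cmod ((2 * PI - 0)%R * df c)).
    2:{ rewrite Cmod_mult, Cmod_R, Rabs_pos_eq by lra. ring. }
    eapply Rle_trans; [apply (Cmod_sub_le _ I1)|]. rewrite Cmod_minus_sym.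
    replace (8 * PI * B / r)%R with (2 * (2 * B / r) * (2 * PI - 0))%R by (field; lra). lra. }
  apply Rmult_le_reg_l with (2 * PI)%R; [lra|]. replace (2 * PI * (4 * B / r + eps))%R with (8 * PI * B / r + 2 * PI * eps)%R by (field; lra).
  exact Z.
Qed.

Lemma C_complete (u : nat -> C) : (forall eps, 0 < eps -> exists N, forall n m, (N <= n)%nat -> (N <= m)%nat ->
   Cmod (u n - u m) <= eps) ->
  exists l, forall eps, 0 < eps -> exists N, forall n, (N <= n)%nat -> Cmod (u n - l) <= eps.
Proof.
  intros H.
  assert (K : forall p : C -> R, (forall z, Rabs (p z) <= Cmod z) -> (forall x y, p (x - y) = (p x - p y)%R) ->
     exists l : R, is_lim_seq (fun n => p (u n)) l).
  { intros p Hp Hm. destruct (proj2 (ex_lim_seq_cauchy_corr (fun n => p (u n)))) as [l Hl].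
    - intros eps. destruct (H (eps / 2)%R) as [N HN]. destruct eps; simpl; lra.
      exists N. intros n m Hn Hm'. rewrite <- Hm. eapply Rle_lt_trans; [apply Hp|].
      eapply Rle_lt_trans; [apply HN; auto|]. destruct eps; simpl; lra.
    - now exists l. }
  destruct (K fst Rabs_fst_le) as [l1 H1]; [reflexivity|].
  destruct (K snd Rabs_snd_le) as [l2 H2]; [reflexivity|].
  exists (l1, l2). intros eps He.
  apply is_lim_seq_spec in H1. apply is_lim_seq_spec in H2.
  assert (He2 : 0 < eps / 2) by lra.
  destruct (H1 (mkposreal _ He2)) as [N1 K1]. destruct (H2 (mkposreal _ He2)) as [N2 K2].
  exists (max N1 N2). intros n Hn. eapply Rle_trans; [apply Cmod_le_sum|].
  specialize (K1 n ltac:(lia)). specialize (K2 n ltac:(lia)). simpl in *. unfold Rminus in *. lra.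
Qed.

(** By Cauchy's estimate the derivatives of the approximants are uniformly close to each other on
    the disc of radius [r / 2]. Hence their values at [c] converge to some [d], and the difference
    between [f] and one good approximant is Lipschitz with a small constant; [f] then inherits the
    difference quotient of that approximant. *)
Lemma cder_uniform_limit (f : C -> C) (c : C) (r : R) : 0 < r ->
  (forall eps, 0 < eps -> exists g, entire g /\ forall h, Cmod h <= r -> Cmod (f (c + h) - g (c + h)) <= eps) ->
  exists d, cder f c d.
Proof.
  intros Hr H.
  assert (H' : forall eps, 0 < eps -> exists g dg : C -> C, (forall s, cder g s (dg s)) /\
     forall h, Cmod h <= r -> Cmod (f (c + h) - g (c + h)) <= eps).
  { intros eps He. destruct (H eps He) as [g [Hg K]]. destruct (entire_cder g Hg) as [dg Hdg]. now exists g, dg. }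
  clear H.
  (* Cauchy's estimate on discs of radius [r / 2] around the points of the half-size disc. *)
  assert (D : forall g dg g' dg' : C -> C, forall eps eps', (forall s, cder g s (dg s)) -> (forall s, cder g' s (dg' s)) ->
    (forall h, Cmod h <= r -> Cmod (f (c + h) - g (c + h)) <= eps) ->
    (forall h, Cmod h <= r -> Cmod (f (c + h) - g' (c + h)) <= eps') ->
    forall h, Cmod h <= r / 2 -> Cmod (dg (c + h) - dg' (c + h)) <= 8 / r * (eps + eps')).
  { intros g dg g' dg' eps eps' Hg Hg' E E' h Hh.
    replace (8 / r * (eps + eps'))%R with (4 * (eps + eps') / (r / 2))%R by (field; lra).
    apply (cauchy_derivative_bound (fun z => g z - g' z) (fun z => dg z - dg' z)); [lra| |].
    - intros s. apply cder_minus; auto.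
    - intros k Hk. assert (Cmod (h + k) <= r) by (generalize (Cmod_triangle h k); lra).
      specialize (E _ H). specialize (E' _ H). rewrite Cplus_assoc in E, E'.
      replace (g (c + h + k) - g' (c + h + k)) with ((f (c + h + k) - g' (c + h + k)) - (f (c + h + k) - g (c + h + k))) by ring.
      generalize (Cmod_triangle_minus (f (c + h + k) - g' (c + h + k)) (f (c + h + k) - g (c + h + k))). lra. }
  assert (Hpos : forall n, 0 < / (INR n + 1)) by (intros; apply Rinv_0_lt_compat; generalize (pos_INR n); lra).
  assert (Ch : exists G : nat -> (C -> C) * (C -> C), forall n, (forall s, cder (fst (G n)) s (snd (G n) s)) /\
     forall h, Cmod h <= r -> Cmod (f (c + h) - fst (G n) (c + h)) <= / (INR n + 1)).
  { exists (fun n => epsilon (inhabits (fun z => z, fun z => z)) (fun G => (forall s, cder (fst G) s (snd G s)) /\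
     forall h, Cmod h <= r -> Cmod (f (c + h) - fst G (c + h)) <= / (INR n + 1))).
    intros n. apply epsilon_spec. destruct (H' _ (Hpos n)) as [g [dg K]]. now exists (g, dg). }
  destruct Ch as [G HG].
  assert (Hsm : forall eps, 0 < eps -> exists N, forall n, (N <= n)%nat -> / (INR n + 1) <= eps).
  { intros eps He. destruct (inverse_small 1 eps He) as [N HN]. exists N. intros n Hn.
    rewrite <- S_INR, <- Rdiv_1_l. auto. }
  assert (H8 : 0 < 8 / r) by (apply Rdiv_lt_0_compat; lra).
  destruct (C_complete (fun n => snd (G n) c)) as [d Hd].
  { intros eps He. destruct (Hsm (eps / (8 / r) / 2)%R) as [N HN].
    { apply Rdiv_lt_0_compat; [|lra]. apply Rdiv_lt_0_compat; lra. }
    exists N. intros n m Hn Hm. assert (K := D _ _ _ _ _ _ (proj1 (HG n)) (proj1 (HG m)) (proj2 (HG n)) (proj2 (HG m)) 0).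
    rewrite Cmod_0, Cplus_0_r in K. eapply Rle_trans; [apply K; lra|].
    apply Rle_trans with (8 / r * (eps / (8 / r)))%R. 
    - apply Rmult_le_compat_l; [lra|]. generalize (HN n Hn) (HN m Hm). lra.
    - right. field. lra. }
  exists d. intros eps He.
  (* The approximant, the Lipschitz difference and the error of [d] add up to [(32 / r + 2) * e1]
     per unit of [Cmod h]. *)
  set (e1 := (eps / (32 / r + 4))%R).
  assert (H32 : 0 < 32 / r) by (apply Rdiv_lt_0_compat; lra).
  assert (He1 : 0 < e1) by (apply Rdiv_lt_0_compat; lra).
  destruct (Hsm e1 He1) as [N HN]. set (g := fst (G N)). set (dg := snd (G N)).
  assert (Hg := proj1 (HG N) : forall s, cder g s (dg s)). assert (Eg : forall h, Cmod h <= r -> Cmod (f (c + h) - g (c + h)) <= e1).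
  { intros h Hh. eapply Rle_trans; [apply (proj2 (HG N)); auto|]. auto. }
  assert (Dd : Cmod (dg c - d) <= 8 / r * e1 * 2 + e1).
  { destruct (Hd e1 He1) as [N2 HN2]. set (n := max N N2).
    replace (dg c - d) with ((dg c - snd (G n) c) + (snd (G n) c - d)) by ring.
    eapply Rle_trans; [apply Cmod_triangle|]. apply Rplus_le_compat.
    - assert (K := D _ _ _ _ _ _ Hg (proj1 (HG n)) Eg (proj2 (HG n)) 0).
      rewrite Cmod_0, Cplus_0_r in K. eapply Rle_trans; [apply K; lra|].
      assert (/ (INR n + 1) <= e1) by (apply HN; lia). nra.
    - apply HN2. lia. }
  (* [f] is not yet known to be differentiable, so it is replaced by an approximant [g2] so fine
     that the exchange costs at most [e2], and the mean value inequality is applied to [g - g2]. *)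
  assert (L : forall h, Cmod h <= r / 2 -> Cmod ((g (c + h) - f (c + h)) - (g c - f c)) <= 8 / r * e1 * 2 * Cmod h).
  { intros h Hh. apply le_epsilon. intros e2 He2.
    destruct (Hsm (Rmin (e2 / 2) e1)) as [N2 HN2]. apply Rmin_pos; lra. set (g2 := fst (G N2)). set (dg2 := snd (G N2)).
    specialize (HN2 N2 (le_n _)).
    assert (M : Cmod ((g (c + h) - g2 (c + h)) - (g c - g2 c)) <= 8 / r * e1 * 2 * Cmod (c + h - c)).
    { apply (cder_mean_value (fun z => g z - g2 z) (fun z => dg z - dg2 z)). intros t Ht. split.
      - apply cder_minus. apply Hg. apply (proj1 (HG N2)).
      - replace (c + h - c) with h by ring. eapply Rle_trans.
        + apply (D _ _ _ _ _ _ Hg (proj1 (HG N2)) Eg (proj2 (HG N2))).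
          rewrite Cmod_mult, Cmod_R, Rabs_pos_eq by lra. generalize (Cmod_ge_0 h). nra.
        + generalize (Rmin_r (e2 / 2) e1). nra. }
    replace (c + h - c) with h in M by ring.
    assert (X1 := proj2 (HG N2) h ltac:(lra)). assert (X0 := proj2 (HG N2) 0). rewrite Cmod_0, Cplus_0_r in X0.
    specialize (X0 ltac:(lra)). fold g2 in X1, X0.
    replace (g (c + h) - f (c + h) - (g c - f c)) with
      ((g (c + h) - g2 (c + h) - (g c - g2 c)) - ((f (c + h) - g2 (c + h)) - (f c - g2 c))) by ring.
    eapply Rle_trans; [apply Cmod_triangle_minus|].
    generalize (Cmod_triangle_minus (f (c + h) - g2 (c + h)) (f c - g2 c)) (Rmin_l (e2 / 2) e1). lra. }
  destruct (Hg c e1 He1) as [del [Hdel Hc]].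
  exists (Rmin del (r / 2)). split; [apply Rmin_pos; lra|]. intros h Hh.
  assert (L1 := Rlt_le_trans _ _ _ Hh (Rmin_l _ _)). assert (L2 := Rlt_le_trans _ _ _ Hh (Rmin_r _ _)).
  specialize (Hc h L1). specialize (L h (Rlt_le _ _ L2)).
  replace (f (c + h) - f c - d * h) with ((g (c + h) - g c - dg c * h) - ((g (c + h) - f (c + h)) - (g c - f c)) + (dg c - d) * h) by ring.
  eapply Rle_trans; [apply Cmod_triangle|]. rewrite Cmod_mult.
  eapply Rle_trans; [apply Rplus_le_compat_r, Cmod_triangle_minus|].
  apply Rle_trans with ((32 / r + 4) * e1 * Cmod h)%R.
  - assert (0 <= Cmod h) by apply Cmod_ge_0.
    assert (Cmod (dg c - d) * Cmod h <= (8 / r * e1 * 2 + e1) * Cmod h) by (apply Rmult_le_compat_r; auto).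
    assert (0 <= e1 * Cmod h) by nra.
    replace (32 / r)%R with (4 * (8 / r))%R by (field; lra). nra.
  - right. unfold e1. field. split; lra.
Qed.

(** A function unbounded on the square around [c] would be unbounded on arbitrarily small rectangles
    around one point, against continuity there. *)
Lemma entire_bounded (f : C -> C) (c : C) (r : R) : entire f -> 0 <= r ->
  exists B, forall h, Cmod h <= r -> Cmod (f (c + h)) <= B.
Proof.
  intros Hf Hr. apply NNPP. intros HN.
  set (P := fun x y u v => forall B, exists s t, x <= s <= x + u /\ y <= t <= y + v /\ B < Cmod (f (pt s t))).
  destruct (bisection P (fst c - r) (snd c - r) (2 * r) (2 * r)) as [p [q Hpq]]; try lra.
  - intros x y u v Hu Hv HP. apply NNPP. intros K.
    apply not_or_and in K. destruct K as [N1 K].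
    apply not_or_and in K. destruct K as [N2 K].
    apply not_or_and in K. destruct K as [N3 N4].
    assert (Q : forall x y u v, ~ P x y u v -> exists B, forall s t, x <= s <= x + u -> y <= t <= y + v -> Cmod (f (pt s t)) <= B).
    { clear. intros x y u v H. apply not_all_ex_not in H. destruct H as [B H]. exists B. intros s t Hs Ht.
      apply Rnot_lt_le. intros HH. apply H. exists s, t. auto. }
    apply Q in N1. apply Q in N2. apply Q in N3. apply Q in N4.
    destruct N1 as [B1 N1], N2 as [B2 N2], N3 as [B3 N3], N4 as [B4 N4].
    destruct (HP (Rmax (Rmax B1 B2) (Rmax B3 B4))) as (s & t & Hs & Ht & HB).
    assert (M1 := Rmax_l (Rmax B1 B2) (Rmax B3 B4)). assert (M2 := Rmax_r (Rmax B1 B2) (Rmax B3 B4)).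
    assert (M3 := Rmax_l B1 B2). assert (M4 := Rmax_r B1 B2). assert (M5 := Rmax_l B3 B4). assert (M6 := Rmax_r B3 B4).
    destruct (Rle_dec s (x + u / 2)); destruct (Rle_dec t (y + v / 2)).
    + specialize (N1 s t ltac:(lra) ltac:(lra)). lra.
    + specialize (N3 s t ltac:(lra) ltac:(lra)). lra.
    + specialize (N2 s t ltac:(lra) ltac:(lra)). lra.
    + specialize (N4 s t ltac:(lra) ltac:(lra)). lra.
  - intros B. apply NNPP. intros K. apply HN. exists B. intros h Hh. apply Rnot_lt_le. intros HB. apply K.
    exists (fst (c + h)), (snd (c + h)).
    assert (A1 := Rle_trans _ _ _ (Rabs_fst_le h) Hh). assert (A2 := Rle_trans _ _ _ (Rabs_snd_le h) Hh).
    apply Rabs_le_between in A1, A2. simpl. repeat split; try lra.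
    replace (pt (fst c + fst h) (snd c + snd h)) with (c + h). exact HB.
    destruct c, h. unfold pt, Cplus, Cmult, RtoC, Ci; simpl. f_equal; ring.
  - destruct (proj1 (holomorphic_at_cder f (pt p q)) (Hf _)) as [d Hd].
    destruct (cder_cont _ _ _ Hd 1%R Rlt_0_1) as [del [Hdel Hc]].
    destruct (Hpq (del / 2)%R ltac:(lra)) as (x & y & u & v & H1 & H2 & H3 & H4 & H5).
    destruct (H5 (Cmod (f (pt p q)) + 1)%R) as (s & t & Hs & Ht & HB).
    specialize (Hc (pt s t - pt p q)). replace (pt p q + (pt s t - pt p q)) with (pt s t) in Hc by ring.
    assert (Cmod (pt s t - pt p q) < del).
    { eapply Rle_lt_trans; [apply Cmod_le_sum|]. unfold pt; simpl.
      replace (s + (t * 0 - 0 * 1) + - (p + (q * 0 - 0 * 1)))%R with (s - p)%R by ring.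
      replace (0 + (t * 1 + 0 * 0) + - (0 + (q * 1 + 0 * 0)))%R with (t - q)%R by ring.
      assert (Rabs (s - p) <= u) by (apply Rabs_le; lra). assert (Rabs (t - q) <= v) by (apply Rabs_le; lra). lra. }
    specialize (Hc H). generalize (Cmod_sub_le (f (pt s t)) (f (pt p q))). lra.
Qed.

(** * Closure properties of holomorphic functions *)

Lemma cder_entire (f df : C -> C) : (forall s, cder f s (df s)) -> entire f.
Proof. intros H s. apply holomorphic_at_cder. now exists (df s). Qed.

Lemma entire_const (c : C) : entire (fun _ => c).
Proof. apply (cder_entire _ (fun _ => 0)). intros s. apply cder_const. Qed.

Lemma entire_id : entire (fun z => z).
Proof. apply (cder_entire _ (fun _ => 1)). intros s. apply cder_id. Qed.

Lemma holo_plus (f g : C -> C) (s : C) :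
  holomorphic_at f s -> holomorphic_at g s -> holomorphic_at (fun z => f z + g z) s.
Proof.
  rewrite !holomorphic_at_cder. intros [a Ha] [b Hb]. exists (a + b). now apply cder_plus.
Qed.

Lemma holo_mult (f g : C -> C) (s : C) :
  holomorphic_at f s -> holomorphic_at g s -> holomorphic_at (fun z => f z * g z) s.
Proof.
  rewrite !holomorphic_at_cder. intros [a Ha] [b Hb]. eexists. apply cder_mult; eassumption.
Qed.

Lemma holo_opp (f : C -> C) (s : C) : holomorphic_at f s -> holomorphic_at (fun z => - f z) s.
Proof. rewrite !holomorphic_at_cder. intros [a Ha]. exists (- a). now apply cder_opp. Qed.

Lemma holo_comp (f g : C -> C) (s : C) :
  holomorphic_at f s -> holomorphic_at g (f s) -> holomorphic_at (fun z => g (f z)) s.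
Proof.
  rewrite !holomorphic_at_cder. intros [a Ha] [b Hb]. eexists. apply cder_comp; eassumption.
Qed.

Lemma holo_ext_loc (f g : C -> C) (s : C) (r : R) : 0 < r ->
  (forall h, Cmod h < r -> f (s + h) = g (s + h)) -> holomorphic_at f s -> holomorphic_at g s.
Proof.
  rewrite !holomorphic_at_cder. intros Hr E [a Ha]. exists a. now apply (cder_ext_loc f g s a r).
Qed.

Lemma holo_ext (f g : C -> C) (s : C) : (forall z, f z = g z) -> holomorphic_at f s -> holomorphic_at g s.
Proof. intros E. apply (holo_ext_loc f g s 1); auto with real. Qed.

Lemma entire_ext (f g : C -> C) : (forall z, f z = g z) -> entire f -> entire g.
Proof. intros E H s. apply (holo_ext f); auto. Qed.

Lemma entire_plus (f g : C -> C) : entire f -> entire g -> entire (fun z => f z + g z).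
Proof. intros Hf Hg s. now apply holo_plus. Qed.

Lemma entire_mult (f g : C -> C) : entire f -> entire g -> entire (fun z => f z * g z).
Proof. intros Hf Hg s. now apply holo_mult. Qed.

Lemma entire_opp (f : C -> C) : entire f -> entire (fun z => - f z).
Proof. intros Hf s. now apply holo_opp. Qed.

Lemma entire_minus (f g : C -> C) : entire f -> entire g -> entire (fun z => f z - g z).
Proof. intros Hf Hg. apply (entire_plus f (fun z => - g z)); auto. now apply entire_opp. Qed.

Lemma entire_one_minus : entire (fun z => 1 - z).
Proof. apply (entire_minus (fun _ => 1)); [apply entire_const|apply entire_id]. Qed.

Lemma entire_scal (c : C) (f : C -> C) : entire f -> entire (fun z => c * f z).
Proof. intros Hf. apply (entire_mult (fun _ => c)); auto. apply entire_const. Qed.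

Lemma entire_comp (f g : C -> C) : entire f -> entire g -> entire (fun z => g (f z)).
Proof. intros Hf Hg s. now apply (holo_comp f g). Qed.

Lemma entire_Cexp (f : C -> C) : entire f -> entire (fun z => Cexp (f z)).
Proof.
  intros Hf. apply (entire_comp f); auto. apply (cder_entire _ Cexp). intros; apply cder_Cexp.
Qed.

Lemma entire_finite_sum {T : Type} (f : T -> C -> C) (l : list T) :
  (forall t, entire (f t)) -> entire (fun s => finite_sum (fun t => f t s) l).
Proof.
  intros H. induction l as [|t l IH]; unfold finite_sum; simpl.
  - apply entire_const.
  - apply entire_plus; auto.
Qed.

Lemma holo_cont (f : C -> C) (s : C) : holomorphic_at f s -> forall eps, 0 < eps ->
  exists del, 0 < del /\ forall h, Cmod h < del -> Cmod (f (s + h) - f s) <= eps.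
Proof.
  rewrite holomorphic_at_cder. intros [d Hd]. now apply (cder_cont f s d).
Qed.

(** * Iterated derivatives and the identity theorem *)

Lemma weierstrass (f : C -> C) (c : C) (r : R) : 0 < r ->
  (forall eps, 0 < eps -> exists g, entire g /\ forall h, Cmod h <= r -> Cmod (f (c + h) - g (c + h)) <= eps) ->
  holomorphic_at f c.
Proof. intros Hr H. apply holomorphic_at_cder. now apply (cder_uniform_limit f c r). Qed.

Lemma derivative_bounded (f df : C -> C) (c : C) (r : R) : 0 <= r ->
  (forall s, cder f s (df s)) -> exists B, forall h, Cmod h <= r -> Cmod (df (c + h)) <= B.
Proof.
  intros Hr Hf. destruct (entire_bounded f c (r + 1)) as [B HB].
  - now apply (cder_entire f df).
  - lra.
  - exists (4 * B / 1)%R. intros h Hh. apply (cauchy_derivative_bound f df (c + h) 1 B); [lra|auto|].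
    intros k Hk. rewrite <- Cplus_assoc. apply HB. eapply Rle_trans; [apply Cmod_triangle|]. lra.
Qed.

(** The derivative is a locally uniform limit of the entire functions [(f (z + k) - f z) / k].
    Uniformity comes from a Lipschitz bound for [df], which is Cauchy's estimate applied to the
    translated difference [f (u + k) - f u]. *)
Lemma entire_derivative (f df : C -> C) : (forall s, cder f s (df s)) -> entire df.
Proof.
  intros Hf c.
  destruct (derivative_bounded f df c 3) as [B HB]; [lra|auto|].
  assert (HB0 : 0 <= B) by (eapply Rle_trans; [apply Cmod_ge_0|apply (HB 0); rewrite Cmod_0; lra]).
  assert (Lip : forall z k, Cmod (z - c) <= 1 -> Cmod k <= 1 -> Cmod (df (z + k) - df z) <= 4 * B * Cmod k).
  { intros z k Hz Hk. replace (4 * B * Cmod k)%R with (4 * (B * Cmod k) / 1)%R by field.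
    apply (cauchy_derivative_bound (fun u => f (u + k) - f u) (fun u => df (u + k) - df u)); [lra| |].
    - intros s. apply cder_minus; auto. apply (cder_eq _ _ (df (s + k) * (1 + 0))); [ring|].
      apply (cder_comp (fun u => u + k) f); auto. apply cder_plus. apply cder_id. apply cder_const.
    - intros h Hh. replace k with ((z + h + k) - (z + h)) at 2 by ring.
      apply (cder_mean_value f df). intros t Ht. split; auto.
      replace (z + h + t * (z + h + k - (z + h))) with (c + ((z - c) + h + t * k)) by ring.
      apply HB. eapply Rle_trans; [apply Cmod_triangle|].
      assert (Cmod (t * k) <= 1) by (rewrite Cmod_mult, Cmod_R, Rabs_pos_eq by lra; generalize (Cmod_ge_0 k); nra).
      generalize (Cmod_triangle (z - c) h). lra. }
  apply (weierstrass df c 1); [lra|]. intros eps He.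
  (* A step length for which the Lipschitz error [4 * B * k] is at most [eps]. *)
  set (k := Rmin 1 (eps / (4 * B + 1))%R).
  assert (Hk : 0 < k) by (apply Rmin_pos; [lra|apply Rdiv_lt_0_compat; lra]).
  assert (Hk1 : k <= 1) by apply Rmin_l.
  assert (Hk2 : 4 * B * k <= eps).
  { apply Rle_trans with ((4 * B + 1) * (eps / (4 * B + 1)))%R; [|right; field; lra].
    apply Rmult_le_compat; try lra. apply Rmin_r. }
  assert (Hkn : RtoC k <> 0) by (intros E; apply RtoC_inj in E; lra).
  exists (fun z => / k * (f (z + k) - f z)). split.
  - apply entire_scal, entire_minus; [|now apply (cder_entire f df)].
    apply (entire_comp (fun z => z + k)); [|now apply (cder_entire f df)].
    apply entire_plus. apply entire_id. apply entire_const.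
  - intros h Hh. set (z := c + h).
    assert (M : Cmod ((f (z + k) - df z * (z + k)) - (f z - df z * z)) <= eps * Cmod (z + k - z)).
    { apply (cder_mean_value (fun u => f u - df z * u) (fun u => df u - df z)). intros t Ht. split.
      - apply cder_minus; auto. apply (cder_eq _ _ (df z * 1)); [ring|]. apply cder_scal, cder_id.
      - replace (z + t * (z + k - z)) with (z + t * k) by ring.
        assert (Cmod (t * k) <= k). { rewrite <- RtoC_mult, Cmod_R, Rabs_pos_eq; nra. }
        eapply Rle_trans; [apply Lip|].
        + unfold z. replace (c + h - c) with h by ring. auto.
        + lra.
        + nra. }
    replace (z + k - z) with (RtoC k) in M by ring. rewrite Cmod_R, Rabs_pos_eq in M by lra.
    replace (df z - / k * (f (z + k) - f z)) with (- / k * (f (z + k) - df z * (z + k) - (f z - df z * z))) by (field; auto).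
    rewrite Cmod_mult, Cmod_opp, Cmod_inv, Cmod_R, Rabs_pos_eq by (auto; lra).
    apply Rmult_le_reg_l with k; auto. rewrite <- Rmult_assoc, Rinv_r by lra. lra.
Qed.

(** A crude form of Stirling's bound: each step of the induction multiplies by [(1 + 1 / m) ^ m],
    which is at most the number e and so at most 3. *)
Lemma pow_le_exp_fact (n : nat) : INR n ^ n <= 3 ^ n * INR (fact n).
Proof.
  assert (P : forall n, 0 < INR (fact n)) by (intros; apply INR_fact_lt_0).
  induction n as [|n IH]; [simpl; lra|].
  destruct n as [|n]; [simpl; lra|].
  set (m := S n) in *.
  assert (Hm : 0 < INR m) by (apply lt_0_INR; unfold m; lia).
  assert (K : (1 + / INR m) ^ m <= 3).
  { apply Rle_trans with (exp 1); [|apply exp_le_3].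
    replace 1%R with (INR m * / INR m)%R at 2 by (field; lra).
    assert (E : forall k, exp (INR k * / INR m) = (exp (/ INR m) ^ k)%R).
    { induction k as [|k IHk]; [simpl; rewrite Rmult_0_l; apply exp_0|].
      rewrite S_INR, Rmult_plus_distr_r, exp_plus, IHk, Rmult_1_l. simpl. ring. }
    rewrite E. apply pow_incr. split.
    - generalize (Rinv_0_lt_compat _ Hm). lra.
    - apply Rlt_le, exp_ineq1. apply Rgt_not_eq, Rinv_0_lt_compat; auto. }
  rewrite fact_simpl, mult_INR. rewrite <- !tech_pow_Rmult.
  apply Rle_trans with (INR (S m) * (3 * (3 ^ m * INR (fact m))))%R; [|right; ring].
  apply Rmult_le_compat_l; [apply pos_INR|].
  replace (INR (S m)) with ((1 + / INR m) * INR m)%R by (rewrite S_INR; field; lra).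
  rewrite Rpow_mult_distr. apply Rmult_le_compat; auto.
  - apply pow_le. generalize (Rinv_0_lt_compat _ Hm). lra.
  - apply pow_le. lra.
Qed.

(** No power series is formed. All derivatives vanish at [c], so [f z] equals its Taylor remainder
    of every order [N]. Cauchy's estimate, iterated [N] times, and [pow_le_exp_fact] bound that
    remainder by [M / 2 ^ N]. *)
Lemma identity_theorem (f : C -> C) (c : C) (r : R) : entire f -> 0 < r ->
  (forall h, Cmod h < r -> f (c + h) = 0) -> forall z, f z = 0.
Proof.
  intros Hf Hr Hz z.
  (* Differentiation as a map on entire functions, so that it can be iterated. *)
  set (step := fun g : {g : C -> C | entire g} =>
     let P := constructive_indefinite_description _ (entire_cder (proj1_sig g) (proj2_sig g)) in
     exist entire (proj1_sig P) (entire_derivative _ _ (proj2_sig P))).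
  set (D := fun n => nat_rect (fun _ => {g : C -> C | entire g}) (exist entire f Hf) (fun _ => step) n).
  set (d := fun n => proj1_sig (D n)).
  assert (Hd : forall n s, cder (d n) s (d (S n) s)).
  { intros n s. unfold d. change (D (S n)) with (step (D n)). unfold step. simpl.
    destruct (constructive_indefinite_description _ _) as [dg Hdg]. simpl. apply Hdg. }
  (* Cauchy's estimate with bound 0: the derivative of a function vanishing on an open disc vanishes
     there. *)
  assert (Hz' : forall n h, Cmod h < r -> d n (c + h) = 0).
  { induction n as [|n IH]; [exact Hz|]. intros h Hh.
    assert (K : Cmod (d (S n) (c + h)) <= 4 * 0 / ((r - Cmod h) / 2)).
    { apply (cauchy_derivative_bound (d n) (d (S n))); auto. lra. intros k Hk.
      rewrite <- Cplus_assoc, IH, Cmod_0. lra.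
      eapply Rle_lt_trans; [apply Cmod_triangle|]. lra. }
    replace (4 * 0 / ((r - Cmod h) / 2))%R with 0%R in K by (field; lra).
    apply Cmod_eq_0. apply Rle_antisym; auto. apply Cmod_ge_0. }
  (* The remainder will be at most [M * (12 * Cmod v / rho) ^ N], with 12 the product of the 4 of
     Cauchy's estimate and the 3 of [pow_le_exp_fact]; this [rho] makes the base at most one
     half. *)
  set (v := z - c). set (rho := (24 * Cmod v + 1)%R).
  assert (Hv := Cmod_ge_0 v). assert (Hrho : 0 < rho) by (unfold rho; lra).
  destruct (entire_bounded f c (Cmod v + rho) Hf) as [M HM]; [lra|].
  assert (HM0 : 0 <= M) by (eapply Rle_trans; [apply Cmod_ge_0|apply (HM 0); rewrite Cmod_0; lra]).
  assert (Main : forall N, Cmod (f z) <= M / 2 ^ N).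
  { intros N. destruct N as [|N'].
    { replace z with (c + v) by (unfold v; ring). replace (M / 2 ^ 0)%R with M by (simpl; field). apply HM. lra. }
    set (N := S N').
    assert (HN : 0 < INR N) by (apply lt_0_INR; unfold N; lia).
    set (delta := (rho / INR N)%R). assert (Hdel : 0 < delta) by (apply Rdiv_lt_0_compat; auto).
    (* Each differentiation gives up a width [rho / N] of the disc, so [N] of them still leave the
       whole segment from [c] to [z]. *)
    assert (B : forall n h, (n <= N)%nat -> Cmod h <= Cmod v + rho - INR n * delta -> Cmod (d n (c + h)) <= M * (4 / delta) ^ n).
    { induction n as [|n IH]; intros h Hn Hh.
      - simpl in *. rewrite Rmult_1_r. apply HM. lra.
      - rewrite S_INR in Hh. replace (M * (4 / delta) ^ S n)%R with (4 * (M * (4 / delta) ^ n) / delta)%R by (simpl; field; lra).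
        apply (cauchy_derivative_bound (d n) (d (S n))); auto. intros k Hk.
        rewrite <- Cplus_assoc. apply IH. lia. eapply Rle_trans; [apply Cmod_triangle|]. lra. }
    set (Q := (M * (4 / delta) ^ N)%R).
    (* Integrating [k] times from [c], where every derivative vanishes, produces the factor
       [t ^ k / k!]. *)
    assert (T : forall k t, (k <= N)%nat -> 0 <= t <= 1 -> Cmod (d (N - k)%nat (c + t * v)) <= Q * Cmod v ^ k / INR (fact k) * t ^ k).
    { induction k as [|k IH]; intros t Hk Ht.
      - rewrite Nat.sub_0_r. simpl. replace (Q * 1 / 1 * 1)%R with Q by field. apply B. lia.
        replace (INR N * delta)%R with rho by (unfold delta; field; lra).
        rewrite Cmod_mult, Cmod_R, Rabs_pos_eq by lra. nra.
      - assert (F : 0 < INR (fact k)) by apply INR_fact_lt_0.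
        assert (K := mean_value_ineq (fun t => d (N - S k)%nat (c + t * v)) (fun t => d (N - k)%nat (c + t * v) * v)
          (fun t => (Q * Cmod v ^ S k / INR (fact (S k)) * t ^ S k)%R)
          (fun t => (Q * Cmod v ^ k / INR (fact k) * t ^ k * Cmod v)%R) 0 t).
        cbv beta in K. replace (c + 0%R * v) with (c + 0) in K by ring.
        rewrite (Hz' (N - S k)%nat 0) in K by (rewrite Cmod_0; lra). rewrite pow_ne_zero, Rmult_0_r, Rminus_0_r in K by lia.
        replace (d (N - S k)%nat (c + t * v) - 0) with (d (N - S k)%nat (c + t * v)) in K by ring.
        apply K; [lra| | |].
        + intros u Hu. apply cder_pder. replace (N - k)%nat with (S (N - S k)) by lia. apply Hd.
        + intros u Hu.
          replace (Q * Cmod v ^ k / INR (fact k) * u ^ k * Cmod v)%R with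
            (Q * Cmod v ^ S k / INR (fact (S k)) * (INR (S k) * u ^ k))%R.
          * apply (is_derive_scal (fun u => u ^ S k)%R). apply is_derive_Reals, (derivable_pt_lim_pow u (S k)).
          * rewrite fact_simpl, mult_INR. simpl pow. field. split; [lra|]. apply not_0_INR. lia.
        + intros u Hu. rewrite Cmod_mult. apply Rmult_le_compat_r; [apply Cmod_ge_0|]. apply IH; [lia|lra]. }
    specialize (T N 1%R (le_n _) ltac:(lra)). rewrite Nat.sub_diag, pow1, Rmult_1_r in T.
    replace (c + 1%R * v) with z in T by (unfold v; ring). change (d 0%nat) with f in T.
    eapply Rle_trans; [apply T|]. unfold Q, delta.
    assert (F : 0 < INR (fact N)) by apply INR_fact_lt_0.
    replace (4 / (rho / INR N))%R with (4 / rho * INR N)%R by (field; lra).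
    rewrite Rpow_mult_distr.
    apply Rle_trans with (M * ((4 / rho) ^ N * (3 ^ N * INR (fact N))) * Cmod v ^ N / INR (fact N))%R.
    - unfold Rdiv. apply Rmult_le_compat_r; [left; now apply Rinv_0_lt_compat|].
      apply Rmult_le_compat_r; [now apply pow_le|]. apply Rmult_le_compat_l; auto.
      apply Rmult_le_compat_l. apply pow_le. apply Rmult_le_pos; [lra|left; now apply Rinv_0_lt_compat].
      apply pow_le_exp_fact.
    - replace (M * ((4 / rho) ^ N * (3 ^ N * INR (fact N))) * Cmod v ^ N / INR (fact N))%R with
        (M * ((4 / rho) ^ N * 3 ^ N * Cmod v ^ N))%R by (field; lra).
      rewrite <- !Rpow_mult_distr. unfold Rdiv at 2. apply Rmult_le_compat_l; auto.
      rewrite <- pow_inv. apply pow_incr. split.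
      + apply Rmult_le_pos; auto. apply Rmult_le_pos; [|lra]. apply Rmult_le_pos; [lra|left; now apply Rinv_0_lt_compat].
      + apply Rmult_le_reg_r with rho; auto. replace (4 / rho * 3 * Cmod v * rho)%R with (12 * Cmod v)%R by (field; lra).
        unfold rho. lra. }
  apply Cmod_eq_0. apply Rle_antisym; [|apply Cmod_ge_0]. apply le_epsilon. intros eps He.
  rewrite Rplus_0_l.
  destruct (INR_archimed 1 (M / eps)) as [N HN]; [lra|].
  eapply Rle_trans; [apply (Main N)|].
  assert (HP : 0 < 2 ^ N) by (apply pow_lt; lra).
  assert (K := poly N 1 Rlt_0_1). replace (1 + 1)%R with 2%R in K by ring.
  apply Rmult_le_reg_r with (2 ^ N)%R; auto. unfold Rdiv. rewrite Rmult_assoc, Rinv_l, Rmult_1_r by lra.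
  assert (M < eps * (INR N * 1)). { apply Rmult_lt_compat_l with (r := eps) in HN; auto. replace (eps * (M / eps))%R with M in HN by (field; lra). lra. }
  nra.
Qed.

Lemma identity_theorem_eq (f g : C -> C) (c : C) (r : R) : entire f -> entire g -> 0 < r ->
  (forall h, Cmod h < r -> f (c + h) = g (c + h)) -> forall z, f z = g z.
Proof.
  intros Hf Hg Hr H z.
  assert (E : f z - g z = 0).
  { apply (identity_theorem (fun z => f z - g z) c r); auto using entire_minus.
    intros h Hh. rewrite H by auto. ring. }
  replace (f z) with (f z - g z + g z) by ring. rewrite E. ring.
Qed.

(** * Unordered sums *)

Definition rsum {T : Type} (g : T -> R) (l : list T) : R := fold_right Rplus 0%R (map g l).

(** The notion for majorants. [abs_summable f] unfolds to [summ (fun t => Cmod (f t))], and several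
    proofs pass between the two by conversion. *)
Definition summ {T : Type} (g : T -> R) : Prop := exists M : R, forall l, NoDup l -> rsum g l <= M.

(** Membership as a boolean by excluded middle, since index types come without decidable
    equality. *)
Definition inb {T : Type} (l : list T) (t : T) : bool :=
  if excluded_middle_informative (In t l) then true else false.

Lemma inb_spec {T : Type} (l : list T) (t : T) : inb l t = true <-> In t l.
Proof. unfold inb. destruct (excluded_middle_informative _); split; auto; discriminate. Qed.

Lemma rsum_cons {T : Type} (g : T -> R) t l : rsum g (t :: l) = (g t + rsum g l)%R.
Proof. reflexivity. Qed.

Lemma finite_sum_cons {T : Type} (g : T -> C) t l : finite_sum g (t :: l) = g t + finite_sum g l.
Proof. reflexivity. Qed.

Lemma rsum_app {T : Type} (g : T -> R) l l' : rsum g (l ++ l') = (rsum g l + rsum g l')%R.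
Proof. induction l as [|t l IH]; simpl app; rewrite ?rsum_cons, ?IH; [unfold rsum; simpl|]; ring. Qed.

Lemma finite_sum_app {T : Type} (g : T -> C) l l' : finite_sum g (l ++ l') = finite_sum g l + finite_sum g l'.
Proof. induction l as [|t l IH]; simpl app; rewrite ?finite_sum_cons, ?IH; [unfold finite_sum; simpl|]; ring. Qed.

Lemma rsum_perm {T : Type} (g : T -> R) l l' : Permutation l l' -> rsum g l = rsum g l'.
Proof. induction 1; rewrite ?rsum_cons; try congruence. ring. Qed.

Lemma finite_sum_perm {T : Type} (g : T -> C) l l' : Permutation l l' -> finite_sum g l = finite_sum g l'.
Proof. induction 1; rewrite ?finite_sum_cons; try congruence. ring. Qed.

Lemma rsum_le {T : Type} (g h : T -> R) l : (forall t, In t l -> g t <= h t) -> rsum g l <= rsum h l.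
Proof.
  induction l as [|t l IH]; intros H. apply Rle_refl. rewrite !rsum_cons.
  apply Rplus_le_compat; [apply H; now left|]. apply IH. intros; apply H; now right.
Qed.

Lemma rsum_nonneg {T : Type} (g : T -> R) l : (forall t, 0 <= g t) -> 0 <= rsum g l.
Proof. intros H. induction l as [|t l IH]; [apply Rle_refl|]. rewrite rsum_cons. specialize (H t). lra. Qed.

Lemma rsum_scal {T : Type} (c : R) (g : T -> R) l : rsum (fun t => c * g t)%R l = (c * rsum g l)%R.
Proof. induction l as [|t l IH]; [unfold rsum; simpl|rewrite !rsum_cons, IH]; ring. Qed.

Lemma rsum_plus {T : Type} (g h : T -> R) l : rsum (fun t => g t + h t)%R l = (rsum g l + rsum h l)%R.
Proof. induction l as [|t l IH]; [unfold rsum; simpl|rewrite !rsum_cons, IH]; ring. Qed.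

Lemma rsum_map {A B : Type} (p : A -> B) (g : B -> R) l : rsum g (map p l) = rsum (fun a => g (p a)) l.
Proof. unfold rsum. now rewrite map_map. Qed.

Lemma finite_sum_map {A B : Type} (p : A -> B) (g : B -> C) l : finite_sum g (map p l) = finite_sum (fun a => g (p a)) l.
Proof. unfold finite_sum. now rewrite map_map. Qed.

Lemma finite_sum_ext {T : Type} (f g : T -> C) l : (forall t, In t l -> f t = g t) -> finite_sum f l = finite_sum g l.
Proof.
  induction l as [|t l IH]; intros H. reflexivity. rewrite !finite_sum_cons, H by now left.
  rewrite IH; auto. intros; apply H; now right.
Qed.

Lemma rsum_ext {T : Type} (f g : T -> R) l : (forall t, In t l -> f t = g t) -> rsum f l = rsum g l.
Proof. intros H. apply Rle_antisym; apply rsum_le; intros t Ht; rewrite H by auto; apply Rle_refl. Qed.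

Lemma finite_sum_plus {T : Type} (f g : T -> C) l : finite_sum (fun t => f t + g t) l = finite_sum f l + finite_sum g l.
Proof. induction l as [|t l IH]; [unfold finite_sum; simpl|rewrite !finite_sum_cons, IH]; ring. Qed.

Lemma finite_sum_scal {T : Type} (c : C) (f : T -> C) l : finite_sum (fun t => c * f t) l = c * finite_sum f l.
Proof. induction l as [|t l IH]; [unfold finite_sum; simpl|rewrite !finite_sum_cons, IH]; ring. Qed.

Lemma finite_sum_zero {T : Type} (f : T -> C) l : (forall t, In t l -> f t = 0) -> finite_sum f l = 0.
Proof.
  intros H. rewrite (finite_sum_ext f (fun _ => 0 * 0)). rewrite finite_sum_scal. ring.
  intros t Ht. rewrite H by auto. ring.
Qed.

Lemma Cmod_finite_sum {T : Type} (f : T -> C) l : Cmod (finite_sum f l) <= rsum (fun t => Cmod (f t)) l.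
Proof.
  induction l as [|t l IH].
  - unfold finite_sum, rsum; simpl. rewrite Cmod_0. lra.
  - rewrite finite_sum_cons, rsum_cons. eapply Rle_trans; [apply Cmod_triangle|]. lra.
Qed.

Lemma NoDup_app_disj {T : Type} (l l' : list T) : NoDup l -> NoDup l' -> (forall t, In t l' -> ~ In t l) -> NoDup (l ++ l').
Proof.
  induction l as [|t l IH]; simpl; auto. intros H H' D. inversion H; subst. constructor.
  - rewrite in_app_iff. intros [K|K]; auto. apply (D t K). now left.
  - apply IH; auto. intros u Hu K. apply (D u Hu). now right.
Qed.

Lemma NoDup_split {T : Type} (l0 l : list T) : NoDup l0 -> NoDup l -> incl l0 l ->
  exists r, NoDup r /\ (forall t, In t r -> ~ In t l0) /\ Permutation l (l0 ++ r).
Proof.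
  intros H0 H I. exists (filter (fun t => negb (inb l0 t)) l).
  assert (D : forall t, In t (filter (fun t => negb (inb l0 t)) l) -> ~ In t l0).
  { intros t Ht K. apply filter_In in Ht. apply inb_spec in K. rewrite K in Ht. now destruct Ht. }
  assert (N : NoDup (filter (fun t => negb (inb l0 t)) l)) by now apply NoDup_filter.
  repeat split; auto. apply NoDup_Permutation; auto. now apply NoDup_app_disj.
  intros t. rewrite in_app_iff, filter_In. split.
  - intros Ht. destruct (inb l0 t) eqn:E; [left; now apply inb_spec|right; auto].
  - intros [K|[K _]]; auto.
Qed.

Lemma NoDup_list {T : Type} (l : list T) : exists l', NoDup l' /\ (forall t, In t l' <-> In t l).
Proof.
  set (dec := fun x y : T => excluded_middle_informative (x = y)).
  exists (nodup dec l). split. apply NoDup_nodup. intros t. apply nodup_In.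
Qed.

Lemma rsum_incl {T : Type} (g : T -> R) l l' : (forall t, 0 <= g t) -> NoDup l -> NoDup l' -> incl l l' -> rsum g l <= rsum g l'.
Proof.
  intros Hg H H' I. destruct (NoDup_split l l' H H' I) as [r [_ [_ P]]].
  rewrite (rsum_perm _ _ _ P), rsum_app. generalize (rsum_nonneg g r Hg). lra.
Qed.

Definition tail_le {T : Type} (g : T -> R) (l0 : list T) (eps : R) : Prop :=
  NoDup l0 /\ forall l, NoDup l -> (forall t, In t l -> ~ In t l0) -> rsum g l <= eps.

(** A finite set whose sum is within [eps] of the supremum leaves no room for more than [eps]
    outside it. *)
Lemma tail_exists {T : Type} (g : T -> R) (eps : R) : summ g -> 0 < eps -> exists l0, tail_le g l0 eps.
Proof.
  intros [M HM] He.
  destruct (completeness (fun x => exists l, NoDup l /\ x = rsum g l)) as [S [H1 H2]].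
  - exists M. intros x [l [Hl ->]]. auto.
  - exists 0%R. exists nil. split; [constructor|reflexivity].
  - assert (exists l0, NoDup l0 /\ S - eps < rsum g l0) as [l0 [N0 K0]].
    { apply NNPP. intros HN. assert (S <= S - eps); [|lra]. apply H2. intros x [l [Hl ->]].
      apply Rnot_lt_le. intros K. apply HN. now exists l. }
    exists l0. split; auto. intros l Hl D.
    assert (rsum g (l0 ++ l) <= S).
    { apply H1. exists (l0 ++ l). split; auto. now apply NoDup_app_disj. }
    rewrite rsum_app in H. lra.
Qed.

Lemma summ_le {T : Type} (g h : T -> R) (c : R) : 0 <= c -> (forall t, g t <= c * h t) -> summ h -> summ g.
Proof.
  intros Hc H [M HM]. exists (c * M)%R. intros l Hl. eapply Rle_trans; [apply rsum_le; intros; apply H|].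
  rewrite rsum_scal. apply Rmult_le_compat_l; auto.
Qed.

Lemma summ_plus {T : Type} (g h : T -> R) : summ g -> summ h -> summ (fun t => g t + h t)%R.
Proof.
  intros [M HM] [M' HM']. exists (M + M')%R. intros l Hl. rewrite rsum_plus.
  specialize (HM l Hl). specialize (HM' l Hl). lra.
Qed.

Lemma abs_summable_le {T : Type} (f : T -> C) (g : T -> R) : (forall t, Cmod (f t) <= g t) -> summ g -> abs_summable f.
Proof. intros H Hg. apply (summ_le (fun t => Cmod (f t)) g 1); auto. lra. intros t. rewrite Rmult_1_l. auto. Qed.

Lemma is_usum_iff {T : Type} (f : T -> C) (v : C) : is_usum f v <->
  forall eps, 0 < eps -> exists l0, forall l, NoDup l -> incl l0 l -> Cmod (finite_sum f l - v) <= eps.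
Proof.
  split.
  - intros H eps He.
    assert (He2 : 0 < eps / 2) by lra.
    (* Balls of the uniform structure on [C] are comparable to discs up to the factor [sqrt 2],
       which halving the radius absorbs. *)
    assert (L : locally (T := C_CompleteNormedModule) v (fun y => Cmod (y - v) <= eps)).
    { exists (mkposreal _ He2). intros y Hy. apply C_NormedModule_mixin_compat2 in Hy.
      change (Cmod (y - v) < sqrt 2 * (eps / 2)) in Hy.
      assert (sqrt 2 <= 2). { rewrite <- (sqrt_square 2) at 2 by lra. apply sqrt_le_1; lra. }
      assert (Cmod (y - v) <= 2 * (eps / 2)) by nra. lra. }
    destruct (H _ L) as [l0 Hl0]. exists l0. intros l Hl I. apply (Hl0 l Hl I).
  - intros H P [eps HP]. destruct (H (eps / 2)%R) as [l0 Hl0]; [destruct eps; simpl; lra|].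
    exists l0. intros l Hl I. apply HP. apply C_NormedModule_mixin_compat1.
    change (Cmod (finite_sum f l - v) < eps). specialize (Hl0 l Hl I). destruct eps; simpl in *; lra.
Qed.

Lemma is_usum_unique2 {T : Type} (f : T -> C) (v w : C) : is_usum f v -> is_usum f w -> v = w.
Proof.
  rewrite !is_usum_iff. intros Hv Hw. apply Cmod_zero_eq. intros eps He.
  destruct (Hv (eps / 2)%R) as [l1 H1]; [lra|]. destruct (Hw (eps / 2)%R) as [l2 H2]; [lra|].
  destruct (NoDup_list (l1 ++ l2)) as [l [Hl Il]].
  specialize (H1 l Hl). specialize (H2 l Hl).
  assert (I1 : incl l1 l) by (intros t Ht; apply Il, in_or_app; auto).
  assert (I2 : incl l2 l) by (intros t Ht; apply Il, in_or_app; auto).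
  specialize (H1 I1). specialize (H2 I2). rewrite Cmod_minus_sym in H1.
  replace (v - w) with ((v - finite_sum f l) + (finite_sum f l - w)) by ring.
  eapply Rle_trans; [apply Cmod_triangle|]. lra.
Qed.

Lemma usum_eq {T : Type} (f : T -> C) (v : C) : is_usum f v -> usum f = v.
Proof.
  intros H. unfold usum. apply (iota_unique (V := C_CompleteNormedModule)); auto.
  intros y Hy. now apply (is_usum_unique2 f).
Qed.

Lemma finite_sum_tail {T : Type} (f : T -> C) l0 l eps : tail_le (fun t => Cmod (f t)) l0 eps ->
  NoDup l -> incl l0 l -> Cmod (finite_sum f l - finite_sum f l0) <= eps.
Proof.
  intros [N0 H0] N I. destruct (NoDup_split l0 l N0 N I) as [r [Nr [Dr P]]].
  rewrite (finite_sum_perm _ _ _ P), finite_sum_app.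
  replace (finite_sum f l0 + finite_sum f r - finite_sum f l0) with (finite_sum f r) by ring.
  eapply Rle_trans; [apply Cmod_finite_sum|]. auto.
Qed.

(** Completeness is needed only along a sequence of finite sets [L n] whose tails are at most
    [1 / (n + 1)]; any finite set containing [L n] has nearly the same sum. *)
Lemma usum_correct {T : Type} (f : T -> C) : abs_summable f -> is_usum f (usum f).
Proof.
  intros H. assert (exists v, is_usum f v) as [v Hv]; [|now rewrite (usum_eq f v Hv)].
  assert (Hpos : forall n, 0 < / (INR n + 1)) by (intros; apply Rinv_0_lt_compat; generalize (pos_INR n); lra).
  assert (Hsm : forall eps, 0 < eps -> exists N, forall n, (N <= n)%nat -> / (INR n + 1) <= eps).
  { intros eps He. destruct (inverse_small 1 eps He) as [N HN]. exists N. intros n Hn.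
    rewrite <- S_INR, <- Rdiv_1_l. auto. }
  set (L := fun n => proj1_sig (constructive_indefinite_description _ (tail_exists (fun t => Cmod (f t)) _ H (Hpos n)))).
  assert (HL : forall n, tail_le (fun t => Cmod (f t)) (L n) (/ (INR n + 1))) by (intros n; apply proj2_sig).
  clearbody L.
  destruct (C_complete (fun n => finite_sum f (L n))) as [v Hv].
  - intros eps He. destruct (Hsm (eps / 2)%R) as [N HN]; [lra|]. exists N. intros n m Hn Hm.
    destruct (NoDup_list (L n ++ L m)) as [l [Hl Il]].
    assert (K1 := finite_sum_tail f _ l _ (HL n) Hl ltac:(intros t Ht; apply Il, in_or_app; auto)).
    assert (K2 := finite_sum_tail f _ l _ (HL m) Hl ltac:(intros t Ht; apply Il, in_or_app; auto)).
    rewrite Cmod_minus_sym in K1.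
    replace (finite_sum f (L n) - finite_sum f (L m)) with ((finite_sum f (L n) - finite_sum f l) + (finite_sum f l - finite_sum f (L m))) by ring.
    eapply Rle_trans; [apply Cmod_triangle|]. generalize (HN n Hn) (HN m Hm). lra.
  - exists v. apply is_usum_iff. intros eps He. destruct (Hsm (eps / 2)%R) as [N1 HN1]; [lra|].
    destruct (Hv (eps / 2)%R) as [N2 HN2]; [lra|]. set (N := max N1 N2).
    exists (L N). intros l Hl I. assert (K := finite_sum_tail f _ l _ (HL N) Hl I).
    specialize (HN1 N ltac:(lia)). specialize (HN2 N ltac:(lia)).
    replace (finite_sum f l - v) with ((finite_sum f l - finite_sum f (L N)) + (finite_sum f (L N) - v)) by ring.
    eapply Rle_trans; [apply Cmod_triangle|]. lra.
Qed.

Lemma is_usum_ext {T : Type} (f g : T -> C) (v : C) : (forall t, f t = g t) -> is_usum f v -> is_usum g v.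
Proof.
  intros E. rewrite !is_usum_iff. intros H eps He. destruct (H eps He) as [l0 K]. exists l0. intros l Hl I.
  rewrite <- (finite_sum_ext f); auto.
Qed.

Lemma usum_ext {T : Type} (f g : T -> C) : (forall t, f t = g t) -> usum f = usum g.
Proof.
  intros E. unfold usum. f_equal. apply functional_extensionality. intros v.
  apply propositional_extensionality. split; apply is_usum_ext; auto.
Qed.

Lemma abs_summable_ext {T : Type} (f g : T -> C) : (forall t, f t = g t) -> abs_summable f -> abs_summable g.
Proof. intros E H. apply (abs_summable_le g (fun t => Cmod (f t))); auto. intros t. rewrite E. lra. Qed.

Lemma is_usum_plus {T : Type} (f g : T -> C) (v w : C) : is_usum f v -> is_usum g w -> is_usum (fun t => f t + g t) (v + w).
Proof.
  rewrite !is_usum_iff. intros Hf Hg eps He.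
  destruct (Hf (eps / 2)%R) as [l1 H1]; [lra|]. destruct (Hg (eps / 2)%R) as [l2 H2]; [lra|].
  exists (l1 ++ l2). intros l Hl I. rewrite finite_sum_plus.
  specialize (H1 l Hl (fun t Ht => I t (in_or_app _ _ _ (or_introl Ht)))).
  specialize (H2 l Hl (fun t Ht => I t (in_or_app _ _ _ (or_intror Ht)))).
  replace (finite_sum f l + finite_sum g l - (v + w)) with ((finite_sum f l - v) + (finite_sum g l - w)) by ring.
  eapply Rle_trans; [apply Cmod_triangle|]. lra.
Qed.

Lemma is_usum_scal {T : Type} (c : C) (f : T -> C) (v : C) : is_usum f v -> is_usum (fun t => c * f t) (c * v).
Proof.
  rewrite !is_usum_iff. intros Hf eps He.
  assert (HK : 0 < Cmod c + 1) by (generalize (Cmod_ge_0 c); lra).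
  destruct (Hf (eps / (Cmod c + 1))%R) as [l0 H0]; [apply Rdiv_lt_0_compat; lra|].
  exists l0. intros l Hl I. rewrite finite_sum_scal. replace (c * finite_sum f l - c * v) with (c * (finite_sum f l - v)) by ring.
  rewrite Cmod_mult. specialize (H0 l Hl I).
  apply Rle_trans with ((Cmod c + 1) * (eps / (Cmod c + 1)))%R.
  - apply Rmult_le_compat; auto using Cmod_ge_0. lra.
  - right. field. lra.
Qed.

Lemma abs_summable_plus {T : Type} (f g : T -> C) : abs_summable f -> abs_summable g -> abs_summable (fun t => f t + g t).
Proof.
  intros Hf Hg. apply (abs_summable_le _ (fun t => Cmod (f t) + Cmod (g t))%R). intros; apply Cmod_triangle.
  now apply summ_plus.
Qed.

Lemma abs_summable_scal {T : Type} (c : C) (f : T -> C) : abs_summable f -> abs_summable (fun t => c * f t).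
Proof.
  intros Hf. apply (summ_le (fun t => Cmod (c * f t)) (fun t => Cmod (f t)) (Cmod c)); auto. apply Cmod_ge_0.
  intros t. rewrite Cmod_mult. lra.
Qed.

Lemma usum_plus {T : Type} (f g : T -> C) : abs_summable f -> abs_summable g ->
  usum (fun t => f t + g t) = usum f + usum g.
Proof. intros Hf Hg. apply usum_eq, is_usum_plus; now apply usum_correct. Qed.

Lemma usum_scal {T : Type} (c : C) (f : T -> C) : abs_summable f -> usum (fun t => c * f t) = c * usum f.
Proof. intros Hf. apply usum_eq, is_usum_scal; now apply usum_correct. Qed.

Lemma usum_minus {T : Type} (f g : T -> C) : abs_summable f -> abs_summable g ->
  usum (fun t => f t - g t) = usum f - usum g.
Proof.
  intros Hf Hg. rewrite (usum_ext _ (fun t => f t + (-(1)) * g t)) by (intros; ring).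
  rewrite usum_plus, usum_scal; auto using abs_summable_scal. ring.
Qed.

Lemma abs_summable_minus {T : Type} (f g : T -> C) : abs_summable f -> abs_summable g -> abs_summable (fun t => f t - g t).
Proof.
  intros Hf Hg. apply (abs_summable_ext (fun t => f t + (-(1)) * g t)). intros; ring.
  apply abs_summable_plus; auto. now apply abs_summable_scal.
Qed.

Lemma usum_tail {T : Type} (f : T -> C) l0 eps : tail_le (fun t => Cmod (f t)) l0 eps -> abs_summable f ->
  Cmod (usum f - finite_sum f l0) <= eps.
Proof.
  intros H0 Hf. apply le_epsilon. intros e1 He1.
  destruct (proj1 (is_usum_iff f (usum f)) (usum_correct f Hf) e1 He1) as [l1 H1].
  destruct (NoDup_list (l0 ++ l1)) as [l [Hl Il]].
  assert (K1 := finite_sum_tail f _ l _ H0 Hl ltac:(intros t Ht; apply Il, in_or_app; auto)).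
  specialize (H1 l Hl ltac:(intros t Ht; apply Il, in_or_app; auto)).
  replace (usum f - finite_sum f l0) with ((finite_sum f l - finite_sum f l0) - (finite_sum f l - usum f)) by ring.
  eapply Rle_trans; [apply Cmod_triangle_minus|]. lra.
Qed.

Lemma usum_bound {T : Type} (f : T -> C) (M : R) : (forall l, NoDup l -> rsum (fun t => Cmod (f t)) l <= M) ->
  Cmod (usum f) <= M.
Proof.
  intros H. replace (usum f) with (usum f - finite_sum f nil) by (unfold finite_sum; simpl; ring).
  apply usum_tail. split; [constructor|auto]. now exists M.
Qed.

Lemma usum_zero {T : Type} (f : T -> C) : (forall t, f t = 0) -> usum f = 0.
Proof.
  intros H. apply usum_eq, is_usum_iff. intros eps He. exists nil. intros l _ _.
  rewrite finite_sum_zero by auto. replace (0 - 0) with (RtoC 0) by ring. rewrite Cmod_0. lra.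
Qed.

(** Basis of all changes of index along an injection [p]: a finite set of [B] is replaced by its
    preimage, and a function supported on the image of [p] does not notice the difference. *)
Lemma pull_list {A B : Type} (p : A -> B) (l : list B) : (forall a a', p a = p a' -> a = a') -> NoDup l ->
  exists k, NoDup k /\ (forall a, In a k <-> In (p a) l) /\
   (forall h : B -> C, (forall b, h b <> 0 -> exists a, b = p a) -> finite_sum h l = finite_sum (fun a => h (p a)) k).
Proof.
  intros Inj N. induction l as [|b l IH].
  - exists nil. repeat split; auto using NoDup_nil.
  - inversion N; subst. destruct (IH H2) as [k [Nk [Ik Sk]]].
    destruct (classic (exists a, b = p a)) as [[a ->]|Hb].
    + exists (a :: k). repeat split.
      * constructor; auto. now rewrite Ik.
      * intros [->|K]; [now left|right; now apply Ik].
      * intros [K|K]; [left; now apply Inj|right; now apply Ik].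
      * intros h Hh. rewrite !finite_sum_cons, Sk; auto.
    + exists k. repeat split; auto.
      * intros K. right. now apply Ik.
      * intros [K|K]; [|now apply Ik]. destruct Hb. now exists a.
      * intros h Hh. rewrite finite_sum_cons, Sk; auto.
        destruct (classic (h b = 0)) as [E|E]; [rewrite E; ring|]. destruct Hb. auto.
Qed.

Lemma finite_sum_RtoC {T : Type} (g : T -> R) l : finite_sum (fun t => RtoC (g t)) l = RtoC (rsum g l).
Proof. induction l as [|t l IH]; [reflexivity|]. now rewrite finite_sum_cons, rsum_cons, IH, RtoC_plus. Qed.

Lemma abs_summable_reindex {A B : Type} (p : A -> B) (f : B -> C) : (forall a a', p a = p a' -> a = a') ->
  (forall b, f b <> 0 -> exists a, b = p a) -> abs_summable (fun a => f (p a)) -> abs_summable f.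
Proof.
  intros Inj Z [M HM]. exists M. intros l Hl. destruct (pull_list p l Inj Hl) as [k [Nk [_ Sk]]].
  specialize (Sk (fun b => RtoC (Cmod (f b)))).
  rewrite !finite_sum_RtoC in Sk.
  assert (E : rsum (fun b => Cmod (f b)) l = rsum (fun a => Cmod (f (p a))) k).
  { apply RtoC_inj, Sk. intros b Hb. apply Z. intros E. apply Hb. rewrite E, Cmod_0. reflexivity. }
  unfold rsum in E. rewrite E. apply HM, Nk.
Qed.

Lemma summ_comp_inj {A B : Type} (p : A -> B) (g : B -> R) : (forall a a', p a = p a' -> a = a') ->
  summ g -> summ (fun a => g (p a)).
Proof.
  intros Inj [M HM]. exists M. intros l Hl. rewrite <- rsum_map. apply HM.
  apply FinFun.Injective_map_NoDup; auto.
Qed.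

Lemma abs_summable_comp_inj {A B : Type} (p : A -> B) (f : B -> C) : (forall a a', p a = p a' -> a = a') ->
  abs_summable f -> abs_summable (fun a => f (p a)).
Proof. intros Inj H. apply (summ_comp_inj p (fun b => Cmod (f b))); auto. Qed.

Lemma usum_reindex {A B : Type} (p : A -> B) (f : B -> C) : (forall a a', p a = p a' -> a = a') ->
  (forall b, f b <> 0 -> exists a, b = p a) -> abs_summable (fun a => f (p a)) -> usum f = usum (fun a => f (p a)).
Proof.
  intros Inj Z H. apply usum_eq. assert (K := usum_correct _ H). rewrite is_usum_iff in K. apply is_usum_iff.
  intros eps He. destruct (K eps He) as [k0 K0]. exists (map p k0). intros l Hl I.
  destruct (pull_list p l Inj Hl) as [k [Nk [Ik Sk]]]. rewrite Sk by auto. apply K0; auto.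
  intros a Ha. apply Ik, I. now apply in_map.
Qed.

Lemma abs_summable_row {A B : Type} (f : A * B -> C) (a : A) : abs_summable f -> abs_summable (fun b => f (a, b)).
Proof. apply (abs_summable_comp_inj (fun b => (a, b))). intros b b' E. now inversion E. Qed.

(** Induction on the number of complete rows. The list [L] of further entries is there for the
    induction: a finite part of the row being added is moved into [L], where the induction
    hypothesis bounds it, and only afterwards is the whole row taken. *)
Lemma usum_rows_bound {A B : Type} (f : A * B -> C) (M : R) :
  (forall l, NoDup l -> rsum (fun t => Cmod (f t)) l <= M) ->
  forall l, NoDup l -> forall L, NoDup L -> (forall t, In t L -> ~ In (fst t) l) ->
  rsum (fun a => Cmod (usum (fun b => f (a, b)))) l + rsum (fun t => Cmod (f t)) L <= M.
Proof.
  intros HM l. induction l as [|a l IH]; intros Nl L NL D.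
  - unfold rsum at 1; simpl. rewrite Rplus_0_l. auto.
  - inversion Nl; subst. rewrite rsum_cons.
    assert (Cmod (usum (fun b => f (a, b))) <= M - rsum (fun a => Cmod (usum (fun b => f (a, b)))) l - rsum (fun t => Cmod (f t)) L).
    { apply usum_bound. intros k Nk.
      specialize (IH H2 (L ++ map (fun b => (a, b)) k)). rewrite rsum_app, rsum_map in IH.
      assert (X : NoDup (L ++ map (fun b => (a, b)) k)).
      { apply NoDup_app_disj; auto.
        - apply FinFun.Injective_map_NoDup; auto. intros b b' E. now inversion E.
        - intros t Ht K. apply in_map_iff in Ht. destruct Ht as [b [<- Hb]]. apply (D _ K). now left. }
      specialize (IH X). assert (Y : forall t, In t (L ++ map (fun b => (a, b)) k) -> ~ In (fst t) l).
      { intros t Ht K. apply in_app_or in Ht. destruct Ht as [Ht|Ht].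
        - apply (D t Ht). now right.
        - apply in_map_iff in Ht. destruct Ht as [b [<- Hb]]. auto. }
      specialize (IH Y). lra. }
    lra.
Qed.

Lemma abs_summable_rows {A B : Type} (f : A * B -> C) : abs_summable f -> abs_summable (fun a => usum (fun b => f (a, b))).
Proof.
  intros [M HM]. exists M. intros l Hl.
  assert (K := usum_rows_bound f M HM l Hl nil (NoDup_nil _) (fun t (H : In t nil) => match H with end)).
  unfold rsum in K. simpl in K. rewrite Rplus_0_r in K. exact K.
Qed.

Lemma usum_fubini {A B : Type} (f : A * B -> C) : abs_summable f -> usum f = usum (fun a => usum (fun b => f (a, b))).
Proof.
  intros H. symmetry. apply usum_eq, is_usum_iff. intros eps He.
  destruct (tail_exists _ eps H He) as [l0 [N0 T0]].
  (* [a0] collects the rows met by [l0]; a set of rows containing them covers all of [l0]. *)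
  destruct (NoDup_list (map fst l0)) as [a0 [Na0 Ia0]].
  exists a0. intros l Hl I.
  set (fl := fun t : A * B => if inb l (fst t) then f t else 0).
  assert (Hfl : forall l, abs_summable (fun t : A * B => if inb l (fst t) then f t else 0)).
  { intros k. apply (abs_summable_le _ (fun t => Cmod (f t))); auto. intros t. destruct (inb k (fst t)); [lra|].
    rewrite Cmod_0. apply Cmod_ge_0. }
  (* Finitely many complete rows are the unordered sum of [f] cut off outside those rows, and the
     difference from [f] then lives outside [l0]. *)
  assert (E : forall l, NoDup l -> finite_sum (fun a => usum (fun b => f (a, b))) l =
     usum (fun t : A * B => if inb l (fst t) then f t else 0)).
  { clear l Hl I fl. induction l as [|a l IH]; intros Nl.
    - symmetry. apply usum_zero. intros t. destruct (inb nil (fst t)) eqn:E; auto. now apply inb_spec in E.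
    - inversion Nl; subst. rewrite finite_sum_cons, IH by auto.
      set (fa := fun t : A * B => if inb (a :: nil) (fst t) then f t else 0).
      assert (E : usum fa = usum (fun b => f (a, b))).
      { rewrite (usum_reindex (fun b => (a, b)) fa).
        - apply usum_ext. intros b. unfold fa. simpl. destruct (inb (a :: nil) a) eqn:E; auto.
          assert (In a (a :: nil)) by now left. apply inb_spec in H0. congruence.
        - intros b b' E. now inversion E.
        - intros [a' b] Hb. exists b. unfold fa in Hb. simpl in Hb. destruct (inb (a :: nil) a') eqn:E; [|now destruct Hb].
          apply inb_spec in E. destruct E as [->|[]]. reflexivity.
        - apply abs_summable_row. apply Hfl. }
      rewrite <- E, <- usum_plus by apply Hfl. apply usum_ext. intros t. unfold fa.
      destruct (inb (a :: nil) (fst t)) eqn:E1; destruct (inb l (fst t)) eqn:E2; destruct (inb (a :: l) (fst t)) eqn:E3; try ring.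
      + apply inb_spec in E1, E2. destruct E1 as [->|[]]. contradiction.
      + apply inb_spec in E1, E2. destruct E1 as [->|[]]. contradiction.
      + apply inb_spec in E1. assert (In (fst t) (a :: l)) by (destruct E1 as [->|[]]; now left). apply inb_spec in H0. congruence.
      + apply inb_spec in E2. assert (In (fst t) (a :: l)) by now right. apply inb_spec in H0. congruence.
      + apply inb_spec in E3. destruct E3 as [K|K].
        * assert (In (fst t) (a :: nil)) by (rewrite K; now left). apply inb_spec in H0. congruence.
        * apply inb_spec in K. congruence. }
  rewrite E by auto. fold fl. rewrite <- usum_minus by (auto; apply Hfl).
  apply usum_bound. intros k Nk.
  apply Rle_trans with (rsum (fun t => Cmod (f t)) (filter (fun t => negb (inb l0 t)) k)).
  - clear Nk. induction k as [|t k IH]; [apply Rle_refl|]. rewrite rsum_cons. simpl filter.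
    destruct (inb l0 t) eqn:E1; simpl negb; cbv iota.
    + replace (fl t - f t) with (RtoC 0). rewrite Cmod_0. lra.
      unfold fl. destruct (inb l (fst t)) eqn:E2; [ring|]. exfalso.
      assert (In (fst t) l). { apply I, Ia0, in_map. now apply inb_spec. } apply inb_spec in H0. congruence.
    + rewrite rsum_cons. apply Rplus_le_compat; auto. unfold fl. destruct (inb l (fst t)).
      * replace (f t - f t) with (RtoC 0) by ring. rewrite Cmod_0. apply Cmod_ge_0.
      * replace (0 - f t) with (- f t) by ring. rewrite Cmod_opp. lra.
  - apply T0. now apply NoDup_filter. intros t Ht K. apply filter_In in Ht. apply inb_spec in K.
    destruct Ht as [_ Ht]. rewrite K in Ht. discriminate.
Qed.

Lemma rsum_list_prod {A B : Type} (g : A * B -> R) la lb :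
  rsum g (list_prod la lb) = rsum (fun a => rsum (fun b => g (a, b)) lb) la.
Proof.
  induction la as [|a la IH]; [reflexivity|]. simpl list_prod. now rewrite rsum_app, rsum_map, rsum_cons, IH.
Qed.

Lemma NoDup_list_prod {A B : Type} (la : list A) (lb : list B) : NoDup la -> NoDup lb -> NoDup (list_prod la lb).
Proof.
  intros Ha Hb. induction la as [|a la IH]; simpl; [constructor|]. inversion Ha; subst. apply NoDup_app_disj; auto.
  - apply FinFun.Injective_map_NoDup; auto. intros b b' E. now inversion E.
  - intros [a' b] H K. apply in_map_iff in K. destruct K as [b' [E _]]. inversion E; subst.
    apply in_prod_iff in H. now destruct H.
Qed.

(** Tonelli's criterion: a finite set of pairs is enclosed in a finite grid, which is summed row by
    row. *)
Lemma summ_iterated {A B : Type} (g : A * B -> R) (G : A -> R) : (forall t, 0 <= g t) ->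
  (forall a l, NoDup l -> rsum (fun b => g (a, b)) l <= G a) -> summ G -> summ g.
Proof.
  intros Hg HG [M HM]. exists M. intros L NL.
  destruct (NoDup_list (map fst L)) as [la [Na Ia]]. destruct (NoDup_list (map snd L)) as [lb [Nb Ib]].
  apply Rle_trans with (rsum g (list_prod la lb)).
  - apply rsum_incl; auto using NoDup_list_prod. intros [a b] H. apply in_prod_iff. split.
    + apply Ia. apply (in_map fst _ _ H).
    + apply Ib. apply (in_map snd _ _ H).
  - rewrite rsum_list_prod. apply Rle_trans with (rsum G la); auto. apply rsum_le. auto.
Qed.

Lemma summ_prod {A B : Type} (g : A -> R) (h : B -> R) : (forall a, 0 <= g a) -> (forall b, 0 <= h b) ->
  summ g -> summ h -> summ (fun t : A * B => g (fst t) * h (snd t))%R.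
Proof.
  intros Hg Hh Sg [M HM]. apply (summ_iterated _ (fun a => g a * Rmax M 0)%R).
  - intros; now apply Rmult_le_pos.
  - intros a l Hl. simpl. rewrite rsum_scal. apply Rmult_le_compat_l; auto. eapply Rle_trans; [apply HM; auto|apply Rmax_l].
  - apply (summ_le _ g (Rmax M 0)); auto. apply Rmax_r. intros; lra.
Qed.

(** * Limits of sequences and dominated convergence *)

Definition Clim (u : nat -> C) (l : C) : Prop :=
  forall eps, 0 < eps -> exists N, forall n, (N <= n)%nat -> Cmod (u n - l) <= eps.

(** Dominated convergence: outside a finite [l0] every sum is below [eps / 4] uniformly in [n], and
    inside it termwise convergence is enough. *)
Lemma tannery {T : Type} (f : nat -> T -> C) (f0 : T -> C) (g : T -> R) : summ g ->
  (forall n t, Cmod (f n t) <= g t) -> (forall t, Clim (fun n => f n t) (f0 t)) ->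
  abs_summable f0 /\ Clim (fun n => usum (f n)) (usum f0).
Proof.
  intros Sg Hf Hl.
  assert (H0 : forall t, Cmod (f0 t) <= g t).
  { intros t. apply le_epsilon. intros eps He. destruct (Hl t eps He) as [N HN]. specialize (HN N (le_n _)).
    rewrite Cmod_minus_sym in HN. generalize (Cmod_sub_le (f0 t) (f N t)) (Hf N t). lra. }
  assert (A0 : abs_summable f0) by (apply (abs_summable_le _ g); auto).
  split; auto. intros eps He.
  destruct (tail_exists g (eps / 4)%R Sg) as [l0 T0]; [lra|].
  assert (F : exists N, forall n, (N <= n)%nat -> Cmod (finite_sum (f n) l0 - finite_sum f0 l0) <= eps / 2).
  { assert (K : forall l e, 0 < e -> exists N, forall n, (N <= n)%nat -> Cmod (finite_sum (f n) l - finite_sum f0 l) <= e).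
    { induction l as [|t l IH]; intros e He'.
      - exists 0%nat. intros. unfold finite_sum; simpl. replace (0 - 0) with (RtoC 0) by ring. rewrite Cmod_0. lra.
      - destruct (IH (e / 2)%R) as [N1 H1]; [lra|]. destruct (Hl t (e / 2)%R) as [N2 H2]; [lra|].
        exists (max N1 N2). intros n Hn. specialize (H1 n ltac:(lia)). specialize (H2 n ltac:(lia)).
        rewrite !finite_sum_cons. replace (f n t + finite_sum (f n) l - (f0 t + finite_sum f0 l)) with
          ((f n t - f0 t) + (finite_sum (f n) l - finite_sum f0 l)) by ring.
        eapply Rle_trans; [apply Cmod_triangle|]. lra. }
    apply K. lra. }
  destruct F as [N HN]. exists N. intros n Hn. specialize (HN n Hn).
  assert (TT : forall h : T -> C, (forall t, Cmod (h t) <= g t) -> tail_le (fun t => Cmod (h t)) l0 (eps / 4)).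
  { intros h Hh. destruct T0 as [N0 T0]. split; auto. intros l Nl D. eapply Rle_trans; [apply rsum_le; intros; apply Hh|]. auto. }
  assert (K1 := usum_tail (f n) l0 _ (TT _ (Hf n)) (abs_summable_le _ g (Hf n) Sg)).
  assert (K2 := usum_tail f0 l0 _ (TT _ H0) A0).
  replace (usum (f n) - usum f0) with ((usum (f n) - finite_sum (f n) l0) - (usum f0 - finite_sum f0 l0) + (finite_sum (f n) l0 - finite_sum f0 l0)) by ring.
  eapply Rle_trans; [apply Cmod_triangle|].
  generalize (Cmod_triangle_minus (usum (f n) - finite_sum (f n) l0) (usum f0 - finite_sum f0 l0)). lra.
Qed.

(** The majorant [g] makes a single finite partial sum uniformly close on the whole disc, so
    Weierstrass' theorem applies. *)
Lemma usum_holomorphic {T : Type} (f : T -> C -> C) (g : T -> R) (c : C) (r : R) : 0 < r ->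
  (forall t, entire (f t)) -> summ g -> (forall t h, Cmod h <= r -> Cmod (f t (c + h)) <= g t) ->
  holomorphic_at (fun s => usum (fun t => f t s)) c.
Proof.
  intros Hr Hf Sg Hg. apply (weierstrass _ c r Hr). intros eps He.
  destruct (tail_exists g eps Sg He) as [l0 [N0 T0]].
  exists (fun s => finite_sum (fun t => f t s) l0). split. now apply entire_finite_sum.
  intros h Hh. apply (usum_tail (fun t => f t (c + h))).
  - split; auto. intros l Nl D. eapply Rle_trans; [apply rsum_le; intros; now apply Hg|]. auto.
  - apply (abs_summable_le _ g); auto.
Qed.

Lemma usum_partial_sums (f : nat -> C) : abs_summable f -> Clim (fun n => finite_sum f (seq 0 n)) (usum f).
Proof.
  intros H eps He. destruct (proj1 (is_usum_iff f _) (usum_correct f H) eps He) as [l0 K].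
  exists (S (list_max l0)). intros n Hn. apply K. apply seq_NoDup. intros t Ht. apply in_seq.
  assert (L := proj1 (list_max_le l0 (list_max l0)) (le_n _)). rewrite Forall_forall in L. specialize (L t Ht). lia.
Qed.

Lemma Clim_unique (u : nat -> C) (a b : C) : Clim u a -> Clim u b -> a = b.
Proof.
  intros Ha Hb. apply Cmod_zero_eq. intros eps He.
  destruct (Ha (eps / 2)%R) as [N1 H1]; [lra|]. destruct (Hb (eps / 2)%R) as [N2 H2]; [lra|].
  specialize (H1 (max N1 N2) ltac:(lia)). specialize (H2 (max N1 N2) ltac:(lia)).
  set (z := u (max N1 N2)) in *. rewrite Cmod_minus_sym in H1.
  replace (a - b) with ((a - z) + (z - b)) by ring. eapply Rle_trans; [apply Cmod_triangle|]. lra.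
Qed.

Lemma pder_RtoC (h : R -> R) (t d : R) : is_derive h t d -> pder (fun t => RtoC (h t)) t (RtoC d).
Proof. intros H. split; simpl; [exact H|]. auto_derive; auto. Qed.

Lemma pder_comp_Cexp (g : R -> C) (t : R) (d : C) : pder g t d -> pder (fun t => Cexp (g t)) t (d * Cexp (g t)).
Proof.
  assert (G : forall (g1 g2 : R -> R) (t d1 d2 : R), is_derive g1 t d1 -> is_derive g2 t d2 ->
    is_derive (fun t => exp (g1 t) * cos (g2 t))%R t (exp (g1 t) * (d1 * cos (g2 t) - d2 * sin (g2 t)))%R /\
    is_derive (fun t => exp (g1 t) * sin (g2 t))%R t (exp (g1 t) * (d1 * sin (g2 t) + d2 * cos (g2 t)))%R).
  { intros g1 g2 u d1 d2 H1 H2.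
    assert (E1 : ex_derive g1 u) by (eexists; apply H1).
    assert (E2 : ex_derive g2 u) by (eexists; apply H2).
    apply is_derive_unique in H1. apply is_derive_unique in H2.
    split; auto_derive; auto; change (fun x => g1 x) with g1; change (fun x => g2 x) with g2; rewrite H1, H2; ring. }
  intros [H1 H2]. destruct (G _ _ _ _ _ H1 H2) as [G1 G2].
  split.
  - apply (is_derive_ext (fun t => exp (fst (g t)) * cos (snd (g t)))%R).
    { intros u. unfold Cexp, Re, Im, RtoC, Cmult; simpl. ring. }
    replace (fst (d * Cexp (g t))) with (exp (fst (g t)) * (fst d * cos (snd (g t)) - snd d * sin (snd (g t))))%R; [exact G1|].
    unfold Cexp, Re, Im, RtoC, Cmult; simpl. ring.
  - apply (is_derive_ext (fun t => exp (fst (g t)) * sin (snd (g t)))%R).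
    { intros u. unfold Cexp, Re, Im, RtoC, Cmult; simpl. ring. }
    replace (snd (d * Cexp (g t))) with (exp (fst (g t)) * (fst d * sin (snd (g t)) + snd d * cos (snd (g t))))%R; [exact G2|].
    unfold Cexp, Re, Im, RtoC, Cmult; simpl. ring.
Qed.

(** * Convergent real series *)

Lemma summ_nat (g : nat -> R) (M : R) : (forall n, 0 <= g n) -> (forall n, rsum g (seq 0 n) <= M) -> summ g.
Proof.
  intros Hg HM. exists M. intros l Hl. eapply Rle_trans; [|apply (HM (S (list_max l)))].
  apply rsum_incl; auto using seq_NoDup. intros t Ht. apply in_seq.
  assert (L := proj1 (list_max_le l (list_max l)) (le_n _)). rewrite Forall_forall in L. specialize (L t Ht). lia.
Qed.

Lemma rsum_seq_S (g : nat -> R) n : rsum g (seq 0 (S n)) = (rsum g (seq 0 n) + g n)%R.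
Proof. rewrite seq_S, rsum_app. unfold rsum at 2. simpl. ring. Qed.

Lemma finite_sum_seq_S (g : nat -> C) n : finite_sum g (seq 0 (S n)) = finite_sum g (seq 0 n) + g n.
Proof. rewrite seq_S, finite_sum_app. unfold finite_sum at 2. simpl. ring. Qed.

Lemma Rpower_pos (x y : R) : 0 < Rpower x y.
Proof. apply exp_pos. Qed.

Lemma exp_le (x y : R) : x <= y -> exp x <= exp y.
Proof. intros [H|H]; [left; now apply exp_increasing|right; now rewrite H]. Qed.

Lemma ln_le' (x y : R) : 0 < x -> x <= y -> ln x <= ln y.
Proof. intros Hx [H|H]; [left; now apply ln_increasing|right; now rewrite H]. Qed.

Lemma Rpower_anti (x y p : R) : 0 < x -> x <= y -> p <= 0 -> Rpower y p <= Rpower x p.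
Proof. intros Hx Hxy Hp. unfold Rpower. apply exp_le. generalize (ln_le' x y Hx Hxy). nra. Qed.

Lemma Rpower_mono (x y p : R) : 0 < x -> x <= y -> 0 <= p -> Rpower x p <= Rpower y p.
Proof. intros Hx Hxy Hp. unfold Rpower. apply exp_le. generalize (ln_le' x y Hx Hxy). nra. Qed.

Lemma Rpower_mult_base (x y p : R) : 0 < x -> 0 < y -> Rpower (x * y) p = (Rpower x p * Rpower y p)%R.
Proof. intros. unfold Rpower. rewrite ln_mult, Rmult_plus_distr_l, exp_plus; auto. Qed.

(** The mean value theorem for [x ^ (1 - p)] bounds each term by an increment of a telescoping
    sum. *)
Lemma summ_p_series (p : R) : 1 < p -> summ (fun k : nat => Rpower (INR k + 1) (- p)).
Proof.
  intros Hp.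
  set (a := fun x : R => Rpower x (1 - p)).
  assert (K : forall k : nat, Rpower (INR k + 1 + 1) (- p) <= / (p - 1) * (a (INR k + 1)%R - a (INR k + 1 + 1)%R)).
  { intros k. set (x := (INR k + 1)%R). assert (Hx : 0 < x) by (unfold x; generalize (pos_INR k); lra).
    destruct (MVT_gen a x (x + 1) (fun y => (1 - p) * Rpower y (- p))%R) as [c [Hc E]].
    - intros y Hy. rewrite Rmin_left in Hy by lra. unfold a, Rpower.
      auto_derive; [lra|]. replace ((1 - p) * ln y)%R with (- p * ln y + ln y)%R by ring.
      rewrite exp_plus, exp_ln by lra. field. lra.
    - intros y Hy. rewrite Rmin_left in Hy by lra. apply continuity_pt_filterlim.
      apply (ex_derive_continuous a). unfold a, Rpower. auto_derive. lra.
    - rewrite Rmin_left, Rmax_right in Hc by lra.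
      replace (a x - a (x + 1))%R with ((p - 1) * Rpower c (- p))%R by lra.
      rewrite <- Rmult_assoc, Rinv_l, Rmult_1_l by lra. apply Rpower_anti; lra. }
  (* [K] controls the power of [k + 2]; as [k + 2 <= 2 (k + 1)], the shift costs the factor
     [2 ^ p]. *)
  apply (summ_le _ (fun k : nat => Rpower (INR k + 1 + 1) (- p)) (Rpower 2 p)).
  - left; apply Rpower_pos.
  - intros k. assert (Hk := pos_INR k).
    replace (Rpower (INR k + 1) (- p)) with (Rpower 2 p * (Rpower 2 (- p) * Rpower (INR k + 1) (- p)))%R.
    + apply Rmult_le_compat_l; [left; apply Rpower_pos|]. rewrite <- Rpower_mult_base by lra. apply Rpower_anti; lra.
    + rewrite <- Rmult_assoc, <- Rpower_plus. replace (p + - p)%R with 0%R by ring. rewrite Rpower_O by lra. ring.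
  - assert (Hi : 0 < / (p - 1)) by (apply Rinv_0_lt_compat; lra).
    apply (summ_nat _ (/ (p - 1) * a 1%R)%R). intros; left; apply Rpower_pos. intros n.
    apply Rle_trans with (/ (p - 1) * (a 1%R - a (INR n + 1)))%R.
    + induction n as [|n IH].
      * unfold rsum; simpl. rewrite Rplus_0_l. right. ring.
      * rewrite rsum_seq_S. specialize (K n). rewrite S_INR. lra.
    + apply Rmult_le_compat_l; [lra|]. assert (0 < a (INR n + 1)%R) by apply Rpower_pos. lra.
Qed.

Lemma abs_summable_RtoC {T : Type} (g : T -> R) : (forall t, 0 <= g t) -> (abs_summable (fun t => RtoC (g t)) <-> summ g).
Proof.
  intros Hg. split; intros [M HM]; exists M; intros l Hl.
  - specialize (HM l Hl). apply Rle_trans with (2 := HM). apply Req_le. apply (rsum_ext g (fun t => Cmod (RtoC (g t)))).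
    intros t _. now rewrite Cmod_R, Rabs_pos_eq.
  - specialize (HM l Hl). apply Rle_trans with (2 := HM). apply Req_le. apply (rsum_ext (fun t => Cmod (RtoC (g t)))).
    intros t _. now rewrite Cmod_R, Rabs_pos_eq.
Qed.

Lemma summ_Z (g : Z -> R) : (forall m, 0 <= g m) -> summ (fun n => g (Z.of_nat n)) -> summ (fun n => g (- Z.of_nat n - 1)%Z) -> summ g.
Proof.
  intros Hg H1 H2.
  set (g1 := fun m => if Z_le_dec 0 m then g m else 0%R). set (g2 := fun m => if Z_le_dec 0 m then 0%R else g m).
  assert (P1 : forall m, 0 <= g1 m) by (intros m; unfold g1; destruct (Z_le_dec 0 m); auto; lra).
  assert (P2 : forall m, 0 <= g2 m) by (intros m; unfold g2; destruct (Z_le_dec 0 m); auto; lra).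
  apply (summ_le _ (fun m => g1 m + g2 m)%R 1); [lra| |].
  { intros m. unfold g1, g2. destruct (Z_le_dec 0 m); lra. }
  apply summ_plus; apply abs_summable_RtoC; auto.
  - apply (abs_summable_reindex Z.of_nat).
    + intros; lia.
    + intros m Hm. exists (Z.to_nat m). unfold g1 in Hm. destruct (Z_le_dec 0 m); [lia|]. now destruct Hm.
    + apply (abs_summable_ext (fun n => RtoC (g (Z.of_nat n)))). intros n. unfold g1. destruct (Z_le_dec 0 (Z.of_nat n)); auto; lia.
      apply (abs_summable_RtoC (fun n => g (Z.of_nat n))); auto.
  - apply (abs_summable_reindex (fun n => - Z.of_nat n - 1)%Z).
    + intros; lia.
    + intros m Hm. exists (Z.to_nat (- m - 1)). unfold g2 in Hm. destruct (Z_le_dec 0 m); [now destruct Hm|lia].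
    + apply (abs_summable_ext (fun n => RtoC (g (- Z.of_nat n - 1)%Z))). intros n. unfold g2. destruct (Z_le_dec 0 (- Z.of_nat n - 1)); auto; lia.
      apply (abs_summable_RtoC (fun n => g (- Z.of_nat n - 1)%Z)); auto.
Qed.

Lemma summ_p_series_Z (p : R) : 1 < p -> summ (fun m : Z => Rpower (Rabs (IZR m) + 1) (- p)).
Proof.
  intros Hp. apply summ_Z.
  - intros; left; apply Rpower_pos.
  - apply (summ_le _ (fun k : nat => Rpower (INR k + 1) (- p)) 1); [lra| |now apply summ_p_series].
    intros k. rewrite <- INR_IZR_INZ, Rabs_pos_eq by apply pos_INR. lra.
  - apply (summ_le _ (fun k : nat => Rpower (INR k + 1) (- p)) 1); [lra| |now apply summ_p_series].
    intros k. rewrite minus_IZR, opp_IZR, <- INR_IZR_INZ. rewrite Rmult_1_l. apply Rpower_anti.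
    + generalize (pos_INR k). lra.
    + rewrite <- Rabs_Ropp. generalize (Rle_abs (- (- INR k - 1))). lra.
    + lra.
Qed.

(** * The reciprocal of the Gamma function *)

Lemma Rcpow_plus (x : R) (s t : C) : Rcpow x (s + t) = Rcpow x s * Rcpow x t.
Proof. unfold Rcpow. rewrite <- Cexp_plus. f_equal. ring. Qed.

Lemma Rcpow_opp (x : R) (s : C) : Rcpow x (- s) = / Rcpow x s.
Proof. unfold Rcpow. rewrite <- Cexp_opp. f_equal. ring. Qed.

Lemma Rcpow_neq_0 (x : R) (s : C) : Rcpow x s <> 0.
Proof. apply Cexp_neq_0. Qed.

Lemma Rcpow_0_r (x : R) : Rcpow x 0 = 1.
Proof. unfold Rcpow. rewrite Cmult_0_l. apply Cexp_0. Qed.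

Lemma Rcpow_cancel (x : R) (s : C) : Rcpow x s * Rcpow x (- s) = 1.
Proof. rewrite <- Rcpow_plus, <- (Rcpow_0_r x). f_equal. ring. Qed.

Lemma Rcpow_1_r (x : R) : 0 < x -> Rcpow x 1 = x.
Proof. intros Hx. unfold Rcpow. rewrite Cmult_1_l, Cexp_R, exp_ln; auto. Qed.

Lemma Rcpow_mult_base (x y : R) (s : C) : 0 < x -> 0 < y -> Rcpow (x * y) s = Rcpow x s * Rcpow y s.
Proof. intros Hx Hy. unfold Rcpow. rewrite ln_mult, RtoC_plus, <- Cexp_plus by auto. f_equal. ring. Qed.

Lemma Cmod_Rcpow (x : R) (s : C) : Cmod (Rcpow x s) = Rpower x (Re s).
Proof.
  unfold Rcpow, Rpower. rewrite Cmod_Cexp. f_equal. unfold Re, Cmult, RtoC; simpl. ring.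
Qed.

Lemma entire_Rcpow (x : R) (f : C -> C) : entire f -> entire (fun s => Rcpow x (f s)).
Proof.
  intros Hf. unfold Rcpow. apply entire_Cexp. apply (entire_mult f (fun _ => RtoC (ln x))); auto. apply entire_const.
Qed.

(** The sequence in the definition of [rGamma]. At [n = 0] it involves the default value of [ln], so
    the estimates start at [n = 1]. *)
Definition gauss (n : nat) (s : C) : C := rising s (S n) / (INR (fact n) * Rcpow (INR n) s).

Lemma entire_rising (n : nat) : entire (fun s => rising s n).
Proof.
  induction n as [|n IH]; simpl. apply entire_const. apply entire_mult; auto.
  apply entire_plus. apply entire_id. apply entire_const.
Qed.

Lemma entire_gauss (n : nat) : entire (gauss n).
Proof.
  apply (entire_ext (fun s => / INR (fact n) * (rising s (S n) * Rcpow (INR n) (- s)))).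
  - intros s. unfold gauss. rewrite Rcpow_opp. field. split. apply Rcpow_neq_0. 
    intros E. apply RtoC_inj in E. now apply (INR_fact_neq_0 n).
  - apply entire_scal. apply (entire_mult (fun s => rising s (S n))). apply entire_rising.
    apply entire_Rcpow. apply entire_opp, entire_id.
Qed.

(** The quotient of consecutive members of Euler's sequence, [(1 + s u) (1 - u) ^ s] with
    [u = 1 / (n + 1)]. *)
Definition gauss_ratio (u : R) (s : C) : C := (1 + s * u) * Cexp (s * ln (1 - u)).

Lemma gauss_S (n : nat) (s : C) : (1 <= n)%nat -> gauss (S n) s = gauss n s * gauss_ratio (/ (INR n + 1)) s.
Proof.
  intros Hn. unfold gauss, gauss_ratio.
  assert (Hp : 0 < INR n) by (apply lt_0_INR; lia).
  replace (1 - / (INR n + 1))%R with (INR n / (INR n + 1))%R by (field; lra).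
  rewrite ln_div by lra. rewrite RtoC_minus.
  replace (s * (ln (INR n) - ln (INR n + 1))) with (s * ln (INR n) + - (s * ln (INR n + 1))) by ring.
  rewrite Cexp_plus, Cexp_opp. fold (Rcpow (INR n) s). fold (Rcpow (INR n + 1) s).
  change (rising s (S (S n))) with (rising s (S n) * (s + INR (S n))).
  rewrite fact_simpl, mult_INR, S_INR, RtoC_mult, RtoC_inv, RtoC_plus by lra.
  assert (RtoC (INR (fact n)) <> 0) by apply RtoC_neq_0, INR_fact_neq_0.
  assert (INR n + 1 <> 0) by (rewrite <- RtoC_plus; intros E; apply RtoC_inj in E; lra).
  field. repeat split; auto using Rcpow_neq_0.
Qed.

Lemma Re_le_Cmod' (z : C) : Re z <= Cmod z.
Proof. eapply Rle_trans; [apply Rle_abs|apply re_le_Cmod]. Qed.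

(** The linear terms in [u] cancel: the derivative is [- s (1 + s) v / (1 - v) * (1 - v) ^ s], which
    vanishes at [v = 0]. For [u <= 1 / 2] the factors [1 / (1 - v)] and [(1 - v) ^ s] are at most 2
    and [2 ^ r], whence [K]. *)
Lemma gauss_ratio_bound (r : R) : 0 <= r -> exists K, 0 <= K /\ forall u s, 0 <= u <= / 2 -> Cmod s <= r ->
  Cmod (gauss_ratio u s - 1) <= K * (u * u).
Proof.
  intros Hr. set (K := (r * (1 + r) * 2 * exp (r * ln 2))%R).
  assert (HK : 0 <= K). { unfold K. assert (0 < exp (r * ln 2)) by apply exp_pos. assert (0 <= r * (1 + r)) by nra. nra. }
  exists K. split; auto. intros u s Hu Hs.
  assert (M := mean_value_ineq_const (fun u => gauss_ratio u s)
    (fun v => s * Cexp (s * ln (1 - v)) + (1 + s * v) * ((s * (- / (1 - v))%R) * Cexp (s * ln (1 - v))))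
    (K * u) 0 u (proj1 Hu)).
  cbv beta in M. assert (E0 : gauss_ratio 0 s = 1).
  { unfold gauss_ratio. rewrite Rminus_0_r, ln_1, !Cmult_0_r, Cexp_0. ring. }
  rewrite E0, Rminus_0_r in M. replace (K * (u * u))%R with (K * u * u)%R by ring. apply M.
  - intros v Hv. unfold gauss_ratio. apply pder_mult.
    + apply (pder_ext (fun v => 1 + v * s)). intros; ring. apply pder_affine.
    + apply pder_comp_Cexp. apply pder_scal. apply pder_RtoC. auto_derive. lra. field. lra.
  - intros v Hv.
    replace (s * Cexp (s * ln (1 - v)) + (1 + s * v) * ((s * (- / (1 - v))%R) * Cexp (s * ln (1 - v)))) with
      (- (s * (1 + s) * (v * / (1 - v))%R) * Cexp (s * ln (1 - v))).
    + rewrite Cmod_mult, Cmod_opp, Cmod_Cexp, !Cmod_mult, Cmod_R.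
      assert (Q1 : Cmod (1 + s) <= 1 + r). { eapply Rle_trans; [apply Cmod_triangle|]. rewrite Cmod_1. lra. }
      assert (Q2 : exp (Re (s * ln (1 - v))) <= exp (r * ln 2)).
      { apply exp_le. eapply Rle_trans; [apply Re_le_Cmod'|]. rewrite Cmod_mult, Cmod_R.
        apply Rmult_le_compat; auto using Cmod_ge_0, Rabs_pos.
        assert (ln (1 - v) <= 0) by (rewrite <- ln_1; apply ln_le'; lra).
        rewrite Rabs_left1 by auto. rewrite <- (Ropp_involutive (ln 2)). apply Ropp_le_contravar. rewrite <- ln_Rinv by lra. apply ln_le'; lra. }
      assert (Q3 : Rabs (v * / (1 - v)) <= 2 * u).
      { assert (0 < / (1 - v)) by (apply Rinv_0_lt_compat; lra).
        assert (/ (1 - v) <= 2). { rewrite <- (Rinv_inv 2). apply Rinv_le_contravar; lra. }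
        rewrite Rabs_pos_eq by (apply Rmult_le_pos; lra). nra. }
      unfold K. generalize (Cmod_ge_0 s) (Cmod_ge_0 (1 + s)) (Rabs_pos (v * / (1 - v))) (exp_pos (Re (s * ln (1 - v)))). intros.
      apply Rle_trans with ((r * (1 + r) * (2 * u)) * exp (r * ln 2))%R; [|right; ring].
      apply Rmult_le_compat; auto; try lra.
      * apply Rmult_le_pos; auto. apply Rmult_le_pos; auto.
      * apply Rmult_le_compat; auto. apply Rmult_le_pos; auto. apply Rmult_le_compat; auto.
    + rewrite RtoC_mult, RtoC_opp, RtoC_inv, RtoC_minus by lra.
      assert (1 - v <> 0) by (rewrite <- RtoC_minus; intros E; apply RtoC_inj in E; lra).
      field. auto.
Qed.

(** Since [1 / (n + 1) ^ 2 <= 1 / n - 1 / (n + 1)], the deviations of the ratios from 1 are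
    dominated by a telescoping sum. With [gauss 1 s = s (s + 1)] this bounds the products by
    [r (r + 1) exp K] and gives the rate [B / n] uniformly for [Cmod s <= r], which later makes the
    limit entire. *)
Lemma gauss_converges (r : R) : 0 <= r -> exists B, 0 <= B /\ forall s, Cmod s <= r ->
  (forall n, (1 <= n)%nat -> Cmod (gauss n s) <= B) /\
  (forall n m, (1 <= n)%nat -> (n <= m)%nat -> Cmod (gauss m s - gauss n s) <= B / INR n).
Proof.
  intros Hr. destruct (gauss_ratio_bound r Hr) as [K [HK HB]].
  assert (Step : forall s n, Cmod s <= r -> (1 <= n)%nat -> Cmod (gauss_ratio (/ (INR n + 1)) s - 1) <= K * (/ INR n - / INR (S n))).
  { intros s n Hs Hn. assert (Hp : 1 <= INR n) by (apply (le_INR 1); auto).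
    eapply Rle_trans; [apply HB; auto|].
    - split. left. apply Rinv_0_lt_compat. lra. apply Rinv_le_contravar; lra.
    - apply Rmult_le_compat_l; auto. rewrite S_INR.
      replace (/ INR n - / (INR n + 1))%R with (/ INR n * / (INR n + 1))%R by (field; lra).
      apply Rmult_le_compat_r. left. apply Rinv_0_lt_compat. lra. apply Rinv_le_contravar; lra. }
  set (B0 := (r * (r + 1) * exp K)%R).
  assert (HB0 : 0 <= B0). { unfold B0. generalize (exp_pos K). intros. assert (0 <= r * (r + 1)) by nra. nra. }
  assert (Bd : forall s n, Cmod s <= r -> (1 <= n)%nat -> Cmod (gauss n s) <= r * (r + 1) * exp (K * (1 - / INR n))).
  { intros s n Hs Hn. induction Hn as [|n Hn IH].
    - unfold gauss, Rcpow. simpl. rewrite ln_1, Cmult_0_r, Cexp_0. replace (K * (1 - / 1))%R with 0%R by field. rewrite exp_0.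
      replace (1 * (s + 0) * (s + 1) / (1 * 1)) with (s * (s + 1)) by field. rewrite Cmod_mult, Rmult_1_r.
      apply Rmult_le_compat; auto using Cmod_ge_0. eapply Rle_trans; [apply Cmod_triangle|]. rewrite Cmod_1. lra.
    - rewrite gauss_S by auto. rewrite Cmod_mult. specialize (Step s n Hs Hn).
      replace (K * (1 - / INR (S n)))%R with (K * (1 - / INR n) + K * (/ INR n - / INR (S n)))%R by ring.
      rewrite exp_plus, <- Rmult_assoc. apply Rmult_le_compat; auto using Cmod_ge_0.
      generalize (Cmod_sub_le (gauss_ratio (/ (INR n + 1)) s) 1). rewrite Cmod_1.
      generalize (exp_ineq1_le (K * (/ INR n - / INR (S n)))). lra. }
  assert (Bd0 : forall s n, Cmod s <= r -> (1 <= n)%nat -> Cmod (gauss n s) <= B0).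
  { intros s n Hs Hn. eapply Rle_trans; [apply (Bd s n Hs Hn)|]. unfold B0. apply Rmult_le_compat_l; [nra|].
    apply exp_le. assert (0 < / INR n) by (apply Rinv_0_lt_compat, lt_0_INR; lia). nra. }
  exists (B0 * (K + 1))%R. split; [nra|]. intros s Hs. split.
  - intros n Hn. eapply Rle_trans; [apply Bd0; auto|]. nra.
  - intros n m Hn Hm. assert (0 < / INR n) by (apply Rinv_0_lt_compat, lt_0_INR; lia).
    apply Rle_trans with (B0 * K * (/ INR n - / INR m))%R.
    + induction Hm as [|m Hm IH].
      * replace (gauss n s - gauss n s) with (RtoC 0) by ring. rewrite Cmod_0. right; ring.
      * rewrite gauss_S by lia.
        replace (gauss m s * gauss_ratio (/ (INR m + 1)) s - gauss n s) with
          (gauss m s * (gauss_ratio (/ (INR m + 1)) s - 1) + (gauss m s - gauss n s)) by ring.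
        eapply Rle_trans; [apply Cmod_triangle|]. rewrite Cmod_mult.
        assert (X : Cmod (gauss m s) * Cmod (gauss_ratio (/ (INR m + 1)) s - 1) <= B0 * (K * (/ INR m - / INR (S m)))).
        { apply Rmult_le_compat; auto using Cmod_ge_0. apply Bd0; auto; lia. apply Step; auto; lia. }
        lra.
    + assert (0 < / INR m) by (apply Rinv_0_lt_compat, lt_0_INR; lia). unfold Rdiv.
      apply Rle_trans with (B0 * K * / INR n)%R; [|nra]. apply Rmult_le_compat_l; [nra|lra].
Qed.

Lemma Clim_filterlim (u : nat -> C) (l : C) : Clim u l <->
  filterlim (fun n => u n : C_CompleteNormedModule) eventually (locally (T := C_CompleteNormedModule) l).
Proof.
  split.
  - intros H P [eps HP]. destruct (H (eps / 2)%R) as [N HN]; [destruct eps; simpl; lra|].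
    exists N. intros n Hn. apply HP. apply C_NormedModule_mixin_compat1.
    change (Cmod (u n - l) < eps). specialize (HN n Hn). destruct eps; simpl in *; lra.
  - intros H eps He. assert (He2 : 0 < eps / 2) by lra.
    assert (L : locally (T := C_CompleteNormedModule) l (fun y => Cmod (y - l) <= eps)).
    { exists (mkposreal _ He2). intros y Hy. apply C_NormedModule_mixin_compat2 in Hy.
      change (Cmod (y - l) < sqrt 2 * (eps / 2)) in Hy.
      assert (sqrt 2 <= 2). { rewrite <- (sqrt_square 2) at 2 by lra. apply sqrt_le_1; lra. }
      assert (Cmod (y - l) <= 2 * (eps / 2)) by nra. lra. }
    destruct (H _ L) as [N HN]. exists N. exact HN.
Qed.

Lemma rGamma_lim (s : C) : Clim (fun n => gauss n s) (rGamma s).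
Proof.
  destruct (gauss_converges (Cmod s) (Cmod_ge_0 s)) as [B [HB0 HB]]. destruct (HB s (Rle_refl _)) as [_ H].
  destruct (C_complete (fun n => gauss n s)) as [l Hl].
  - intros eps He. destruct (inverse_small B (eps / 2)) as [N HN]; [lra|].
    exists (S N). intros n m Hn Hm.
    assert (Q := HN N (le_n _)).
    assert (K1 := H (S N) n ltac:(lia) Hn). assert (K2 := H (S N) m ltac:(lia) Hm).
    replace (gauss n s - gauss m s) with ((gauss n s - gauss (S N) s) - (gauss m s - gauss (S N) s)) by ring.
    eapply Rle_trans; [apply Cmod_triangle_minus|]. lra.
  - assert (E : rGamma s = l); [|now rewrite E].
    unfold rGamma. apply (iota_unique (V := C_CompleteNormedModule)).
    + intros y Hy. apply (Clim_unique (fun n => gauss n s)); auto. apply Clim_filterlim. exact Hy.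
    + apply Clim_filterlim. exact Hl.
Qed.

Lemma rGamma_error (r : R) : 0 <= r -> exists B, forall s n, Cmod s <= r -> (1 <= n)%nat -> Cmod (rGamma s - gauss n s) <= B / INR n.
Proof.
  intros Hr. destruct (gauss_converges r Hr) as [B [HB0 HB]]. exists B. intros s n Hs Hn.
  apply le_epsilon. intros eps He. destruct (rGamma_lim s eps He) as [N HN].
  specialize (HN (max N n) ltac:(lia)). assert (K := proj2 (HB s Hs) n (max N n) Hn ltac:(lia)).
  rewrite Cmod_minus_sym in HN.
  replace (rGamma s - gauss n s) with ((rGamma s - gauss (max N n) s) + (gauss (max N n) s - gauss n s)) by ring.
  eapply Rle_trans; [apply Cmod_triangle|]. lra.
Qed.

Lemma entire_rGamma : entire rGamma.
Proof.
  intros c. destruct (rGamma_error (Cmod c + 1)) as [B HB]; [generalize (Cmod_ge_0 c); lra|].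
  apply (weierstrass rGamma c 1); [lra|]. intros eps He.
  destruct (inverse_small B eps He) as [N HN].
  exists (gauss (S N)). split. apply entire_gauss. intros h Hh.
  eapply Rle_trans; [apply HB; [|lia]|now apply HN].
  eapply Rle_trans; [apply Cmod_triangle|]. lra.
Qed.

(** * Binomial coefficients with complex exponent *)

Definition bcoef (s : C) (l : nat) : C := rising s l / INR (fact l).

Lemma bcoef_gauss (s : C) (n : nat) : (1 <= n)%nat -> bcoef s (S n) = gauss n s * (Rcpow (INR n) s / (INR n + 1)%R).
Proof.
  intros Hn. unfold bcoef, gauss. rewrite fact_simpl, mult_INR, S_INR, RtoC_mult, RtoC_plus.
  assert (RtoC (INR (fact n)) <> 0) by apply RtoC_neq_0, INR_fact_neq_0.
  assert (INR n + 1 <> 0) by (rewrite <- RtoC_plus; intros E; apply RtoC_inj in E; generalize (pos_INR n); lra).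
  field. repeat split; auto using Rcpow_neq_0.
Qed.

(** From the second index on, [bcoef_gauss] exhibits the power [n ^ s / (n + 1)] with a bounded
    factor. With [1 <= Re s] the power on the right is at least 1, so the first two coefficients fit
    under the same bound. *)
Lemma bcoef_bound (s : C) : 1 <= Re s -> exists B, 0 <= B /\ forall l, Cmod (bcoef s l) <= B * Rpower (INR l + 1) (Re s - 1).
Proof.
  intros Hs. destruct (gauss_converges (Cmod s) (Cmod_ge_0 s)) as [B [HB0 HB]]. destruct (HB s (Rle_refl _)) as [H _].
  set (B1 := (B + 1 + Cmod s)%R). assert (HB1 : 0 <= B1) by (unfold B1; generalize (Cmod_ge_0 s); lra).
  assert (P1 : forall l, 1 <= Rpower (INR l + 1) (Re s - 1)).
  { intros l. rewrite <- (Rpower_O (INR l + 1)) at 1 by (generalize (pos_INR l); lra).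
    apply Rle_Rpower; generalize (pos_INR l); lra. }
  exists B1. split; auto. intros l. destruct l as [|[|n]].
  - unfold bcoef; simpl. replace (1 / 1) with (RtoC 1) by field. rewrite Cmod_1.
    generalize (P1 0%nat). simpl. intros. unfold B1. generalize (Cmod_ge_0 s). nra.
  - unfold bcoef; simpl. replace (1 * (s + 0) / 1) with s by field.
    generalize (P1 1%nat). simpl. intros. unfold B1. generalize (Cmod_ge_0 s). nra.
  - set (m := S n). assert (Hm : (1 <= m)%nat) by (unfold m; lia). assert (Hp : 1 <= INR m) by (apply (le_INR 1); auto).
    rewrite bcoef_gauss by auto. rewrite Cmod_mult, Cmod_div, Cmod_Rcpow, Cmod_R, Rabs_pos_eq; try lra.
    2:{ intros E; apply RtoC_inj in E; lra. }
    apply Rmult_le_compat; auto using Cmod_ge_0.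
    + apply Rmult_le_pos. left; apply Rpower_pos. left; apply Rinv_0_lt_compat; lra.
    + eapply Rle_trans; [apply H; auto|]. unfold B1. generalize (Cmod_ge_0 s). lra.
    + rewrite S_INR. apply Rle_trans with (Rpower (INR m + 1) (Re s) / (INR m + 1))%R.
      * apply Rmult_le_compat_r. left; apply Rinv_0_lt_compat; lra. apply Rpower_mono; lra.
      * replace (Re s) with ((Re s - 1) + 1)%R at 1 by ring. rewrite Rpower_plus, Rpower_1 by lra.
        replace (Rpower (INR m + 1) (Re s - 1) * (INR m + 1) / (INR m + 1))%R with (Rpower (INR m + 1) (Re s - 1)) by (field; lra).
        apply Rpower_mono; lra.
Qed.

(** * Powers on the right half-plane *)

(** The principal logarithm on the right half-plane. There [atan] gives the argument without case
    distinction, so it can be differentiated by [auto_derive]; the arguments of the statement are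
    reduced to it by quarter turns. *)
Definition Clog (W : C) : C := (ln (Cmod W), atan (Im W / Re W)).

Definition pw (W s : C) : C := Cexp (s * Clog W).

Lemma Re_pos_neq_0 (W : C) : 0 < Re W -> W <> 0.
Proof. intros H E. rewrite E in H. unfold Re in H; simpl in H. lra. Qed.

Lemma pder_Clog (p q : C) (t : R) : 0 < Re (p + t * q) -> pder (fun t => Clog (p + t * q)) t (q / (p + t * q)).
Proof.
  destruct p as [p1 p2], q as [q1 q2]. unfold Re. simpl. intros H.
  assert (Hx : 0 < p1 + t * q1) by lra.
  assert (Hn : 0 < (p1 + t * q1) * (p1 + t * q1) + (p2 + t * q2) * (p2 + t * q2)).
  { generalize (Rmult_lt_0_compat _ _ Hx Hx) (Rle_0_sqr (p2 + t * q2)). unfold Rsqr. lra. }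
  split; simpl.
  - apply (is_derive_ext (fun t => ln (sqrt ((p1 + t * q1) * (p1 + t * q1) + (p2 + t * q2) * (p2 + t * q2))))).
    { intros u. unfold Cmod; simpl. do 2 f_equal. ring. }
    assert (0 < sqrt ((p1 + t * q1) * (p1 + t * q1) + (p2 + t * q2) * (p2 + t * q2))) by now apply sqrt_lt_R0.
    auto_derive. repeat split; auto.
    set (S := sqrt _) in *.
    assert (ES : (S * S = (p1 + t * q1) * (p1 + t * q1) + (p2 + t * q2) * (p2 + t * q2))%R) by (apply sqrt_sqrt; lra).
    apply Rmult_eq_reg_r with (S * S)%R; [|nra].
    transitivity ((p1 + t * q1) * q1 + (p2 + t * q2) * q2)%R.
    + field. lra.
    + rewrite ES. field. nra.
  - apply (is_derive_ext (fun t => atan ((p2 + t * q2) / (p1 + t * q1)))).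
    { intros u. unfold Im, Re; simpl. f_equal. f_equal; ring. }
    auto_derive. lra. field. repeat split; nra.
Qed.

Lemma Cmod_sqr (W : C) : (Cmod W * Cmod W = Re W * Re W + Im W * Im W)%R.
Proof. generalize (Cmod2_alt W). simpl. lra. Qed.

Lemma Cmod_factor (W : C) : 0 < Re W -> Cmod W = (Re W * sqrt (1 + (Im W / Re W)²))%R.
Proof.
  intros H. apply Rsqr_inj. apply Cmod_ge_0. apply Rmult_le_pos; [lra|apply sqrt_pos].
  rewrite Rsqr_mult, Rsqr_sqrt. unfold Rsqr. rewrite Cmod_sqr. field. lra.
  generalize (Rle_0_sqr (Im W / Re W)). lra.
Qed.

Lemma Cexp_Clog (W : C) : 0 < Re W -> Cexp (Clog W) = W.
Proof.
  intros H. assert (HC : 0 < Cmod W) by (apply Cmod_gt_0, Re_pos_neq_0, H).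
  unfold Cexp, Clog. simpl. rewrite exp_ln by auto. rewrite cos_atan, sin_atan, (Cmod_factor W H).
  assert (S : 0 < sqrt (1 + (Im W / Re W)²)) by (apply sqrt_lt_R0; generalize (Rle_0_sqr (Im W / Re W)); lra).
  set (q := sqrt _) in *. unfold Cmult, RtoC; simpl. destruct W as [x y]. unfold Re, Im in *; simpl in *.
  f_equal; field; lra.
Qed.

Lemma pw_plus (W s t : C) : pw W (s + t) = pw W s * pw W t.
Proof. unfold pw. rewrite <- Cexp_plus. f_equal. ring. Qed.

Lemma pw_1 (W : C) : 0 < Re W -> pw W 1 = W.
Proof. intros H. unfold pw. rewrite Cmult_1_l. now apply Cexp_Clog. Qed.

Lemma pw_opp (W s : C) : pw W (- s) = / pw W s.
Proof. unfold pw. rewrite <- Cexp_opp. f_equal. ring. Qed.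

Lemma pw_neq_0 (W s : C) : pw W s <> 0.
Proof. apply Cexp_neq_0. Qed.

Lemma Clog_RtoC (x : R) : 0 < x -> Clog x = RtoC (ln x).
Proof.
  intros H. unfold Clog. rewrite Cmod_R, Rabs_pos_eq by lra. unfold RtoC. f_equal. unfold Im, Re; simpl.
  unfold Rdiv. rewrite Rmult_0_l. apply atan_0.
Qed.

Lemma pw_RtoC (x : R) (s : C) : 0 < x -> pw x s = Rcpow x s.
Proof. intros H. unfold pw, Rcpow. now rewrite Clog_RtoC. Qed.

Lemma Clog_scale (x : R) (W : C) : 0 < x -> 0 < Re W -> Clog (x * W) = ln x + Clog W.
Proof.
  intros H HW. assert (HC : 0 < Cmod W) by (apply Cmod_gt_0, Re_pos_neq_0, HW).
  unfold Clog. rewrite Cmod_mult, Cmod_R, Rabs_pos_eq, ln_mult by lra. unfold RtoC, Cplus; cbn [fst snd]. f_equal.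
  rewrite Rplus_0_l. f_equal. destruct W as [a b]. unfold Im, Re in *; simpl in *. field. split; lra.
Qed.

Lemma pw_scale (x : R) (W s : C) : 0 < x -> 0 < Re W -> pw (x * W) s = Rcpow x s * pw W s.
Proof. intros H HW. unfold pw, Rcpow. rewrite Clog_scale, <- Cexp_plus by auto. f_equal. ring. Qed.

Lemma Cmod_pw (W s : C) : Cmod (pw W s) = exp (Re s * ln (Cmod W) - Im s * atan (Im W / Re W)).
Proof. unfold pw. rewrite Cmod_Cexp. f_equal. Qed.

Lemma Cmod_pw_le (W s : C) : Cmod (pw W s) <= Rpower (Cmod W) (Re s) * exp (2 * Rabs (Im s)).
Proof.
  rewrite Cmod_pw. unfold Rpower. rewrite <- exp_plus. apply exp_le.
  assert (H := atan_bound (Im W / Re W)). assert (H2 := PI_4).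
  assert (Rabs (atan (Im W / Re W)) <= 2) by (apply Rabs_le; lra).
  generalize (Rle_abs (- (Im s * atan (Im W / Re W)))). rewrite Rabs_Ropp, Rabs_mult.
  generalize (Rabs_pos (Im s)) (Rabs_pos (atan (Im W / Re W))). nra.
Qed.

Lemma entire_pw (W : C) (f : C -> C) : entire f -> entire (fun s => pw W (f s)).
Proof.
  intros Hf. unfold pw. apply entire_Cexp. apply (entire_mult f (fun _ => Clog W)); auto. apply entire_const.
Qed.

Lemma Clog_continuous (W : C) : 0 < Re W -> forall h, Cmod h <= Re W / 2 -> Cmod (Clog (W + h) - Clog W) <= 2 / Re W * Cmod h.
Proof.
  intros HW h Hh.
  assert (HR : forall t, 0 <= t <= 1 -> Re W / 2 <= Re (W + t * h)).
  { intros t Ht. assert (Rabs (Re h) <= Re W / 2) by (eapply Rle_trans; [apply re_le_Cmod|auto]).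
    apply Rabs_le_between in H. destruct W, h. unfold Re in *; simpl in *. nra. }
  assert (K := mean_value_ineq_const (fun t => Clog (W + t * h)) (fun t => h / (W + t * h)) (2 / Re W * Cmod h) 0 1 ltac:(lra)).
  cbv beta in K. replace (W + 1%R * h) with (W + h) in K by ring. replace (W + 0%R * h) with W in K by ring.
  rewrite Rminus_0_r, Rmult_1_r in K. apply K.
  - intros t Ht. apply pder_Clog. specialize (HR t Ht). lra.
  - intros t Ht. specialize (HR t Ht). rewrite Cmod_div by (apply Re_pos_neq_0; lra).
    unfold Rdiv. rewrite Rmult_comm. apply Rmult_le_compat_r; [apply Cmod_ge_0|].
    replace (2 * / Re W)%R with (/ (Re W / 2))%R by (field; lra). apply Rinv_le_contravar. lra.
    eapply Rle_trans; [apply HR|]. apply Re_le_Cmod'.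
Qed.

Lemma Clim_const (c : C) : Clim (fun _ => c) c.
Proof. intros eps He. exists 0%nat. intros. replace (c - c) with (RtoC 0) by ring. rewrite Cmod_0. lra. Qed.

Lemma Clim_ext (u v : nat -> C) (l : C) : (exists N, forall n, (N <= n)%nat -> u n = v n) -> Clim u l -> Clim v l.
Proof.
  intros [N0 E] H eps He. destruct (H eps He) as [N HN]. exists (max N0 N). intros n Hn.
  rewrite <- E by lia. apply HN. lia.
Qed.

Lemma Clim_plus (u v : nat -> C) (a b : C) : Clim u a -> Clim v b -> Clim (fun n => u n + v n) (a + b).
Proof.
  intros Ha Hb eps He. destruct (Ha (eps / 2)%R) as [N1 H1]; [lra|]. destruct (Hb (eps / 2)%R) as [N2 H2]; [lra|].
  exists (max N1 N2). intros n Hn. specialize (H1 n ltac:(lia)). specialize (H2 n ltac:(lia)).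
  replace (u n + v n - (a + b)) with ((u n - a) + (v n - b)) by ring. eapply Rle_trans; [apply Cmod_triangle|]. lra.
Qed.

Lemma Clim_comp (f : C -> C) (u : nat -> C) (a : C) :
  (forall eps, 0 < eps -> exists del, 0 < del /\ forall h, Cmod h < del -> Cmod (f (a + h) - f a) <= eps) ->
  Clim u a -> Clim (fun n => f (u n)) (f a).
Proof.
  intros Hf Hu eps He. destruct (Hf eps He) as [del [Hd K]]. destruct (Hu (del / 2)%R) as [N HN]; [lra|].
  exists N. intros n Hn. specialize (HN n Hn). replace (u n) with (a + (u n - a)) by ring. apply K. lra.
Qed.

Lemma Clim_mult (u v : nat -> C) (a b : C) : Clim u a -> Clim v b -> Clim (fun n => u n * v n) (a * b).
Proof.
  intros Ha Hb.
  assert (S : forall c w l, Clim w l -> Clim (fun n => c * w n) (c * l)).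
  { intros c w l. apply (Clim_comp (fun z => c * z)). apply (cder_cont (fun z => c * z) l (c * 1)). apply cder_scal, cder_id. }
  assert (Z : Clim (fun n => (u n - a) * (v n - b)) 0).
  { intros eps He. destruct (Ha (Rmin 1 eps)) as [N1 H1]; [apply Rmin_pos; lra|]. destruct (Hb 1%R) as [N2 H2]; [lra|].
    exists (max N1 N2). intros n Hn. specialize (H1 n ltac:(lia)). specialize (H2 n ltac:(lia)).
    replace ((u n - a) * (v n - b) - 0) with ((u n - a) * (v n - b)) by ring. rewrite Cmod_mult.
    generalize (Rmin_r 1 eps) (Cmod_ge_0 (u n - a)) (Cmod_ge_0 (v n - b)). nra. }
  assert (K := Clim_plus _ _ _ _ (Clim_plus _ _ _ _ Z (S a v b Hb)) (Clim_plus _ _ _ _ (S b u a Ha) (Clim_const (- (a * b))))).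
  replace (a * b) with (0 + a * b + (b * a + - (a * b))) by ring.
  eapply Clim_ext; [|exact K]. exists 0%nat. intros n _. ring.
Qed.

Lemma Clim_Cexp (u : nat -> C) (a : C) : Clim u a -> Clim (fun n => Cexp (u n)) (Cexp a).
Proof. apply (Clim_comp Cexp). apply (cder_cont Cexp a (Cexp a)). apply cder_Cexp. Qed.

Lemma Clim_pw (u : nat -> C) (W s : C) : 0 < Re W -> Clim u W -> Clim (fun n => pw (u n) s) (pw W s).
Proof.
  intros HW Hu. unfold pw. apply Clim_Cexp. apply Clim_mult; [apply Clim_const|].
  apply (Clim_comp Clog); auto. intros eps He.
  exists (Rmin (Re W / 2) (eps * (Re W / 2))%R). split. apply Rmin_pos; nra. intros h Hh.
  assert (L1 := Rlt_le_trans _ _ _ Hh (Rmin_l _ _)). assert (L2 := Rlt_le_trans _ _ _ Hh (Rmin_r _ _)).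
  eapply Rle_trans; [apply Clog_continuous; auto; lra|].
  apply Rle_trans with (2 / Re W * (eps * (Re W / 2)))%R.
  - apply Rmult_le_compat_l; [|lra]. left. apply Rdiv_lt_0_compat; lra.
  - right. field. lra.
Qed.

Lemma sqrt_one_minus_sqr (a b : R) : 0 < b -> sqrt (1 - (a / b)²) = (sqrt (b * b - a * a) / b)%R.
Proof.
  intros Hb. transitivity (sqrt (b * b - a * a) / sqrt (b * b))%R; [|now rewrite sqrt_square by lra].
  assert (Hbb : 0 < b * b) by now apply Rmult_lt_0_compat.
  replace (1 - (a / b)²)%R with ((b * b - a * a) / (b * b))%R by (unfold Rsqr; field; lra).
  now rewrite sqrt_div_alt.
Qed.

(** For [W] in the upper half-plane, [- i W] lies in the right half-plane and its argument is
    [atan (- Re W / Im W)]; the quarter turn accounts for [PI / 2]. *)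
Lemma acos_upper (W : C) : 0 < Im W -> acos (Re W / Cmod W) = (PI / 2 + atan (- Re W / Im W))%R.
Proof.
  intros H. assert (HW : W <> 0) by (intros E; rewrite E in H; unfold Im in H; simpl in H; lra).
  assert (HC := proj1 (Cmod_gt_0 W) HW). assert (HS := Cmod_sqr W).
  rewrite acos_asin. 2:{ split; apply Rmult_le_reg_r with (Cmod W); auto; unfold Rdiv; rewrite ?Rmult_assoc, ?Rinv_l by lra; nra. }
  rewrite asin_atan. 2:{ split; apply Rmult_lt_reg_r with (Cmod W); auto; unfold Rdiv; rewrite ?Rmult_assoc, ?Rinv_l by lra; nra. }
  rewrite sqrt_one_minus_sqr by auto. rewrite HS.
  replace (Re W * Re W + Im W * Im W - Re W * Re W)%R with (Im W * Im W)%R by ring. rewrite sqrt_square by lra.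
  replace (Re W / Cmod W / (Im W / Cmod W))%R with (Re W / Im W)%R by (field; lra).
  replace (- Re W / Im W)%R with (- (Re W / Im W))%R by (field; lra). rewrite atan_opp. ring.
Qed.

Lemma acos_right (W : C) : 0 < Re W -> acos (Re W / Cmod W) = atan (Rabs (Im W) / Re W).
Proof.
  intros H. assert (HC := proj1 (Cmod_gt_0 W) (Re_pos_neq_0 W H)). assert (HS := Cmod_sqr W).
  rewrite acos_atan by (apply Rdiv_lt_0_compat; auto).
  rewrite sqrt_one_minus_sqr by auto. rewrite HS.
  replace (Re W * Re W + Im W * Im W - Re W * Re W)%R with (Im W)² by (unfold Rsqr; ring). rewrite sqrt_Rsqr_abs.
  f_equal. field. lra.
Qed.

Lemma Carg_right (W : C) : 0 < Re W -> Carg W = atan (Im W / Re W) /\ Carg_lower W = atan (Im W / Re W).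
Proof.
  intros H. unfold Carg, Carg_lower. rewrite acos_right by auto.
  destruct (Rlt_dec (Im W) 0); destruct (Rlt_dec 0 (Im W)); try lra.
  - rewrite Rabs_left by auto. rewrite <- atan_opp. split; f_equal; field; lra.
  - rewrite Rabs_pos_eq by lra. auto.
  - replace (Im W) with 0%R by lra. rewrite Rabs_R0. unfold Rdiv. rewrite Rmult_0_l, atan_0. split; ring.
Qed.

Lemma Cpow_right (W s : C) : 0 < Re W -> Cpow_arg Carg W s = pw W s /\ Cpow_arg Carg_lower W s = pw W s.
Proof.
  intros H. destruct (Carg_right W H) as [H1 H2]. unfold Cpow_arg, pw. rewrite H1, H2.
  assert (E : ln (Cmod W) + Ci * atan (Im W / Re W) = Clog W).
  { unfold Clog, Ci, RtoC, Cplus, Cmult; simpl. f_equal; ring. }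
  now rewrite E.
Qed.

Lemma Cmod_Ci_mult (W : C) : Cmod (Ci * W) = Cmod W.
Proof. rewrite Cmod_mult, Cmod_Ci. ring. Qed.

(** Off the real line the two choices of the argument coincide, and both are the principal power of
    [- i W] times the phase of a quarter turn. *)
Lemma Cpow_upper (W s : C) : 0 < Im W ->
  Cpow_arg Carg W s = Cexp (PI * Ci * s / 2) * pw (- (Ci * W)) s /\
  Cpow_arg Carg_lower W s = Cexp (PI * Ci * s / 2) * pw (- (Ci * W)) s.
Proof.
  intros H. unfold Cpow_arg, pw, Carg, Carg_lower. rewrite acos_upper by auto.
  destruct (Rlt_dec (Im W) 0); [lra|]. destruct (Rlt_dec 0 (Im W)); [|lra].
  rewrite <- Cexp_plus.
  assert (E : s * (ln (Cmod W) + Ci * (PI / 2 + atan (- Re W / Im W))%R) = PI * Ci * s / 2 + s * Clog (- (Ci * W))).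
  { replace (Clog (- (Ci * W))) with (ln (Cmod W) + Ci * atan (- Re W / Im W)).
    - rewrite RtoC_plus, RtoC_div by lra. field.
    - unfold Clog. rewrite Cmod_opp, Cmod_Ci_mult. unfold Ci, RtoC, Cplus, Cmult, Copp, Im, Re; simpl. f_equal; [ring|].
      match goal with |- _ = atan ?y => replace y with (- fst W / snd W)%R by (field; unfold Im in *; lra) end. ring. }
  now rewrite E.
Qed.

Lemma Cpow_lower (W s : C) : Im W < 0 ->
  Cpow_arg Carg W s = Cexp (- (PI * Ci * s / 2)) * pw (Ci * W) s /\
  Cpow_arg Carg_lower W s = Cexp (- (PI * Ci * s / 2)) * pw (Ci * W) s.
Proof.
  intros H. unfold Cpow_arg, pw, Carg, Carg_lower.
  (* The [acos] expression depends only on [Re W] and [Cmod W], so the upper half-plane formula can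
     be read at the conjugate. *)
  assert (A := acos_upper (Cconj W)). rewrite Cmod_conj in A.
  replace (Re (Cconj W)) with (Re W) in A by (destruct W; reflexivity).
  replace (Im (Cconj W)) with (- Im W)%R in A by (destruct W; reflexivity).
  rewrite A by lra. replace (- Re W / - Im W)%R with (Re W / Im W)%R by (field; lra).
  destruct (Rlt_dec (Im W) 0); [|lra]. destruct (Rlt_dec 0 (Im W)); [lra|].
  rewrite <- Cexp_plus.
  assert (E : s * (ln (Cmod W) + Ci * (- (PI / 2 + atan (Re W / Im W)))%R) = - (PI * Ci * s / 2) + s * Clog (Ci * W)).
  { replace (Clog (Ci * W)) with (ln (Cmod W) + Ci * (- atan (Re W / Im W))%R).
    - rewrite !RtoC_opp, RtoC_plus, RtoC_div by lra. field.
    - unfold Clog. rewrite Cmod_Ci_mult. rewrite <- atan_opp. unfold Ci, RtoC, Cplus, Cmult, Copp, Im, Re in *; simpl in *. f_equal; [ring|].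
      match goal with |- _ = atan ?y => replace y with (- (fst W / snd W))%R by (field; lra) end. ring. }
  now rewrite E.
Qed.

(** * The binomial series *)

(** Follows from [ln x <= x / M + ln M]; taking [M = A / c] makes [A * ln x] at most [c * x] plus a
    constant. *)
Lemma exp_beats_power (a c : R) : 0 < c -> exists K, 0 <= K /\ forall x, 1 <= x -> Rpower x a * exp (- c * x) <= K * Rpower x (- (2)).
Proof.
  intros Hc. set (A := (Rabs (a + 2) + 1)%R). assert (HA : 0 < A) by (unfold A; generalize (Rabs_pos (a + 2)); lra).
  set (M := (A / c)%R). assert (HM : 0 < M) by (apply Rdiv_lt_0_compat; auto).
  exists (exp (A * Rabs (ln M))). split; [left; apply exp_pos|]. intros x Hx.
  unfold Rpower. rewrite <- !exp_plus. apply exp_le.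
  assert (L : ln x <= x / M + ln M).
  { replace x with (x / M * M)%R at 1 by (field; lra). rewrite ln_mult; auto; [|apply Rdiv_lt_0_compat; lra].
    assert (0 < x / M) by (apply Rdiv_lt_0_compat; lra).
    assert (ln (x / M) <= x / M); [|lra].
    rewrite <- (ln_exp (x / M)) at 2. apply ln_le'; auto. generalize (exp_ineq1_le (x / M)). lra. }
  assert (L0 : 0 <= ln x) by (rewrite <- ln_1; apply ln_le'; lra).
  assert ((a + 2) * ln x <= A * ln x) by (apply Rmult_le_compat_r; auto; unfold A; generalize (Rle_abs (a + 2)); lra).
  assert (A * ln x <= A * (x / M + ln M)) by (apply Rmult_le_compat_l; lra).
  assert (A * (x / M) = c * x)%R by (unfold M; field; split; lra).
  assert (A * ln M <= A * Rabs (ln M)) by (apply Rmult_le_compat_l; [lra|apply Rle_abs]).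
  lra.
Qed.

Lemma pow_exp_bound (rho : R) : 0 <= rho < 1 -> exists c, 0 < c /\ forall n : nat, rho ^ n <= exp (- c * INR n).
Proof.
  intros H. set (r' := ((1 + rho) / 2)%R). assert (Hr : 0 < r' < 1) by (unfold r'; lra).
  exists (- ln r')%R. split.
  - assert (ln r' < ln 1) by (apply ln_increasing; lra). rewrite ln_1 in H0. lra.
  - intros n. apply Rle_trans with (r' ^ n)%R. apply pow_incr. unfold r'; lra.
    rewrite <- Rpower_pow by lra. unfold Rpower. right. f_equal. ring.
Qed.

(** The version with the factor [INR l] controls the boundary term of [bpoly_ode], the other one
    gives summability. *)
Lemma bcoef_geometric_bound (s : C) (rho : R) : 1 <= Re s -> 0 <= rho < 1 -> exists K, 0 <= K /\
  forall l, Cmod (bcoef s l) * rho ^ l * INR l <= K * Rpower (INR l + 1) (- (2)) /\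
            Cmod (bcoef s l) * rho ^ l <= K * Rpower (INR l + 1) (- (2)).
Proof.
  intros Hs Hr. destruct (bcoef_bound s Hs) as [B [HB0 HB]].
  destruct (pow_exp_bound rho Hr) as [c [Hc Hp]].
  destruct (exp_beats_power (Re s) c Hc) as [K [HK0 HK]].
  exists (B * (K * exp c))%R. split; [generalize (exp_pos c); intros; apply Rmult_le_pos; nra|]. intros l.
  assert (Hl : 0 <= INR l) by apply pos_INR.
  assert (HX : 1 <= INR l + 1) by lra.
  assert (P : Cmod (bcoef s l) * rho ^ l * (INR l + 1) <= B * (K * exp c) * Rpower (INR l + 1) (- (2))).
  { apply Rle_trans with (B * Rpower (INR l + 1) (Re s - 1) * exp (- c * INR l) * (INR l + 1))%R.
    - apply Rmult_le_compat_r; [lra|]. apply Rmult_le_compat; auto using Cmod_ge_0. apply pow_le; lra.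
    - assert (E1 : Rpower (INR l + 1) (Re s) = (Rpower (INR l + 1) (Re s - 1) * (INR l + 1))%R).
      { rewrite <- (Rpower_1 (INR l + 1)) at 3 by lra. rewrite <- Rpower_plus. f_equal. ring. }
      assert (E2 : exp (- c * INR l) = (exp c * exp (- c * (INR l + 1)))%R) by (rewrite <- exp_plus; f_equal; ring).
      replace (B * Rpower (INR l + 1) (Re s - 1) * exp (- c * INR l) * (INR l + 1))%R with
        (B * exp c * (Rpower (INR l + 1) (Re s) * exp (- c * (INR l + 1))))%R by (rewrite E1, E2; ring).
      specialize (HK _ HX). generalize (exp_pos c). intros.
      replace (B * (K * exp c) * Rpower (INR l + 1) (- (2)))%R with (B * exp c * (K * Rpower (INR l + 1) (- (2))))%R by ring.
      apply Rmult_le_compat_l; auto. nra. }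
  assert (Q : 0 <= Cmod (bcoef s l) * rho ^ l) by (apply Rmult_le_pos; [apply Cmod_ge_0|apply pow_le; lra]).
  split; nra.
Qed.

Lemma bcoef_S (s : C) (l : nat) : INR (S l) * bcoef s (S l) = (s + INR l) * bcoef s l.
Proof.
  unfold bcoef. rewrite fact_simpl, mult_INR, RtoC_mult. simpl rising.
  assert (RtoC (INR (fact l)) <> 0) by apply RtoC_neq_0, INR_fact_neq_0.
  assert (RtoC (INR (S l)) <> 0) by (intros E; apply RtoC_inj in E; now apply (not_0_INR (S l)) in E).
  field. auto.
Qed.

Lemma pder_pow (y : C) (l : nat) (t : R) : pder (fun t => (t * y) ^ l) t (INR l * y * (t * y) ^ pred l).
Proof.
  induction l as [|l IH].
  - simpl. apply (pder_eq _ _ 0); [ring|]. apply pder_const.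
  - apply (pder_eq _ _ (y * (t * y) ^ l + (t * y) * (INR l * y * (t * y) ^ pred l))).
    + rewrite S_INR, RtoC_plus. simpl pred. destruct l; simpl; ring.
    + apply (pder_mult (fun t => t * y) (fun t => (t * y) ^ l)); auto.
      apply (pder_ext (fun t => 0 + t * y)). intros; ring. apply pder_affine.
Qed.

Definition bpoly (s x : C) (N : nat) : C := finite_sum (fun l => bcoef s l * x ^ l) (seq 0 N).

Definition bpoly' (s x : C) (N : nat) : C := finite_sum (fun l => bcoef s l * (INR l * x ^ pred l)) (seq 0 N).

(** By [bcoef_S] the partial sums satisfy the differential equation [(1 - x) p' = s p] of
    [(1 - x) ^ (- s)] up to one boundary term. *)
Lemma bpoly_ode (s x : C) (N : nat) : (1 - x) * bpoly' s x N = s * bpoly s x N - INR N * bcoef s N * x ^ pred N.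
Proof.
  induction N as [|N IH].
  - unfold bpoly, bpoly', finite_sum; simpl. ring.
  - unfold bpoly, bpoly' in *. rewrite !finite_sum_seq_S.
    rewrite Cmult_plus_distr_l, IH, bcoef_S. destruct N as [|N]; simpl pred; [simpl; ring|].
    change (x ^ S N) with (x * x ^ N). ring.
Qed.

Lemma pder_bpoly (s y : C) (N : nat) (t : R) : pder (fun t => bpoly s (t * y) N) t (y * bpoly' s (t * y) N).
Proof.
  induction N as [|N IH].
  - apply (pder_eq _ _ 0); [unfold bpoly', finite_sum; simpl; ring|]. apply (pder_const 0).
  - unfold bpoly, bpoly' in *. rewrite finite_sum_seq_S.
    apply (pder_ext (fun t => finite_sum (fun l => bcoef s l * (t * y) ^ l) (seq 0 N) + bcoef s N * (t * y) ^ N)).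
    { intros u. now rewrite finite_sum_seq_S. }
    rewrite Cmult_plus_distr_l. apply pder_plus; auto.
    apply (pder_eq _ _ (bcoef s N * (INR N * y * (t * y) ^ pred N))); [ring|]. apply pder_scal, pder_pow.
Qed.

Lemma Re_one_minus (y : C) : Cmod y < 1 -> 0 < Re (1 - y).
Proof. intros H. generalize (Re_le_Cmod' y). destruct y. unfold Re; simpl. lra. Qed.

(** Multiply the partial sum by [(1 - t y) ^ s] and differentiate along the segment: by [bpoly_ode]
    only the boundary term survives. It is geometrically small, so the product at [t = 1] tends to
    its value 1 at [t = 0]. *)
Lemma binomial_series (s y : C) : 1 <= Re s -> Cmod y < 1 ->
  abs_summable (fun l => bcoef s l * y ^ l) /\ usum (fun l => bcoef s l * y ^ l) = pw (1 - y) (- s).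
Proof.
  intros Hs Hy. destruct (bcoef_geometric_bound s (Cmod y) Hs) as [K [HK0 HK]]. { split; [apply Cmod_ge_0|auto]. }
  assert (A : abs_summable (fun l => bcoef s l * y ^ l)).
  { apply (summ_le (fun l => Cmod (bcoef s l * y ^ l)) (fun k : nat => Rpower (INR k + 1) (- (2))) K); auto.
    - intros l. rewrite Cmod_mult, Cmod_pow. apply HK.
    - apply summ_p_series. lra. }
  split; auto.
  set (G := fun N => bpoly s y N * pw (1 - y) s).
  assert (HG : Clim G 1).
  { set (d := (1 - Cmod y)%R). assert (Hd : 0 < d) by (unfold d; lra).
    set (E := (Rpower 2 (Re s) * exp (2 * Rabs (Im s)) / d)%R).
    assert (HE : 0 <= E). { unfold E. apply Rdiv_le_0_compat; auto. left; apply Rmult_lt_0_compat. apply Rpower_pos. apply exp_pos. }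
    (* The value at [t = 0] is 1 except for the empty partial sum; [d] bounds [1 - t y] away from
       0. *)
    assert (B : forall N, Cmod (G N - (match N with O => 0 | _ => 1 end)) <= E * (Cmod (bcoef s N) * Cmod y ^ N * INR N)).
    { intros N.
      assert (M := mean_value_ineq_const (fun t => bpoly s (t * y) N * pw (1 + t * (- y)) s)
         (fun t => - (y / (1 + t * (- y)) * (INR N * bcoef s N * (t * y) ^ pred N) * pw (1 + t * (- y)) s))
         (E * (Cmod (bcoef s N) * Cmod y ^ N * INR N)) 0 1 ltac:(lra)).
      cbv beta in M. replace (1%R * y) with y in M by ring. replace (1 + 1%R * - y) with (1 - y) in M by ring.
      replace (0%R * y) with (RtoC 0) in M by ring. replace (1 + 0%R * - y) with (RtoC 1) in M by ring.
      replace (pw 1 s) with (RtoC 1) in M by (unfold pw; rewrite Clog_RtoC, ln_1 by lra; now rewrite Cmult_0_r, Cexp_0).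
      replace (bpoly s 0 N) with (match N with O => RtoC 0 | _ => RtoC 1 end) in M.
      2:{ destruct N as [|N]; [reflexivity|]. unfold bpoly. change (seq 0 (S N)) with (0%nat :: seq 1 N).
          rewrite finite_sum_cons, (finite_sum_zero _ (seq 1 N)). unfold bcoef; simpl. field.
          intros l Hl. apply in_seq in Hl. destruct l; [lia|]. simpl. ring. }
      rewrite Rminus_0_r, Rmult_1_r in M. unfold G. replace (match N with O => RtoC 0 | _ => RtoC 1 end) with
        ((match N with O => RtoC 0 | _ => RtoC 1 end) * 1) by ring.
      assert (Pos : forall t, 0 <= t <= 1 -> 0 < Re (1 + t * - y) /\ d <= Cmod (1 + t * - y) <= 2).
      { intros t Ht. assert (C1 : Cmod (t * - y) <= Cmod y). { rewrite Cmod_mult, Cmod_opp, Cmod_R, Rabs_pos_eq by lra. generalize (Cmod_ge_0 y). nra. }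
        split; [|split].
        - replace (1 + t * - y) with (1 - (- (t * - y))) by ring. apply Re_one_minus. rewrite Cmod_opp. lra.
        - generalize (Cmod_triangle_minus (1 + t * - y) (t * - y)). replace (1 + t * - y - t * - y) with (RtoC 1) by ring.
          rewrite Cmod_1. unfold d. lra.
        - generalize (Cmod_triangle 1 (t * - y)). rewrite Cmod_1. lra. }
      apply M.
      - intros t Ht. destruct (Pos t Ht) as [P1 P2].
        apply (pder_eq _ _ ((y * bpoly' s (t * y) N) * pw (1 + t * - y) s + bpoly s (t * y) N * (s * (- y / (1 + t * - y)) * pw (1 + t * - y) s))).
        + assert (NZ : 1 + t * - y <> 0) by now apply Re_pos_neq_0.
          assert (O := bpoly_ode s (t * y) N). replace (1 - t * y) with (1 + t * - y) in O by ring.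
          replace (bpoly' s (t * y) N) with ((s * bpoly s (t * y) N - INR N * bcoef s N * (t * y) ^ pred N) / (1 + t * - y)).
          field. auto. rewrite <- O. field. auto.
        + apply pder_mult. apply pder_bpoly. unfold pw. apply pder_comp_Cexp. apply pder_scal. now apply pder_Clog.
      - intros t Ht. destruct (Pos t Ht) as [P1 P2]. rewrite Cmod_opp, !Cmod_mult, Cmod_div by now apply Re_pos_neq_0.
        rewrite Cmod_R, (Rabs_pos_eq (INR N)) by apply pos_INR. rewrite Cmod_pow.
        assert (C1 : Cmod (t * y) <= Cmod y). { rewrite Cmod_mult, Cmod_R, Rabs_pos_eq by lra. generalize (Cmod_ge_0 y). nra. }
        assert (C2 : Cmod (t * y) ^ pred N <= Cmod y ^ pred N) by (apply pow_incr; split; auto using Cmod_ge_0).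
        assert (C3 : Cmod (pw (1 + t * - y) s) <= Rpower 2 (Re s) * exp (2 * Rabs (Im s))).
        { eapply Rle_trans; [apply Cmod_pw_le|]. apply Rmult_le_compat_r; [left; apply exp_pos|]. apply Rpower_mono; lra. }
        assert (C4 : Cmod y / Cmod (1 + t * - y) <= Cmod y / d).
        { unfold Rdiv. apply Rmult_le_compat_l; [apply Cmod_ge_0|]. apply Rinv_le_contravar; lra. }
        assert (0 <= Cmod y / Cmod (1 + t * - y)) by (apply Rdiv_le_0_compat; [apply Cmod_ge_0|lra]).
        apply Rle_trans with (Cmod y / d * (INR N * Cmod (bcoef s N) * Cmod y ^ pred N) * (Rpower 2 (Re s) * exp (2 * Rabs (Im s))))%R.
        + assert (0 <= INR N * Cmod (bcoef s N) * Cmod (t * y) ^ pred N).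
          { apply Rmult_le_pos. apply Rmult_le_pos. apply pos_INR. apply Cmod_ge_0. apply pow_le, Cmod_ge_0. }
          apply Rmult_le_compat; auto using Cmod_ge_0.
          * apply Rmult_le_pos; auto.
          * apply Rmult_le_compat; auto. apply Rmult_le_compat_l; auto. apply Rmult_le_pos. apply pos_INR. apply Cmod_ge_0.
        + right. destruct N as [|N]; [simpl; ring|]. unfold E. simpl pred. simpl pow. field. lra. }
    intros eps He.
    destruct (inverse_small (E * K) eps He) as [N HN]. exists (S N). intros n Hn.
    assert (Hp : 0 < INR n) by (apply lt_0_INR; lia).
    specialize (B n). destruct n as [|n]; [lia|]. eapply Rle_trans; [apply B|].
    apply Rle_trans with (E * (K * Rpower (INR (S n) + 1) (- (2))))%R. apply Rmult_le_compat_l; auto. apply HK.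
    assert (Rpower (INR (S n) + 1) (- (2)) <= / INR (S n)).
    { apply Rle_trans with (Rpower (INR (S n) + 1) (- (1))). unfold Rpower. apply exp_le.
      assert (0 <= ln (INR (S n) + 1)) by (rewrite <- ln_1; apply ln_le'; lra). nra.
      rewrite Rpower_Ropp, Rpower_1 by lra. apply Rinv_le_contravar; lra. }
    apply Rle_trans with (E * K * / INR (S n))%R; [|apply HN; lia].
    rewrite <- Rmult_assoc. apply Rmult_le_compat_l; nra. }
  assert (HG2 : Clim G (usum (fun l => bcoef s l * y ^ l) * pw (1 - y) s)).
  { apply Clim_mult; [|apply Clim_const]. apply (usum_partial_sums (fun l => bcoef s l * y ^ l) A). }
  assert (U := Clim_unique _ _ _ HG HG2). rewrite pw_opp.
  transitivity (usum (fun l => bcoef s l * y ^ l) * pw (1 - y) s * / pw (1 - y) s).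
  - field. apply pw_neq_0.
  - rewrite <- U. field. apply pw_neq_0.
Qed.

(** * Lipschitz's summation formula *)

Arguments e x%_C.

Lemma e_plus (a b : C) : e (a + b) = e a * e b.
Proof. unfold e. rewrite <- Cexp_plus. f_equal. ring. Qed.

Lemma e_0 : e 0 = 1.
Proof. unfold e. rewrite Cmult_0_r. apply Cexp_0. Qed.

Lemma e_opp (a : C) : e (- a) = / e a.
Proof. unfold e. rewrite <- Cexp_opp. f_equal. ring. Qed.

Lemma Cmod_e (z : C) : Cmod (e z) = exp (- (2 * PI * Im z)).
Proof.
  unfold e. rewrite Cmod_Cexp. f_equal. destruct z. unfold Re, Im, Cmult, RtoC, Ci; simpl. ring.
Qed.

Lemma Cmod_e_R (x : R) : Cmod (e x) = 1%R.
Proof. rewrite Cmod_e. unfold Im; simpl. rewrite Rmult_0_r, Ropp_0. apply exp_0. Qed.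

Lemma e_pow (a : C) (n : nat) : e a ^ n = e (INR n * a).
Proof. unfold e. rewrite <- Cexp_pow. f_equal. ring. Qed.

Lemma e_nat (n : nat) : e (INR n) = 1.
Proof.
  replace (RtoC (INR n)) with (INR n * 1) by ring. rewrite <- e_pow.
  replace (e 1) with (RtoC 1). apply Cpow_1_l. unfold e. rewrite Cmult_1_r. symmetry. apply Cexp_2PI.
Qed.

Lemma e_Z (n : Z) : e (IZR n) = 1.
Proof.
  destruct (Z_le_dec 0 n) as [H|H].
  - replace (IZR n) with (INR (Z.to_nat n)). apply e_nat. rewrite INR_IZR_INZ. f_equal. lia.
  - replace (RtoC (IZR n)) with (- RtoC (INR (Z.to_nat (- n)))).
    + rewrite e_opp, e_nat. field.
    + rewrite INR_IZR_INZ, Z2Nat.id, opp_IZR, RtoC_opp by lia. ring.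
Qed.

Lemma e_root_neq_1 (r N : R) : 0 < r < N -> e (r / N)%R <> 1.
Proof.
  intros H E. unfold e in E.
  replace (2 * PI * Ci * RtoC (r / N)) with ((0%R, (2 * PI * (r / N))%R) : C) in E
    by (unfold Cmult, RtoC, Ci; simpl; f_equal; ring).
  unfold Cexp, RtoC, Cmult, Re, Im in E; cbn [fst snd] in E. rewrite exp_0 in E. assert (E1 := f_equal fst E). assert (E2 := f_equal snd E). cbn [fst snd] in E1, E2.
  assert (HPI := PI_RGT_0).
  assert (0 < r / N < 1).
  { split. apply Rdiv_lt_0_compat; lra. apply Rmult_lt_reg_r with N; [lra|]. unfold Rdiv. rewrite Rmult_assoc, Rinv_l; lra. }
  set (q := (r / N)%R) in *.
  assert (0 < PI * q) by (apply Rmult_lt_0_compat; lra).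
  assert (PI * q < PI * 1) by (apply Rmult_lt_compat_l; lra).
  destruct (sin_eq_O_2PI_0 (2 * PI * q)) as [K|[K|K]]; try lra.
  rewrite K, cos_PI in E1. lra.
Qed.

Lemma e_geometric (z : C) (N : nat) (x0 : C) :
  (z = 1 -> finite_sum (fun i => x0 * z ^ i) (seq 0 N) = x0 * INR N) /\
  (z <> 1 -> z ^ N = 1 -> finite_sum (fun i => x0 * z ^ i) (seq 0 N) = 0).
Proof.
  split.
  - intros ->. induction N as [|N IH]; [unfold finite_sum; simpl; ring|].
    rewrite finite_sum_seq_S, IH, S_INR, RtoC_plus, Cpow_1_l. ring.
  - intros Hz HN.
    assert (E : forall N, (z - 1) * finite_sum (fun i => x0 * z ^ i) (seq 0 N) = x0 * (z ^ N - 1)).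
    { induction N0 as [|M IH]; [unfold finite_sum; simpl; ring|].
      rewrite finite_sum_seq_S, Cmult_plus_distr_l, IH. simpl. ring. }
    specialize (E N). rewrite HN in E.
    assert (NZ : z - 1 <> 0). { intros K. apply Hz. replace z with (z - 1 + 1) by ring. rewrite K. ring. }
    replace (finite_sum (fun i => x0 * z ^ i) (seq 0 N)) with (/ (z - 1) * ((z - 1) * finite_sum (fun i => x0 * z ^ i) (seq 0 N))).
    + rewrite E. ring.
    + field. auto.
Qed.

(** A full period of roots of unity. The start [j0] is left free because the window of summation
    will be centred at [- Re w]. *)
Lemma dft_orthogonality (j0 d : Z) (N : nat) : (1 <= N)%nat ->
  finite_sum (fun i => e (IZR (j0 + Z.of_nat i) * IZR d / INR N)) (seq 0 N) =
  if Z.eq_dec (d mod Z.of_nat N) 0 then INR N else 0.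
Proof.
  intros HN. assert (Hp : 0 < INR N) by (apply lt_0_INR; lia).
  assert (NZ : RtoC (INR N) <> 0) by (apply RtoC_neq_0; lra).
  assert (NZ' : (Z.of_nat N <> 0)%Z) by lia.
  set (x0 := e (IZR j0 * IZR d / INR N)). set (z := e (IZR d / INR N)).
  rewrite (finite_sum_ext _ (fun i => x0 * z ^ i)).
  2:{ intros i _. unfold x0, z. rewrite e_pow, <- e_plus. f_equal. rewrite plus_IZR, RtoC_plus, <- INR_IZR_INZ. field. auto. }
  destruct (e_geometric z N x0) as [G1 G2].
  assert (Hd := Z.div_mod d (Z.of_nat N) NZ'). assert (Hm := Z.mod_pos_bound d (Z.of_nat N) ltac:(lia)).
  assert (Ez : z = e (IZR (d mod Z.of_nat N) / INR N)%R).
  { unfold z. rewrite Hd at 1. rewrite plus_IZR, mult_IZR, <- INR_IZR_INZ, RtoC_plus, RtoC_mult, RtoC_div by lra.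
    replace ((INR N * IZR (d / Z.of_nat N) + IZR (d mod Z.of_nat N)) / INR N) with
      (IZR (d / Z.of_nat N) + IZR (d mod Z.of_nat N) / INR N) by (field; auto).
    rewrite e_plus, e_Z. ring. }
  destruct (Z.eq_dec (d mod Z.of_nat N) 0) as [Hz|Hz].
  - rewrite G1.
    + replace x0 with (RtoC 1); [ring|]. unfold x0. rewrite Hd, Hz, Z.add_0_r, mult_IZR, <- INR_IZR_INZ, RtoC_mult.
      replace (IZR j0 * (INR N * IZR (d / Z.of_nat N)) / INR N) with (RtoC (IZR (j0 * (d / Z.of_nat N)))).
      now rewrite e_Z. rewrite mult_IZR, RtoC_mult. field. auto.
    + rewrite Ez, Hz. unfold Rdiv. rewrite Rmult_0_l. apply e_0.
  - apply G2.
    + rewrite Ez. apply e_root_neq_1. rewrite INR_IZR_INZ. split; apply IZR_lt; lia.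
    + unfold z. rewrite e_pow. replace (INR N * (IZR d / INR N)) with (RtoC (IZR d)) by (field; auto). apply e_Z.
Qed.

Lemma usum_finite_sum {A B : Type} (f : A -> B -> C) (l : list A) : (forall a, abs_summable (f a)) ->
  abs_summable (fun b => finite_sum (fun a => f a b) l) /\
  finite_sum (fun a => usum (f a)) l = usum (fun b => finite_sum (fun a => f a b) l).
Proof.
  intros H. induction l as [|a l [IH1 IH2]].
  - unfold finite_sum; simpl. split; [|symmetry; now apply usum_zero].
    exists 0%R. intros l _. induction l as [|b l IHl]; simpl; rewrite ?Cmod_0 in *; lra.
  - split.
    + apply (abs_summable_ext (fun b => f a b + finite_sum (fun a => f a b) l)); [reflexivity|]. now apply abs_summable_plus.
    + rewrite finite_sum_cons, IH2, <- usum_plus by auto. apply usum_ext. reflexivity.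
Qed.

Lemma is_usum_finite_support {T : Type} (f : T -> C) (l : list T) : NoDup l -> (forall t, ~ In t l -> f t = 0) ->
  is_usum f (finite_sum f l).
Proof.
  intros Nl Z. apply is_usum_iff. intros eps He. exists l. intros k Nk I.
  destruct (NoDup_split l k Nl Nk I) as [r [_ [Dr P]]]. rewrite (finite_sum_perm _ _ _ P), finite_sum_app.
  rewrite (finite_sum_zero f r) by auto.
  replace (finite_sum f l + 0 - finite_sum f l) with (RtoC 0) by ring. rewrite Cmod_0. lra.
Qed.

(* The binomial series at the points [e ((j + w) / N)]; summing over [j] against a character
   leaves the exponents congruent to [l0] modulo [N]. *)
Lemma finite_lipschitz (s w : C) (N l0 : nat) (j0 : Z) : 1 <= Re s -> 0 < Im w -> (l0 < N)%nat ->
  finite_sum (fun i => e (- (IZR (j0 + Z.of_nat i) * INR l0 / INR N)) *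
      pw (INR N * (1 - e ((IZR (j0 + Z.of_nat i) + w) / INR N))) (- s)) (seq 0 N) =
  usum (fun k : nat => Rcpow (INR N) (1 - s) * bcoef s (l0 + k * N) * e (INR (l0 + k * N) * w / INR N)).
Proof.
  intros Hs Hw Hl. assert (Hp : 0 < INR N) by (apply lt_0_INR; lia).
  assert (NZ : RtoC (INR N) <> 0) by (apply RtoC_neq_0; lra).
  set (y := fun i : nat => e ((IZR (j0 + Z.of_nat i) + w) / INR N)).
  assert (Hy : forall i, Cmod (y i) < 1).
  { intros i. unfold y. rewrite Cmod_e. rewrite <- exp_0. apply exp_increasing.
    assert (0 < Im ((IZR (j0 + Z.of_nat i) + w) / INR N)).
    { replace (Im ((IZR (j0 + Z.of_nat i) + w) / INR N)) with (Im w / INR N)%R. now apply Rdiv_lt_0_compat.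
      destruct w. unfold Im, Cdiv, Cinv, Cmult, Cplus, RtoC; simpl. field. lra. }
    assert (H2 := PI_RGT_0). nra. }
  assert (A : forall i, abs_summable (fun l => e (- (IZR (j0 + Z.of_nat i) * INR l0 / INR N)) * (bcoef s l * y i ^ l))).
  { intros i. apply abs_summable_scal. now apply binomial_series. }
  transitivity (Rcpow (INR N) (- s) * finite_sum (fun i => usum (fun l => e (- (IZR (j0 + Z.of_nat i) * INR l0 / INR N)) * (bcoef s l * y i ^ l))) (seq 0 N)).
  { rewrite <- finite_sum_scal. apply finite_sum_ext. intros i _. fold (y i).
    rewrite usum_scal by now apply binomial_series. rewrite (proj2 (binomial_series s (y i) Hs (Hy i))).
    rewrite pw_scale by auto using Re_one_minus. ring. }
  destruct (usum_finite_sum (fun i l => e (- (IZR (j0 + Z.of_nat i) * INR l0 / INR N)) * (bcoef s l * y i ^ l)) (seq 0 N) A) as [A2 ->].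
  assert (E : forall l, finite_sum (fun i => e (- (IZR (j0 + Z.of_nat i) * INR l0 / INR N)) * (bcoef s l * y i ^ l)) (seq 0 N) =
    bcoef s l * e (INR l * w / INR N) * (if Z.eq_dec ((Z.of_nat l - Z.of_nat l0) mod Z.of_nat N) 0 then INR N else 0)).
  { intros l. rewrite <- (dft_orthogonality j0) by lia. rewrite <- finite_sum_scal. apply finite_sum_ext. intros i _.
    unfold y. rewrite e_pow. 
    transitivity (bcoef s l * (e (- (IZR (j0 + Z.of_nat i) * INR l0 / INR N)) * e (INR l * ((IZR (j0 + Z.of_nat i) + w) / INR N)))); [ring|].
    rewrite <- Cmult_assoc, <- !e_plus. do 2 f_equal. rewrite minus_IZR, RtoC_minus, <- !INR_IZR_INZ. field. auto. }
  rewrite <- usum_scal by auto.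
  rewrite (usum_reindex (fun k => l0 + k * N)%nat).
  - apply usum_ext. intros k. rewrite E.
    replace (Z.of_nat (l0 + k * N) - Z.of_nat l0)%Z with (Z.of_nat k * Z.of_nat N)%Z by lia.
    rewrite Z.mod_mul by lia. simpl. unfold Cminus. rewrite Rcpow_plus, Rcpow_1_r by auto. ring.
  - intros k k' K. assert ((k - k') * N = 0)%nat by nia. assert ((k' - k) * N = 0)%nat by nia. nia.
  - intros l Hn. rewrite E in Hn. destruct (Z.eq_dec _ 0) as [K|K]; [|exfalso; apply Hn; ring].
    apply Z.mod_divide in K; [|lia]. destruct K as [k Hk]. 
    assert (0 <= k)%Z by nia. exists (Z.to_nat k). nia.
  - apply (abs_summable_comp_inj (fun k => l0 + k * N)%nat (fun l => Rcpow (INR N) (- s) *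
      finite_sum (fun i => e (- (IZR (j0 + Z.of_nat i) * INR l0 / INR N)) * (bcoef s l * y i ^ l)) (seq 0 N))).
    + intros k k' K. assert ((k - k') * N = 0)%nat by nia. assert ((k' - k) * N = 0)%nat by nia. nia.
    + now apply abs_summable_scal.
Qed.

(** The slope 1/4 is crude but elementary: beyond [PI / 6] the sine is at least 1/2 while [x <= 2],
    and before it the cosine is at least 1/2. *)
Lemma sin_lower (x : R) : 0 <= x <= PI / 2 -> x / 4 <= sin x.
Proof.
  intros H. assert (H4 := PI_4). assert (H0 := PI_RGT_0).
  destruct (Rle_dec (PI / 6) x) as [K|K].
  - apply Rle_trans with (sin (PI / 6)). rewrite sin_PI6. lra. apply sin_incr_1; lra.
  - destruct (MVT_gen sin 0 x cos) as [c [Hc E]].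
    + intros y _. apply is_derive_sin.
    + intros y _. apply continuity_sin.
    + rewrite Rmin_left, Rmax_right in Hc by lra. rewrite sin_0, !Rminus_0_r in E. rewrite E.
      assert (1 / 2 <= cos c). { rewrite <- cos_PI3. apply cos_decr_1; lra. } nra.
Qed.

Lemma sin_lower_abs (x : R) : Rabs x <= PI / 2 -> Rabs x / 4 <= Rabs (sin x).
Proof.
  intros H. destruct (Rle_dec 0 x) as [K|K].
  - rewrite Rabs_pos_eq in * by auto. eapply Rle_trans; [apply sin_lower; lra|]. apply Rle_abs.
  - rewrite Rabs_left in * by lra. rewrite <- Rabs_Ropp, <- sin_neg. eapply Rle_trans; [apply sin_lower; lra|]. apply Rle_abs.
Qed.

Lemma Cmod_one_minus_cis (phi : R) : Cmod (1 - Cexp (0%R, phi)) = (2 * Rabs (sin (phi / 2)))%R.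
Proof.
  apply Rsqr_inj. apply Cmod_ge_0. generalize (Rabs_pos (sin (phi / 2))); lra.
  rewrite Rsqr_mult. rewrite <- Rsqr_abs. unfold Rsqr. rewrite Cmod_sqr.
  unfold Cexp, Re, Im, RtoC, Cmult, Cminus, Cplus, Copp; cbn [fst snd]. rewrite exp_0.
  assert (S2 := sin2_cos2 (phi / 2)). unfold Rsqr in S2.
  replace phi with (2 * (phi / 2))%R at 1 2 3 4 5 6 7 8 by field. rewrite sin_2a, cos_2a.
  set (a := sin (phi / 2)) in *. set (b := cos (phi / 2)) in *.
  replace (b * b)%R with (1 - a * a)%R by lra.
  replace (2 * a * b)%R with (2 * (a * b))%R by ring.
  transitivity ((2 * (a * a)) * (2 * (a * a)) + 4 * (a * a) * (b * b))%R; [ring|].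
  replace (b * b)%R with (1 - a * a)%R by lra. ring.
Qed.

(** The first bound is radial, from [1 - Cmod (e z)]; the second is angular, from the sine of half
    the angle. The restriction on [Re z] keeps that half angle within a quarter turn. *)
Lemma one_minus_e_lower (z : C) : 0 < Im z -> Rabs (Re z) <= 1 / 2 ->
  2 * PI * Im z / (1 + 2 * PI * Im z) <= Cmod (1 - e z) /\ Rabs (Re z) / 2 <= Cmod (1 - e z).
Proof.
  intros Hv Ha. assert (HPI := PI_RGT_0). assert (HPI2 := PI2_3_2).
  set (x := (2 * PI * Im z)%R). assert (Hx : 0 < x) by (unfold x; nra).
  set (rho := exp (- x)). assert (Hrho : Cmod (e z) = rho) by (apply Cmod_e).
  assert (R1 : x / (1 + x) <= 1 - rho).
  { unfold rho. rewrite exp_Ropp. assert (1 + x < exp x) by (apply exp_ineq1; lra).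
    assert (/ exp x <= / (1 + x)) by (apply Rinv_le_contravar; lra).
    replace (x / (1 + x))%R with (1 - / (1 + x))%R by (field; lra). lra. }
  assert (R2 : 1 - rho <= Cmod (1 - e z)).
  { generalize (Cmod_sub_le 1 (e z)). rewrite Cmod_1, Hrho. lra. }
  split; [lra|].
  set (phi := (2 * PI * Re z)%R).
  assert (Ee : e z = rho * Cexp (0%R, phi)).
  { unfold e. replace (2 * PI * Ci * z) with (RtoC (- x) + ((0%R, phi) : C)).
    - rewrite Cexp_plus, Cexp_R. reflexivity.
    - unfold x, phi. destruct z. unfold Re, Im, RtoC, Cmult, Cplus, Ci; simpl. f_equal; ring. }
  (* Projecting [e z] radially onto the unit circle moves it by [1 - rho], which is itself at most
     [Cmod (1 - e z)]. *)
  assert (K : Cmod (1 - Cexp (0%R, phi)) <= 2 * Cmod (1 - e z)).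
  { replace (1 - Cexp (0%R, phi)) with ((1 - e z) + (rho - 1)%R * Cexp (0%R, phi)).
    - eapply Rle_trans; [apply Cmod_triangle|]. rewrite Cmod_mult, Cmod_R, Cmod_Cexp. unfold Re at 1; simpl. rewrite exp_0.
      assert (0 < x / (1 + x)) by (apply Rdiv_lt_0_compat; lra).
      rewrite Rabs_left by lra. lra.
    - rewrite Ee, RtoC_minus. ring. }
  rewrite Cmod_one_minus_cis in K.
  assert (Hphi : Rabs (phi / 2) = (PI * Rabs (Re z))%R).
  { unfold phi. replace (2 * PI * Re z / 2)%R with (PI * Re z)%R by field. now rewrite Rabs_mult, (Rabs_pos_eq PI) by lra. }
  assert (L := sin_lower_abs (phi / 2)). rewrite Hphi in L.
  assert (PI * Rabs (Re z) <= PI / 2) by nra. specialize (L H). generalize (Rabs_pos (Re z)). nra.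
Qed.

(** A lower bound uniform in [N], as the majorant on the lattice side requires: the radial estimate
    handles bounded [j], the angular one makes the bound grow with [j], and [D] merges the two. *)
Lemma lattice_lower (w : C) : 0 < Im w -> exists c, 0 < c /\ forall (N : nat) (j : Z), (1 <= N)%nat ->
  Rabs (IZR j + Re w) <= INR N / 2 -> c * (Rabs (IZR j) + 1) <= Cmod (INR N * (1 - e ((IZR j + w) / INR N))).
Proof.
  intros Hw. assert (HPI := PI_RGT_0).
  set (c1 := (2 * PI * Im w / (1 + 2 * PI * Im w))%R).
  assert (Hx : 0 < 2 * PI * Im w) by nra.
  assert (Hc1 : 0 < c1) by (apply Rdiv_lt_0_compat; lra).
  set (D := ((1 + Rabs (Re w)) / c1 + 2)%R).
  assert (HD : 0 < D). { unfold D. assert (0 <= (1 + Rabs (Re w)) / c1) by (apply Rdiv_le_0_compat; auto; generalize (Rabs_pos (Re w)); lra). lra. }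
  exists (/ D)%R. split; [now apply Rinv_0_lt_compat|]. intros N j HN Hj.
  assert (Hp : 1 <= INR N) by (apply (le_INR 1); auto).
  set (z := (IZR j + w) / INR N).
  assert (Ez1 : Im z = (Im w / INR N)%R) by (unfold z; destruct w; unfold Im, Cdiv, Cinv, Cmult, Cplus, RtoC; simpl; field; lra).
  assert (Ez2 : Re z = ((IZR j + Re w) / INR N)%R) by (unfold z; destruct w; unfold Re, Cdiv, Cinv, Cmult, Cplus, RtoC; simpl; field; lra).
  destruct (one_minus_e_lower z) as [L1 L2].
  - rewrite Ez1. apply Rdiv_lt_0_compat; lra.
  - rewrite Ez2. unfold Rdiv. rewrite Rabs_mult, Rabs_inv, (Rabs_pos_eq (INR N)) by lra.
    apply Rmult_le_reg_r with (INR N); [lra|]. rewrite Rmult_assoc, Rinv_l by lra. lra.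
  - rewrite Cmod_mult, Cmod_R, (Rabs_pos_eq (INR N)) by lra.
    set (X := (INR N * Cmod (1 - e z))%R).
    assert (X1 : c1 <= X).
    { unfold X. apply Rle_trans with (INR N * (2 * PI * Im z / (1 + 2 * PI * Im z)))%R; [|apply Rmult_le_compat_l; lra].
      rewrite Ez1. unfold c1. replace (INR N * (2 * PI * (Im w / INR N) / (1 + 2 * PI * (Im w / INR N))))%R with
        (2 * PI * Im w / (1 + 2 * PI * Im w / INR N))%R.
      - unfold Rdiv. apply Rmult_le_compat_l; [lra|]. apply Rinv_le_contravar.
        + assert (0 < 2 * PI * Im w * / INR N) by (apply Rmult_lt_0_compat; auto; apply Rinv_0_lt_compat; lra). lra.
        + assert (/ INR N <= 1) by (rewrite <- Rinv_1; apply Rinv_le_contravar; lra). nra.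
      - field. split; [|lra]. nra. }
    assert (X2 : Rabs (IZR j + Re w) / 2 <= X).
    { unfold X. rewrite Ez2 in L2. unfold Rdiv in L2. rewrite Rabs_mult, Rabs_inv, (Rabs_pos_eq (INR N)) in L2 by lra.
      apply Rle_trans with (INR N * (Rabs (IZR j + Re w) * / INR N * / 2))%R; [right; field; lra|apply Rmult_le_compat_l; lra]. }
    assert (X3 : Rabs (IZR j) + 1 <= D * X).
    { assert (Rabs (IZR j) <= Rabs (IZR j + Re w) + Rabs (Re w)).
      { replace (IZR j) with ((IZR j + Re w) + - Re w)%R at 1 by ring. eapply Rle_trans; [apply Rabs_triang|]. rewrite Rabs_Ropp. lra. }
      unfold D. assert (1 + Rabs (Re w) <= (1 + Rabs (Re w)) / c1 * X); [|lra].
      apply Rle_trans with ((1 + Rabs (Re w)) / c1 * c1)%R; [right; field; lra|].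
      apply Rmult_le_compat_l; auto. apply Rdiv_le_0_compat; auto. generalize (Rabs_pos (Re w)); lra. }
    apply Rmult_le_reg_l with D; auto. rewrite <- Rmult_assoc, Rinv_r, Rmult_1_l by lra. exact X3.
Qed.

(** * The limit of the finite formula *)

Lemma Clim_bound (u : nat -> C) (l : C) (K : R) : (forall n, Cmod (u n - l) <= K / INR (S n)) -> Clim u l.
Proof.
  intros H eps He. destruct (inverse_small K eps He) as [N HN]. exists N. intros n Hn.
  eapply Rle_trans; [apply H|auto].
Qed.

Lemma Clim_RtoC (u : nat -> R) (l : R) (K : R) : (forall n, Rabs (u n - l) <= K / INR (S n)) -> Clim (fun n => RtoC (u n)) (RtoC l).
Proof. intros H. apply (Clim_bound _ _ K). intros n. rewrite <- RtoC_minus, Cmod_R. apply H. Qed.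

Lemma Clim_one_minus_e (a : C) : Clim (fun n => INR (S n) * (1 - e (a / INR (S n)))) (- (2 * PI * Ci * a)).
Proof.
  set (b := 2 * PI * Ci * a).
  apply (Clim_bound _ _ (Cmod b * Cmod b * exp (Cmod b))). intros n.
  assert (HSN : 1 <= INR (S n)) by (apply (le_INR 1); lia).
  assert (NZ : RtoC (INR (S n)) <> 0) by (apply RtoC_neq_0; lra).
  unfold e. replace (2 * PI * Ci * (a / INR (S n))) with (b / INR (S n)) by (unfold b; field; auto).
  set (h := b / INR (S n)).
  assert (Hh : Cmod h = (Cmod b / INR (S n))%R) by (unfold h; rewrite Cmod_div, Cmod_R, Rabs_pos_eq; auto; lra).
  replace (INR (S n) * (1 - Cexp h) - - b) with (- (INR (S n) * (Cexp h - 1 - h))) by (unfold h; field; auto).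
  rewrite Cmod_opp, Cmod_mult, Cmod_R, Rabs_pos_eq by lra.
  apply Rle_trans with (INR (S n) * (Cmod h * Cmod h * exp (Cmod h)))%R. apply Rmult_le_compat_l; [lra|apply Cexp_bound2].
  assert (Hb := Cmod_ge_0 b).
  assert (exp (Cmod h) <= exp (Cmod b)).
  { apply exp_le. rewrite Hh. apply Rmult_le_reg_r with (INR (S n)); [lra|]. unfold Rdiv. rewrite Rmult_assoc, Rinv_l; nra. }
  replace (Cmod b * Cmod b * exp (Cmod b) / INR (S n))%R with (INR (S n) * (Cmod h * Cmod h * exp (Cmod b)))%R by (rewrite Hh; field; lra).
  apply Rmult_le_compat_l; [lra|]. apply Rmult_le_compat_l; auto. generalize (Cmod_ge_0 h); nra.
Qed.

Lemma Clim_subseq (u : nat -> C) (l : C) (phi : nat -> nat) : (forall M, exists N, forall n, (N <= n)%nat -> (M <= phi n)%nat) ->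
  Clim u l -> Clim (fun n => u (phi n)) l.
Proof.
  intros H Hu eps He. destruct (Hu eps He) as [M HM]. destruct (H M) as [N HN]. exists N. auto.
Qed.

Lemma Clim_Rcpow_zero (s : C) : Re s < 0 -> Clim (fun n => Rcpow (INR (S n)) s) 0.
Proof.
  intros Hs eps He. destruct (INR_archimed 1 (exp (ln eps / Re s))) as [N HN]; [lra|]. exists N. intros n Hn.
  replace (Rcpow (INR (S n)) s - 0) with (Rcpow (INR (S n)) s) by ring. rewrite Cmod_Rcpow.
  assert (HSN : 0 < INR (S n)) by (apply lt_0_INR; lia).
  rewrite <- (exp_ln eps) by auto. unfold Rpower. apply exp_le.
  assert (L : ln eps / Re s <= ln (INR (S n))).
  { rewrite <- (ln_exp (ln eps / Re s)). apply ln_le'. apply exp_pos. rewrite S_INR. apply le_INR in Hn. lra. }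
  replace (ln eps) with (Re s * (ln eps / Re s))%R by (field; lra). nra.
Qed.

Definition lip_left (s w : C) (th : R) (j : Z) : C :=
  e (- (IZR j * th)%R) * pw (- (2 * PI * Ci * (IZR j + w))) (- s).

Definition lip_right (s w : C) (th : R) (k : nat) : C :=
  if Rlt_dec 0 (th + INR k) then Rcpow (th + INR k) (s - 1) * e ((th + INR k)%R * w) else 0.

(** The residue class modulo [N = n + 1] is chosen so that its quotient by [N] tends to [th]; the
    members [residue + k N] divided by [N] then tend to [th + k]. *)
Definition residue (th : R) (n : nat) : nat := Z.to_nat (Int_part (th * INR (S n))).

Lemma residue_spec (th : R) (n : nat) : 0 <= th < 1 ->
  INR (residue th n) <= th * INR (S n) /\ th * INR (S n) - 1 < INR (residue th n) /\ (residue th n < S n)%nat.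
Proof.
  intros H. assert (HS : 0 < INR (S n)) by (apply lt_0_INR; lia).
  destruct (base_Int_part (th * INR (S n))) as [B1 B2].
  assert (0 <= th * INR (S n)) by (apply Rmult_le_pos; lra).
  assert (0 <= Int_part (th * INR (S n)))%Z.
  { assert (-1 < Int_part (th * INR (S n)))%Z; [apply lt_IZR; lra|lia]. }
  assert (E : INR (residue th n) = IZR (Int_part (th * INR (S n)))) by (unfold residue; rewrite INR_IZR_INZ, Z2Nat.id; auto).
  rewrite E. repeat split; try lra. apply INR_lt. rewrite E.
  assert (th * INR (S n) < 1 * INR (S n)) by (apply Rmult_lt_compat_r; lra). lra.
Qed.

(** Any [n + 1] consecutive integers would serve in the finite formula; these satisfy
    [Rabs (j + Re w) <= (n + 1) / 2], the range in which [lattice_lower] holds. *)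
Definition window_start (w : C) (n : nat) : Z := up (- INR (S n) / 2 - Re w).

(** The modulus is [n + 1], so that it is never 0, and terms outside the window are set to 0 in
    order that dominated convergence takes place over all of [Z]. *)
Definition lip_left_n (s w : C) (th : R) (n : nat) (j : Z) : C :=
  if andb (window_start w n <=? j)%Z (j <? window_start w n + Z.of_nat (S n))%Z then
    e (- (IZR j * INR (residue th n) / INR (S n))) * pw (INR (S n) * (1 - e ((IZR j + w) / INR (S n)))) (- s)
  else 0.

Definition lip_right_n (s w : C) (th : R) (n : nat) (k : nat) : C :=
  Rcpow (INR (S n)) (1 - s) * bcoef s (residue th n + k * S n) * e (INR (residue th n + k * S n) * w / INR (S n)).

Lemma window_in (w : C) (n : nat) (j : Z) : (window_start w n <= j < window_start w n + Z.of_nat (S n))%Z ->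
  Rabs (IZR j + Re w) <= INR (S n) / 2.
Proof.
  intros [H1 H2]. destruct (archimed (- INR (S n) / 2 - Re w)) as [A1 A2].
  fold (window_start w n) in A1, A2. assert (H3 : (j <= window_start w n + Z.of_nat n)%Z) by lia.
  apply IZR_le in H1, H3. rewrite plus_IZR, <- INR_IZR_INZ in H3. rewrite S_INR in *. apply Rabs_le. lra.
Qed.

Lemma lip_n_eq (s w : C) (th : R) (n : nat) : 1 < Re s -> 0 < Im w -> 0 <= th < 1 ->
  usum (lip_left_n s w th n) = usum (lip_right_n s w th n).
Proof.
  intros Hs Hw Hth. unfold lip_right_n. rewrite <- (finite_lipschitz s w (S n) (residue th n) (window_start w n)); auto; [|lra|now apply residue_spec].
  set (p := fun i => (window_start w n + Z.of_nat i)%Z).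
  rewrite (usum_eq _ (finite_sum (lip_left_n s w th n) (map p (seq 0 (S n))))).
  - rewrite finite_sum_map. apply finite_sum_ext. intros i Hi. apply in_seq in Hi. unfold lip_left_n, p.
    replace (window_start w n <=? window_start w n + Z.of_nat i)%Z with true by (symmetry; apply Z.leb_le; lia).
    replace (window_start w n + Z.of_nat i <? window_start w n + Z.of_nat (S n))%Z with true by (symmetry; apply Z.ltb_lt; lia).
    reflexivity.
  - apply is_usum_finite_support.
    + apply FinFun.Injective_map_NoDup; [|apply seq_NoDup]. intros i i' E. unfold p in E. lia.
    + intros j Hj. unfold lip_left_n.
      destruct (Z.leb_spec (window_start w n) j); destruct (Z.ltb_spec j (window_start w n + Z.of_nat (S n))); simpl; auto.
      exfalso. apply Hj. apply in_map_iff. exists (Z.to_nat (j - window_start w n)). unfold p. split; [lia|]. apply in_seq. lia.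
Qed.

Lemma Cmod_e_real (x : C) : Im x = 0%R -> Cmod (e x) = 1%R.
Proof. intros H. rewrite Cmod_e, H, Rmult_0_r, Ropp_0. apply exp_0. Qed.

Lemma lip_left_dominated (s w : C) (th : R) : 1 < Re s -> 0 < Im w -> exists K, 0 <= K /\
  forall n j, Cmod (lip_left_n s w th n j) <= K * Rpower (Rabs (IZR j) + 1) (- Re s).
Proof.
  intros Hs Hw. destruct (lattice_lower w Hw) as [c [Hc HL]].
  exists (Rpower c (- Re s) * exp (2 * Rabs (Im s)))%R. split.
  { left; apply Rmult_lt_0_compat. apply Rpower_pos. apply exp_pos. }
  intros n j. unfold lip_left_n.
  destruct (Z.leb_spec (window_start w n) j); destruct (Z.ltb_spec j (window_start w n + Z.of_nat (S n))); simpl andb; cbv iota.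
  2,3,4: rewrite Cmod_0; left; repeat apply Rmult_lt_0_compat; apply Rpower_pos || apply exp_pos.
  assert (Hj := window_in w n j (conj H H0)).
  specialize (HL (S n) j ltac:(lia) Hj).
  rewrite Cmod_mult, Cmod_e_real, Rmult_1_l.
  2:{ assert (INR (S n) <> 0%R) by (apply not_0_INR; lia).
      replace (- (IZR j * INR (residue th n) / INR (S n))) with (RtoC (- (IZR j * INR (residue th n) / INR (S n)))). reflexivity.
      now rewrite RtoC_opp, RtoC_div, RtoC_mult. }
  eapply Rle_trans; [apply Cmod_pw_le|].
  replace (Im (- s)) with (- Im s)%R by (destruct s; reflexivity). rewrite Rabs_Ropp.
  replace (Re (- s)) with (- Re s)%R by (destruct s; reflexivity).
  assert (HP : 0 < Rabs (IZR j) + 1) by (generalize (Rabs_pos (IZR j)); lra).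
  rewrite (Rmult_comm (Rpower c (- Re s))), Rmult_assoc, <- Rpower_mult_base by auto.
  rewrite Rmult_comm. apply Rmult_le_compat_l; [left; apply exp_pos|].
  apply Rpower_anti; try lra. now apply Rmult_lt_0_compat.
Qed.

Lemma Re_rot (j : Z) (w : C) : Re (- (2 * PI * Ci * (IZR j + w))) = (2 * PI * Im w)%R.
Proof. destruct w. unfold Re, Im, Ci, RtoC, Cmult, Cplus, Copp; simpl. ring. Qed.

Lemma lip_left_limit (s w : C) (th : R) (j : Z) : 0 < Im w -> 0 <= th < 1 ->
  Clim (fun n => lip_left_n s w th n j) (lip_left s w th j).
Proof.
  intros Hw Hth.
  apply (Clim_ext (fun n => e (- (IZR j * INR (residue th n) / INR (S n))) * pw (INR (S n) * (1 - e ((IZR j + w) / INR (S n)))) (- s))).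
  - destruct (INR_archimed 1 (2 * (Rabs (IZR j) + Rabs (Re w) + 1))) as [N HN]; [lra|]. exists N. intros n Hn. unfold lip_left_n.
    assert (Hn' : INR N <= INR n) by now apply le_INR.
    destruct (archimed (- INR (S n) / 2 - Re w)) as [A1 A2]. fold (window_start w n) in A1, A2.
    assert (J1 := Rle_abs (IZR j)). assert (J2 := Rle_abs (- IZR j)). rewrite Rabs_Ropp in J2.
    assert (W1 := Rle_abs (Re w)). assert (W2 := Rle_abs (- Re w)). rewrite Rabs_Ropp in W2.
    rewrite S_INR in A1, A2.
    assert (window_start w n <= j)%Z by (apply le_IZR; lra).
    assert (j < window_start w n + Z.of_nat (S n))%Z by (apply lt_IZR; rewrite plus_IZR, <- INR_IZR_INZ, S_INR; lra).
    replace (window_start w n <=? j)%Z with true by (symmetry; now apply Z.leb_le).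
    replace (j <? window_start w n + Z.of_nat (S n))%Z with true by (symmetry; now apply Z.ltb_lt). reflexivity.
  - unfold lip_left. apply Clim_mult.
    + unfold e. apply Clim_Cexp. apply Clim_mult; [apply Clim_const|].
      apply (Clim_ext (fun n => RtoC (- (IZR j * INR (residue th n) / INR (S n))))).
      { exists 0%nat. intros n _. rewrite RtoC_opp, RtoC_div, RtoC_mult; auto. apply not_0_INR; lia. }
      rewrite <- RtoC_opp. apply (Clim_RtoC _ _ (Rabs (IZR j))). intros n.
      destruct (residue_spec th n Hth) as [R1 [R2 _]].
      assert (HS : 0 < INR (S n)) by (apply lt_0_INR; lia).
      replace (- (IZR j * INR (residue th n) / INR (S n)) - - (IZR j * th))%R with (IZR j * ((th * INR (S n) - INR (residue th n)) / INR (S n)))%R by (field; lra).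
      rewrite Rabs_mult. unfold Rdiv at 2. apply Rmult_le_compat_l; [apply Rabs_pos|].
      unfold Rdiv. assert (0 < / INR (S n)) by now apply Rinv_0_lt_compat. rewrite Rabs_pos_eq; [|apply Rmult_le_pos; lra].
      rewrite <- (Rmult_1_l (/ INR (S n))) at 2. apply Rmult_le_compat_r; lra.
    + apply Clim_pw.
      * rewrite Re_rot. assert (H := PI_RGT_0). apply Rmult_lt_0_compat; lra.
      * apply (Clim_one_minus_e (IZR j + w)).
Qed.

(** The exponent [l] is at most [N (k + 1) - 1] and at least [k N]. The first makes the powers of
    [N] cancel against the prefactor, the second gives exponential decay in [k]. *)
Lemma lip_right_dominated (s w : C) (th : R) : 1 < Re s -> 0 < Im w -> 0 <= th < 1 -> exists K, 0 <= K /\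
  forall n k, Cmod (lip_right_n s w th n k) <= K * Rpower (INR k + 1) (- (2)).
Proof.
  intros Hs Hw Hth. assert (HPI := PI_RGT_0). set (v := (2 * PI * Im w)%R).
  assert (Hv : 0 < v) by (unfold v; apply Rmult_lt_0_compat; lra).
  destruct (bcoef_bound s) as [B [HB0 HB]]; [lra|].
  destruct (exp_beats_power (Re s - 1) v Hv) as [K [HK0 HK]].
  exists (B * exp v * K)%R. split. { apply Rmult_le_pos; auto. apply Rmult_le_pos; auto. left; apply exp_pos. }
  intros n k. unfold lip_right_n. set (l := (residue th n + k * S n)%nat).
  assert (HS : 1 <= INR (S n)) by (apply (le_INR 1); lia).
  assert (Hk : 0 <= INR k) by apply pos_INR.
  destruct (residue_spec th n Hth) as [_ [_ R3]].
  assert (L1 : (INR l + 1 <= INR (S n) * (INR k + 1))).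
  { rewrite <- S_INR, Rmult_plus_distr_l, Rmult_1_r, <- mult_INR, <- plus_INR. apply le_INR. unfold l. nia. }
  assert (L2 : INR k * INR (S n) <= INR l) by (rewrite <- mult_INR; apply le_INR; unfold l; lia).
  rewrite !Cmod_mult, Cmod_Rcpow, Cmod_e.
  replace (Re (1 - s)) with (- (Re s - 1))%R by (destruct s; unfold Re; simpl; ring).
  replace (Im (INR l * w / INR (S n))) with (INR l * Im w / INR (S n))%R.
  2:{ destruct w. unfold Im, Cdiv, Cinv, Cmult, RtoC; cbn [fst snd]. field. lra. }
  apply Rle_trans with (Rpower (INR (S n)) (- (Re s - 1)) * (B * Rpower (INR (S n) * (INR k + 1)) (Re s - 1)) * exp (- v * INR k))%R.
  - assert (0 < Rpower (INR (S n)) (- (Re s - 1))) by apply Rpower_pos.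
    apply Rmult_le_compat.
    + apply Rmult_le_pos; [lra|apply Cmod_ge_0].
    + left; apply exp_pos.
    + apply Rmult_le_compat_l; [lra|]. eapply Rle_trans; [apply HB|]. apply Rmult_le_compat_l; auto. apply Rpower_mono; try lra.
      generalize (pos_INR l); lra.
    + apply exp_le. replace (- (2 * PI * (INR l * Im w / INR (S n))))%R with (- v * (INR l / INR (S n)))%R by (unfold v; field; lra).
      assert (INR k <= INR l / INR (S n)). { apply Rmult_le_reg_r with (INR (S n)); [lra|]. unfold Rdiv. rewrite Rmult_assoc, Rinv_l; lra. }
      nra.
  - rewrite Rpower_mult_base by lra.
    replace (exp (- v * INR k)) with (exp v * exp (- v * (INR k + 1)))%R by (rewrite <- exp_plus; f_equal; ring).
    assert (E : (Rpower (INR (S n)) (- (Re s - 1)) * Rpower (INR (S n)) (Re s - 1) = 1)%R).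
    { rewrite <- Rpower_plus. replace (- (Re s - 1) + (Re s - 1))%R with 0%R by ring. apply Rpower_O. lra. }
    assert (H1 : 1 <= INR k + 1) by lra. specialize (HK _ H1).
    set (P := Rpower (INR (S n)) (- (Re s - 1))) in *. set (Q := Rpower (INR (S n)) (Re s - 1)) in *.
    replace (P * (B * (Q * Rpower (INR k + 1) (Re s - 1))) * (exp v * exp (- v * (INR k + 1))))%R with
      ((P * Q) * (B * exp v * (Rpower (INR k + 1) (Re s - 1) * exp (- v * (INR k + 1)))))%R by ring.
    rewrite E, Rmult_1_l, !Rmult_assoc. apply Rmult_le_compat_l; auto. apply Rmult_le_compat_l; auto. left; apply exp_pos.
Qed.

(** With [l / N] tending to [t = th + k], the coefficient [b_l] is [gauss (l - 1) s] times
    [(l - 1) ^ s / l], and the powers of [N] turn the latter into [t ^ (s - 1)]. *)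
Lemma lip_right_limit (s w : C) (th : R) (k : nat) : 1 < Re s -> 0 <= th < 1 ->
  Clim (fun n => lip_right_n s w th n k) (rGamma s * lip_right s w th k).
Proof.
  intros Hs Hth. unfold lip_right. destruct (Rlt_dec 0 (th + INR k)) as [Ht|Ht].
  - set (t := (th + INR k)%R) in *.
    set (l := fun n => (residue th n + k * S n)%nat).
    assert (Hl : forall n, t * INR (S n) - 1 < INR (l n) <= t * INR (S n)).
    { intros n. destruct (residue_spec th n Hth) as [R1 [R2 _]]. unfold l. rewrite plus_INR, mult_INR. unfold t. lra. }
    assert (HS : forall n, 0 < INR (S n)) by (intros; apply lt_0_INR; lia).
    assert (NZ : forall n, RtoC (INR (S n)) <> 0) by (intros n E; apply RtoC_inj in E; generalize (HS n); lra).
    destruct (INR_archimed t 3 Ht) as [N0 HN0].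
    assert (Hbig : forall n, (N0 <= n)%nat -> (2 <= l n)%nat).
    { intros n Hn. apply INR_le. destruct (Hl n) as [A _]. apply le_INR in Hn. rewrite S_INR in A. simpl (INR 2). nra. }
    (* On positive reals [pw] agrees with [Rcpow], and its continuity in the base is already
       available as [Clim_pw]. *)
    apply (Clim_ext (fun n => gauss (pred (l n)) s * (pw (INR (pred (l n)) / INR (S n))%R s * pw (INR (l n) / INR (S n))%R (- (1))) *
        e ((INR (l n) / INR (S n))%R * w))).
    { exists N0. intros n Hn. specialize (Hbig n Hn). unfold lip_right_n. fold (l n).
      assert (P1 : 0 < INR (pred (l n))) by (apply lt_0_INR; lia).
      assert (P2 : 0 < INR (l n)) by (apply lt_0_INR; lia).
      assert (NL : RtoC (INR (l n)) <> 0) by (apply RtoC_neq_0; lra).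
      assert (EL : l n = S (pred (l n))) by lia.
      f_equal.
      2:{ f_equal. rewrite RtoC_div by (apply Rgt_not_eq, HS). field. auto. }
      assert (Pos1 : 0 < INR (pred (l n)) / INR (S n)) by (apply Rdiv_lt_0_compat; auto).
      assert (Pos2 : 0 < INR (l n) / INR (S n)) by (apply Rdiv_lt_0_compat; auto).
      rewrite !pw_RtoC by auto. rewrite (Rcpow_opp _ 1), Rcpow_1_r by auto.
      unfold Rdiv at 1. rewrite Rcpow_mult_base by (auto; now apply Rinv_0_lt_compat).
      replace (Rcpow (/ INR (S n)) s) with (Rcpow (INR (S n)) (- s)).
      2:{ unfold Rcpow. f_equal. rewrite ln_Rinv, RtoC_opp by auto. ring. }
      rewrite EL at 4. rewrite bcoef_gauss by lia.
      unfold Cminus. rewrite Rcpow_plus, Rcpow_1_r by auto.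
      replace (INR (pred (l n)) + 1)%R with (INR (l n)) by (rewrite EL at 1; apply S_INR).
      rewrite RtoC_div by (apply Rgt_not_eq, HS). field. auto. }
    assert (Lim1 : Clim (fun n => RtoC (INR (l n) / INR (S n))) t).
    { apply (Clim_RtoC _ _ 1). intros n. destruct (Hl n) as [A1 A2]. specialize (HS n).
      replace (INR (l n) / INR (S n) - t)%R with (- ((t * INR (S n) - INR (l n)) / INR (S n)))%R by (field; lra).
      rewrite Rabs_Ropp. rewrite Rabs_pos_eq.
      - unfold Rdiv. apply Rmult_le_compat_r; [left; now apply Rinv_0_lt_compat|lra].
      - apply Rdiv_le_0_compat; lra. }
    assert (Lim2 : Clim (fun n => RtoC (INR (pred (l n)) / INR (S n))) t).
    { apply (Clim_ext (fun n => RtoC (INR (l n) / INR (S n)) + RtoC (- / INR (S n)))).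
      - exists N0. intros n Hn. specialize (Hbig n Hn). rewrite <- RtoC_plus. f_equal.
        replace (INR (l n)) with (INR (pred (l n)) + 1)%R by (rewrite <- S_INR; f_equal; lia). field. apply Rgt_not_eq, HS.
      - replace (RtoC t) with (t + 0%R) by ring. apply Clim_plus; auto.
        apply (Clim_RtoC _ _ 1). intros n. rewrite Rminus_0_r, Rabs_Ropp, Rabs_pos_eq. lra. left; apply Rinv_0_lt_compat, HS. }
    replace (rGamma s * (Rcpow t (s - 1) * e (t * w))) with (rGamma s * (pw t s * pw t (- (1))) * e (t * w)).
    2:{ rewrite !pw_RtoC by auto. rewrite <- Rcpow_plus. unfold Cminus. ring. }
    apply Clim_mult; [apply Clim_mult; [|apply Clim_mult]|].
    + apply (Clim_subseq (fun m => gauss m s)); [|apply rGamma_lim]. intros M.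
      destruct (INR_archimed t (INR M + 3) Ht) as [N1 HN1]. exists N1. intros n Hn.
      apply INR_le. destruct (Hl n) as [A _]. apply le_INR in Hn. rewrite S_INR in A.
      assert (INR (l n) <= INR (pred (l n)) + 1) by (rewrite <- S_INR; apply le_INR; lia). nra.
    + apply Clim_pw; auto.
    + apply Clim_pw; auto.
    + unfold e. apply Clim_Cexp. apply Clim_mult; [apply Clim_const|]. apply Clim_mult; auto. apply Clim_const.
  (* The exponent [l = 0], which occurs when [th = 0]: its term is [N ^ (1 - s)] and dies out since
     [1 < Re s], in accordance with the strict inequality in [lip_right]. *)
  - assert (Hk := pos_INR k). assert (Eth : th = 0%R) by lra. assert (Ek : k = 0%nat) by (apply INR_eq; simpl; lra).
    rewrite Cmult_0_r. apply (Clim_ext (fun n => Rcpow (INR (S n)) (1 - s))).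
    + exists 0%nat. intros n _. unfold lip_right_n. 
      assert (Er : residue th n = 0%nat).
      { destruct (residue_spec th n Hth) as [R1 _]. rewrite Eth, Rmult_0_l in R1. apply INR_eq. simpl (INR 0). generalize (pos_INR (residue 0 n)). rewrite Eth. lra. }
      rewrite Er, Ek. simpl (0 + 0 * S n)%nat. unfold bcoef. simpl rising. simpl fact. simpl (INR 1). simpl (INR 0).
      replace (0 * w / INR (S n)) with (RtoC 0). rewrite e_0. field.
      assert (RtoC (INR (S n)) <> 0) by (intros E; apply RtoC_inj in E; generalize (lt_0_INR (S n) ltac:(lia)); lra). field. auto.
    + apply Clim_Rcpow_zero. destruct s; unfold Re in *; simpl in *; lra.
Qed.

Lemma lipschitz_unit (s w : C) (th : R) : 1 < Re s -> 0 < Im w -> 0 <= th < 1 ->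
  abs_summable (lip_left s w th) /\ usum (lip_left s w th) = usum (fun k => rGamma s * lip_right s w th k).
Proof.
  intros Hs Hw Hth.
  destruct (lip_left_dominated s w th Hs Hw) as [K1 [HK1 D1]].
  destruct (lip_right_dominated s w th Hs Hw Hth) as [K2 [HK2 D2]].
  assert (S1 : summ (fun j : Z => K1 * Rpower (Rabs (IZR j) + 1) (- Re s))%R).
  { apply (summ_le _ (fun j : Z => Rpower (Rabs (IZR j) + 1) (- Re s)) K1); auto. intros; lra. now apply summ_p_series_Z. }
  assert (S2 : summ (fun k : nat => K2 * Rpower (INR k + 1) (- (2)))%R).
  { apply (summ_le _ (fun k : nat => Rpower (INR k + 1) (- (2))) K2); auto. intros; lra. apply summ_p_series. lra. }
  destruct (tannery (lip_left_n s w th) (lip_left s w th) _ S1 D1) as [A1 L1]. { intros j. now apply lip_left_limit. }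
  destruct (tannery (lip_right_n s w th) (fun k => rGamma s * lip_right s w th k) _ S2 D2) as [A2 L2]. { intros k. now apply lip_right_limit. }
  split; auto. apply (Clim_unique (fun n => usum (lip_left_n s w th n))); auto.
  eapply Clim_ext; [|apply L2]. exists 0%nat. intros n _. symmetry. now apply lip_n_eq.
Qed.

(** * One-sided series and the general form of Lipschitz's formula *)

Lemma rpow_exp_summable (a : R) (v : R) : 0 < v -> summ (fun k : nat => Rpower (INR k + 1) a * exp (- v * INR k))%R.
Proof.
  intros Hv. destruct (exp_beats_power a v Hv) as [K [HK0 HK]].
  apply (summ_le _ (fun k : nat => Rpower (INR k + 1) (- (2))) (exp v * K)).
  - apply Rmult_le_pos; auto. left; apply exp_pos.
  - intros k. assert (Hk : 1 <= INR k + 1) by (generalize (pos_INR k); lra). specialize (HK _ Hk).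
    replace (exp (- v * INR k)) with (exp v * exp (- v * (INR k + 1)))%R by (rewrite <- exp_plus; f_equal; ring).
    replace (Rpower (INR k + 1) a * (exp v * exp (- v * (INR k + 1))))%R with (exp v * (Rpower (INR k + 1) a * exp (- v * (INR k + 1))))%R by ring.
    rewrite Rmult_assoc. apply Rmult_le_compat_l; auto. left; apply exp_pos.
  - apply summ_p_series. lra.
Qed.

(* The least positive element of [g + Z]. *)
Definition base (g : R) : R := g + IZR (up (- g)).

Lemma base_bounds (g : R) : 0 < base g <= 1.
Proof. unfold base. destruct (archimed (- g)). lra. Qed.

(** The common shape of [lerch_term] and of the two indices of [qseries_term]: a function of the
    positive number [g + k], extended by 0 to all integers. The lemmas below rewrite it as a series
    over [nat] that starts at [base g]. *)
Definition zterm (g : R) (phi : R -> C) (k : Z) : C :=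
  if Rlt_dec (- g) (IZR k) then phi (g + IZR k)%R else 0.

Lemma zterm_nat (g : R) (phi : R -> C) (n : nat) : zterm g phi (up (- g) + Z.of_nat n) = phi (base g + INR n)%R.
Proof.
  unfold zterm. destruct (archimed (- g)) as [A1 A2]. rewrite plus_IZR, <- INR_IZR_INZ.
  destruct (Rlt_dec _ _) as [H|H].
  - f_equal. unfold base. ring.
  - exfalso. apply H. generalize (pos_INR n). lra.
Qed.

Lemma zterm_range (g : R) (phi : R -> C) (k : Z) : zterm g phi k <> 0 -> exists n : nat, k = (up (- g) + Z.of_nat n)%Z.
Proof.
  unfold zterm. destruct (Rlt_dec _ _) as [H|H]; [|intros K; now destruct K]. intros _.
  destruct (archimed (- g)) as [A1 A2]. exists (Z.to_nat (k - up (- g))).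
  assert (up (- g) - 1 < k)%Z by (apply lt_IZR; rewrite minus_IZR; lra). lia.
Qed.

Lemma zterm_summable (g : R) (phi : R -> C) :
  abs_summable (fun n : nat => phi (base g + INR n)%R) <-> abs_summable (zterm g phi).
Proof.
  split; intros H.
  - apply (abs_summable_reindex (fun n => up (- g) + Z.of_nat n)%Z). intros; lia. apply zterm_range.
    apply (abs_summable_ext (fun n : nat => phi (base g + INR n)%R)); auto. intros n. symmetry. apply zterm_nat.
  - apply (abs_summable_ext (fun n : nat => zterm g phi (up (- g) + Z.of_nat n))). intros; apply zterm_nat.
    apply (abs_summable_comp_inj (fun n => up (- g) + Z.of_nat n)%Z). intros; lia. auto.
Qed.

Lemma zterm_usum (g : R) (phi : R -> C) : abs_summable (fun n : nat => phi (base g + INR n)%R) ->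
  usum (zterm g phi) = usum (fun n : nat => phi (base g + INR n)%R).
Proof.
  intros H. rewrite (usum_reindex (fun n => up (- g) + Z.of_nat n)%Z).
  - apply usum_ext. intros; apply zterm_nat.
  - intros; lia.
  - apply zterm_range.
  - apply (abs_summable_ext (fun n : nat => phi (base g + INR n)%R)); auto. intros n. symmetry. apply zterm_nat.
Qed.

(** A bound uniform over all exponents with [Rabs a <= A], as needed for majorants that hold on a
    disc in [s]. *)
Lemma Rpower_shift_bound (b a A : R) (n : nat) : 0 < b <= 1 -> Rabs a <= A ->
  Rpower (b + INR n) a <= Rpower (/ b) A * Rpower (INR n + 1) A.
Proof.
  intros Hb Ha. assert (Hn := pos_INR n). apply Rabs_le_between in Ha.
  assert (B1 : 1 <= / b) by (rewrite <- Rinv_1; apply Rinv_le_contravar; lra).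
  assert (One : forall x, 1 <= x -> 1 <= Rpower x A).
  { intros x Hx. rewrite <- (Rpower_O x) by lra. apply Rle_Rpower; lra. }
  assert (O1 := One _ B1). assert (O2 := One (INR n + 1)%R ltac:(lra)).
  destruct (Rle_dec 0 a) as [H|H].
  - apply Rle_trans with (1 * Rpower (INR n + 1) A)%R; [|apply Rmult_le_compat_r; lra]. rewrite Rmult_1_l.
    apply Rle_trans with (Rpower (INR n + 1) a). apply Rpower_mono; lra. apply Rle_Rpower; lra.
  - apply Rle_trans with (Rpower (/ b) A * 1)%R; [|apply Rmult_le_compat_l; lra]. rewrite Rmult_1_r.
    apply Rle_trans with (Rpower b a). apply Rpower_anti; lra.
    replace (Rpower b a) with (Rpower (/ b) (- a)). apply Rle_Rpower; lra.
    unfold Rpower. f_equal. rewrite ln_Rinv by lra. ring.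
Qed.

Lemma summ_power_exp (b a v : R) : 0 < b <= 1 -> 0 < v ->
  summ (fun n : nat => Rpower (b + INR n) a * exp (- v * (b + INR n)))%R.
Proof.
  intros Hb Hv. apply (summ_le _ (fun k : nat => Rpower (INR k + 1) (Rabs a) * exp (- v * INR k))%R (Rpower (/ b) (Rabs a))).
  - left; apply Rpower_pos.
  - intros n. rewrite <- Rmult_assoc. apply Rmult_le_compat; try (left; apply Rpower_pos || apply exp_pos).
    apply Rpower_shift_bound; auto. lra. apply exp_le. assert (Hn := pos_INR n). nra.
  - now apply rpow_exp_summable.
Qed.

Lemma base_ge (b : R) (n : nat) : 0 < b <= 1 -> b * (INR n + 1) <= b + INR n.
Proof. intros H. assert (Hn := pos_INR n). nra. Qed.

Lemma summ_power (b p : R) : 0 < b <= 1 -> 1 < p -> summ (fun n : nat => Rpower (b + INR n) (- p)).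
Proof.
  intros Hb Hp. apply (summ_le _ (fun k : nat => Rpower (INR k + 1) (- p)) (Rpower b (- p))).
  - left; apply Rpower_pos.
  - intros n. assert (Hn := pos_INR n). rewrite <- Rpower_mult_base by lra. apply Rpower_anti; try lra. apply Rmult_lt_0_compat; lra.
    now apply base_ge.
  - now apply summ_p_series.
Qed.

Definition qphi (s w : C) (x : R) : C := Rcpow x (s - 1) * e (x * w).

Lemma Cmod_qphi (s w : C) (x : R) : Cmod (qphi s w x) = (Rpower x (Re s - 1) * exp (- (2 * PI * Im w) * x))%R.
Proof.
  unfold qphi. rewrite Cmod_mult, Cmod_Rcpow, Cmod_e. destruct s, w. unfold Re, Im; simpl. f_equal.
  f_equal. ring.
Qed.

Lemma two_PI_pos (v : R) : 0 < v -> 0 < 2 * PI * v.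
Proof. intros H. assert (K := PI_RGT_0). apply Rmult_lt_0_compat; lra. Qed.

Lemma qphi_summable (g : R) (s w : C) : 0 < Im w -> abs_summable (zterm g (qphi s w)).
Proof.
  intros Hw. apply zterm_summable.
  apply (abs_summable_le _ (fun n : nat => Rpower (base g + INR n) (Re s - 1) * exp (- (2 * PI * Im w) * (base g + INR n)))%R).
  - intros n. rewrite Cmod_qphi. lra.
  - apply summ_power_exp. apply base_bounds. now apply two_PI_pos.
Qed.

Lemma lipschitz (s w : C) (mu : R) : 1 < Re s -> 0 < Im w ->
  abs_summable (fun j : Z => e (IZR j * mu)%R * pw (- (2 * PI * Ci * (IZR j + w))) (- s)) /\
  usum (fun j : Z => e (IZR j * mu)%R * pw (- (2 * PI * Ci * (IZR j + w))) (- s)) = rGamma s * usum (zterm (- mu) (qphi s w)).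
Proof.
  (* [lipschitz_unit] is used with the fractional part [th] of [- mu]. On the left the integer [j K]
     is invisible to [e]; on the right the index is shifted by [K]. *)
  intros Hs Hw. set (K := Int_part (- mu)). set (th := (- mu - IZR K)%R).
  destruct (base_Int_part (- mu)) as [B1 B2]. fold K in B1, B2.
  assert (Hth : 0 <= th < 1) by (unfold th; lra).
  destruct (lipschitz_unit s w th Hs Hw Hth) as [A E].
  assert (EL : forall j, lip_left s w th j = e (IZR j * mu)%R * pw (- (2 * PI * Ci * (IZR j + w))) (- s)).
  { intros j. unfold lip_left. f_equal. rewrite <- RtoC_opp.
    replace (- (IZR j * th))%R with (IZR j * mu + IZR (j * K))%R by (rewrite mult_IZR; unfold th; ring).
    rewrite RtoC_plus, e_plus, e_Z. ring. }
  assert (ER : forall k, lip_right s w th k = zterm (- mu) (qphi s w) (Z.of_nat k - K)).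
  { intros k. unfold lip_right, zterm. rewrite minus_IZR, <- INR_IZR_INZ, Ropp_involutive.
    replace (- mu + (INR k - IZR K))%R with (th + INR k)%R by (unfold th; ring).
    destruct (Rlt_dec 0 (th + INR k)); destruct (Rlt_dec mu (INR k - IZR K)); auto; exfalso; unfold th in *; lra. }
  assert (Sk : abs_summable (fun k : nat => zterm (- mu) (qphi s w) (Z.of_nat k - K))).
  { apply (abs_summable_comp_inj (fun k => Z.of_nat k - K)%Z). intros; lia. now apply qphi_summable. }
  split.
  - apply (abs_summable_ext (lip_left s w th)); auto.
  - rewrite <- (usum_ext (lip_left s w th)) by auto. rewrite E.
    rewrite (usum_ext (fun k => rGamma s * lip_right s w th k) (fun k => rGamma s * zterm (- mu) (qphi s w) (Z.of_nat k - K))).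
    2:{ intros k. now rewrite ER. }
    rewrite usum_scal by auto. f_equal. symmetry. apply (usum_reindex (fun k => Z.of_nat k - K)%Z); auto.
    + intros; lia.
    + intros l Hl. exists (Z.to_nat (l + K)). unfold zterm in Hl. destruct (Rlt_dec _ _) as [H|H]; [|now destruct Hl].
      assert (-1 < l + K)%Z by (apply lt_IZR; rewrite plus_IZR; lra). lia.
Qed.

Lemma entire_qseries (g : R) (w : C) : 0 < Im w -> entire (fun s => usum (zterm g (qphi s w))).
Proof.
  intros Hw c.
  apply (holo_ext (fun s => usum (fun n : nat => qphi s w (base g + INR n)%R))).
  { intros s. symmetry. apply zterm_usum. apply zterm_summable. now apply qphi_summable. }
  set (A := (Cmod c + 2)%R). set (v := (2 * PI * Im w)%R).
  apply (usum_holomorphic (fun (n : nat) s => qphi s w (base g + INR n)%R)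
     (fun n : nat => Rpower (/ base g) A * (Rpower (INR n + 1) A * exp (- v * INR n)))%R c 1); [lra| | |].
  - intros n. unfold qphi. apply entire_mult; [|apply entire_const]. apply entire_Rcpow. apply entire_minus. apply entire_id. apply entire_const.
  - apply (summ_le _ (fun n : nat => Rpower (INR n + 1) A * exp (- v * INR n))%R (Rpower (/ base g) A)).
    left; apply Rpower_pos. intros; lra. apply rpow_exp_summable. now apply two_PI_pos.
  - intros n h Hh. rewrite Cmod_qphi, <- Rmult_assoc. assert (Bg := base_bounds g).
    apply Rmult_le_compat; try (left; apply Rpower_pos || apply exp_pos).
    + apply Rpower_shift_bound; auto.
      assert (L : Rabs (Re (c + h)) <= Cmod c + 1). { eapply Rle_trans; [apply re_le_Cmod|]. eapply Rle_trans; [apply Cmod_triangle|]. lra. }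
      apply Rabs_le_between in L. apply Rabs_le. unfold A. lra.
    + apply exp_le. assert (Hn := pos_INR n). assert (0 < v) by now apply two_PI_pos. fold v. nra.
Qed.

(** * Euler-Maclaurin summation *)

Definition csum (f : nat -> C) (n : nat) : C := finite_sum f (seq 0 n).

Lemma csum_S (f : nat -> C) n : csum f (S n) = csum f n + f n.
Proof. apply finite_sum_seq_S. Qed.

Lemma csum_ext (f g : nat -> C) n : (forall i, (i < n)%nat -> f i = g i) -> csum f n = csum g n.
Proof. intros H. apply finite_sum_ext. intros i Hi. apply in_seq in Hi. apply H. lia. Qed.

Lemma csum_plus (f g : nat -> C) n : csum (fun i => f i + g i) n = csum f n + csum g n.
Proof. apply finite_sum_plus. Qed.

Lemma csum_scal (c : C) (f : nat -> C) n : csum (fun i => c * f i) n = c * csum f n.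
Proof. apply finite_sum_scal. Qed.

Lemma csum_head (f : nat -> C) n : csum f (S n) = f 0%nat + csum (fun i => f (S i)) n.
Proof.
  induction n as [|n IH]; [unfold csum, finite_sum; simpl; ring|]. rewrite csum_S, IH, csum_S. ring.
Qed.

Lemma csum_rev (f : nat -> C) n : csum f n = csum (fun i => f (n - 1 - i)%nat) n.
Proof.
  induction n as [|n IH]; [reflexivity|]. rewrite csum_S, IH, csum_head.
  rewrite Cplus_comm. f_equal. f_equal; lia. apply csum_ext. intros i Hi. f_equal. lia.
Qed.

(** Both sides run over the pairs [n <= m <= M], on the left with [m = n + i]. *)
Lemma csum_triangle (f : nat -> nat -> C) (M : nat) :
  csum (fun n => csum (fun i => f n (n + i)%nat) (S M - n)) (S M) = csum (fun m => csum (fun n => f n m) (S m)) (S M).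
Proof.
  induction M as [|M IH].
  - unfold csum, finite_sum; simpl. ring.
  - rewrite csum_S, (csum_S (fun m => csum _ (S m))), <- IH.
    rewrite (csum_ext _ (fun n => csum (fun i => f n (n + i)%nat) (S M - n) + f n (S M))).
    2:{ intros n Hn. replace (S (S M) - n)%nat with (S (S M - n)) by lia. rewrite csum_S. do 2 f_equal. lia. }
    rewrite csum_plus, (csum_S (fun n => f n (S M)) (S M)).
    replace (S (S M) - S M)%nat with 1%nat by lia. rewrite csum_S. unfold csum at 5. unfold finite_sum. simpl fold_right.
    rewrite Nat.add_0_r. ring.
Qed.

(** Here [g (S n)] is the derivative of [g n]. The remainder of [g n] vanishes at 0 and has the
    remainder of [g (S n)], one order lower, as its derivative. On an interval of length at most 1
    the bound [D] survives each integration, so no factorial is kept. *)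
Lemma taylor_remainder (g : nat -> R -> C) (D : R) : forall m n,
  (forall n t, 0 <= t <= 1 -> pder (g n) t (g (S n) t)) -> (forall t, 0 <= t <= 1 -> Cmod (g (n + S m)%nat t) <= D) ->
  forall t, 0 <= t <= 1 -> Cmod (g n t - csum (fun i => g (n + i)%nat 0%R * (t ^ i / INR (fact i))%R) (S m)) <= D.
Proof.
  assert (PF : forall i t, pder (fun t => RtoC (t ^ S i / INR (fact (S i)))) t (RtoC (t ^ i / INR (fact i)))).
  { intros i t. apply pder_RtoC. replace (t ^ i / INR (fact i))%R with (/ INR (fact (S i)) * (INR (S i) * t ^ i))%R.
    - apply (is_derive_ext (fun t => / INR (fact (S i)) * t ^ S i)%R). { intros u. apply Rmult_comm. }
      apply is_derive_scal. apply is_derive_Reals, (derivable_pt_lim_pow t (S i)).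
    - rewrite fact_simpl, mult_INR. field. split. apply INR_fact_neq_0. apply not_0_INR; lia. }
  assert (PS : forall m n t, (forall n t, 0 <= t <= 1 -> pder (g n) t (g (S n) t)) -> 0 <= t <= 1 ->
    pder (fun t => csum (fun i => g (n + i)%nat 0%R * (t ^ i / INR (fact i))%R) (S m)) t
      (csum (fun i => g (S n + i)%nat 0%R * (t ^ i / INR (fact i))%R) m)).
  { intros m n t Hg Ht. induction m as [|m IH].
    - unfold csum, finite_sum; simpl. apply (pder_ext (fun t => g (n + 0)%nat 0%R * (1 / 1)%R + 0)). reflexivity. apply pder_const.
    - rewrite csum_S. apply (pder_ext (fun t => csum (fun i => g (n + i)%nat 0%R * (t ^ i / INR (fact i))%R) (S m) + g (n + S m)%nat 0%R * (t ^ S m / INR (fact (S m)))%R)).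
      { intros u. rewrite (csum_S _ (S m)). reflexivity. }
      apply pder_plus; auto. replace (S n + m)%nat with (n + S m)%nat by lia. apply pder_scal. apply PF. }
  induction m as [|m IH]; intros n Hg HD t Ht.
  - assert (K := mean_value_ineq_const (g n) (g (S n)) D 0 t (proj1 Ht)).
    rewrite csum_S. replace (csum _ 0) with (RtoC 0) by reflexivity. rewrite Nat.add_0_r.
    replace (t ^ 0 / INR (fact 0))%R with 1%R by (simpl; field).
    replace (g n t - (0 + g n 0%R * 1)) with (g n t - g n 0%R) by ring.
    assert (0 <= D). { eapply Rle_trans; [apply Cmod_ge_0|apply (HD 0%R); lra]. }
    apply Rle_trans with (D * (t - 0))%R; [|nra]. apply K.
    + intros u Hu. apply Hg. lra.
    + intros u Hu. rewrite <- (Nat.add_1_r n). apply HD. lra.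
  - set (T := fun t => g n t - csum (fun i => g (n + i)%nat 0%R * (t ^ i / INR (fact i))%R) (S (S m))).
    set (T' := fun t => g (S n) t - csum (fun i => g (S n + i)%nat 0%R * (t ^ i / INR (fact i))%R) (S m)).
    assert (K := mean_value_ineq_const T T' D 0 t (proj1 Ht)).
    assert (T0 : T 0%R = 0).
    { unfold T. rewrite csum_head. rewrite (csum_ext (fun i => _ * (0 ^ S i / _)%R) (fun i => 0 * 0)).
      rewrite csum_scal, Nat.add_0_r. replace (0 ^ 0 / INR (fact 0))%R with 1%R by (simpl; field). ring.
      intros i _. rewrite pow_ne_zero by lia. unfold Rdiv. rewrite Rmult_0_l. ring. }
    rewrite T0 in K. replace (T t - 0) with (T t) in K by ring.
    assert (0 <= D). { eapply Rle_trans; [apply Cmod_ge_0|apply (HD 0%R); lra]. }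
    apply Rle_trans with (D * (t - 0))%R; [|nra]. apply K.
    + intros u Hu. unfold T, T'. apply (pder_ext (fun t => g n t + (-(1)) * csum (fun i => g (n + i)%nat 0%R * (t ^ i / INR (fact i))%R) (S (S m)))).
      { intros; ring. }
      apply (pder_eq _ _ (g (S n) u + (-(1)) * csum (fun i => g (S n + i)%nat 0%R * (u ^ i / INR (fact i))%R) (S m))); [ring|].
      apply pder_plus. apply Hg; lra. apply pder_scal. apply PS; auto. lra.
    + intros u Hu. apply IH; auto; [|lra]. intros v Hv. replace (S n + S m)%nat with (n + S (S m))%nat by lia. now apply HD.
Qed.

(** Course-of-values recursion: [bl m] is a sequence that is final up to index [m], and the diagonal
    is the solution. *)
Lemma strong_recursion (F : nat -> (nat -> C) -> C) :
  (forall m u v, (forall k, (k < m)%nat -> u k = v k) -> F m u = F m v) -> exists b : nat -> C, forall m, b m = F m b.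
Proof.
  intros HF.
  set (bl := nat_rect (fun _ => nat -> C) (fun _ => F 0%nat (fun _ => 0))
     (fun m u k => if Nat.eq_dec k (S m) then F (S m) u else u k)).
  assert (Ext : forall m k, (k <= m)%nat -> bl m k = bl k k).
  { induction m as [|m IH]; intros k Hk. now replace k with 0%nat by lia.
    destruct (Nat.eq_dec k (S m)) as [->|N]; auto. simpl. destruct (Nat.eq_dec k (S m)); [lia|]. apply IH. lia. }
  exists (fun m => bl m m). intros [|m].
  - simpl. apply HF. intros; lia.
  - change (bl (S m) (S m)) with (if Nat.eq_dec (S m) (S m) then F (S m) (bl m) else bl m (S m)).
    destruct (Nat.eq_dec (S m) (S m)); [|lia]. apply HF. intros k Hk. apply Ext. lia.
Qed.

(* [b] are the Taylor coefficients of [t^e0 / (x exp t - 1)]. *)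
Definition em_coeffs (x : C) (e0 : nat) (b : nat -> C) : Prop :=
  forall m, x * csum (fun i => b (m - i)%nat * (/ INR (fact i))%R) (S m) - b m = if Nat.eq_dec m e0 then 1 else 0.

Lemma em_coeffs_generic (x : C) : x <> 1 -> exists b, em_coeffs x 0 b.
Proof.
  intros Hx.
  destruct (strong_recursion (fun m u => ((if Nat.eq_dec m 0 then 1 else 0) - x * csum (fun i => u (m - S i)%nat * (/ INR (fact (S i)))%R) m) / (x - 1))) as [b Hb].
  - intros m u v E. rewrite (csum_ext (fun i => u (m - S i)%nat * _) (fun i => v (m - S i)%nat * (/ INR (fact (S i)))%R)); auto.
    intros i Hi. rewrite E by lia. reflexivity.
  - exists b. intros m. rewrite csum_head, Nat.sub_0_r. replace (/ INR (fact 0))%R with 1%R by (simpl; field).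
    assert (NZ : x - 1 <> 0). { intros K. apply Hx. replace x with (x - 1 + 1) by ring. rewrite K. ring. }
    replace (x * (b m * 1%R + csum (fun i => b (m - S i)%nat * (/ INR (fact (S i)))%R) m) - b m) with
      ((x - 1) * b m + x * csum (fun i => b (m - S i)%nat * (/ INR (fact (S i)))%R) m) by ring.
    rewrite (Hb m) at 1. field. auto.
Qed.

(** For [x = 1] the term [b m] cancels from the relation of order [m], so the relation of order
    [m + 1] determines it. These are the Bernoulli numbers divided by factorials, and the
    cancellation is why the right-hand side has order 1. *)
Lemma em_coeffs_one : exists b, em_coeffs 1 1 b.
Proof.
  destruct (strong_recursion (fun n u => (if Nat.eq_dec n 0 then 1 else 0) - csum (fun i => u (n - S i)%nat * (/ INR (fact (S (S i))))%R) n)) as [b Hb].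
  - intros m u v E. rewrite (csum_ext (fun i => u (m - S i)%nat * _) (fun i => v (m - S i)%nat * (/ INR (fact (S (S i))))%R)); auto.
    intros i Hi. rewrite E by lia. reflexivity.
  - exists b. intros [|m].
    + unfold csum, finite_sum; simpl. rewrite Rinv_1. ring.
    + rewrite csum_head, Nat.sub_0_r, csum_head. replace (S m - 1)%nat with m by lia.
      replace (/ INR (fact 0))%R with 1%R by (simpl; field). replace (/ INR (fact 1))%R with 1%R by (simpl; field).
      replace (1 * (b (S m) * 1 + (b m * 1 + csum (fun i => b (S m - S (S i))%nat * (/ INR (fact (S (S i))))%R) m)) - b (S m)) with
        (b m + csum (fun i => b (S m - S (S i))%nat * (/ INR (fact (S (S i))))%R) m) by ring.
      change (csum (fun i => b (S m - S (S i))%nat * (/ INR (fact (S (S i))))%R) m) with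
        (csum (fun i => b (m - S i)%nat * (/ INR (fact (S (S i))))%R) m).
      rewrite (Hb m) at 1.
      destruct (Nat.eq_dec m 0); destruct (Nat.eq_dec (S m) 1); try lia; ring.
Qed.

Fixpoint falling (n : nat) (s : C) : C := match n with O => 1 | S m => falling m s * (- s - INR m) end.

Lemma entire_falling (n : nat) : entire (falling n).
Proof.
  induction n as [|n IH]; simpl. apply entire_const. apply (entire_mult (falling n)); auto.
  apply entire_minus. apply entire_opp, entire_id. apply entire_const.
Qed.

(** The [n]-th derivative of [W ^ (- s)] with respect to [W]. *)
Definition dpow (n : nat) (s W : C) : C := falling n s * pw W (- s - INR n).

Lemma pder_pw (W s : C) (t : R) : 0 < Re (W + t * 1) -> pder (fun t => pw (W + t * 1) s) t (s * pw (W + t * 1) (s - 1)).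
Proof.
  intros H. unfold pw at 1. apply (pder_eq _ _ (s * (1 / (W + t * 1)) * pw (W + t * 1) s)).
  - unfold Cminus. rewrite pw_plus, pw_opp, pw_1 by auto.
    apply Re_pos_neq_0 in H. set (V := W + t * 1) in *. field. auto.
  - unfold pw. apply pder_comp_Cexp. apply pder_scal. now apply pder_Clog.
Qed.

Lemma pder_dpow (n : nat) (s W : C) (t : R) : 0 < Re (W + t * 1) ->
  pder (fun t => dpow n s (W + t * 1)) t (dpow (S n) s (W + t * 1)).
Proof.
  intros H. unfold dpow. apply (pder_eq _ _ (falling n s * ((- s - INR n) * pw (W + t * 1) (- s - INR n - 1)))).
  - rewrite S_INR, RtoC_plus. replace (- s - (INR n + 1)) with (- s - INR n - 1) by ring. simpl falling. ring.
  - apply pder_scal. now apply pder_pw.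
Qed.

(** Multiplied by [x ^ k] and taken at [W + k], this is the [k]-th term of the series of [e0]-th
    derivatives minus the increment from [k] to [k + 1] of [x ^ k] times the correction sum. Summing
    over [k] therefore yields the series plus the correction at [W]. *)
Definition em_rem (x : C) (e0 : nat) (b : nat -> C) (M : nat) (s W : C) : C :=
  dpow e0 s W - x * csum (fun n => b n * dpow n s (W + 1)) (S M) + csum (fun n => b n * dpow n s W) (S M).

(** Formally the shift by 1 is the exponential of the derivative, and [(x exp t - 1)] times the
    generating series of [b] is [t ^ e0]. All derivatives up to order [M] thus cancel, and only
    Taylor remainders, bounded through the derivative of order [M + 1], are left. *)
Lemma em_rem_bound (x : C) (e0 : nat) (b : nat -> C) (M : nat) (s W : C) (D : R) : em_coeffs x e0 b -> (e0 <= M)%nat -> 0 < Re W ->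
  (forall t, 0 <= t <= 1 -> Cmod (dpow (S M) s (W + t * 1)) <= D) ->
  Cmod (em_rem x e0 b M s W) <= Cmod x * rsum (fun n => Cmod (b n)) (seq 0 (S M)) * D.
Proof.
  intros Hb He HW HD.
  set (g := fun n t => dpow n s (W + RtoC t * 1)).
  assert (RW : forall t, 0 <= t <= 1 -> 0 < Re (W + t * 1)). { intros t Ht. destruct W. unfold Re in *; simpl in *. lra. }
  assert (Hg : forall n t, 0 <= t <= 1 -> pder (g n) t (g (S n) t)). { intros n t Ht. apply pder_dpow. auto. }
  set (T := fun n m => g n 1%R - csum (fun i => g (n + i)%nat 0%R * (1 ^ i / INR (fact i))%R) (S m)).
  assert (HT : forall n, (n <= M)%nat -> Cmod (T n (M - n)%nat) <= D).
  { intros n Hn. apply (taylor_remainder g D (M - n) n Hg); [|lra]. intros t Ht.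
    replace (n + S (M - n))%nat with (S M) by lia. now apply HD. }
  assert (E : em_rem x e0 b M s W = - (x * csum (fun n => b n * T n (M - n)%nat) (S M))).
  (* The Taylor polynomials are regrouped by the total order [m = n + i] of the derivative, where
     the relation [em_coeffs] can be read off. *)
  { assert (Z : csum (fun n => b n * csum (fun i => g (n + i)%nat 0%R * (1 ^ i / INR (fact i))%R) (S (M - n))) (S M) =
       csum (fun m => g m 0%R * csum (fun i => b (m - i)%nat * (/ INR (fact i))%R) (S m)) (S M)).
    { rewrite (csum_ext _ (fun n => csum (fun i => b n * (g (n + i)%nat 0%R * (/ INR (fact (n + i - n)))%R)) (S M - n))).
      - rewrite (csum_triangle (fun n m => b n * (g m 0%R * (/ INR (fact (m - n)))%R))).
        apply csum_ext. intros m _. rewrite <- csum_scal, csum_rev. apply csum_ext. intros i Hi.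
        replace (S m - 1 - i)%nat with (m - i)%nat by lia. replace (m - (m - i))%nat with i by lia. ring.
      - intros n Hn. replace (S M - n)%nat with (S (M - n)) by lia. rewrite <- csum_scal. apply csum_ext. intros i _.
        rewrite pow1. unfold Rdiv. rewrite Rmult_1_l. replace (n + i - n)%nat with i by lia. ring. }
    assert (Y : x * csum (fun n => b n * g n 1%R) (S M) = x * csum (fun n => b n * T n (M - n)%nat) (S M) +
       x * csum (fun n => b n * csum (fun i => g (n + i)%nat 0%R * (1 ^ i / INR (fact i))%R) (S (M - n))) (S M)).
    { rewrite <- Cmult_plus_distr_l, <- csum_plus. f_equal. apply csum_ext. intros n _. unfold T. ring. }
    assert (V : csum (fun m => g m 0%R * (x * csum (fun i => b (m - i)%nat * (/ INR (fact i))%R) (S m) - b m)) (S M) = g e0 0%R).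
    { rewrite (csum_ext _ (fun m => g m 0%R * (if Nat.eq_dec m e0 then 1 else 0))) by (intros m _; now rewrite Hb).
      clear - He. induction M as [|M IH].
      - replace e0 with 0%nat by lia. unfold csum, finite_sum; simpl. ring.
      - rewrite csum_S. destruct (Nat.eq_dec (S M) e0) as [<-|N].
        + rewrite (csum_ext _ (fun _ => 0 * 0)). rewrite csum_scal. ring.
          intros m Hm. destruct (Nat.eq_dec m (S M)); [lia|ring].
        + rewrite IH by lia. ring. }
    unfold em_rem. replace (W + 1) with (W + 1%R * 1) by ring.
    replace (csum (fun n => b n * dpow n s (W + 1%R * 1)) (S M)) with (csum (fun n => b n * g n 1%R) (S M)) by reflexivity.
    assert (G0 : forall n, dpow n s W = g n 0%R). { intros n. unfold g. f_equal. ring. }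
    rewrite (csum_ext (fun n => b n * dpow n s W) (fun n => b n * g n 0%R)) by (intros; now rewrite G0).
    rewrite G0, Y, Z, <- V.
    rewrite (csum_ext (fun m => g m 0%R * (x * _ - b m)) (fun m => x * (g m 0%R * csum (fun i => b (m - i)%nat * (/ INR (fact i))%R) (S m)) + (-(1)) * (b m * g m 0%R))) by (intros; ring).
    rewrite csum_plus, !csum_scal. ring. }
  rewrite E, Cmod_opp, Cmod_mult, Rmult_assoc. apply Rmult_le_compat_l; [apply Cmod_ge_0|].
  eapply Rle_trans; [apply Cmod_finite_sum|]. rewrite Rmult_comm, <- rsum_scal. apply rsum_le. intros n Hn. apply in_seq in Hn.
  rewrite Cmod_mult, Rmult_comm. apply Rmult_le_compat_r; [apply Cmod_ge_0|]. apply HT. lia.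
Qed.

Lemma entire_dpow (n : nat) (W : C) : entire (fun s => dpow n s W).
Proof.
  unfold dpow. apply (entire_mult (falling n)). apply entire_falling. apply entire_pw. apply entire_minus; [apply entire_opp, entire_id|apply entire_const].
Qed.

Lemma entire_csum (f : nat -> C -> C) (n : nat) : (forall i, entire (f i)) -> entire (fun s => csum (fun i => f i s) n).
Proof. intros H. now apply entire_finite_sum. Qed.

Lemma entire_em_rem (x : C) (e0 : nat) (b : nat -> C) (M : nat) (W : C) : entire (fun s => em_rem x e0 b M s W).
Proof.
  unfold em_rem. apply entire_plus; [apply entire_minus|].
  - apply entire_dpow.
  - apply entire_scal, entire_csum. intros i. apply entire_scal, entire_dpow.
  - apply entire_csum. intros i. apply entire_scal, entire_dpow.
Qed.

Lemma dpow_bound (n : nat) (r : R) : 0 <= r -> exists K, 0 <= K /\ forall s W, Cmod s <= r -> 0 < Re W ->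
  0 <= Re s + INR n -> Cmod (dpow n s W) <= K * Rpower (Re W) (- (Re s + INR n)).
Proof.
  intros Hr. destruct (entire_bounded (falling n) 0 r (entire_falling n) Hr) as [B HB].
  assert (HB0 : 0 <= B) by (eapply Rle_trans; [apply Cmod_ge_0|apply (HB 0); rewrite Cmod_0; lra]).
  exists (B * exp (2 * r))%R. split. { apply Rmult_le_pos; auto. left; apply exp_pos. }
  intros s W Hs HW Hn. unfold dpow. rewrite Cmod_mult, Rmult_assoc. apply Rmult_le_compat; auto using Cmod_ge_0.
  - specialize (HB s Hs). now rewrite Cplus_0_l in HB.
  - eapply Rle_trans; [apply Cmod_pw_le|]. rewrite Rmult_comm.
    replace (Re (- s - INR n)) with (- (Re s + INR n))%R by (destruct s; unfold Re; simpl; ring).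
    replace (Im (- s - INR n)) with (- Im s)%R by (destruct s; unfold Im; simpl; ring).
    rewrite Rabs_Ropp. apply Rmult_le_compat; try (left; apply Rpower_pos || apply exp_pos).
    + apply exp_le. assert (Rabs (Im s) <= Cmod s) by apply Rabs_snd_le. lra.
    + apply Rpower_anti; auto; [|lra]. apply Re_le_Cmod'.
Qed.

Definition shiftpt (c y : R) (k : nat) : C := (c + INR k, y)%R.

Lemma Re_shiftpt (c y : R) (k : nat) : Re (shiftpt c y k) = (c + INR k)%R.
Proof. reflexivity. Qed.

Lemma shiftpt_S (c y : R) (k : nat) : shiftpt c y (S k) = shiftpt c y k + 1.
Proof. unfold shiftpt, Cplus, RtoC; cbn [fst snd]. rewrite S_INR. f_equal; ring. Qed.

Lemma dpow_dominated (n : nat) (r c : R) : 0 <= r -> 0 < c <= 1 -> exists K, 0 <= K /\ forall s y k t, Cmod s <= r -> 0 <= t ->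
  2 <= Re s + INR n -> Cmod (dpow n s (shiftpt c y k + t * 1)) <= K * Rpower (INR k + 1) (- (2)).
Proof.
  intros Hr Hc. destruct (dpow_bound n r Hr) as [K [HK0 HK]].
  assert (Hi : 1 <= / c) by (rewrite <- Rinv_1; apply Rinv_le_contravar; lra).
  exists (K * Rpower (/ c) (r + INR n))%R. split. { apply Rmult_le_pos; auto. left; apply Rpower_pos. }
  intros s y k t Hs Ht Hn.
  assert (Hk := pos_INR k).
  assert (RW : Re (shiftpt c y k + t * 1) = (c + INR k + t)%R) by (unfold shiftpt, Re; simpl; ring).
  eapply Rle_trans; [apply HK; auto; rewrite ?RW; lra|]. rewrite Rmult_assoc. apply Rmult_le_compat_l; auto.
  rewrite RW. set (p := (Re s + INR n)%R) in *.
  apply Rle_trans with (Rpower (c * (INR k + 1)) (- p)).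
  - apply Rpower_anti; try lra. apply Rmult_lt_0_compat; lra. generalize (base_ge c k Hc). lra.
  - rewrite Rpower_mult_base by lra. apply Rmult_le_compat; try (left; apply Rpower_pos).
    + replace (Rpower c (- p)) with (Rpower (/ c) p) by (unfold Rpower; f_equal; rewrite ln_Rinv by lra; ring).
      apply Rle_Rpower; auto. unfold p. assert (Re s <= Cmod s) by apply Re_le_Cmod'. lra.
    + apply Rle_Rpower; lra.
Qed.

(** * Continuation of sums over shifted points *)

Section EM.

Variables (x : C) (e0 : nat) (b : nat -> C) (c : R).
Hypotheses (Hx : Cmod x = 1%R) (Hb : em_coeffs x e0 b) (Hc : 0 < c <= 1).

(** The condition [r + 1 <= INR M] gives [Re s + (M + 1) >= 2], hence quadratic decay. [K] depends
    neither on [s] in the disc, which gives holomorphy, nor on [y], which allows the limit in the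
    shift. *)
Lemma em_rem_dominated (M : nat) (r : R) : (e0 <= M)%nat -> 0 <= r -> r + 1 <= INR M -> exists K, 0 <= K /\
  forall s y k, Cmod s <= r -> Cmod (x ^ k * em_rem x e0 b M s (shiftpt c y k)) <= K * Rpower (INR k + 1) (- (2)).
Proof.
  intros He Hr HM. destruct (dpow_dominated (S M) r c Hr Hc) as [K [HK0 HK]].
  set (S0 := rsum (fun n => Cmod (b n)) (seq 0 (S M))).
  assert (HS : 0 <= S0) by (apply rsum_nonneg; intros; apply Cmod_ge_0).
  exists (S0 * K)%R. split. now apply Rmult_le_pos. intros s y k Hs.
  rewrite Cmod_mult, Cmod_pow, Hx, pow1, Rmult_1_l.
  eapply Rle_trans; [apply (em_rem_bound x e0 b M s _ (K * Rpower (INR k + 1) (- (2)))); auto|].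
  - rewrite Re_shiftpt. generalize (pos_INR k). lra.
  - intros t Ht. apply HK; auto; try lra. rewrite S_INR. assert (Rabs (Re s) <= Cmod s) by apply re_le_Cmod. apply Rabs_le_between in H. lra.
  - rewrite Hx. fold S0. right; ring.
Qed.

Definition em_value (M : nat) (s : C) (y : R) : C :=
  usum (fun k => x ^ k * em_rem x e0 b M s (shiftpt c y k)) - csum (fun n => b n * dpow n s (shiftpt c y 0)) (S M).

Lemma em_rem_summable (M : nat) (s : C) (y : R) : (e0 <= M)%nat -> Cmod s + 1 <= INR M ->
  abs_summable (fun k => x ^ k * em_rem x e0 b M s (shiftpt c y k)).
Proof.
  intros He HM. destruct (em_rem_dominated M (Cmod s) He (Cmod_ge_0 s) HM) as [K [HK0 HK]].
  apply (summ_le (fun k => Cmod _) (fun k : nat => Rpower (INR k + 1) (- (2))) K); auto.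
  - intros k. apply HK. lra.
  - apply summ_p_series. lra.
Qed.

Lemma telescoping (u : nat -> C) : Clim u 0 -> abs_summable (fun k => u (S k) - u k) -> usum (fun k => u (S k) - u k) = - u 0%nat.
Proof.
  intros Hu A. apply (Clim_unique (fun n => finite_sum (fun k => u (S k) - u k) (seq 0 n))).
  - now apply usum_partial_sums.
  - apply (Clim_ext (fun n => u n + (- u 0%nat))).
    + exists 0%nat. intros n _. induction n as [|n IH]; [unfold finite_sum; simpl; ring|].
      rewrite finite_sum_seq_S, <- IH by lia. ring.
    + assert (K := Clim_plus u (fun _ => - u 0%nat) 0 (- u 0%nat) Hu (Clim_const _)). rewrite Cplus_0_l in K. exact K.
Qed.

Lemma Clim_power_zero (u : nat -> C) (K p : R) : 0 < p -> (forall k, Cmod (u k) <= K * Rpower (c + INR k) (- p)) -> Clim u 0.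
Proof.
  intros Hp Hu eps He.
  assert (HK : 0 <= K). { specialize (Hu 0%nat). assert (P := Rpower_pos (c + INR 0) (- p)). generalize (Cmod_ge_0 (u 0%nat)). nra. }
  assert (H1 : 0 < eps / (K + 1)) by (apply Rdiv_lt_0_compat; lra).
  destruct (INR_archimed 1 (exp (ln (eps / (K + 1)) / (- p)))) as [N HN]; [lra|]. exists N. intros n Hn.
  replace (u n - 0) with (u n) by ring. eapply Rle_trans; [apply Hu|].
  assert (HX : exp (ln (eps / (K + 1)) / (- p)) <= c + INR n) by (apply le_INR in Hn; lra).
  assert (L : Rpower (c + INR n) (- p) <= eps / (K + 1)).
  { rewrite <- (exp_ln (eps / (K + 1))) by auto. unfold Rpower. apply exp_le.
    assert (ln (eps / (K + 1)) / (- p) <= ln (c + INR n)). { rewrite <- (ln_exp (ln (eps / (K + 1)) / - p)). apply ln_le'; auto. apply exp_pos. }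
    replace (ln (eps / (K + 1))) with (- p * (ln (eps / (K + 1)) / (- p)))%R by (field; lra). nra. }
  apply Rle_trans with ((K + 1) * (eps / (K + 1)))%R; [|right; field; lra].
  apply Rmult_le_compat; auto; try lra. left; apply Rpower_pos.
Qed.

Lemma dpow_decay (n : nat) (s : C) (y : R) : exists K, 0 <= K /\ forall k, 0 <= Re s + INR n -> Cmod (dpow n s (shiftpt c y k)) <= K * Rpower (c + INR k) (- (Re s + INR n)).
Proof.
  destruct (dpow_bound n (Cmod s) (Cmod_ge_0 s)) as [K [HK0 HK]]. exists K. split; auto. intros k H.
  rewrite <- (Re_shiftpt c y k). apply HK; auto. lra. rewrite Re_shiftpt. generalize (pos_INR k). lra.
Qed.

Lemma dpow_limit_zero (n : nat) (s : C) (y : R) : 0 < Re s + INR n -> Clim (fun k => x ^ k * dpow n s (shiftpt c y k)) 0.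
Proof.
  intros H. destruct (dpow_decay n s y) as [K [HK0 HK]]. apply (Clim_power_zero _ K (Re s + INR n)); auto.
  intros k. rewrite Cmod_mult, Cmod_pow, Hx, pow1, Rmult_1_l. apply HK. lra.
Qed.

(** Raising the order changes the remainders by a telescoping series, whose boundary term is exactly
    the additional correction. *)
Lemma em_value_S (M : nat) (s : C) (y : R) : (e0 <= M)%nat -> Cmod s + 1 <= INR M -> em_value (S M) s y = em_value M s y.
Proof.
  intros He HM. unfold em_value.
  assert (A1 := em_rem_summable M s y He HM). assert (A2 := em_rem_summable (S M) s y ltac:(lia) ltac:(rewrite S_INR; lra)).
  set (u := fun k => x ^ k * (b (S M) * dpow (S M) s (shiftpt c y k))).
  assert (E : forall k, x ^ k * em_rem x e0 b (S M) s (shiftpt c y k) - x ^ k * em_rem x e0 b M s (shiftpt c y k) = -(1) * (u (S k) - u k)).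
  { intros k. unfold em_rem, u. rewrite !(csum_S _ (S M)), shiftpt_S. simpl Cpow. ring. }
  assert (A3 : abs_summable (fun k => u (S k) - u k)).
  { apply (abs_summable_ext (fun k => -(1) * (x ^ k * em_rem x e0 b (S M) s (shiftpt c y k) - x ^ k * em_rem x e0 b M s (shiftpt c y k)))).
    - intros k. rewrite E. ring.
    - apply abs_summable_scal. now apply abs_summable_minus. }
  assert (U : usum (fun k => x ^ k * em_rem x e0 b (S M) s (shiftpt c y k)) - usum (fun k => x ^ k * em_rem x e0 b M s (shiftpt c y k)) = u 0%nat).
  { rewrite <- usum_minus by auto. rewrite (usum_ext _ (fun k => -(1) * (u (S k) - u k))) by auto.
    rewrite usum_scal, telescoping; auto. ring.
    apply (Clim_ext (fun k => b (S M) * (x ^ k * dpow (S M) s (shiftpt c y k)))).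
    - exists 0%nat. intros; unfold u; ring.
    - replace (RtoC 0) with (b (S M) * 0) by ring. apply Clim_mult; [apply Clim_const|]. apply dpow_limit_zero.
      rewrite S_INR. assert (Rabs (Re s) <= Cmod s) by apply re_le_Cmod. apply Rabs_le_between in H. lra. }
  rewrite (csum_S _ (S M)). unfold u in U. simpl Cpow in U.
  set (P := usum _) in *. set (Q := usum (fun k => x ^ k * em_rem x e0 b M s (shiftpt c y k))) in *.
  replace P with (P - Q + Q) by ring. rewrite U. ring.
Qed.

Lemma em_value_stable (M M' : nat) (s : C) (y : R) : (e0 <= M)%nat -> Cmod s + 1 <= INR M -> (M <= M')%nat -> em_value M' s y = em_value M s y.
Proof.
  intros He HM. induction 1 as [|M' HM' IH]; auto. rewrite em_value_S, IH; auto. lia. apply le_INR in HM'. lra.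
Qed.

Definition em_order (s : C) : nat := (e0 + Z.to_nat (up (Cmod s)) + 1)%nat.

Lemma em_order_spec (s : C) : (e0 <= em_order s)%nat /\ Cmod s + 1 <= INR (em_order s) /\
  forall s', Cmod s' <= Cmod s + 1 -> (em_order s' <= em_order s + 1)%nat.
Proof.
  unfold em_order. assert (H := archimed (Cmod s)). assert (H0 := Cmod_ge_0 s).
  assert (P : (0 <= up (Cmod s))%Z) by (apply le_IZR; lra). split; [lia|split].
  - rewrite !plus_INR, (INR_IZR_INZ (Z.to_nat _)), Z2Nat.id by auto. generalize (pos_INR e0). simpl (INR 1). lra.
  - intros s' Hs'. assert (H' := archimed (Cmod s')).
    assert (up (Cmod s') < up (Cmod s) + 2)%Z by (apply lt_IZR; rewrite plus_IZR; lra).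
    lia.
Qed.

Definition em_fun (s : C) (y : R) : C := em_value (em_order s) s y.

(** The order [em_order s] varies with [s]; by stability it can be replaced on the unit disc around
    [s0] by the single order [M], and there the remainders form a uniformly dominated series of
    entire functions. *)
Lemma entire_em_fun (y : R) : entire (fun s => em_fun s y).
Proof.
  intros s0. destruct (em_order_spec s0) as [O1 [O2 O3]].
  set (M := (em_order s0 + 1)%nat).
  apply (holo_ext_loc (fun s => em_value M s y) _ s0 1); [lra| |].
  - intros h Hh. unfold em_fun. destruct (em_order_spec (s0 + h)) as [P1 [P2 P3]].
    apply em_value_stable; auto. apply O3. eapply Rle_trans; [apply Cmod_triangle|]. lra.
  - unfold em_value. apply (holo_plus (fun s => usum _) (fun s => - csum _ (S M))).
    + destruct (em_rem_dominated M (Cmod s0 + 1)) as [K [HK0 HK]].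
      * unfold M; lia.
      * generalize (Cmod_ge_0 s0); lra.
      * unfold M. rewrite plus_INR. simpl (INR 1). lra.
      * apply (usum_holomorphic (fun k s => x ^ k * em_rem x e0 b M s (shiftpt c y k)) (fun k : nat => K * Rpower (INR k + 1) (- (2)))%R s0 1); [lra| | |].
        -- intros k. apply entire_scal, entire_em_rem.
        -- apply (summ_le _ (fun k : nat => Rpower (INR k + 1) (- (2))) K); auto. intros; lra. apply summ_p_series. lra.
        -- intros k h Hh. apply HK. eapply Rle_trans; [apply Cmod_triangle|]. lra.
    + apply entire_opp, entire_csum. intros i. apply entire_scal, entire_dpow.
Qed.

(** When the original series converges absolutely, the corrections telescope and vanish at infinity;
    the latter uses [0 < Re s], as the correction of order 0 decays only like [k ^ (- Re s)]. *)
Lemma em_fun_series (s : C) (y : R) : 0 < Re s -> 1 < Re s + INR e0 ->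
  abs_summable (fun k => x ^ k * dpow e0 s (shiftpt c y k)) /\ em_fun s y = usum (fun k => x ^ k * dpow e0 s (shiftpt c y k)).
Proof.
  intros Hs Hs1. destruct (em_order_spec s) as [O1 [O2 _]]. unfold em_fun. set (M := em_order s) in *.
  assert (A : abs_summable (fun k => x ^ k * dpow e0 s (shiftpt c y k))).
  { destruct (dpow_decay e0 s y) as [K [HK0 HK]].
    apply (summ_le (fun k => Cmod _) (fun k : nat => Rpower (c + INR k) (- (Re s + INR e0))) K); auto.
    - intros k. rewrite Cmod_mult, Cmod_pow, Hx, pow1, Rmult_1_l. apply HK. lra.
    - now apply summ_power. }
  split; auto. assert (A1 := em_rem_summable M s y O1 O2).
  set (u := fun k => csum (fun n => b n * (x ^ k * dpow n s (shiftpt c y k))) (S M)).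
  assert (Hu : forall k, u k = x ^ k * csum (fun n => b n * dpow n s (shiftpt c y k)) (S M)).
  { intros k. unfold u. rewrite <- csum_scal. apply csum_ext. intros; ring. }
  assert (E : forall k, x ^ k * em_rem x e0 b M s (shiftpt c y k) = x ^ k * dpow e0 s (shiftpt c y k) - (u (S k) - u k)).
  { intros k. rewrite !Hu. unfold em_rem. rewrite shiftpt_S. simpl Cpow. ring. }
  assert (A3 : abs_summable (fun k => u (S k) - u k)).
  { apply (abs_summable_ext (fun k => x ^ k * dpow e0 s (shiftpt c y k) - x ^ k * em_rem x e0 b M s (shiftpt c y k))).
    - intros k. rewrite E. ring.
    - now apply abs_summable_minus. }
  unfold em_value. rewrite (usum_ext _ _ E), usum_minus, telescoping; auto.
  - rewrite Hu. simpl Cpow. ring.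
  - unfold u. clear - Hs Hx Hc. induction (S M) as [|m IH].
    + apply (Clim_const 0).
    + apply (Clim_ext (fun k => csum (fun n => b n * (x ^ k * dpow n s (shiftpt c y k))) m + b m * (x ^ k * dpow m s (shiftpt c y k)))).
      { exists 0%nat. intros k _. now rewrite csum_S. }
      replace (RtoC 0) with (0 + b m * 0) by ring. apply Clim_plus; auto. apply Clim_mult; [apply Clim_const|].
      apply dpow_limit_zero. generalize (pos_INR m). lra.
Qed.

(** Continuity in the shift for fixed [s], outside the domain of convergence as well; this is what
    makes the passage from the upper half-plane to the real line possible. *)
Lemma em_fun_limit (s : C) (y : nat -> R) (y0 : R) : Clim (fun n => RtoC (y n)) y0 -> Clim (fun n => em_fun s (y n)) (em_fun s y0).
Proof.
  intros Hy. destruct (em_order_spec s) as [O1 [O2 _]]. unfold em_fun. set (M := em_order s) in *.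
  assert (Hsh : forall k, Clim (fun n => shiftpt c (y n) k) (shiftpt c y0 k)).
  { intros k. apply (Clim_ext (fun n => RtoC (c + INR k) + Ci * y n)).
    - exists 0%nat. intros. unfold shiftpt, Cplus, Cmult, RtoC, Ci; simpl. f_equal; ring.
    - replace (shiftpt c y0 k) with (RtoC (c + INR k) + Ci * y0) by (unfold shiftpt, Cplus, Cmult, RtoC, Ci; simpl; f_equal; ring).
      apply Clim_plus. apply Clim_const. apply Clim_mult; auto. apply Clim_const. }
  assert (HD : forall i k, Clim (fun n => dpow i s (shiftpt c (y n) k)) (dpow i s (shiftpt c y0 k))).
  { intros i k. unfold dpow. apply Clim_mult; [apply Clim_const|]. apply Clim_pw; auto. rewrite Re_shiftpt. generalize (pos_INR k); lra. }
  assert (HS : forall k m, Clim (fun n => csum (fun i => b i * dpow i s (shiftpt c (y n) k)) m) (csum (fun i => b i * dpow i s (shiftpt c y0 k)) m)).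
  { intros k m. induction m as [|m IH]. apply (Clim_const 0).
    rewrite csum_S. apply (Clim_ext (fun n => csum (fun i => b i * dpow i s (shiftpt c (y n) k)) m + b m * dpow m s (shiftpt c (y n) k))).
    { exists 0%nat. intros n _. now rewrite csum_S. }
    apply Clim_plus; auto. apply Clim_mult; auto. apply Clim_const. }
  unfold em_value. apply Clim_plus.
  - destruct (em_rem_dominated M (Cmod s) O1 (Cmod_ge_0 s) O2) as [K [HK0 HK]].
    apply (tannery (fun n k => x ^ k * em_rem x e0 b M s (shiftpt c (y n) k)) (fun k => x ^ k * em_rem x e0 b M s (shiftpt c y0 k)) (fun k : nat => K * Rpower (INR k + 1) (- (2)))%R).
    + apply (summ_le _ (fun k : nat => Rpower (INR k + 1) (- (2))) K); auto. intros; lra. apply summ_p_series. lra.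
    + intros n k. apply HK. lra.
    + intros k. apply Clim_mult; [apply Clim_const|]. unfold em_rem. apply Clim_plus; [apply Clim_plus|]; auto.
      apply (Clim_ext (fun n => (- x) * csum (fun i => b i * dpow i s (shiftpt c (y n) (S k))) (S M))).
      { exists 0%nat. intros n _. rewrite shiftpt_S. ring. }
      rewrite <- shiftpt_S. replace (- (x * csum (fun n => b n * dpow n s (shiftpt c y0 (S k))) (S M))) with ((- x) * csum (fun n => b n * dpow n s (shiftpt c y0 (S k))) (S M)) by ring.
      apply Clim_mult; auto. apply Clim_const.
  - apply (Clim_ext (fun n => (-(1)) * csum (fun i => b i * dpow i s (shiftpt c (y n) 0)) (S M))).
    { exists 0%nat. intros. ring. }
    replace (- csum (fun n => b n * dpow n s (shiftpt c y0 0)) (S M)) with ((-(1)) * csum (fun n => b n * dpow n s (shiftpt c y0 0)) (S M)) by ring.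
    apply Clim_mult; auto. apply Clim_const.
Qed.

End EM.

(** * Meromorphic continuation of the one-sided series *)

Lemma cder_inv (z : C) : z <> 0 -> cder (fun w => / w) z (- (/ z * / z)).
Proof.
  intros Hz eps He. set (m := Cmod z). assert (Hm : 0 < m) by now apply Cmod_gt_0.
  exists (Rmin (m / 2) (eps * m * m * m / 2)%R). split.
  { apply Rmin_pos; [lra|]. assert (0 < eps * m * m * m) by (repeat apply Rmult_lt_0_compat; auto). lra. }
  intros h Hh. assert (L1 := Rlt_le_trans _ _ _ Hh (Rmin_l _ _)). assert (L2 := Rlt_le_trans _ _ _ Hh (Rmin_r _ _)).
  assert (M : m / 2 <= Cmod (z + h)).
  { generalize (Cmod_triangle_minus (z + h) h). replace (z + h - h) with z by ring. fold m. lra. }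
  assert (NZ : z + h <> 0) by (apply Cmod_gt_0; lra).
  replace (/ (z + h) - / z - - (/ z * / z) * h) with (h * h / ((z + h) * (z * z))) by (field; auto).
  rewrite Cmod_div, !Cmod_mult by (repeat apply Cmult_neq_0; auto). fold m.
  assert (Hc := Cmod_ge_0 h). apply Rmult_le_reg_r with (Cmod (z + h) * (m * m))%R.
  { apply Rmult_lt_0_compat; [lra|]. now apply Rmult_lt_0_compat. }
  unfold Rdiv. rewrite Rmult_assoc, Rinv_l, Rmult_1_r.
  2:{ apply Rgt_not_eq. apply Rmult_lt_0_compat; [lra|]. now apply Rmult_lt_0_compat. }
  apply Rle_trans with ((eps * m * m * m / 2) * Cmod h)%R. apply Rmult_le_compat_r; lra.
  replace (eps * Cmod h * (Cmod (z + h) * (m * m)))%R with ((eps * m * m * Cmod h) * Cmod (z + h))%R by ring.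
  replace (eps * m * m * m / 2 * Cmod h)%R with ((eps * m * m * Cmod h) * (m / 2))%R by field.
  apply Rmult_le_compat_l; auto. apply Rmult_le_pos; auto. left. repeat apply Rmult_lt_0_compat; auto.
Qed.

Lemma holo_inv (f : C -> C) (s : C) : holomorphic_at f s -> f s <> 0 -> holomorphic_at (fun z => / f z) s.
Proof.
  intros Hf Hn. apply (holo_comp f (fun w => / w)); auto. apply holomorphic_at_cder. eexists. now apply cder_inv.
Qed.

Lemma Cmult_cancel (a x y : C) : a <> 0 -> a * x = a * y -> x = y.
Proof.
  intros Ha H. replace x with (/ a * (a * x)) by (field; auto). rewrite H. field. auto.
Qed.

Lemma Cminus_neq_0 (a b : C) : a <> b -> a - b <> 0.
Proof. intros H K. apply H. replace a with (a - b + b) by ring. rewrite K. ring. Qed.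

(** Continuity fills in the single point at which an identity between continuations cannot be
    obtained directly. *)
Lemma holo_agree (f g : C -> C) (s : C) (r : R) : 0 < r -> holomorphic_at f s -> holomorphic_at g s ->
  (forall h : C, h <> 0 -> Cmod h < r -> f (s + h) = g (s + h)) -> f s = g s.
Proof.
  intros Hr Hf Hg E. apply Cmod_zero_eq. intros eps He.
  destruct (holo_cont f s Hf (eps / 2)%R) as [d1 [P1 H1]]; [lra|].
  destruct (holo_cont g s Hg (eps / 2)%R) as [d2 [P2 H2]]; [lra|].
  set (d := Rmin r (Rmin d1 d2)). assert (Hd : 0 < d) by (repeat apply Rmin_pos; auto).
  assert (D1 : d <= r) by apply Rmin_l. assert (D2 : d <= d1) by (eapply Rle_trans; [apply Rmin_r|apply Rmin_l]).
  assert (D3 : d <= d2) by (eapply Rle_trans; [apply Rmin_r|apply Rmin_r]).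
  set (h := RtoC (d / 2)). assert (Hh : Cmod h = (d / 2)%R) by (unfold h; rewrite Cmod_R, Rabs_pos_eq; lra).
  assert (Hh0 : h <> 0) by (apply Cmod_gt_0; lra).
  specialize (H1 h ltac:(lra)). specialize (H2 h ltac:(lra)). specialize (E h Hh0 ltac:(lra)).
  rewrite E in H1. rewrite Cmod_minus_sym in H1.
  replace (f s - g s) with ((f s - g (s + h)) + (g (s + h) - g s)) by ring.
  eapply Rle_trans; [apply Cmod_triangle|]. lra.
Qed.

(** The continuation of the sum of [x ^ k (c + k + i y) ^ (- s)], with the possible simple pole at
    [s = 1] expressed through the entire function [(s - 1) * P s y] to which the identity theorem
    can be applied. *)
Record lerch_family (x : C) (c : R) (P : C -> R -> C) : Prop := {
  lf_entire : forall y, exists g, entire g /\ forall s : C, s <> 1 -> g s = (s - 1) * P s y;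
  lf_holo : forall (y : R) (s : C), s <> 1 \/ x <> 1 -> holomorphic_at (fun s => P s y) s;
  lf_series : forall (y : R) (s : C), 1 < Re s -> abs_summable (fun k => x ^ k * pw (shiftpt c y k) (- s)) /\
     P s y = usum (fun k => x ^ k * pw (shiftpt c y k) (- s));
  lf_limit : forall (s : C) (y : nat -> R) (y0 : R), s <> 1 \/ x <> 1 -> Clim (fun n => RtoC (y n)) y0 ->
     Clim (fun n => P s (y n)) (P s y0) }.

Lemma lerch_family_exists (x : C) (c : R) : Cmod x = 1%R -> 0 < c <= 1 -> exists P, lerch_family x c P.
Proof.
  intros Hx Hc. destruct (classic (x = 1)) as [E1|N1].
  - destruct em_coeffs_one as [b Hb]. rewrite <- E1 in Hb.
    exists (fun s y => em_fun x 1 b c (s - 1) y * / (1 - s)).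
    assert (Ent : forall y, entire (fun s => em_fun x 1 b c (s - 1) y)).
    { intros y. apply (entire_comp (fun s => s - 1) (fun s => em_fun x 1 b c s y)).
      apply entire_minus. apply entire_id. apply entire_const. now apply entire_em_fun. }
    constructor.
    + intros y. exists (fun s => - em_fun x 1 b c (s - 1) y). split. now apply entire_opp.
      intros s Hs. field. apply Cminus_neq_0. auto.
    + intros y s [Hs|Hs]; [|contradiction]. apply (holo_mult (fun s => em_fun x 1 b c (s - 1) y) (fun s => / (1 - s))). apply Ent.
      apply (holo_inv (fun s => 1 - s)). apply entire_one_minus.
      apply Cminus_neq_0. auto.
    + intros y s Hs.
      assert (Hs1 : 0 < Re (s - 1)) by (destruct s; unfold Re in *; simpl in *; lra).
      assert (NZ : 1 - s <> 0). { apply Cminus_neq_0. intros K. rewrite <- K in Hs. unfold Re in Hs; simpl in Hs. lra. }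
      destruct (em_fun_series x 1 b c Hx Hb Hc (s - 1) y Hs1 ltac:(simpl (INR 1); lra)) as [A E].
      assert (ED : forall k, x ^ k * dpow 1 (s - 1) (shiftpt c y k) = (1 - s) * (x ^ k * pw (shiftpt c y k) (- s))).
      { intros k. unfold dpow. simpl falling. simpl (INR 1). simpl (INR 0).
        replace (- (s - 1) - 1) with (- s) by ring. ring. }
      assert (A2 : abs_summable (fun k => x ^ k * pw (shiftpt c y k) (- s))).
      { apply (abs_summable_ext (fun k => / (1 - s) * (x ^ k * dpow 1 (s - 1) (shiftpt c y k)))).
        - intros k. rewrite ED. field. auto.
        - now apply abs_summable_scal. }
      split; auto. rewrite E. rewrite (usum_ext _ _ ED), usum_scal by auto. field. auto.
    + intros s y y0 [Hs|Hs] Hy; [|contradiction]. apply Clim_mult; [|apply Clim_const].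
      now apply em_fun_limit.
  - destruct (em_coeffs_generic x N1) as [b Hb].
    exists (fun s y => em_fun x 0 b c s y). constructor.
    + intros y. exists (fun s => (s - 1) * em_fun x 0 b c s y). split; auto.
      apply (entire_mult (fun s => s - 1)). apply entire_minus. apply entire_id. apply entire_const. now apply entire_em_fun.
    + intros y s _. now apply entire_em_fun.
    + intros y s Hs. destruct (em_fun_series x 0 b c Hx Hb Hc s y ltac:(lra) ltac:(simpl (INR 0); lra)) as [A E].
      assert (ED : forall k, x ^ k * dpow 0 s (shiftpt c y k) = x ^ k * pw (shiftpt c y k) (- s)).
      { intros k. unfold dpow. simpl falling. simpl (INR 0). replace (- s - 0) with (- s) by ring. ring. }
      split. now apply (abs_summable_ext _ _ ED). rewrite E. now apply usum_ext.
    + intros s y y0 _ Hy. now apply em_fun_limit.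
Qed.

Lemma e_neq_1 (k : R) : ~ is_int k -> e k <> 1.
Proof.
  intros Hk. set (n := Int_part k). destruct (base_Int_part k) as [B1 B2]. fold n in B1, B2.
  assert (NE : IZR n <> k) by (intros E; apply Hk; now exists n).
  replace (RtoC k) with (IZR n + RtoC ((k - IZR n) / 1)).
  - rewrite e_plus, e_Z, Cmult_1_l. apply e_root_neq_1. lra.
  - rewrite <- RtoC_plus. f_equal. field.
Qed.

Definition lphi (r : C) (kappa y x : R) : C := e (x * kappa)%R * pw (x, y) (- r).

Record lerch_cont (gamma kappa : R) (P : C -> R -> C) : Prop := {
  lc_entire : forall y, exists g, entire g /\ forall s : C, s <> 1 -> g s = (s - 1) * P s y;
  lc_holo : forall (y : R) (s : C), s <> 1 \/ ~ is_int kappa -> holomorphic_at (fun s => P s y) s;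
  lc_series : forall (y : R) (s : C), 1 < Re s -> abs_summable (zterm gamma (lphi s kappa y)) /\ P s y = usum (zterm gamma (lphi s kappa y));
  lc_limit : forall (s : C) (y : nat -> R) (y0 : R), s <> 1 -> Clim (fun n => RtoC (y n)) y0 ->
     Clim (fun n => P s (y n)) (P s y0) }.

Lemma lerch_cont_exists (gamma kappa : R) : exists P, lerch_cont gamma kappa P.
Proof.
  destruct (lerch_family_exists (e kappa) (base gamma) (Cmod_e_R kappa) (base_bounds gamma)) as [P [H1 H2 H3 H4]].
  (* The series starts at [base gamma], so its characters are [e0] times the powers of [e kappa]. *)
  set (e0 := e (base gamma * kappa)%R).
  exists (fun s y => e0 * P s y). constructor.
  - intros y. destruct (H1 y) as [g [Hg E]]. exists (fun s => e0 * g s). split. now apply entire_scal.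
    intros s Hs. rewrite E by auto. ring.
  - intros y s Hs. apply (holo_mult (fun _ => e0)). apply entire_const. apply H2. destruct Hs; [now left|right; now apply e_neq_1].
  - intros y s Hs. destruct (H3 y s Hs) as [A E].
    assert (ET : forall n : nat, lphi s kappa y (base gamma + INR n) = e0 * (e kappa ^ n * pw (shiftpt (base gamma) y n) (- s))).
    { intros n. unfold lphi, e0, shiftpt. rewrite e_pow, Cmult_assoc, <- e_plus. do 2 f_equal.
      rewrite <- RtoC_mult, <- RtoC_plus. f_equal. ring. }
    assert (A2 : abs_summable (fun n : nat => lphi s kappa y (base gamma + INR n))).
    { apply (abs_summable_ext (fun n => e0 * (e kappa ^ n * pw (shiftpt (base gamma) y n) (- s)))). intros; symmetry; apply ET.
      now apply abs_summable_scal. }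
    split. now apply zterm_summable. rewrite zterm_usum by auto. rewrite (usum_ext _ _ ET), usum_scal by auto. now rewrite E.
  - intros s y y0 Hs Hy. apply Clim_mult; [apply Clim_const|]. apply H4; auto.
Qed.

(** The continued one-sided series with base points [gamma + k + i y]; at [y = 0] it is [psi]
    wherever the latter is determined. *)
Definition Psi (gamma kappa : R) : C -> R -> C := proj1_sig (constructive_indefinite_description _ (lerch_cont_exists gamma kappa)).

Lemma Psi_spec (gamma kappa : R) : lerch_cont gamma kappa (Psi gamma kappa).
Proof. apply (proj2_sig (constructive_indefinite_description _ (lerch_cont_exists gamma kappa))). Qed.

Lemma zterm_lphi_0 (r : C) (gamma kappa : R) (k : Z) : zterm gamma (lphi r kappa 0) k = lerch_term r gamma kappa k.
Proof.
  unfold zterm, lerch_term, lphi. destruct (Rlt_dec _ _) as [H|H]; auto. f_equal.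
  - now rewrite RtoC_mult, RtoC_plus.
  - change ((gamma + IZR k)%R, 0%R) with (RtoC (gamma + IZR k)). apply pw_RtoC. lra.
Qed.

Lemma zterm_ext (g : R) (phi psi : R -> C) : (forall x, 0 < x -> phi x = psi x) -> forall k, zterm g phi k = zterm g psi k.
Proof. intros H k. unfold zterm. destruct (Rlt_dec _ _) as [K|K]; auto. apply H. lra. Qed.

Lemma Psi_is_lerch (gamma kappa : R) : is_lerch gamma kappa (fun r => Psi gamma kappa r 0).
Proof.
  destruct (Psi_spec gamma kappa) as [H1 H2 H3 H4]. constructor.
  - intros r Hr. destruct (H3 0%R r Hr) as [A E]. rewrite E. apply (is_usum_ext (zterm gamma (lphi r kappa 0))).
    apply zterm_lphi_0. now apply usum_correct.
  - intros r Hr. now apply (H2 0%R).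
  - apply H1.
Qed.

(** Multiplied by [r - 1], both candidates are entire and agree near 3. At [r = 1], when [kappa] is
    not an integer, they agree by continuity. *)
Lemma is_lerch_unique (gamma kappa : R) (f1 f2 : C -> C) : is_lerch gamma kappa f1 -> is_lerch gamma kappa f2 ->
  forall r : C, r <> 1 \/ ~ is_int kappa -> f1 r = f2 r.
Proof.
  intros [S1 H1 [g1 [G1 E1]]] [S2 H2 [g2 [G2 E2]]].
  assert (EG : forall r, g1 r = g2 r).
  { apply (identity_theorem_eq g1 g2 3 1); auto; [lra|]. intros h Hh.
    assert (Hr : 1 < Re (3 + h)).
    { assert (Rabs (Re h) <= Cmod h) by apply re_le_Cmod. apply Rabs_le_between in H. destruct h. unfold Re in *; simpl in *. lra. }
    assert (N : 3 + h <> 1) by (intros K; rewrite K in Hr; unfold Re in Hr; simpl in Hr; lra).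
    rewrite E1, E2 by auto. f_equal. apply (is_usum_unique2 _ _ _ (S1 _ Hr) (S2 _ Hr)). }
  assert (EF : forall r : C, r <> 1 -> f1 r = f2 r).
  { intros r Hr. assert (NZ := Cminus_neq_0 _ _ Hr). replace (f1 r) with (/ (r - 1) * ((r - 1) * f1 r)) by (field; auto).
    rewrite <- E1, EG, E2 by auto. field. auto. }
  intros r Hr. destruct (classic (r = 1)) as [E|N]; [|auto].
  apply (holo_agree f1 f2 r 1); [lra|auto|auto|]. intros h Hh _. apply EF. rewrite E. intros K. apply Hh.
  replace h with (1 + h - 1) by ring. rewrite K. ring.
Qed.

Lemma psi_eq (gamma kappa : R) (r : C) : r <> 1 \/ ~ is_int kappa -> psi r gamma kappa = Psi gamma kappa r 0.
Proof.
  intros Hr. unfold psi. apply (iota_unique (V := C_CompleteNormedModule)).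
  - intros v [f [Hf <-]]. apply (is_lerch_unique gamma kappa f (fun r => Psi gamma kappa r 0)); auto. apply Psi_is_lerch.
  - exists (fun r => Psi gamma kappa r 0). split; auto. apply Psi_is_lerch.
Qed.

(** * The functional equation *)

Lemma one_minus_neq_1 (s : C) : s <> 0 -> 1 - s <> 1.
Proof. intros H K. apply H. replace s with (1 - (1 - s)) by ring. rewrite K. ring. Qed.

Lemma PI_2_pos : 0 < 2 * PI.
Proof. generalize PI_RGT_0. lra. Qed.

(** For [y > 0] the number [- i (x + i y)] has positive real part. It is compared with [x + i y]
    when [x > 0], and with [- x - i y] when [x < 0]; this is why the second family in the functional
    equation appears with [- alpha], [- mu] and the shift [- y]. *)
Lemma Clog_rot_right (x y : R) : 0 < x -> 0 < y -> Clog (- (Ci * (x, y))) = Clog (x, y) - PI * Ci / 2.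
Proof.
  intros Hx Hy. unfold Clog. rewrite Cmod_opp, Cmod_Ci_mult.
  replace (Im (- (Ci * (x, y))) / Re (- (Ci * (x, y))))%R with (- / (y / x))%R.
  - rewrite atan_opp, atan_inv by (apply Rdiv_lt_0_compat; auto). unfold Re, Im; cbn [fst snd].
    replace (PI * Ci / 2) with ((0%R, (PI / 2)%R) : C).
    + unfold Cminus, Cplus, Copp; cbn [fst snd]. f_equal; ring.
    + unfold Cdiv, Cinv, Cmult, RtoC, Ci; simpl. f_equal; field.
  - unfold Re, Im, Cmult, Copp, Ci; simpl. field. lra.
Qed.

Lemma Clog_rot_left (x y : R) : x < 0 -> 0 < y -> Clog (- (Ci * (x, y))) = Clog (- x, - y)%R + PI * Ci / 2.
Proof.
  intros Hx Hy. unfold Clog. rewrite Cmod_opp, Cmod_Ci_mult.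
  replace (Cmod (- x, - y)%R) with (Cmod (x, y)) by (rewrite <- Cmod_opp; reflexivity).
  replace (Im (- (Ci * (x, y))) / Re (- (Ci * (x, y))))%R with (/ (y / (- x)))%R.
  - rewrite atan_inv by (apply Rdiv_lt_0_compat; lra). unfold Re, Im; cbn [fst snd].
    replace (- y / - x)%R with (- (y / - x))%R by (field; lra). rewrite atan_opp.
    replace (PI * Ci / 2) with ((0%R, (PI / 2)%R) : C).
    + unfold Cplus; cbn [fst snd]. f_equal; ring.
    + unfold Cdiv, Cinv, Cmult, RtoC, Ci; simpl. f_equal; field.
  - unfold Re, Im, Cmult, Copp, Ci; simpl. field. lra.
Qed.

Lemma pw_rot_scale (W s : C) : 0 < Re (- (Ci * W)) -> pw (- (2 * PI * Ci * W)) (- s) = Rcpow (2 * PI) (- s) * pw (- (Ci * W)) (- s).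
Proof.
  intros H. rewrite <- pw_scale by (auto using PI_2_pos). f_equal. rewrite RtoC_mult. ring.
Qed.

Lemma Re_rot1 (x y : R) : Re (- (Ci * (x, y))) = y.
Proof. unfold Re, Cmult, Copp, Ci; simpl. ring. Qed.

Lemma pw_rot_right (x y : R) (s : C) : 0 < x -> 0 < y ->
  pw (- (Ci * (x, y))) (- s) = Cexp (PI * Ci * s / 2) * pw (x, y) (- s).
Proof. intros Hx Hy. unfold pw. rewrite Clog_rot_right, <- Cexp_plus by auto. f_equal. field. Qed.

Lemma pw_rot_left (x y : R) (s : C) : x < 0 -> 0 < y ->
  pw (- (Ci * (x, y))) (- s) = Cexp (- (PI * Ci * s / 2)) * pw (- x, - y)%R (- s).
Proof. intros Hx Hy. unfold pw. rewrite Clog_rot_left, <- Cexp_plus by auto. f_equal. field. Qed.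

(** Turns the factor [delta a] of the statement into a summand of a sum over [Z], so that the three
    signs of [a + j] can be treated termwise. *)
Definition zero_term (a : R) (v : C) (j : Z) : C := if Req_EM_T (a + IZR j) 0 then v else 0.

Lemma zero_term_sum (a : R) (v : C) : abs_summable (zero_term a v) /\ usum (zero_term a v) = delta a * v.
Proof.
  unfold delta. destruct (Req_EM_T (IZR (Int_part a)) a) as [E|N].
  - set (j0 := (- Int_part a)%Z).
    assert (Z : forall j, ~ In j (j0 :: nil) -> zero_term a v j = 0).
    { intros j Hj. unfold zero_term. destruct (Req_EM_T _ _) as [K|K]; auto. exfalso. apply Hj. left. unfold j0.
      rewrite <- E, <- plus_IZR in K. apply eq_IZR in K. lia. }
    assert (ND : NoDup (j0 :: nil)) by (constructor; [intros []|constructor]).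
    assert (V : zero_term a v j0 = v).
    { unfold zero_term, j0. rewrite opp_IZR, E. destruct (Req_EM_T _ _) as [K|K]; auto. exfalso; apply K; ring. }
    split.
    + exists (Cmod v). intros l Hl. change (rsum (fun t => Cmod (zero_term a v t)) l <= Cmod v).
      apply Rle_trans with (rsum (fun t => Cmod (zero_term a v t)) (j0 :: nil)); [|rewrite rsum_cons, V; unfold rsum; simpl; lra].
      destruct (classic (In j0 l)) as [I|I].
      * destruct (NoDup_split (j0 :: nil) l ND Hl) as [r [Nr [Dr P]]]. { intros t [<-|[]]. auto. }
        rewrite (rsum_perm _ _ _ P), rsum_app.
        assert (rsum (fun t => Cmod (zero_term a v t)) r = 0%R); [|lra].
        clear - Dr Z. induction r as [|t r IH]; [reflexivity|]. rewrite rsum_cons, IH, Z, Cmod_0. ring. apply Dr. now left. intros u Hu. apply Dr. now right.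
      * apply Rle_trans with 0%R; [|apply (rsum_nonneg (fun t => Cmod (zero_term a v t))); intros; apply Cmod_ge_0].
        clear Hl. induction l as [|t l IH]; [unfold rsum; simpl; lra|]. rewrite rsum_cons, Z, Cmod_0, Rplus_0_l.
        apply IH. intros K; apply I; now right. intros [K|[]]. apply I. left; auto.
    + rewrite (usum_eq _ _ (is_usum_finite_support _ (j0 :: nil) ND Z)). rewrite finite_sum_cons, V. unfold finite_sum; simpl. ring.
  - assert (Z : forall j, zero_term a v j = 0).
    { intros j. unfold zero_term. destruct (Req_EM_T _ _) as [K|K]; auto. exfalso. apply N.
      replace a with (IZR (- j)) by (rewrite opp_IZR; lra).
      f_equal. assert (H := base_Int_part (IZR (- j))). destruct H as [H1 H2].
      assert (Int_part (IZR (- j)) <= - j)%Z by (now apply le_IZR). assert (- j - 1 < Int_part (IZR (- j)))%Z by (apply lt_IZR; rewrite minus_IZR; lra). lia. }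
    split.
    + exists 0%R. intros l _. induction l as [|t l IH]; simpl; [lra|]. rewrite Z, Cmod_0. lra.
    + rewrite usum_zero by auto. ring.
Qed.

Lemma usum_opp_index (f : Z -> C) : abs_summable f -> abs_summable (fun j => f (- j)%Z) /\ usum (fun j => f (- j)%Z) = usum f.
Proof.
  intros A. assert (A' : abs_summable (fun j => f (- j)%Z)) by (apply (abs_summable_comp_inj Z.opp); auto; intros; lia).
  split; auto. symmetry. apply (usum_reindex Z.opp); auto. intros; lia. intros j _. exists (- j)%Z. lia.
Qed.

(** Lipschitz's formula at [w = alpha + i y], its bilateral sum divided according to the sign of
    [alpha + j]. The index with [alpha + j = 0] contributes the power of [y]. *)
Lemma functional_equation_upper (alpha mu y : R) (s : C) : 0 < y -> 1 < Re s ->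
  Cexp (PI * Ci * s / 2) * Psi alpha mu s y + Cexp (- (PI * Ci * s / 2)) * Psi (- alpha) (- mu) s (- y) + delta alpha * Rcpow y (- s)
  = e (alpha * mu)%R * (Rcpow (2 * PI) s * rGamma s) * usum (zterm (- mu) (qphi s (alpha, y))).
Proof.
  intros Hy Hs.
  destruct (lc_series _ _ _ (Psi_spec alpha mu) y s Hs) as [A1 E1].
  destruct (lc_series _ _ _ (Psi_spec (- alpha) (- mu)) (- y)%R s Hs) as [A2 E2].
  destruct (usum_opp_index _ A2) as [A2' E2'].
  destruct (zero_term_sum alpha (Rcpow y (- s))) as [A3 E3].
  destruct (lipschitz s (alpha, y) mu Hs Hy) as [AL EL].
  assert (T : forall j, e (alpha * mu)%R * Rcpow (2 * PI) s * (e (IZR j * mu)%R * pw (- (2 * PI * Ci * (IZR j + (alpha, y)))) (- s)) =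
    Cexp (PI * Ci * s / 2) * zterm alpha (lphi s mu y) j + Cexp (- (PI * Ci * s / 2)) * zterm (- alpha) (lphi s (- mu) (- y)) (- j) + zero_term alpha (Rcpow y (- s)) j).
  { intros j. replace (IZR j + (alpha, y)) with (((alpha + IZR j)%R, y) : C) by (unfold Cplus, RtoC; simpl; f_equal; ring).
    rewrite pw_rot_scale by (rewrite Re_rot1; auto).
    set (x := (alpha + IZR j)%R).
    assert (EE : e (alpha * mu)%R * e (IZR j * mu)%R = e (x * mu)%R).
    { rewrite <- e_plus, <- RtoC_plus. do 2 f_equal. unfold x. ring. }
    assert (EP := Rcpow_cancel (2 * PI) s).
    transitivity (e (x * mu)%R * pw (- (Ci * (x, y))) (- s)).
    { rewrite <- EE. transitivity ((Rcpow (2 * PI) s * Rcpow (2 * PI) (- s)) * (e (alpha * mu)%R * e (IZR j * mu)%R * pw (- (Ci * (x, y))) (- s))); [ring|rewrite EP; ring]. }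
    unfold zterm, zero_term. rewrite opp_IZR, Ropp_involutive. fold x.
    destruct (Rlt_dec (- alpha) (IZR j)) as [H1|H1]; destruct (Rlt_dec alpha (- IZR j)) as [H2|H2]; destruct (Req_EM_T x 0) as [H3|H3]; try (exfalso; unfold x in *; lra).
    - rewrite pw_rot_right by (unfold x; lra). unfold lphi. ring.
    - rewrite pw_rot_left by (unfold x; lra). unfold lphi.
      replace (- alpha + - IZR j)%R with (- x)%R by (unfold x; ring).
      replace (- x * - mu)%R with (x * mu)%R by ring. ring.
    - rewrite H3, Rmult_0_l, e_0. replace (- (Ci * (0%R, y))) with (RtoC y). rewrite pw_RtoC by auto. ring.
      unfold Cmult, Copp, Ci, RtoC; simpl. f_equal; ring. }
  rewrite E1, E2, <- E2', <- E3.
  rewrite <- (usum_scal _ _ A1), <- (usum_scal _ _ A2').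
  rewrite <- usum_plus by (now apply abs_summable_scal).
  rewrite <- usum_plus by (auto; apply abs_summable_plus; now apply abs_summable_scal).
  rewrite <- (usum_ext _ _ T). rewrite usum_scal by auto. rewrite EL. ring.
Qed.

Lemma entire_exp_lin (a : C) : entire (fun s => Cexp (a * s)).
Proof. apply entire_Cexp. apply entire_scal, entire_id. Qed.

Lemma entire_phase : entire (fun s => Cexp (PI * Ci * s / 2)).
Proof. apply (entire_ext (fun s => Cexp (PI * Ci / 2 * s))). intros; f_equal; field. apply entire_exp_lin. Qed.

Lemma entire_phase_opp : entire (fun s => Cexp (- (PI * Ci * s / 2))).
Proof. apply (entire_ext (fun s => Cexp (- (PI * Ci / 2) * s))). intros; f_equal; field. apply entire_exp_lin. Qed.

Lemma entire_gamma_factor (c : C) : entire (fun s => c * (Rcpow (2 * PI) s * rGamma s)).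
Proof.
  apply entire_scal. apply (entire_mult (fun s => Rcpow (2 * PI) s)). apply entire_Rcpow, entire_id. apply entire_rGamma.
Qed.

(** The factor [s - 1] makes both sides entire, and near 3 all the series converge. *)
Lemma functional_equation_upper_all (alpha mu y : R) (s : C) : 0 < y -> s <> 1 ->
  Cexp (PI * Ci * s / 2) * Psi alpha mu s y + Cexp (- (PI * Ci * s / 2)) * Psi (- alpha) (- mu) s (- y) + delta alpha * Rcpow y (- s)
  = e (alpha * mu)%R * (Rcpow (2 * PI) s * rGamma s) * usum (zterm (- mu) (qphi s (alpha, y))).
Proof.
  intros Hy Hs1.
  destruct (lc_entire _ _ _ (Psi_spec alpha mu) y) as [g1 [G1 E1]].
  destruct (lc_entire _ _ _ (Psi_spec (- alpha) (- mu)) (- y)%R) as [g2 [G2 E2]].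
  set (L := fun s => Cexp (PI * Ci * s / 2) * g1 s + Cexp (- (PI * Ci * s / 2)) * g2 s + delta alpha * ((s - 1) * Rcpow y (- s))).
  set (Rr := fun s => (s - 1) * (e (alpha * mu)%R * (Rcpow (2 * PI) s * rGamma s) * usum (zterm (- mu) (qphi s (alpha, y))))).
  assert (EL : entire (fun s => s - 1)) by (apply entire_minus; [apply entire_id|apply entire_const]).
  assert (K : forall s, L s = Rr s).
  { apply (identity_theorem_eq L Rr 3 1); [| |lra|].
    - unfold L. apply entire_plus; [apply entire_plus|].
      + apply (entire_mult (fun s => Cexp (PI * Ci * s / 2)) g1); auto using entire_phase.
      + apply (entire_mult (fun s => Cexp (- (PI * Ci * s / 2))) g2); auto using entire_phase_opp.
      + apply entire_scal. apply (entire_mult (fun s => s - 1)); auto. apply entire_Rcpow, entire_opp, entire_id.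
    - unfold Rr. apply (entire_mult (fun s => s - 1)); auto. apply (entire_mult (fun s => e (alpha * mu)%R * (Rcpow (2 * PI) s * rGamma s))).
      apply entire_gamma_factor. apply entire_qseries. exact Hy.
    - intros h Hh. set (r := 3 + h). assert (Hr : 1 < Re r).
      { assert (Rabs (Re h) <= Cmod h) by apply re_le_Cmod. apply Rabs_le_between in H. unfold r. destruct h. unfold Re in *; simpl in *. lra. }
      assert (N : r <> 1) by (intros K; rewrite K in Hr; unfold Re in Hr; simpl in Hr; lra).
      unfold L, Rr. rewrite <- functional_equation_upper by auto. rewrite E1, E2 by auto. ring. }
  specialize (K s). unfold L, Rr in K. rewrite E1, E2 in K by auto. assert (NZ := Cminus_neq_0 _ _ Hs1).
  apply (Cmult_cancel (s - 1)); auto.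
  rewrite <- K. ring.
Qed.

Lemma zterm_bound_summ (g : R) (h : R -> R) : (forall x, 0 < x -> 0 <= h x) -> summ (fun n : nat => h (base g + INR n)%R) ->
  summ (fun k : Z => if Rlt_dec (- g) (IZR k) then h (g + IZR k)%R else 0%R).
Proof.
  intros Hh S.
  assert (A : abs_summable (zterm g (fun x => RtoC (h x)))).
  { apply zterm_summable. apply (abs_summable_RtoC (fun n : nat => h (base g + INR n)%R)); auto.
    intros n. apply Hh. generalize (base_bounds g) (pos_INR n). lra. }
  apply (summ_le _ (fun k => Cmod (zterm g (fun x => RtoC (h x)) k)) 1); [lra| |exact A].
  intros k. unfold zterm. destruct (Rlt_dec _ _) as [H|H]; [|rewrite Cmod_0; lra]. cbv beta. rewrite Cmod_R, Rmult_1_l. rewrite Rabs_pos_eq; [lra|]. apply Hh. lra.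
Qed.

(** [Re s < 0] acts twice: the power [y ^ (- s)] of the zero term tends to 0 with [y], and the
    one-sided series on the right is dominated by [x ^ (Re s - 1)], summable because [1 - Re s > 1].
    Its limit is the Lerch series at [1 - s]. *)
Lemma functional_equation_left (alpha mu : R) (s : C) : Re s < 0 ->
  Cexp (PI * Ci * s / 2) * Psi alpha mu s 0 + Cexp (- (PI * Ci * s / 2)) * Psi (- alpha) (- mu) s 0
  = e (alpha * mu)%R * (Rcpow (2 * PI) s * rGamma s) * Psi (- mu) alpha (1 - s) 0.
Proof.
  intros Hs. assert (N1 : s <> 1) by (intros K; rewrite K in Hs; unfold Re in Hs; simpl in Hs; lra).
  set (y := fun n : nat => (/ INR (S n))%R).
  assert (Hy : forall n, 0 < y n) by (intros n; apply Rinv_0_lt_compat, lt_0_INR; lia).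
  assert (Ly : Clim (fun n => RtoC (y n)) 0%R).
  { apply (Clim_RtoC _ _ 1). intros n. rewrite Rminus_0_r, Rabs_pos_eq by (left; apply Hy). unfold y. lra. }
  assert (Ly' : Clim (fun n => RtoC (- y n)%R) 0%R).
  { apply (Clim_RtoC _ _ 1). intros n. rewrite Rminus_0_r, Rabs_Ropp, Rabs_pos_eq by (left; apply Hy). unfold y. lra. }
  set (X := fun n => Cexp (PI * Ci * s / 2) * Psi alpha mu s (y n) + Cexp (- (PI * Ci * s / 2)) * Psi (- alpha) (- mu) s (- y n) + delta alpha * Rcpow (y n) (- s)).
  apply (Clim_unique X).
  - assert (L3 : Clim (fun n => Rcpow (y n) (- s)) 0).
    { apply (Clim_ext (fun n => Rcpow (INR (S n)) s)); [|now apply Clim_Rcpow_zero]. exists 0%nat. intros n _.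
      unfold Rcpow, y. rewrite ln_Rinv by (apply lt_0_INR; lia). rewrite RtoC_opp. f_equal. ring. }
    assert (L := Clim_plus _ _ _ _ (Clim_plus _ _ _ _
       (Clim_mult _ _ _ _ (Clim_const (Cexp (PI * Ci * s / 2))) (lc_limit _ _ _ (Psi_spec alpha mu) s y 0 N1 Ly))
       (Clim_mult _ _ _ _ (Clim_const (Cexp (- (PI * Ci * s / 2)))) (lc_limit _ _ _ (Psi_spec (- alpha) (- mu)) s (fun n => (- y n)%R) 0 N1 Ly')))
       (Clim_mult _ _ _ _ (Clim_const (delta alpha)) L3)).
    rewrite Cmult_0_r, Cplus_0_r in L. exact L.
  - assert (Hs1 : 1 < Re (1 - s)) by (destruct s; unfold Re in *; simpl in *; lra).
    destruct (lc_series _ _ _ (Psi_spec (- mu) alpha) 0%R (1 - s) Hs1) as [_ E]. rewrite E.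
    apply (Clim_ext (fun n => e (alpha * mu)%R * (Rcpow (2 * PI) s * rGamma s) * usum (zterm (- mu) (qphi s (alpha, y n))))).
    { exists 0%nat. intros n _. unfold X. symmetry. now apply functional_equation_upper_all. }
    apply Clim_mult; [apply Clim_const|].
    rewrite (usum_ext _ (zterm (- mu) (qphi s (alpha, 0%R)))).
    2:{ apply zterm_ext. intros x Hx. unfold lphi, qphi. change (x, 0%R) with (RtoC x). rewrite pw_RtoC by auto.
        replace (- (1 - s)) with (s - 1) by ring. rewrite RtoC_mult. change (alpha, 0%R) with (RtoC alpha). ring. }
    apply (tannery (fun n => zterm (- mu) (qphi s (alpha, y n))) (zterm (- mu) (qphi s (alpha, 0%R)))
      (fun k : Z => if Rlt_dec (- - mu) (IZR k) then Rpower (- mu + IZR k) (- (1 - Re s)) else 0%R)).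
    + apply (zterm_bound_summ (- mu) (fun x => Rpower x (- (1 - Re s)))). intros; left; apply Rpower_pos.
      apply summ_power. apply base_bounds. lra.
    + intros n k. unfold zterm. destruct (Rlt_dec _ _) as [H|H]; [|rewrite Cmod_0; lra].
      rewrite Cmod_qphi. replace (- (1 - Re s))%R with (Re s - 1)%R by ring.
      assert (0 < Rpower (- mu + IZR k) (Re s - 1)) by apply Rpower_pos.
      assert (exp (- (2 * PI * Im (alpha, y n)) * (- mu + IZR k)) <= exp 0).
      { apply exp_le. unfold Im; simpl. generalize (two_PI_pos _ (Hy n)). intros. nra. }
      rewrite exp_0 in H1. nra.
    + intros k. unfold zterm. destruct (Rlt_dec _ _) as [H|H]; [|apply Clim_const].
      unfold qphi. apply Clim_mult; [apply Clim_const|]. unfold e. apply Clim_Cexp. apply Clim_mult; [apply Clim_const|].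
      apply Clim_mult; [apply Clim_const|].
      apply (Clim_ext (fun n => RtoC alpha + Ci * y n)).
      { exists 0%nat. intros n _. unfold Cplus, Cmult, RtoC, Ci; simpl. f_equal; ring. }
      replace ((alpha, 0%R) : C) with (RtoC alpha + Ci * 0%R) by (unfold Cplus, Cmult, RtoC, Ci; simpl; f_equal; ring).
      apply Clim_plus; [apply Clim_const|]. apply Clim_mult; auto. apply Clim_const.
Qed.

(** Both sides are compared after multiplication by [s (s - 1)], which removes the pole of [Psi] at
    [s = 1] on the left and the one at [1 - s = 1] on the right. *)
Lemma functional_equation (alpha mu : R) (s : C) : s <> 0 -> s <> 1 ->
  Cexp (PI * Ci * s / 2) * Psi alpha mu s 0 + Cexp (- (PI * Ci * s / 2)) * Psi (- alpha) (- mu) s 0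
  = e (alpha * mu)%R * (Rcpow (2 * PI) s * rGamma s) * Psi (- mu) alpha (1 - s) 0.
Proof.
  intros Hs0 Hs1.
  destruct (lc_entire _ _ _ (Psi_spec alpha mu) 0%R) as [g1 [G1 E1]].
  destruct (lc_entire _ _ _ (Psi_spec (- alpha) (- mu)) 0%R) as [g2 [G2 E2]].
  destruct (lc_entire _ _ _ (Psi_spec (- mu) alpha) 0%R) as [g3 [G3 E3]].
  set (L := fun s => s * (Cexp (PI * Ci * s / 2) * g1 s + Cexp (- (PI * Ci * s / 2)) * g2 s)).
  set (Rr := fun s => (1 - s) * (e (alpha * mu)%R * (Rcpow (2 * PI) s * rGamma s) * g3 (1 - s))).
  assert (EL := entire_one_minus).
  assert (K : forall s, L s = Rr s).
  { apply (identity_theorem_eq L Rr (- (2)) 1); [| |lra|].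
    - unfold L. apply (entire_mult (fun s => s)). apply entire_id. apply entire_plus.
      + apply (entire_mult (fun s => Cexp (PI * Ci * s / 2)) g1); auto using entire_phase.
      + apply (entire_mult (fun s => Cexp (- (PI * Ci * s / 2))) g2); auto using entire_phase_opp.
    - unfold Rr. apply (entire_mult (fun s => 1 - s)); auto. apply (entire_mult (fun s => e (alpha * mu)%R * (Rcpow (2 * PI) s * rGamma s))).
      apply entire_gamma_factor. now apply (entire_comp (fun s => 1 - s) g3).
    - intros h Hh. set (r := - (2) + h). assert (Hr : Re r < 0).
      { assert (Rabs (Re h) <= Cmod h) by apply re_le_Cmod. apply Rabs_le_between in H. unfold r. destruct h. unfold Re in *; simpl in *. lra. }
      assert (N : r <> 1) by (intros K; rewrite K in Hr; unfold Re in Hr; simpl in Hr; lra).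
      assert (N0 : 1 - r <> 1) by (apply one_minus_neq_1; intros K; rewrite K in Hr; unfold Re in Hr; simpl in Hr; lra).
      unfold L, Rr. rewrite E1, E2, E3 by auto.
      transitivity (r * (r - 1) * (Cexp (PI * Ci * r / 2) * Psi alpha mu r 0 + Cexp (- (PI * Ci * r / 2)) * Psi (- alpha) (- mu) r 0)); [ring|].
      rewrite functional_equation_left by auto. ring. }
  specialize (K s). unfold L, Rr in K.
  assert (N0 := one_minus_neq_1 s Hs0).
  rewrite E1, E2, E3 in K by auto. assert (NZ := Cminus_neq_0 _ _ Hs1).
  apply (Cmult_cancel (s * (s - 1))).
  - now apply Cmult_neq_0.
  - transitivity (s * (Cexp (PI * Ci * s / 2) * ((s - 1) * Psi alpha mu s 0) + Cexp (- (PI * Ci * s / 2)) * ((s - 1) * Psi (- alpha) (- mu) s 0))).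
    + ring.
    + rewrite K. ring.
Qed.

(** * The two expressions for the function A *)

Definition A_left (alpha mu : R) (s : C) : C := Ccos (PI * s) * Psi (- alpha) (- mu) s 0 + Psi alpha mu s 0.

Definition A_right (alpha mu : R) (s : C) : C :=
  e (alpha * mu) * (Rcpow (2 * PI) s * rGamma s / 2) *
    (Cexp (- (PI * Ci * s / 2)) * Psi (- mu) alpha (1 - s) 0 + Cexp (PI * Ci * s / 2) * Psi mu (- alpha) (1 - s) 0).

(** With [p] and [q] the phases of a quarter turn in the two directions, half of [q] times the
    functional equation plus half of [p] times its version for [- alpha], [- mu] gives the claim,
    since [p q = 1] and [(p p + q q) / 2] is the cosine. *)
Lemma A_left_right (alpha mu : R) (s : C) : s <> 0 -> s <> 1 -> A_left alpha mu s = A_right alpha mu s.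
Proof.
  intros H0 H1.
  assert (E1 := functional_equation alpha mu s H0 H1).
  assert (E2 := functional_equation (- alpha) (- mu) s H0 H1). rewrite !Ropp_involutive in E2.
  replace (- alpha * - mu)%R with (alpha * mu)%R in E2 by ring.
  unfold A_left, A_right, Ccos. rewrite RtoC_mult in E1, E2.
  set (p := Cexp (PI * Ci * s / 2)) in *. set (q := Cexp (- (PI * Ci * s / 2))) in *.
  assert (PQ : p * q = 1) by (unfold p, q; rewrite <- Cexp_plus, <- Cexp_0; f_equal; ring).
  replace (Cexp (Ci * (PI * s))) with (p * p) by (unfold p; rewrite <- Cexp_plus; f_equal; field).
  replace (Cexp (- (Ci * (PI * s)))) with (q * q) by (unfold q; rewrite <- Cexp_plus; f_equal; field).
  transitivity (/ 2 * (q * (p * Psi alpha mu s 0 + q * Psi (- alpha) (- mu) s 0) + p * (p * Psi (- alpha) (- mu) s 0 + q * Psi alpha mu s 0))).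
  - transitivity ((p * p + q * q) / 2 * Psi (- alpha) (- mu) s 0 + (p * q) * Psi alpha mu s 0); [rewrite PQ; ring|field].
  - rewrite E1, E2. field.
Qed.

Lemma entire_Ccos : entire (fun s => Ccos (PI * s)).
Proof.
  apply (entire_ext (fun s => / 2 * (Cexp ((Ci * PI) * s) + Cexp (- (Ci * PI) * s)))).
  - intros s. unfold Ccos. replace (Ci * (PI * s)) with (Ci * PI * s) by ring. replace (- (Ci * PI * s)) with (- (Ci * PI) * s) by ring. field.
  - apply entire_scal, entire_plus; apply entire_exp_lin.
Qed.

Lemma is_int_opp (x : R) : is_int (- x) -> is_int x.
Proof. intros [n Hn]. exists (- n)%Z. rewrite opp_IZR, <- Hn. ring. Qed.

Lemma holo_A_left (alpha mu : R) (s : C) : s <> 1 \/ ~ is_int mu -> holomorphic_at (A_left alpha mu) s.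
Proof.
  intros H. unfold A_left. apply holo_plus; [apply (holo_mult (fun s => Ccos (PI * s)) (fun s => Psi (- alpha) (- mu) s 0))|].
  - apply entire_Ccos.
  - apply (lc_holo _ _ _ (Psi_spec (- alpha) (- mu))). destruct H; [now left|right; intros K; now apply H, is_int_opp].
  - apply (lc_holo _ _ _ (Psi_spec alpha mu)). exact H.
Qed.

Lemma holo_A_right (alpha mu : R) (s : C) : s <> 0 \/ ~ is_int alpha -> holomorphic_at (A_right alpha mu) s.
Proof.
  intros H. assert (H' : 1 - s <> 1 \/ ~ is_int alpha).
  { destruct H as [H|H]; [left; now apply one_minus_neq_1|now right]. }
  assert (EL := entire_one_minus).
  unfold A_right. apply (holo_mult (fun s => e (alpha * mu) * (Rcpow (2 * PI) s * rGamma s / 2))).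
  - apply (entire_ext (fun s => (e (alpha * mu) / 2) * (Rcpow (2 * PI) s * rGamma s))). intros; field. apply entire_gamma_factor.
  - apply holo_plus.
    + apply (holo_mult (fun s => Cexp (- (PI * Ci * s / 2))) (fun s => Psi (- mu) alpha (1 - s) 0)). apply entire_phase_opp.
      apply (holo_comp (fun s => 1 - s) (fun s => Psi (- mu) alpha s 0)). apply EL.
      apply (lc_holo _ _ _ (Psi_spec (- mu) alpha)). exact H'.
    + apply (holo_mult (fun s => Cexp (PI * Ci * s / 2)) (fun s => Psi mu (- alpha) (1 - s) 0)). apply entire_phase.
      apply (holo_comp (fun s => 1 - s) (fun s => Psi mu (- alpha) s 0)). apply EL.
      apply (lc_holo _ _ _ (Psi_spec mu (- alpha))). destruct H'; [now left|right; intros K; now apply H0, is_int_opp].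
Qed.

(** [A_left] can be singular only at [s = 1] and [A_right] only at [s = 0]. Elsewhere they agree, so
    near each point at least one of them shows that the glued function is holomorphic. *)
Definition A_fun (alpha mu : R) (s : C) : C := if Ceq_dec s 1 then A_right alpha mu s else A_left alpha mu s.

Lemma nonzero_near (a b h : C) : a <> b -> Cmod h < Cmod (a - b) -> a + h <> b.
Proof.
  intros Hn Hh K. assert (a - b = - h) by (rewrite <- K; ring). rewrite H, Cmod_opp in Hh. lra.
Qed.

Lemma A_fun_right (alpha mu : R) (s : C) : s <> 0 -> A_fun alpha mu s = A_right alpha mu s.
Proof. intros H. unfold A_fun. destruct (Ceq_dec s 1) as [E|N]; auto. now apply A_left_right. Qed.

Lemma A_fun_left (alpha mu : R) (s : C) : s <> 1 -> A_fun alpha mu s = A_left alpha mu s.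
Proof. intros H. unfold A_fun. destruct (Ceq_dec s 1); auto. contradiction. Qed.

Lemma C1_neq_C0 : RtoC 1 <> RtoC 0.
Proof. intros K. apply RtoC_inj in K. lra. Qed.

Lemma entire_A_fun (alpha mu : R) : entire (A_fun alpha mu).
Proof.
  intros s. destruct (classic (s = 1)) as [E|N].
  - assert (N : s <> 0) by (rewrite E; apply C1_neq_C0).
    apply (holo_ext_loc (A_right alpha mu) _ s (Cmod (s - 0))).
    + apply Cmod_gt_0. now apply Cminus_neq_0.
    + intros h Hh. symmetry. apply A_fun_right. now apply nonzero_near.
    + apply holo_A_right. now left.
  - apply (holo_ext_loc (A_left alpha mu) _ s (Cmod (s - 1))).
    + apply Cmod_gt_0. now apply Cminus_neq_0.
    + intros h Hh. symmetry. apply A_fun_left. now apply nonzero_near.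
    + apply holo_A_left. now left.
Qed.

Lemma A_fun_left_all (alpha mu : R) (s : C) : s <> 1 \/ ~ is_int mu -> A_fun alpha mu s = A_left alpha mu s.
Proof.
  intros H. destruct (classic (s = 1)) as [E|N]; [|now apply A_fun_left].
  apply (holo_agree _ _ s 1); [lra|apply entire_A_fun|now apply holo_A_left|].
  intros h Hh _. apply A_fun_left. rewrite E. intros K. apply Hh. replace h with (1 + h - 1) by ring. rewrite K. ring.
Qed.

Lemma A_fun_right_all (alpha mu : R) (s : C) : s <> 0 \/ ~ is_int alpha -> A_fun alpha mu s = A_right alpha mu s.
Proof.
  intros H. destruct (classic (s = 0)) as [E|N]; [|now apply A_fun_right].
  apply (holo_agree _ _ s 1); [lra|apply entire_A_fun|now apply holo_A_right|].
  intros h Hh _. apply A_fun_right. rewrite E. intros K. apply Hh. now rewrite <- K, Cplus_0_l.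
Qed.

Lemma calA_eq (alpha mu : R) (s : C) : s <> 1 \/ ~ is_int mu -> calA s alpha mu = A_left alpha mu s.
Proof.
  intros H. unfold calA, A_left. rewrite !psi_eq; auto. destruct H; [now left|right; intros K; now apply H, is_int_opp].
Qed.

Lemma A_right_psi (alpha mu : R) (s : C) : s <> 0 \/ ~ is_int alpha -> A_right alpha mu s =
  e (alpha * mu) * (Rcpow (2 * PI) s * rGamma s / 2) *
    (Cexp (- (PI * Ci * s / 2)) * psi (1 - s) (- mu) alpha + Cexp (PI * Ci * s / 2) * psi (1 - s) mu (- alpha)).
Proof.
  intros H. assert (H' : 1 - s <> 1 \/ ~ is_int alpha).
  { destruct H as [H|H]; [left; now apply one_minus_neq_1|now right]. }
  unfold A_right. rewrite !psi_eq; auto. destruct H'; [now left|right; intros K; now apply H0, is_int_opp].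
Qed.

(** * The q-series *)

Lemma base_min (g : R) (k : Z) : - g < IZR k -> base g <= g + IZR k.
Proof.
  intros H. unfold base. destruct (archimed (- g)) as [A1 A2].
  assert (up (- g) - 1 < k)%Z by (apply lt_IZR; rewrite minus_IZR; lra).
  assert (up (- g) <= k)%Z by lia. apply IZR_le in H1. lra.
Qed.

Definition half_line (g : R) (h : R -> R) (k : Z) : R := if Rlt_dec (- g) (IZR k) then h (g + IZR k)%R else 0%R.

(** A majorant in product form. As [x >= base gamma] and [y >= base delta], the product [x y] is at
    least half of [base delta * x + base gamma * y], which separates the exponential. The sum of two
    powers covers all exponents between [a1] and [a2]. *)
Definition qdom (gamma delta v a1 a2 : R) (kl : Z * Z) : R :=
  half_line gamma (fun x => exp (- (PI * v * base delta) * x)) (fst kl) *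
  half_line delta (fun y => (Rpower y a1 + Rpower y a2) * exp (- (PI * v * base gamma) * y))%R (snd kl).

Lemma half_line_nonneg (g : R) (h : R -> R) (k : Z) : (forall x, 0 < x -> 0 <= h x) -> 0 <= half_line g h k.
Proof. intros H. unfold half_line. destruct (Rlt_dec _ _); [|lra]. apply H. lra. Qed.

Lemma qdom_summ (gamma delta v a1 a2 : R) : 0 < v -> summ (qdom gamma delta v a1 a2).
Proof.
  intros Hv. assert (HPI := PI_RGT_0). assert (Bg := base_bounds gamma). assert (Bd := base_bounds delta).
  assert (C1 : 0 < PI * v * base delta) by (apply Rmult_lt_0_compat; [apply Rmult_lt_0_compat|]; lra).
  assert (C2 : 0 < PI * v * base gamma) by (apply Rmult_lt_0_compat; [apply Rmult_lt_0_compat|]; lra).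
  apply (summ_prod (half_line gamma _) (half_line delta _)).
  - intros k. apply half_line_nonneg. intros; left; apply exp_pos.
  - intros k. apply half_line_nonneg. intros x Hx. generalize (Rpower_pos x a1) (Rpower_pos x a2) (exp_pos (- (PI * v * base gamma) * x)). intros. nra.
  - apply (zterm_bound_summ gamma (fun x => exp (- (PI * v * base delta) * x))). intros; left; apply exp_pos.
    apply (summ_le _ (fun n : nat => Rpower (base gamma + INR n) 0 * exp (- (PI * v * base delta) * (base gamma + INR n)))%R 1); [lra| |].
    + intros n. rewrite Rpower_O by (generalize (pos_INR n); lra). lra.
    + now apply summ_power_exp.
  - apply (zterm_bound_summ delta (fun y => (Rpower y a1 + Rpower y a2) * exp (- (PI * v * base gamma) * y))%R).
    + intros x Hx. generalize (Rpower_pos x a1) (Rpower_pos x a2) (exp_pos (- (PI * v * base gamma) * x)). intros. nra.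
    + apply (summ_le _ (fun n : nat => Rpower (base delta + INR n) a1 * exp (- (PI * v * base gamma) * (base delta + INR n)) +
         Rpower (base delta + INR n) a2 * exp (- (PI * v * base gamma) * (base delta + INR n)))%R 1); [lra| |].
      * intros n. right. ring.
      * apply summ_plus; now apply summ_power_exp.
Qed.

Lemma Rpower_le_sum (y a t b : R) : 0 < y -> a <= t <= b -> Rpower y t <= Rpower y a + Rpower y b.
Proof.
  intros Hy Ht. generalize (Rpower_pos y a) (Rpower_pos y b). intros. destruct (Rle_dec 1 y) as [H1|H1].
  - assert (Rpower y t <= Rpower y b) by (apply Rle_Rpower; lra). lra.
  - assert (Rpower y t <= Rpower y a); [|lra]. unfold Rpower. apply exp_le.
    assert (ln y <= 0) by (rewrite <- ln_1; apply ln_le'; lra). nra.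
Qed.

(** For fixed [k] the terms in [l] are those of the right-hand side of Lipschitz's formula at
    [w = lambda + x z] with [x = gamma + k]. *)
Lemma qseries_term_split (r : C) (gamma delta kappa lambda : R) (z : C) (k l : Z) :
  qseries_term r gamma delta kappa lambda z (k, l) =
  zterm gamma (fun x => e (x * kappa)%R * zterm delta (qphi (1 - r) (lambda + x * z)) l) k.
Proof.
  unfold qseries_term, zterm. destruct (Rlt_dec (- gamma) (IZR k)); auto.
  destruct (Rlt_dec (- delta) (IZR l)); [|ring]. unfold qphi.
  rewrite <- !RtoC_plus. set (x := (gamma + IZR k)%R). set (y := (delta + IZR l)%R).
  replace (1 - r - 1) with (- r) by ring. rewrite Rcpow_opp, RtoC_mult.
  replace (y * (lambda + x * z)) with (y * lambda + x * y * z) by ring.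
  rewrite !e_plus. unfold Cdiv. ring.
Qed.

Lemma qseries_term_bound (r : C) (gamma delta kappa lambda a1 a2 : R) (z : C) (kl : Z * Z) : 0 < Im z -> a1 <= - Re r <= a2 ->
  Cmod (qseries_term r gamma delta kappa lambda z kl) <= qdom gamma delta (Im z) a1 a2 kl.
Proof.
  intros Hz Ha. destruct kl as [k l]. rewrite qseries_term_split. unfold qdom, zterm, half_line. cbn [fst snd].
  assert (HPI := PI_RGT_0).
  destruct (Rlt_dec (- gamma) (IZR k)) as [H1|H1]; [|rewrite Cmod_0, Rmult_0_l; lra].
  destruct (Rlt_dec (- delta) (IZR l)) as [H2|H2]; [|rewrite Cmult_0_r, Cmod_0, Rmult_0_r; lra].
  assert (X := base_min gamma k H1). assert (Y := base_min delta l H2).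
  assert (Bg := base_bounds gamma). assert (Bd := base_bounds delta).
  set (x := (gamma + IZR k)%R) in *. set (y := (delta + IZR l)%R) in *.
  rewrite Cmod_mult, Cmod_e_R, Rmult_1_l, Cmod_qphi.
  replace (Im (lambda + x * z)) with (x * Im z)%R by (destruct z; unfold Im; simpl; ring).
  replace (Re (1 - r) - 1)%R with (- Re r)%R by (destruct r; unfold Re; simpl; ring).
  replace (exp (- (PI * Im z * base delta) * x) * ((Rpower y a1 + Rpower y a2) * exp (- (PI * Im z * base gamma) * y)))%R with
    ((Rpower y a1 + Rpower y a2) * (exp (- (PI * Im z * base delta) * x) * exp (- (PI * Im z * base gamma) * y)))%R by ring.
  apply Rmult_le_compat; try (left; apply Rpower_pos || apply exp_pos).
  - apply Rpower_le_sum; lra.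
  - rewrite <- exp_plus. apply exp_le.
    assert (base gamma * y <= x * y) by (apply Rmult_le_compat_r; lra).
    assert (base delta * x <= x * y) by (rewrite (Rmult_comm x); apply Rmult_le_compat_r; lra).
    assert (0 < PI * Im z) by (apply Rmult_lt_0_compat; lra). nra.
Qed.

Lemma qseries_summable (r : C) (gamma delta kappa lambda : R) (z : C) : 0 < Im z ->
  abs_summable (qseries_term r gamma delta kappa lambda z).
Proof.
  intros Hz. apply (abs_summable_le _ (qdom gamma delta (Im z) (- Re r) (- Re r))).
  - intros kl. apply qseries_term_bound; auto. lra.
  - now apply qdom_summ.
Qed.

Lemma entire_qseries2 (gamma delta kappa lambda : R) (z : C) : 0 < Im z ->
  entire (fun s => qseries (1 - s) gamma delta kappa lambda z).
Proof.
  intros Hz c. unfold qseries.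
  apply (usum_holomorphic (fun kl s => qseries_term (1 - s) gamma delta kappa lambda z kl)
     (qdom gamma delta (Im z) (Re c - 2) (Re c)) c 1); [lra| | |].
  - intros [k l]. unfold qseries_term. destruct (Rlt_dec _ _); [|apply entire_const]. destruct (Rlt_dec _ _); [|apply entire_const].
    apply (entire_ext (fun s => (e ((gamma + IZR k) * kappa + (delta + IZR l) * lambda) * e ((gamma + IZR k) * (delta + IZR l) * z)) * Rcpow (delta + IZR l) (s - 1))).
    + intros s. replace (s - 1) with (- (1 - s)) by ring. rewrite Rcpow_opp. unfold Cdiv. ring.
    + apply entire_scal. apply entire_Rcpow. apply entire_minus. apply entire_id. apply entire_const.
  - now apply qdom_summ.
  - intros kl h Hh. apply qseries_term_bound; auto.
    assert (L : Rabs (Re h) <= 1) by (eapply Rle_trans; [apply re_le_Cmod|auto]). apply Rabs_le_between in L.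
    replace (Re (1 - (c + h))) with (1 - Re c - Re h)%R by (destruct c, h; unfold Re; simpl; ring). lra.
Qed.

(** * The two-dimensional sum *)

(** [m0], the smaller of the least positive elements of [a + Z] and [- a + Z], bounds every nonzero
    [a + m] from below; [D] converts this into growth with [m]. *)
Lemma gap (a : R) : exists c, 0 < c /\ forall m : Z, (a + IZR m)%R <> 0%R -> c * (Rabs (IZR m) + 1) <= Rabs (a + IZR m).
Proof.
  set (m0 := Rmin (base a) (base (- a))).
  assert (Hm0 : 0 < m0) by (apply Rmin_pos; apply base_bounds).
  set (D := (1 + (Rabs a + 1) / m0)%R).
  assert (HD : 0 < D). { unfold D. assert (0 <= (Rabs a + 1) / m0) by (apply Rdiv_le_0_compat; auto; generalize (Rabs_pos a); lra). lra. }
  exists (/ D)%R. split; [now apply Rinv_0_lt_compat|]. intros m Hm.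
  assert (G : m0 <= Rabs (a + IZR m)).
  { destruct (Rlt_dec 0 (a + IZR m)) as [H|H].
    - eapply Rle_trans; [apply Rmin_l|]. rewrite Rabs_pos_eq by lra. apply base_min. lra.
    - assert (Hneg : a + IZR m < 0) by (apply Rnot_lt_le in H; destruct H as [H|H]; [exact H|contradiction]).
      eapply Rle_trans; [apply Rmin_r|]. rewrite Rabs_left by lra. replace (- (a + IZR m))%R with (- a + IZR (- m))%R by (rewrite opp_IZR; ring).
      apply base_min. rewrite opp_IZR. lra. }
  assert (T : Rabs (IZR m) <= Rabs (a + IZR m) + Rabs a).
  { replace (IZR m) with ((a + IZR m) + - a)%R at 1 by ring. eapply Rle_trans; [apply Rabs_triang|]. rewrite Rabs_Ropp. lra. }
  apply Rmult_le_reg_l with D; auto. rewrite <- Rmult_assoc, Rinv_r, Rmult_1_l by lra.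
  unfold D. assert (Rabs a + 1 <= (Rabs a + 1) / m0 * Rabs (a + IZR m)); [|lra].
  apply Rle_trans with ((Rabs a + 1) / m0 * m0)%R; [right; field; lra|]. apply Rmult_le_compat_l; auto.
  apply Rdiv_le_0_compat; auto; generalize (Rabs_pos a); lra.
Qed.

(** The imaginary part of [w] controls [beta + n], and then its real part controls [alpha + m]. Two
    separate linear bounds are stated so that a power of [Cmod w] can be distributed over both
    indices. *)
Lemma quadratic_lower (alpha beta : R) (z : C) : 0 < Im z -> exists c, 0 < c /\ forall m n : Z,
  let w := alpha + IZR m + (beta + IZR n) * z in w <> 0 ->
  c * (Rabs (IZR m) + 1) <= Cmod w /\ c * (Rabs (IZR n) + 1) <= Cmod w.
Proof.
  intros Hz. destruct (gap alpha) as [ca [Ca Ha]]. destruct (gap beta) as [cb [Cb Hb]].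
  set (D := (1 + Rabs (Re z) / Im z)%R).
  assert (HD : 1 <= D). { unfold D. assert (0 <= Rabs (Re z) / Im z) by (apply Rdiv_le_0_compat; auto; apply Rabs_pos). lra. }
  set (A1 := (Rabs alpha + 1)%R). set (B1 := (Rabs beta + 1)%R).
  assert (HA1 : 1 <= A1) by (unfold A1; generalize (Rabs_pos alpha); lra).
  assert (HB1 : 1 <= B1) by (unfold B1; generalize (Rabs_pos beta); lra).
  set (p := (ca / D)%R). set (q := (Im z * cb)%R).
  assert (Hp : 0 < p) by (apply Rdiv_lt_0_compat; lra). assert (Hq : 0 < q) by (unfold q; now apply Rmult_lt_0_compat).
  assert (P1 : 0 < p / B1) by (apply Rdiv_lt_0_compat; lra). assert (Q1 : 0 < q / A1) by (apply Rdiv_lt_0_compat; lra).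
  assert (DV : forall u v, 0 < u -> 1 <= v -> u / v <= u).
  { intros u v Hu Hv. unfold Rdiv. rewrite <- (Rmult_1_r u) at 2. apply Rmult_le_compat_l; [lra|].
    rewrite <- Rinv_1. apply Rinv_le_contravar; lra. }
  assert (P2 := DV p B1 Hp HB1). assert (Q2 := DV q A1 Hq HA1).
  set (c := Rmin (p / B1) (q / A1)). assert (Hc : 0 < c) by (now apply Rmin_pos).
  assert (Cp : c <= p / B1) by apply Rmin_l. assert (Cq : c <= q / A1) by apply Rmin_r.
  exists c. split; auto. intros m n w Hw.
  set (u := (alpha + IZR m)%R). set (x := (beta + IZR n)%R).
  assert (Er : Re w = (u + x * Re z)%R) by (unfold w, u, x; destruct z; unfold Re; simpl; ring).
  assert (Ei : Im w = (x * Im z)%R) by (unfold w, x; destruct z; unfold Im; simpl; ring).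
  assert (W1 : Rabs x * Im z <= Cmod w).
  { rewrite <- (Rabs_pos_eq (Im z)) by lra. rewrite <- Rabs_mult, <- Ei. apply Rabs_snd_le. }
  assert (W2 : Rabs u <= D * Cmod w).
  { replace u with (Re w + - (x * Re z))%R by (rewrite Er; ring). eapply Rle_trans; [apply Rabs_triang|]. rewrite Rabs_Ropp, Rabs_mult.
    assert (R1 : Rabs (Re w) <= Cmod w) by apply re_le_Cmod.
    assert (Rabs x * Rabs (Re z) <= Rabs (Re z) / Im z * Cmod w); [|unfold D; lra].
    apply Rle_trans with (Rabs (Re z) / Im z * (Rabs x * Im z))%R; [right; field; lra|]. apply Rmult_le_compat_l; auto.
    apply Rdiv_le_0_compat; auto; apply Rabs_pos. }
  assert (Hm := Rabs_pos (IZR m)). assert (Hn := Rabs_pos (IZR n)).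
  assert (U : u <> 0%R -> p * (Rabs (IZR m) + 1) <= Cmod w).
  { intros Hu. specialize (Ha m Hu). fold u in Ha. unfold p. apply Rmult_le_reg_l with D; [lra|].
    replace (D * (ca / D * (Rabs (IZR m) + 1)))%R with (ca * (Rabs (IZR m) + 1))%R by (field; lra). lra. }
  assert (X : x <> 0%R -> q * (Rabs (IZR n) + 1) <= Cmod w).
  { intros Hx. specialize (Hb n Hx). fold x in Hb. unfold q. apply Rle_trans with (Rabs x * Im z)%R; auto.
    rewrite (Rmult_comm (Im z)), Rmult_assoc, (Rmult_comm (Im z)), <- Rmult_assoc. apply Rmult_le_compat_r; lra. }
  (* If one coordinate vanishes, [gap] gives nothing for it, but then its index is [- alpha] or
     [- beta] and [A1] or [B1] is the exact value to be dominated. *)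
  destruct (Req_EM_T u 0) as [U0|U0]; destruct (Req_EM_T x 0) as [X0|X0].
  - exfalso. apply Hw. unfold w. rewrite <- !RtoC_plus. fold u x. rewrite U0, X0. ring.
  - specialize (X X0). assert (Rabs (IZR m) + 1 = A1)%R.
    { unfold A1. replace (IZR m) with (- alpha)%R by (unfold u in U0; lra). now rewrite Rabs_Ropp. }
    split; [|nra]. rewrite H. apply Rle_trans with (q / A1 * A1)%R. apply Rmult_le_compat_r; lra.
    replace (q / A1 * A1)%R with q by (field; lra). nra.
  - specialize (U U0). assert (Rabs (IZR n) + 1 = B1)%R.
    { unfold B1. replace (IZR n) with (- beta)%R by (unfold x in X0; lra). now rewrite Rabs_Ropp. }
    split; [nra|]. rewrite H. apply Rle_trans with (p / B1 * B1)%R. apply Rmult_le_compat_r; lra.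
    replace (p / B1 * B1)%R with p by (field; lra). nra.
  - specialize (U U0). specialize (X X0). split; nra.
Qed.

Lemma Cmod_Cpow_arg (arg : C -> R) (w s : C) : Rabs (arg w) <= 4 -> Cmod (Cpow_arg arg w (- s)) <= Rpower (Cmod w) (- Re s) * exp (4 * Rabs (Im s)).
Proof.
  intros H. unfold Cpow_arg. rewrite Cmod_Cexp. unfold Rpower. rewrite <- exp_plus. apply exp_le.
  replace (Re (- s * (ln (Cmod w) + Ci * arg w))) with (- Re s * ln (Cmod w) + Im s * arg w)%R by (destruct s; unfold Re, Im, Ci, RtoC; cbn [fst snd Cmult Cplus Copp]; simpl; ring).
  assert (Im s * arg w <= 4 * Rabs (Im s)); [|lra].
  eapply Rle_trans; [apply Rle_abs|]. rewrite Rabs_mult. generalize (Rabs_pos (Im s)). nra.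
Qed.

Lemma Carg_bounded (w : C) : Rabs (Carg w) <= 4 /\ Rabs (Carg_lower w) <= 4.
Proof.
  assert (B := acos_bound (Re w / Cmod w)). assert (P4 := PI_4).
  unfold Carg, Carg_lower. split; destruct (Rlt_dec _ _); apply Rabs_le; lra.
Qed.

(** Half of the exponent goes to each bound of [quadratic_lower], which leaves a product of two
    p-series with [p = Re s / 2 > 1]. *)
Lemma F_term_summable (arg : C -> R) (s : C) (alpha beta mu nu : R) (z : C) : (forall w, Rabs (arg w) <= 4) -> 0 < Im z -> 2 < Re s ->
  abs_summable (F_term arg s alpha beta mu nu z).
Proof.
  intros Harg Hz Hs. destruct (quadratic_lower alpha beta z Hz) as [c [Hc H]].
  set (p := (Re s / 2)%R).
  set (K := (Rpower c (- p) * Rpower c (- p) * exp (4 * Rabs (Im s)))%R).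
  assert (HK : 0 < K) by (unfold K; apply Rmult_lt_0_compat; [apply Rmult_lt_0_compat; apply Rpower_pos|apply exp_pos]).
  apply (summ_le (fun mn => Cmod (F_term arg s alpha beta mu nu z mn))
    (fun mn : Z * Z => Rpower (Rabs (IZR (fst mn)) + 1) (- p) * Rpower (Rabs (IZR (snd mn)) + 1) (- p))%R K); [lra| |].
  - intros [m n]. cbn [fst snd]. unfold F_term. destruct (Ceq_dec _ _) as [E|N].
    + rewrite Cmod_0. left. apply Rmult_lt_0_compat; auto. apply Rmult_lt_0_compat; apply Rpower_pos.
    + specialize (H m n N). set (w := alpha + IZR m + (beta + IZR n) * z) in *. destruct H as [H1 H2].
      rewrite Cmod_mult. rewrite Cmod_e_real, Rmult_1_l by (unfold Im; simpl; ring).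
      eapply Rle_trans; [apply Cmod_Cpow_arg; auto|].
      assert (Hm : 0 < Rabs (IZR m) + 1) by (generalize (Rabs_pos (IZR m)); lra).
      assert (Hn : 0 < Rabs (IZR n) + 1) by (generalize (Rabs_pos (IZR n)); lra).
      unfold K. replace (- Re s)%R with (- p + - p)%R by (unfold p; field). rewrite Rpower_plus.
      replace (Rpower c (- p) * Rpower c (- p) * exp (4 * Rabs (Im s)) * (Rpower (Rabs (IZR m) + 1) (- p) * Rpower (Rabs (IZR n) + 1) (- p)))%R with
        (((Rpower c (- p) * Rpower (Rabs (IZR m) + 1) (- p)) * (Rpower c (- p) * Rpower (Rabs (IZR n) + 1) (- p))) * exp (4 * Rabs (Im s)))%R by ring.
      apply Rmult_le_compat_r; [left; apply exp_pos|]. rewrite <- (Rpower_mult_base c (Rabs (IZR m) + 1)), <- (Rpower_mult_base c (Rabs (IZR n) + 1)) by auto.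
      apply Rmult_le_compat; try (left; apply Rpower_pos); apply Rpower_anti; auto; try (now apply Rmult_lt_0_compat); unfold p; lra.
  - apply (summ_prod (fun m : Z => Rpower (Rabs (IZR m) + 1) (- p)) (fun m : Z => Rpower (Rabs (IZR m) + 1) (- p))).
    1,2: intros; left; apply Rpower_pos.
    1,2: apply summ_p_series_Z; unfold p; lra.
Qed.

(** The two branches are averaged termwise, before summation: off the negative real axis nothing
    changes, and on it the phases [exp (- PI i s)] and [exp (PI i s)] combine to [cos (PI s)]. *)
Definition F_avg (s : C) (alpha beta mu nu : R) (z : C) (mn : Z * Z) : C :=
  / 2 * (F_term Carg s alpha beta mu nu z mn + F_term Carg_lower s alpha beta mu nu z mn).

Lemma half_sum (a : C) : / 2 * (a + a) = a.
Proof. field. Qed.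

Lemma F_row_upper (s : C) (alpha beta mu nu : R) (z : C) (n : Z) : 0 < Im z -> 1 < Re s -> 0 < beta + IZR n ->
  usum (fun m => F_avg s alpha beta mu nu z (m, n)) =
  e (alpha * mu)%R * (Rcpow (2 * PI) s * rGamma s) * Cexp (- (PI * Ci * s / 2)) *
    (e ((beta + IZR n) * nu)%R * usum (zterm (- mu) (qphi s (alpha + (beta + IZR n)%R * z)))).
Proof.
  intros Hz Hs Hx. set (x := (beta + IZR n)%R) in *. set (w0 := alpha + x * z).
  assert (Hw : 0 < Im w0). { replace (Im w0) with (x * Im z)%R by (unfold w0; destruct z; unfold Im; simpl; ring). now apply Rmult_lt_0_compat. }
  destruct (lipschitz s w0 mu Hs Hw) as [AL EL].
  rewrite (usum_ext _ (fun m : Z => (e (alpha * mu)%R * e (x * nu)%R * Cexp (- (PI * Ci * s / 2)) * Rcpow (2 * PI) s) *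
     (e (IZR m * mu)%R * pw (- (2 * PI * Ci * (IZR m + w0))) (- s)))).
  - rewrite usum_scal, EL by auto. ring.
  - intros m. unfold F_avg, F_term. rewrite <- (RtoC_plus beta). fold x.
    replace (alpha + IZR m + x * z) with (IZR m + w0) by (unfold w0; ring).
    assert (Hi : 0 < Im (IZR m + w0)) by (replace (Im (IZR m + w0)) with (Im w0) by (unfold Im; simpl; ring); auto).
    destruct (Ceq_dec _ _) as [E|N]. { rewrite E in Hi. unfold Im in Hi; simpl in Hi. lra. }
    destruct (Cpow_upper (IZR m + w0) (- s) Hi) as [-> ->]. rewrite half_sum.
    rewrite pw_rot_scale.
    2:{ replace (Re (- (Ci * (IZR m + w0)))) with (Im (IZR m + w0)) by (unfold Re, Im, Ci, Cmult, Copp; simpl; ring). auto. }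
    replace (PI * Ci * - s / 2) with (- (PI * Ci * s / 2)) by field.
    assert (EP := Rcpow_cancel (2 * PI) s).
    replace ((alpha + IZR m) * mu + x * nu) with (RtoC (alpha * mu) + RtoC (IZR m * mu) + RtoC (x * nu)) by (rewrite !RtoC_mult; ring).
    rewrite !e_plus.
    transitivity ((Rcpow (2 * PI) s * Rcpow (2 * PI) (- s)) * (e (alpha * mu)%R * e (IZR m * mu)%R * e (x * nu)%R * (Cexp (- (PI * Ci * s / 2)) * pw (- (Ci * (IZR m + w0))) (- s)))); [rewrite EP|]; ring.
Qed.

(** The row is reflected into the upper half-plane by [w -> - w], that is, [m -> - m] and
    [n -> - n], and Lipschitz's formula is used with [- mu]. *)
Lemma F_row_lower (s : C) (alpha beta mu nu : R) (z : C) (n : Z) : 0 < Im z -> 1 < Re s -> beta + IZR n < 0 ->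
  usum (fun m => F_avg s alpha beta mu nu z (m, n)) =
  e (alpha * mu)%R * (Rcpow (2 * PI) s * rGamma s) * Cexp (PI * Ci * s / 2) *
    (e ((- beta + IZR (- n)) * - nu)%R * usum (zterm mu (qphi s ((- alpha)%R + (- beta + IZR (- n))%R * z)))).
Proof.
  intros Hz Hs Hx. set (x := (- beta + IZR (- n))%R). set (w0 := (- alpha)%R + x * z).
  assert (Hx' : 0 < x) by (unfold x; rewrite opp_IZR; lra).
  assert (Hw : 0 < Im w0). { replace (Im w0) with (x * Im z)%R by (unfold w0; destruct z; unfold Im; simpl; ring). now apply Rmult_lt_0_compat. }
  destruct (lipschitz s w0 (- mu) Hs Hw) as [AL EL]. rewrite Ropp_involutive in EL.
  destruct (usum_opp_index _ AL) as [AL' EL'].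
  rewrite (usum_ext _ (fun m : Z => (e (alpha * mu)%R * e (x * - nu)%R * Cexp (PI * Ci * s / 2) * Rcpow (2 * PI) s) *
     (e (IZR (- m) * - mu)%R * pw (- (2 * PI * Ci * (IZR (- m) + w0))) (- s)))).
  - rewrite (usum_scal _ _ AL'), EL', EL. ring.
  - intros m. unfold F_avg, F_term. rewrite <- (RtoC_plus beta).
    replace (beta + IZR n)%R with (- x)%R by (unfold x; rewrite opp_IZR; ring).
    set (V := IZR (- m) + w0).
    assert (EV : alpha + IZR m + (- x)%R * z = - V) by (unfold V, w0; rewrite opp_IZR, !RtoC_opp; ring).
    rewrite EV.
    assert (Hi : 0 < Im V) by (replace (Im V) with (Im w0) by (unfold V, Im; simpl; ring); auto).
    assert (Hi' : Im (- V) < 0) by (destruct V; unfold Im in *; simpl in *; lra).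
    destruct (Ceq_dec _ _) as [E|N]. { rewrite E in Hi'. unfold Im in Hi'; simpl in Hi'. lra. }
    destruct (Cpow_lower (- V) (- s) Hi') as [-> ->]. rewrite half_sum.
    rewrite pw_rot_scale.
    2:{ replace (Re (- (Ci * V))) with (Im V) by (destruct V; unfold Re, Im, Ci, Cmult, Copp; simpl; ring). auto. }
    replace (- (PI * Ci * - s / 2)) with (PI * Ci * s / 2) by field.
    replace (Ci * - V) with (- (Ci * V)) by ring.
    assert (EP := Rcpow_cancel (2 * PI) s).
    replace ((alpha + IZR m) * mu + (- x)%R * nu) with (RtoC (alpha * mu) + RtoC (IZR (- m) * - mu) + RtoC (x * - nu))
      by (rewrite opp_IZR, !RtoC_mult, !RtoC_opp; ring).
    rewrite !e_plus.
    transitivity ((Rcpow (2 * PI) s * Rcpow (2 * PI) (- s)) * (e (alpha * mu)%R * e (IZR (- m) * - mu)%R * e (x * - nu)%R * (Cexp (PI * Ci * s / 2) * pw (- (Ci * V)) (- s)))); [rewrite EP|]; ring.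
Qed.

Lemma Cpow_negative (x : R) (s : C) : x < 0 ->
  Cpow_arg Carg x (- s) = Cexp (- (Ci * (PI * s))) * Rcpow (- x) (- s) /\ Cpow_arg Carg_lower x (- s) = Cexp (Ci * (PI * s)) * Rcpow (- x) (- s).
Proof.
  intros Hx. unfold Cpow_arg, Carg, Carg_lower. rewrite Cmod_R, Rabs_left by auto.
  replace (Re x / - x)%R with (-1)%R by (unfold Re; simpl; field; lra).
  assert (EA : acos (-1) = PI). { replace (-1)%R with (cos PI) by apply cos_PI. apply acos_cos. generalize PI_RGT_0; lra. }
  rewrite EA. replace (Im x) with 0%R by reflexivity. destruct (Rlt_dec 0 0); [lra|]. unfold Rcpow. rewrite <- !Cexp_plus.
  split; f_equal; rewrite ?RtoC_opp; ring.
Qed.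

(** The row on the real line: positive points give the second summand of [A_left], negative ones the
    first with its cosine, and a point at 0 is omitted on both sides. *)
Lemma F_row_real (s : C) (alpha beta mu nu : R) (z : C) (n : Z) : 1 < Re s -> (beta + IZR n)%R = 0%R ->
  usum (fun m => F_avg s alpha beta mu nu z (m, n)) = A_left alpha mu s.
Proof.
  intros Hs Hx.
  destruct (lc_series _ _ _ (Psi_spec alpha mu) 0%R s Hs) as [A1 E1].
  destruct (lc_series _ _ _ (Psi_spec (- alpha) (- mu)) 0%R s Hs) as [A2 E2].
  destruct (usum_opp_index _ A2) as [A2' E2'].
  unfold A_left. rewrite E1, E2, <- E2', <- (usum_scal _ _ A2'), <- usum_plus by (auto using abs_summable_scal).
  apply usum_ext. intros m. unfold F_avg, F_term. rewrite <- !RtoC_plus, Hx.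
  set (u := (alpha + IZR m)%R). replace (u + 0%R * z) with (RtoC u) by ring. replace (u * mu + 0%R * nu) with (RtoC (u * mu)) by (rewrite RtoC_mult; ring).
  unfold zterm. rewrite opp_IZR, Ropp_involutive. fold u.
  destruct (Rlt_dec (- alpha) (IZR m)) as [H1|H1]; destruct (Rlt_dec alpha (- IZR m)) as [H2|H2]; try (exfalso; lra).
  - assert (Hu : 0 < u) by (unfold u; lra). destruct (Ceq_dec u 0) as [E|N]. { apply RtoC_inj in E. lra. }
    destruct (Cpow_right u (- s)) as [-> ->]; [exact Hu|]. rewrite half_sum. unfold lphi. change (u, 0%R) with (RtoC u). ring.
  - assert (Hu : u < 0) by (unfold u; lra). destruct (Ceq_dec u 0) as [E|N]. { apply RtoC_inj in E. lra. }
    destruct (Cpow_negative u s Hu) as [-> ->]. unfold lphi, Ccos.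
    replace (- alpha + - IZR m)%R with (- u)%R by (unfold u; ring). change ((- u)%R, 0%R) with (RtoC (- u)). rewrite pw_RtoC by lra.
    replace (- u * - mu)%R with (u * mu)%R by ring. field.
  - assert (Hu : u = 0%R) by (unfold u; lra). destruct (Ceq_dec u 0) as [E|N]; [ring|]. exfalso. apply N. now rewrite Hu.
Qed.

Lemma qseries_row (s : C) (gamma delta kappa lambda : R) (z : C) (k : Z) : 0 < Im z ->
  usum (fun l => qseries_term (1 - s) gamma delta kappa lambda z (k, l)) =
  zterm gamma (fun x => e (x * kappa)%R * usum (zterm delta (qphi s (lambda + x * z)))) k.
Proof.
  intros Hz. rewrite (usum_ext _ _ (qseries_term_split (1 - s) gamma delta kappa lambda z k)). unfold zterm at 1 3.
  replace (1 - (1 - s)) with s by ring. destruct (Rlt_dec _ _) as [H|H].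
  - apply usum_scal. apply qphi_summable. destruct z; unfold Im in *; simpl in *.
    replace (0 + ((gamma + IZR k) * r0 + 0 * r))%R with ((gamma + IZR k) * r0)%R by ring. apply Rmult_lt_0_compat; lra.
  - now apply usum_zero.
Qed.

(** Rows of constant [n] are summed first: those with [beta + n] positive or negative form the two
    q-series, and the row with [beta + n = 0], present only for integral [beta], produces the term
    with [delta beta]. *)
Lemma F_Z2_formula (s : C) (alpha beta mu nu : R) (z : C) : 0 < Im z -> 2 < Re s ->
  F_Z2 s alpha beta mu nu z = delta beta * A_left alpha mu s +
    e (alpha * mu)%R * (Rcpow (2 * PI) s * rGamma s) *
    (Cexp (- (PI * Ci * s / 2)) * qseries (1 - s) beta (- mu) nu alpha z +
     Cexp (PI * Ci * s / 2) * qseries (1 - s) (- beta) mu (- nu) (- alpha) z).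
Proof.
  intros Hz Hs.
  assert (S1 := F_term_summable Carg s alpha beta mu nu z (fun w => proj1 (Carg_bounded w)) Hz Hs).
  assert (S2 := F_term_summable Carg_lower s alpha beta mu nu z (fun w => proj2 (Carg_bounded w)) Hz Hs).
  assert (SA : abs_summable (F_avg s alpha beta mu nu z)) by (apply abs_summable_scal; now apply abs_summable_plus).
  assert (E1 : F_Z2 s alpha beta mu nu z = usum (F_avg s alpha beta mu nu z)).
  { unfold F_Z2, F_plus, F_minus, F_avg. rewrite usum_scal, usum_plus by (auto; now apply abs_summable_plus). field. }
  (* [usum_fubini] sums over the second component first, so the pairs are reversed to obtain rows in
     [m]. *)
  set (swap := fun nm : Z * Z => (snd nm, fst nm)).
  assert (Inj : forall a a', swap a = swap a' -> a = a') by (intros [a b] [a' b'] E; unfold swap in E; simpl in E; inversion E; now subst).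
  assert (SW : abs_summable (fun nm => F_avg s alpha beta mu nu z (swap nm))) by (apply abs_summable_comp_inj; auto).
  rewrite E1, (usum_reindex swap) by (auto; intros [a b] _; now exists (b, a)).
  rewrite usum_fubini by auto. unfold swap. cbn [fst snd].
  assert (Q1 := qseries_summable (1 - s) beta (- mu) nu alpha z Hz).
  assert (Q2 := qseries_summable (1 - s) (- beta) mu (- nu) (- alpha) z Hz).
  set (R1 := fun k => usum (fun l => qseries_term (1 - s) beta (- mu) nu alpha z (k, l))).
  set (R2 := fun k => usum (fun l => qseries_term (1 - s) (- beta) mu (- nu) (- alpha) z (k, l))).
  assert (AR1 : abs_summable R1) by now apply abs_summable_rows.
  assert (AR2 : abs_summable R2) by now apply abs_summable_rows.
  destruct (usum_opp_index R2 AR2) as [AR2' ER2].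
  destruct (zero_term_sum beta (A_left alpha mu s)) as [AZ EZ].
  set (G := e (alpha * mu)%R * (Rcpow (2 * PI) s * rGamma s)).
  rewrite (usum_ext _ (fun n => (zero_term beta (A_left alpha mu s) n + (G * Cexp (- (PI * Ci * s / 2))) * R1 n) + (G * Cexp (PI * Ci * s / 2)) * R2 (- n)%Z)).
  - rewrite usum_plus, usum_plus, EZ by (repeat apply abs_summable_plus; auto using abs_summable_scal).
    rewrite (usum_scal _ _ AR1), (usum_scal _ _ AR2'), ER2.
    unfold qseries. rewrite (usum_fubini _ Q1), (usum_fubini _ Q2). fold R1 R2. ring.
  - intros n. unfold R1, R2. rewrite !qseries_row by auto. unfold zterm at 1 3, zero_term.
    rewrite opp_IZR, Ropp_involutive.
    destruct (Rlt_dec (- beta) (IZR n)) as [H1|H1]; destruct (Rlt_dec beta (- IZR n)) as [H2|H2]; destruct (Req_EM_T (beta + IZR n) 0) as [H3|H3]; try (exfalso; lra).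
    + rewrite F_row_upper by (auto; lra). unfold G. ring.
    + rewrite F_row_lower by (auto; lra). rewrite opp_IZR. unfold G. ring.
    + rewrite F_row_real by (auto; lra). ring.
Qed.

Lemma Re_tau_pos (tau : C) : tau <> 0 -> Rabs (Carg tau) < PI / 2 -> 0 < Re tau.
Proof.
  intros Hn Ha. assert (HC := proj1 (Cmod_gt_0 tau) Hn).
  assert (A : Rabs (Carg tau) = acos (Re tau / Cmod tau)).
  { unfold Carg. destruct (acos_bound (Re tau / Cmod tau)). destruct (Rlt_dec _ _); rewrite ?Rabs_Ropp; apply Rabs_pos_eq; lra. }
  rewrite A in Ha. destruct (acos_bound (Re tau / Cmod tau)) as [B1 _].
  assert (C1 : 0 < cos (acos (Re tau / Cmod tau))) by (apply cos_gt_0; generalize PI_RGT_0; lra).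
  rewrite cos_acos in C1.
  - replace (Re tau) with (Re tau / Cmod tau * Cmod tau)%R by (field; lra). now apply Rmult_lt_0_compat.
  - assert (K : Rabs (Re tau) <= Cmod tau) by apply re_le_Cmod. apply Rabs_le_between in K.
    split; apply Rmult_le_reg_r with (Cmod tau); auto; unfold Rdiv; rewrite Rmult_assoc, Rinv_l; lra.
Qed.

(** [A] is asserted to exist because [psi], and with it [calA], has no prescribed value at a
    possible pole. The two identities for [A] hold wherever their other sides are determined, and
    the formula for [F], written with [A] and the entire [rGamma], holds at every [s]. *)
Theorem theorem1 (alpha beta mu nu : R) (tau : C)
    (tau_neq0 : tau <> 0) (arg_tau : (Rabs (Carg tau) < PI / 2)%R) :
  let z := Ci * tau in
  exists A : C -> C,
    (entire A /\
     forall s : C, s <> 1 \/ ~ is_int mu -> A s = calA s alpha mu) /\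
    (forall s : C, s <> 0 \/ ~ is_int alpha ->
       A s = e (alpha * mu) * (Rcpow (2 * PI) s * rGamma s / 2) *
             (Cexp (- (PI * Ci * s / 2)) * psi (1 - s) (- mu) alpha +
              Cexp (PI * Ci * s / 2) * psi (1 - s) mu (- alpha))) /\
    (forall s : C,
       abs_summable (qseries_term (1 - s) beta (- mu) nu alpha z) /\
       abs_summable (qseries_term (1 - s) (- beta) mu (- nu) (- alpha) z)) /\
    (exists F : C -> C,
       entire F /\
       (forall s : C, (2 < Re s)%R ->
          abs_summable (F_term Carg s alpha beta mu nu z) /\
          abs_summable (F_term Carg_lower s alpha beta mu nu z) /\
          F s = F_Z2 s alpha beta mu nu z) /\
       (forall s : C,
          F s = delta beta * A s +
                e (alpha * mu) * (Rcpow (2 * PI) s * rGamma s) *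
                (Cexp (- (PI * Ci * s / 2)) * qseries (1 - s) beta (- mu) nu alpha z +
                 Cexp (PI * Ci * s / 2) * qseries (1 - s) (- beta) mu (- nu) (- alpha) z))).
Proof.
  intros z. assert (Hz : 0 < Im z).
  { replace (Im z) with (Re tau) by (unfold z; destruct tau; unfold Re, Im, Ci; simpl; ring). now apply Re_tau_pos. }
  exists (A_fun alpha mu). split; [split|split; [|split]].
  - apply entire_A_fun.
  - intros s Hs. rewrite calA_eq by auto. now apply A_fun_left_all.
  - intros s Hs. rewrite <- A_right_psi by auto. now apply A_fun_right_all.
  - intros s. split; now apply qseries_summable.
  - exists (fun s => delta beta * A_fun alpha mu s +
                e (alpha * mu) * (Rcpow (2 * PI) s * rGamma s) *
                (Cexp (- (PI * Ci * s / 2)) * qseries (1 - s) beta (- mu) nu alpha z +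
                 Cexp (PI * Ci * s / 2) * qseries (1 - s) (- beta) mu (- nu) (- alpha) z)).
    split; [|split; [|reflexivity]].
    + apply entire_plus; [apply entire_scal, entire_A_fun|].
      apply (entire_mult (fun s => e (alpha * mu) * (Rcpow (2 * PI) s * rGamma s))); [apply entire_gamma_factor|].
      apply entire_plus.
      * apply (entire_mult (fun s => Cexp (- (PI * Ci * s / 2)))); [apply entire_phase_opp|now apply entire_qseries2].
      * apply (entire_mult (fun s => Cexp (PI * Ci * s / 2))); [apply entire_phase|now apply entire_qseries2].
    + intros s Hs. split; [|split].
      * apply F_term_summable; auto. intros w; apply Carg_bounded.
      * apply F_term_summable; auto. intros w; apply Carg_bounded.
      * rewrite F_Z2_formula by auto. rewrite A_fun_left, RtoC_mult; auto.
        intros K. rewrite K in Hs. unfold Re in Hs; simpl in Hs. lra.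
Qed.
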